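(* Let $0<e\le 1$ and let $\widetilde B$ satisfy the standing assumptions below. Then for every probability density $f$ on $\mathbb{R}^3$, $$I\big(Q_e^+(f,f)\big)\le \Big[1+(1-e)\,\frac{2+e+15e^2}{8e^3}\Big]\, I(f).$$ Consequently, if $f(v,t)$ is a solution of the inelastic Boltzmann equation (E1) below with initial datum $f(\cdot,0)$, then for all $t\ge 0$ $$I(f(\cdot,t))\le \exp\!\Big(\frac{(1-e)(2+e+15e^2)}{8e^3}\,t\Big)\, I(f(\cdot,0)).$$
   Context: Restitution coefficient $0<e\le1$. $\widetilde B$ is a positive, integrable, even function on $[-1,1]$, normalized so that $\int_{-1}^1\widetilde B(s)\,ds=2$ (equivalently $\int_{S^2}\widetilde B(k\cdot n)\,dn=4\pi$ for every unit vector $k$). Here $dn$ denotes the uniform measure on $S^2$ with total mass $4\pi$. For $v,w\in\mathbb{R}^3$, $n\in S^2$, the post-collisional velocity is $v'=v-\frac{1+e}{2}((v-w)\cdot n)\,n$. The gain operator $Q_e^+(f,f)$ is the (probability) density defined by $$\int_{\mathbb{R}^3}Q_e^+(f,f)\varphi\,dv=\frac1{4\pi}\int_{\mathbb{R}^3}\int_{\mathbb{R}^3}\int_{S^2}\widetilde B\Big(n\cdot\frac{v-w}{|v-w|}\Big)f(v)f(w)\varphi(v')\,dn\,dv\,dw$$ for all bounded continuous $\varphi$, and $Q_e(f,f)=Q_e^+(f,f)-f$ (loss term equals $f$ by the normalization). Equation (E1): for every bounded continuous $\varphi$, $\frac{d}{dt}\int f(v,t)\varphi(v)\,dv=\frac1{4\pi}\iiint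 \widetilde B(n\cdot\frac{v-w}{|v-w|})f(v,t)f(w,t)[\varphi(v')-\varphi(v)]\,dn\,dv\,dw$. Fisher information of a probability density $f$: $I(f)=4\int_{\mathbb{R}^3}|\nabla\sqrt f|^2dv$ if $\nabla\sqrt f\in L^2$ (distributional gradient), $+\infty$ otherwise. *)

(* Defs.v *)
From mathcomp Require Import all_boot all_order all_algebra.
From mathcomp Require Import all_classical all_reals all_analysis.
Import numFieldNormedType.Exports.
Import Order.TTheory GRing.Theory Num.Theory.

Set Implicit Arguments.
Unset Strict Implicit.
Unset Printing Implicit Defensive.

Local Open Scope classical_set_scope.
Local Open Scope ring_scope.

Section Defs.
Variable R : realType.

Definition V3 := (R * R * R)%type.

Definition v3x (x : V3) : R := x.1.1.
Definition v3y (x : V3) : R := x.1.2.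
Definition v3z (x : V3) : R := x.2.
Definition mkV3 (a b c : R) : V3 := (a, b, c).

Definition dot3 (x y : V3) : R := v3x x * v3x y + v3y x * v3y y + v3z x * v3z y.
Definition norm3 (x : V3) : R := Num.sqrt (dot3 x x).
Definition add3 (x y : V3) : V3 := mkV3 (v3x x + v3x y) (v3y x + v3y y) (v3z x + v3z y).
Definition scale3 (a : R) (x : V3) : V3 := mkV3 (a * v3x x) (a * v3y x) (a * v3z x).
Definition sub3 (x y : V3) : V3 := add3 x (scale3 (-1) y).

Definition e3_1 : V3 := mkV3 1 0 0.
Definition e3_2 : V3 := mkV3 0 1 0.
Definition e3_3 : V3 := mkV3 0 0 1.

Definition leb3 := ((@lebesgue_measure R \x @lebesgue_measure R) \x @lebesgue_measure R)%E.

(** Integral over S^2 against the uniform (surface) measure dn of total mass 4 pi,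
    expressed through the cone measure:  int_{S^2} h dn = 3 int_{|x|<=1} h(x/|x|) dx. *)
Definition sphere_int (h : V3 -> \bar R) : \bar R :=
  (3%:E * \int[leb3]_(x in [set x : V3 | (norm3 x <= 1)%R]) h (scale3 (norm3 x)^-1%R x))%E.

Definition kernel_hyp (B : R -> R) : Prop :=
  (forall s, -1 <= s <= 1 -> 0 < B s) /\
  (lebesgue_measure.-integrable `[(-1)%R, 1%R] (fun s => (B s)%:E)) /\
  (forall s, -1 <= s <= 1 -> B (- s) = B s) /\
  (\int[lebesgue_measure]_(s in `[(-1)%R, 1%R]) (B s)%:E = 2%:E)%E.

Definition prob_density (f : V3 -> R) : Prop :=
  measurable_fun setT f /\ (forall v, 0 <= f v) /\
  (\int[leb3]_v (f v)%:E = 1%:E)%E.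

Definition bounded_continuous (phi : V3 -> R) : Prop :=
  continuous phi /\ exists M : R, forall x, `|phi x| <= M.

Definition post_vel (e : R) (v w n : V3) : V3 :=
  sub3 v (scale3 ((1 + e) / 2 * dot3 (sub3 v w) n) n).

Definition rel_dir (v w : V3) : V3 := scale3 (norm3 (sub3 v w))^-1 (sub3 v w).

Definition coll_int (B : R -> R) (f : V3 -> R) (psi : V3 -> V3 -> V3 -> R) : \bar R :=
  ((4 * pi)^-1%:E *
   \int[leb3]_v \int[leb3]_w
     sphere_int (fun n => (B (dot3 n (rel_dir v w)) * f v * f w * psi v w n)%:E))%E.

Definition is_Qplus (e : R) (B : R -> R) (f g : V3 -> R) : Prop :=
  prob_density g /\
  forall phi, bounded_continuous phi ->
    (\int[leb3]_v (g v * phi v)%:E)%E =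
    coll_int B f (fun v w n => phi (post_vel e v w n)).

Fixpoint iterD (l : seq V3) (phi : V3 -> R) : V3 -> R :=
  if l is u :: l' then (fun x => 'D_u (iterD l' phi) x) else phi.

Definition smooth_cpt (phi : V3 -> R) : Prop :=
  (forall l, continuous (iterD l phi)) /\
  (forall l (x u : V3), derivable (iterD l phi) x u) /\
  (exists M : R, forall x, M < norm3 x -> phi x = 0).

Definition loc_integrable (g : V3 -> R) : Prop :=
  forall r : R, leb3.-integrable [set x | norm3 x <= r] (fun x => (g x)%:E).

Definition weak_grad (g : V3 -> R) (h : V3 -> V3) : Prop :=
  loc_integrable g /\
  loc_integrable (fun x => v3x (h x)) /\
  loc_integrable (fun x => v3y (h x)) /\
  loc_integrable (fun x => v3z (h x)) /\
  forall phi, smooth_cpt phi ->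
    [/\ (\int[leb3]_x (g x * 'D_e3_1 phi x)%:E = - \int[leb3]_x (v3x (h x) * phi x)%:E)%E,
        (\int[leb3]_x (g x * 'D_e3_2 phi x)%:E = - \int[leb3]_x (v3y (h x) * phi x)%:E)%E &
        (\int[leb3]_x (g x * 'D_e3_3 phi x)%:E = - \int[leb3]_x (v3z (h x) * phi x)%:E)%E].

(** Fisher information I(f) = 4 int |grad sqrt f|^2 if grad sqrt f exists
    (distributionally) and is in L^2; +oo otherwise (inf of the empty set). *)
Definition fisher (f : V3 -> R) : \bar R :=
  ereal_inf [set (4%:E * \int[leb3]_x (dot3 (h x) (h x))%:E)%E
            | h in [set h | weak_grad (fun x => Num.sqrt (f x)) h]].

Definition E1_solution (e : R) (B : R -> R) (f : R -> V3 -> R) : Prop :=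
  (forall t, 0 <= t -> prob_density (f t)) /\
  forall phi, bounded_continuous phi ->
    let m := fun t => fine (\int[leb3]_v (f t v * phi v)%:E)%E in
    {within `[0, +oo[, continuous m} /\
    forall t, 0 < t ->
      derivable m t 1 /\
      'D_1 m t = fine (coll_int B (f t) (fun v w n => phi (post_vel e v w n) - phi v)).

Definition fisher_const (e : R) : R :=
  1 + (1 - e) * (2 + e + 15 * e ^+ 2) / (8 * e ^+ 3).

Definition fisher_rate (e : R) : R :=
  (1 - e) * (2 + e + 15 * e ^+ 2) / (8 * e ^+ 3).

End Defs.

(* Main.v *)
From HB Require Import structures.
Require Import Defs.
From mathcomp Require Import all_boot all_order all_algebra.
From mathcomp Require Import all_classical all_reals all_analysis measurable_realfun.
From mathcomp Require Import ring lra.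
Import numFieldNormedType.Exports.
Import Order.TTheory GRing.Theory Num.Theory.
Local Open Scope ring_scope.
Local Open Scope classical_set_scope.
Set Implicit Arguments.
Unset Strict Implicit.
Unset Printing Implicit Defensive.

(* The Fisher information of a density g is the supremum over fields phi of the linear
   functionals - int g (2 div phi + |phi|^2): a bound K on this supremum gives, through the
   Hamilton-Jacobi flow of phi, int (sqrt g(. + t e_j) - sqrt g)^2 <= K_j t^2 / 4, hence weak
   derivatives of sqrt g in L^2 with the right norm.  It can therefore be bounded for
   g = Q_e^+(f,f) from the weak formulation.  With n = y / |y| for y in the unit ball, a
   divergence free vector field on the space of (v, w, y) preserves the kernel and translates
   v' at unit speed; integration by parts along it expresses the score of Q_e^+(f,f) by the
   scores of f at v and w.  In the resulting quadratic form the cross terms cancel by the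
   symmetry v <-> w and by int grad f = 0, and what remains is the angular average of
   1 + p/2 + p^2/2 with p = (1 - e^2) (n . u/|u|)^2, which is at most the constant.
   Along (E1), the Euler iterates (1 - tau) f + tau Q_e^+(f,f) stay O(tau)-close in L^1 to the
   solution, multiply the bound by at most 1 + tau * rate at each step, and the dual
   functionals pass to the limit. *)

(** * Integrals of real functions *)

(** [Q_e^+] is known only through its pairings with bounded continuous functions, so nothing can be
    differentiated directly: the existence of grad sqrt g and its size must both come from a
    functional that is linear in g and is tested by such functions. The vector field is singular at
    v = w and at y = 0. At y = 0 nothing is lost, because the field preserves |y| and a cut-off in
    |y| is transported freely. It does not preserve |u|, u = v - w, and a cut-off in |u| leaves an
    error of size 1 / |u|; this is integrable against f(v) f(w) by Hardy's inequality, which finite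
    Fisher information provides. The kernel is merely integrable, while integration by parts needs a
    C^1 weight; as the field preserves (n . u / |u|)^2, the estimate involves the angular integral
    of the weight and not its derivative, so it survives an L1 approximation of the kernel by C^1
    functions of (n . u / |u|)^2. For the constant, p <= 1 - e^2 bounds 1 + p/2 + p^2/2 by its value
    at 1 - e^2, and the stated constant exceeds that value by a nonnegative multiple of 1 - e. *)

Section RealIntegrals.
Context d (T : measurableType d) (R : realType) (mu : {measure set T -> \bar R}).
Implicit Types f g : T -> R.

Definition L1 f := mu.-integrable setT (EFin \o f).
(** Integrals are handled as real numbers, so that [ring], [lra] and [nra] apply. [RI] is 0 when the
    integral is infinite, hence the [L1] facts carried along every computation. *)
Definition RI f : R := fine (\int[mu]_x (f x)%:E)%E.

Lemma L1_meas f : L1 f -> measurable_fun setT f.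
Proof. by move=> /measurable_int /measurable_EFinP. Qed.

Lemma L1_eq f g : (forall x, f x = g x) -> L1 f -> L1 g.
Proof. by move=> fg; rewrite (funext fg). Qed.

Lemma RI_eq f g : (forall x, f x = g x) -> RI f = RI g.
Proof. by move=> fg; rewrite (funext fg). Qed.

Lemma L1_dom f g : measurable_fun setT f -> (forall x, `|f x| <= g x) -> L1 g -> L1 f.
Proof.
move=> mf fg; apply: le_integrable => //; first exact/measurable_EFinP.
by move=> x _ /=; rewrite lee_fin (le_trans (fg x))// ler_norm.
Qed.

Lemma L1D f g : L1 f -> L1 g -> L1 (fun x => f x + g x).
Proof. by move=> lf lg; exact: (integrableD measurableT lf lg). Qed.

Lemma L1Zl c f : L1 f -> L1 (fun x => c * f x).
Proof. by move=> lf; exact: (integrableZl measurableT c lf). Qed.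

Lemma L1N f : L1 f -> L1 (fun x => - f x).
Proof. by move=> /(L1Zl (-1)); apply: L1_eq => x; rewrite mulN1r. Qed.

Lemma L1B f g : L1 f -> L1 g -> L1 (fun x => f x - g x).
Proof. by move=> lf /L1N lg; exact: L1D. Qed.

Lemma L1_0 : L1 (fun=> 0).
Proof. exact: integrable0. Qed.

Lemma L1_abs f : L1 f -> L1 (fun x => `|f x|).
Proof. by move=> lf; exact: (integrable_norm lf). Qed.

Lemma L1_bd f g C : L1 f -> measurable_fun setT g -> (forall x, `|g x| <= C) ->
  L1 (fun x => f x * g x).
Proof.
move=> lf mg gC; apply: (@L1_dom _ (fun x => C * `|f x|)).
- exact: measurable_funM (L1_meas lf) mg.
- by move=> x; rewrite normrM mulrC ler_wpM2r.
- exact/L1Zl/L1_abs.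
Qed.

Lemma RI_E f : L1 f -> (\int[mu]_x (f x)%:E = (RI f)%:E)%E.
Proof. by move=> lf; rewrite /RI fineK//; exact: integrable_fin_num. Qed.

Lemma RID f g : L1 f -> L1 g -> RI (fun x => f x + g x) = RI f + RI g.
Proof. exact: RintegralD. Qed.

Lemma RIZl c f : L1 f -> RI (fun x => c * f x) = c * RI f.
Proof. by move=> lf; exact: RintegralZl. Qed.

Lemma RIN f : L1 f -> RI (fun x => - f x) = - RI f.
Proof. by move=> lf; rewrite -mulN1r -RIZl//; apply: RI_eq => x; rewrite mulN1r. Qed.

Lemma RIB f g : L1 f -> L1 g -> RI (fun x => f x - g x) = RI f - RI g.
Proof. exact: RintegralB. Qed.

Lemma RI0 : RI (fun=> 0) = 0.
Proof. by rewrite /RI integral0. Qed.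

Lemma RI_ge0 f : (forall x, 0 <= f x) -> 0 <= RI f.
Proof. by move=> f0; apply: fine_ge0; apply: integral_ge0 => x _; rewrite lee_fin. Qed.

Lemma RI_le f g : L1 f -> L1 g -> (forall x, f x <= g x) -> RI f <= RI g.
Proof. by move=> lf lg fg; apply: le_Rintegral. Qed.

Lemma RI_abs f g : measurable_fun setT f -> L1 g -> (forall x, `|f x| <= g x) ->
  `|RI f| <= RI g.
Proof.
move=> mf lg fg; have lf := L1_dom mf fg lg.
apply: (le_trans (le_normr_Rintegral measurableT lf)).
exact: RI_le (L1_abs lf) lg fg.
Qed.

Lemma L1_bound f C : measurable_fun setT f -> (forall x, 0 <= f x) ->
  (\int[mu]_x (f x)%:E <= C%:E)%E -> L1 f /\ RI f <= C.
Proof.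
move=> mf f0 fC; have lf : L1 f.
  apply/integrableP; split; first exact/measurable_EFinP.
  under eq_integral => x _ do rewrite /= ger0_norm//.
  exact: le_lt_trans fC (ltry _).
by split=> //; rewrite -lee_fin -RI_E.
Qed.

Lemma L1_ae f g : measurable_fun setT g -> {ae mu, forall x, f x = g x} -> L1 f ->
  L1 g /\ RI g = RI f.
Proof.
move=> mg fg lf.
have mf := L1_meas lf.
have fg' : ae_eq mu setT (EFin \o f) (EFin \o g).
  by apply: filterS fg => x /= ->.
split; last first.
  congr fine; apply/esym/ae_eq_integral => //; exact/measurable_EFinP.
apply/integrableP; split; first exact/measurable_EFinP.
move/integrableP: lf => [_]; congr (_ < _)%E.
apply: ae_eq_integral => //.
- by do 2! apply: measurableT_comp => //.
- by do 2! apply: measurableT_comp => //.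
by apply: filterS fg => x /= ->.
Qed.

Lemma RI_dct (fn : nat -> T -> R) f g :
  (forall n, measurable_fun setT (fn n)) -> measurable_fun setT f -> L1 g ->
  (forall n x, `|fn n x| <= g x) ->
  {ae mu, forall x, fn ^~ x @ \oo --> f x} ->
  L1 f /\ RI (fn n) @[n --> \oo] --> RI f.
Proof.
move=> mfn mf lg fng fnf.
have [] := @dominated_convergence _ _ _ mu setT measurableT
   (fun n => EFin \o fn n) (EFin \o f) (EFin \o g).
- by move=> n; exact/measurable_EFinP.
- exact/measurable_EFinP.
- by apply: filterS fnf => x /= fx _; apply/fine_cvgP; split => //; near=> n.
- exact: lg.
- by apply: aeW => x n _ /=; rewrite lee_fin.
move=> lf _ cv; split=> //.
by apply: fine_cvg; rewrite -RI_E.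
Unshelve. all: by end_near. Qed.

Lemma RI_fatou (fn : nat -> T -> R) f C :
  (forall n, L1 (fn n)) -> measurable_fun setT f ->
  (forall n x, 0 <= fn n x) -> (forall x, 0 <= f x) -> (forall n, RI (fn n) <= C) ->
  {ae mu, forall x, fn ^~ x @ \oo --> f x} ->
  L1 f /\ RI f <= C.
Proof.
move=> lfn mf fn0 f0 fnC fnf.
apply: L1_bound => //.
have -> : (\int[mu]_x (f x)%:E = \int[mu]_x limn_einf (fun n => (fn n x)%:E))%E.
  apply: ae_eq_integral => //.
  - exact/measurable_EFinP.
  - apply: (@measurableT_comp _ _ _ _ _ _ (-%E)) => //.
    apply: measurable_fun_limn_esup => n; apply: (@measurableT_comp _ _ _ _ _ _ (-%E)) => //.
    exact/measurable_EFinP/L1_meas.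
  apply: filterS fnf => x /= fx _.
  have : (fn n x)%:E @[n --> \oo] --> (f x)%:E.
    by apply/fine_cvgP; split => //; near=> n.
  by move=> /cvg_limn_einf_sup[->].
apply: le_trans (fatou _ _ _ _) _ => //.
- by move=> n; exact/measurable_EFinP/L1_meas.
- by move=> n x _; rewrite lee_fin.
rewrite limn_einf_lim; apply: lime_le; first exact: is_cvg_einfs.
near=> n; apply: (@le_trans _ _ (\int[mu]_x (fn n x)%:E)%E).
  by apply: ereal_inf_lbound; exists n => /=.
by rewrite RI_E// lee_fin.
Unshelve. all: by end_near. Qed.

Definition L2 f := measurable_fun setT f /\ L1 (fun x => f x ^+ 2).

Lemma L2_mul f g : L2 f -> L2 g -> L1 (fun x => f x * g x).
Proof.
move=> [mf lf] [mg lg]; apply: (L1_dom _ _ (L1D lf lg)).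
  exact: measurable_funM.
move=> x; rewrite ler_norml; apply/andP; split; nra.
Qed.

Lemma L2D f g : L2 f -> L2 g -> L2 (fun x => f x + g x).
Proof.
move=> Lf Lg; have [mf lf] := Lf; have [mg lg] := Lg.
split; first exact: measurable_funD.
apply: L1_eq (L1D (L1D lf lg) (L1Zl 2 (L2_mul Lf Lg))) => x; ring.
Qed.

Lemma L2Zl c f : L2 f -> L2 (fun x => c * f x).
Proof.
move=> [mf lf]; split; first exact: measurable_funM.
by apply: L1_eq (L1Zl (c ^+ 2) lf) => x; rewrite exprMn.
Qed.

Lemma L2B f g : L2 f -> L2 g -> L2 (fun x => f x - g x).
Proof.
move=> Lf /(L2Zl (-1)) Lg; have := L2D Lf Lg.
by under [X in L2 X]eq_fun do rewrite mulN1r.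
Qed.

Lemma L2_bd f g C : L2 f -> measurable_fun setT g -> (forall x, `|g x| <= C) ->
  L2 (fun x => f x * g x).
Proof.
move=> [mf lf] mg gC; split; first exact: measurable_funM.
apply: L1_eq (L1_bd (C := C ^+ 2) lf (measurable_funX 2 mg) _) => x.
  by rewrite exprMn.
by rewrite normrX lerXn2r ?nnegrE// (le_trans (normr_ge0 _) (gC x)).
Qed.

Lemma cauchy_schwarz f g : L2 f -> L2 g ->
  (RI (fun x => f x * g x)) ^+ 2 <= RI (fun x => f x ^+ 2) * RI (fun x => g x ^+ 2).
Proof.
move=> Lf Lg; have [mf lf] := Lf; have [mg lg] := Lg.
set A := RI (fun x => f x ^+ 2); set B := RI (fun x => g x ^+ 2).
set C := RI _.
have A0 : 0 <= A by apply: RI_ge0 => x; exact: sqr_ge0.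
have B0 : 0 <= B by apply: RI_ge0 => x; exact: sqr_ge0.
have key (t : R) : 0 <= A + 2 * t * C + t ^+ 2 * B.
  have <- : RI (fun x => f x ^+ 2 + (2 * t) * (f x * g x) + t ^+ 2 * g x ^+ 2) =
      A + 2 * t * C + t ^+ 2 * B.
    rewrite RID ?RID ?RIZl//; do ?[exact: L1D|exact: L1Zl].
    - exact: L2_mul.
    - exact/L1Zl/L2_mul.
    - by apply: L1D => //; exact/L1Zl/L2_mul.
  apply: RI_ge0 => x; have := sqr_ge0 (f x + t * g x); nra.
have [B1|] := ltP 0 B.
  have := key (- (C / B)); rewrite -(ler_pM2r B1) mul0r.
  have -> : (A + 2 * - (C / B) * C + (- (C / B)) ^+ 2 * B) * B = A * B - C ^+ 2.
    by field; rewrite gt_eqF.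
  by rewrite subr_ge0.
move=> Bn; have B00 : B = 0 by lra.
rewrite B00 mulr0 real_leNgt ?num_real//; apply/negP => C2.
(* For [B = 0] the polynomial in [t] is affine; at this [t] it equals -1, against its
   nonnegativity. *)
have := key (- (A + 1) / (2 * C)); rewrite B00.
have C0 : C != 0 by apply/eqP => C0; move: C2; rewrite C0 expr0n ltxx.
have -> : A + 2 * (- (A + 1) / (2 * C)) * C + (- (A + 1) / (2 * C)) ^+ 2 * 0 = -1.
  by field.
lra.
Qed.

Lemma cauchy_schwarz_sqrt f g : L2 f -> L2 g ->
  `|RI (fun x => f x * g x)| <=
    Num.sqrt (RI (fun x => f x ^+ 2)) * Num.sqrt (RI (fun x => g x ^+ 2)).
Proof.
move=> Lf Lg; have f0 : 0 <= RI (fun x => f x ^+ 2) by apply: RI_ge0 => x; exact: sqr_ge0.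
by rewrite -sqrtrM// -sqrtr_sqr ler_wsqrtr// cauchy_schwarz.
Qed.

End RealIntegrals.

(** * Product measures, Fubini and Tonelli *)

Section Products.
Context d1 d2 (T1 : measurableType d1) (T2 : measurableType d2) (R : realType).
Variables (m1 : {sigma_finite_measure set T1 -> \bar R})
          (m2 : {sigma_finite_measure set T2 -> \bar R}).

(* The library's product measure has no canonical sigma-finite structure for
   general sigma-finite factors, hence the alias [pmeas]. *)
Definition pmeas : set (T1 * T2)%type -> \bar R := (m1 \x m2)%E.
HB.instance Definition _ := Measure.on pmeas.

Lemma pmeas_sigma_finite : sigma_finite setT pmeas.
Proof.
have /sigma_finiteP[F [TF ndF Foo]] := sigma_finiteT m1.
have /sigma_finiteP[G [TG ndG Goo]] := sigma_finiteT m2.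
exists (fun n => F n `*` G n).
  rewrite -setXTT TF TG predeqE => -[x y]; split.
    move=> [/= [n _ Fnx] [k _ Gky]]; exists (maxn n k) => //; split.
    - by move: x Fnx; exact/subsetPset/ndF/leq_maxl.
    - by move: y Gky; exact/subsetPset/ndG/leq_maxr.
  by move=> [n _ []/= ? ?]; split; exists n.
move=> k; have [? ?] := Foo k; have [? ?] := Goo k.
split; first exact: measurableX.
by rewrite /pmeas product_measure1E// lte_mul_pinfty// ge0_fin_numE.
Qed.

HB.instance Definition _ := Measure_isSigmaFinite.Build _ _ _ pmeas pmeas_sigma_finite.

Definition pm : {sigma_finite_measure set (T1 * T2)%type -> \bar R} := pmeas.

Lemma measurable_xsec d3 (T3 : measurableType d3) (F : T1 * T2 -> T3) x :
  measurable_fun setT F -> measurable_fun setT (fun y => F (x, y)).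
Proof. by move=> mF; apply: measurableT_comp => //; exact: measurable_pair1. Qed.

Lemma measurable_ysec d3 (T3 : measurableType d3) (F : T1 * T2 -> T3) y :
  measurable_fun setT F -> measurable_fun setT (fun x => F (x, y)).
Proof. by move=> mF; apply: measurableT_comp => //; exact: measurable_pair2. Qed.

(** Integrability of every section, and not only of almost every one, makes the inner [RI] the
    genuine integral everywhere, so that no exceptional set has to be carried along. *)
Lemma fubini_x (F : T1 * T2 -> R) : L1 pm F -> (forall x, L1 m2 (fun y => F (x, y))) ->
  L1 m1 (fun x => RI m2 (fun y => F (x, y))) /\
  RI pm F = RI m1 (fun x => RI m2 (fun y => F (x, y))).
Proof.
move=> lF lFx.
have eqF : EFin \o (fun x => RI m2 (fun y => F (x, y))) = fubini_F m2 (EFin \o F).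
  by apply/funext => x; rewrite /fubini_F /= RI_E.
split; first by rewrite /L1 eqF; exact: integrable_fubini_F.
by rewrite /RI -(integral12_prod_meas1 lF) -eqF.
Qed.

Lemma fubini_y (F : T1 * T2 -> R) : L1 pm F -> (forall y, L1 m1 (fun x => F (x, y))) ->
  L1 m2 (fun y => RI m1 (fun x => F (x, y))) /\
  RI pm F = RI m2 (fun y => RI m1 (fun x => F (x, y))).
Proof.
move=> lF lFx.
have eqF : EFin \o (fun y => RI m1 (fun x => F (x, y))) = fubini_G m1 (EFin \o F).
  by apply/funext => x; rewrite /fubini_G /= RI_E.
have mF := measurable_int _ lF.
split; last by rewrite /RI -(integral21_prod_meas1 lF) -eqF.
rewrite /L1 eqF; apply/integrableP; split; first exact: (measurable_fubini_G lF).
apply: le_lt_trans ((@integrable21ltyP _ _ _ _ _ m1 m2 _ mF).1 lF).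
apply: ge0_le_integral => //.
- by apply: measurableT_comp => //; exact: (measurable_fubini_G lF).
- by apply: (measurable_fun_fubini_tonelli_G (abse \o (EFin \o F))) => //=; exact: measurableT_comp.
- move=> y _; apply: le_abse_integral => //.
  exact: (measurable_int _ (lFx y)).
Qed.

Lemma tonelli_x (F : T1 * T2 -> R) (G : T1 -> R) : measurable_fun setT F ->
  (forall z, 0 <= F z) -> (forall x, L1 m2 (fun y => F (x, y))) ->
  (forall x, RI m2 (fun y => F (x, y)) = G x) -> L1 m1 G ->
  L1 pm F /\ RI pm F = RI m1 G.
Proof.
move=> mF F0 lFx FG lG.
have lF : L1 pm F.
  apply/(@integrable12ltyP _ _ _ _ _ m1 m2); first exact/measurable_EFinP.
  rewrite (_ : integral _ _ _ = (\int[m1]_x (G x)%:E)%E); first by rewrite RI_E ?ltry.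
  apply: eq_integral => x _; rewrite -FG -RI_E//.
  by apply: eq_integral => y _ /=; rewrite ger0_norm.
by split=> //; rewrite (fubini_x lF lFx).2; exact: RI_eq.
Qed.

Lemma tonelli_y (F : T1 * T2 -> R) (G : T2 -> R) : measurable_fun setT F ->
  (forall z, 0 <= F z) -> (forall y, L1 m1 (fun x => F (x, y))) ->
  (forall y, RI m1 (fun x => F (x, y)) = G y) -> L1 m2 G ->
  L1 pm F /\ RI pm F = RI m2 G.
Proof.
move=> mF F0 lFx FG lG.
have lF : L1 pm F.
  apply/(@integrable21ltyP _ _ _ _ _ m1 m2); first exact/measurable_EFinP.
  rewrite (_ : integral _ _ _ = (\int[m2]_x (G x)%:E)%E); first by rewrite RI_E ?ltry.
  apply: eq_integral => x _; rewrite -FG -RI_E//.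
  by apply: eq_integral => y _ /=; rewrite ger0_norm.
by split=> //; rewrite (fubini_y lF lFx).2; exact: RI_eq.
Qed.

Lemma measurable_fst_comp d3 (T3 : measurableType d3) (f : T1 -> T3) :
  measurable_fun setT f -> measurable_fun setT (fun z : T1 * T2 => f z.1).
Proof. by move=> mf; apply: measurableT_comp. Qed.

Lemma measurable_snd_comp d3 (T3 : measurableType d3) (f : T2 -> T3) :
  measurable_fun setT f -> measurable_fun setT (fun z : T1 * T2 => f z.2).
Proof. by move=> mf; apply: measurableT_comp. Qed.

Lemma L1_tensor (f : T1 -> R) (g : T2 -> R) : L1 m1 f -> L1 m2 g ->
  L1 pm (fun z => f z.1 * g z.2) /\
  RI pm (fun z => f z.1 * g z.2) = RI m1 f * RI m2 g.
Proof.
move=> lf lg.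
have mF : measurable_fun setT (fun z : T1 * T2 => f z.1 * g z.2).
  by apply: measurable_funM; [exact: measurable_fst_comp (L1_meas lf)|
    exact: measurable_snd_comp (L1_meas lg)].
have lF : L1 pm (fun z => f z.1 * g z.2).
  have [] := @tonelli_x (fun z => `|f z.1 * g z.2|)
     (fun x => RI m2 (fun y => `|g y|) * `|f x|).
  - exact: measurableT_comp.
  - by move=> z; exact: normr_ge0.
  - by move=> x; apply: L1_eq (L1Zl `|f x| (L1_abs lg)) => y /=; rewrite normrM.
  - move=> x; rewrite mulrC -RIZl; last exact: L1_abs.
    by apply: RI_eq => y; rewrite normrM.
  - by apply: L1Zl; apply: L1_abs.
  by move=> h _; apply: L1_dom h.
split=> //; rewrite (fubini_x lF _).2; last by move=> x /=; exact: L1Zl.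
rewrite mulrC -RIZl//; apply: RI_eq => x /=; rewrite RIZl//; exact: mulrC.
Qed.

End Products.

(** * Measure preserving maps *)

Section MeasurePreserving.
Context d1 d2 (T1 : measurableType d1) (T2 : measurableType d2) (R : realType).
Variables (m1 : {measure set T1 -> \bar R}) (m2 : {measure set T2 -> \bar R}).

Definition mpres (th : T1 -> T2) := measurable_fun setT th /\
  forall A, measurable A -> m1 (th @^-1` A) = m2 A.

(** Packages the image measure as a measure, the form in which uniqueness theorems (for products and
    for Lebesgue measure) can be applied to it. *)
Lemma pushforward_measure (th : T1 -> T2) : measurable_fun setT th ->
  {nu : {measure set T2 -> \bar R} | forall A, nu A = m1 (th @^-1` A)}.
Proof.
move=> mth.
pose thm : {mfun T1 >-> T2} := HB.pack th (isMeasurableFun.Build _ _ _ _ th mth).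
pose nu : {measure set T2 -> \bar R} := pushforward m1 thm.
by exists (nu mth).
Qed.

Lemma mpres_int th (f : T2 -> \bar R) : mpres th -> measurable_fun setT f ->
  (forall x, 0 <= f x)%E -> (\int[m1]_x f (th x) = \int[m2]_x f x)%E.
Proof.
move=> [mth thE] mf f0.
transitivity (\int[pushforward m1 th]_y f y)%E.
  by rewrite (ge0_integral_pushforward mth).
pose thm : {mfun T1 >-> T2} := HB.pack th (isMeasurableFun.Build _ _ _ _ th mth).
pose nu : {measure set T2 -> \bar R} := pushforward m1 thm.
change (\int[nu mth]_y f y = \int[m2]_y f y)%E.
by apply: eq_measure_integral => A mA _; exact: thE.
Qed.

Lemma mpres_RI th (f : T2 -> R) : mpres th -> L1 m2 f ->
  L1 m1 (fun x => f (th x)) /\ RI m1 (fun x => f (th x)) = RI m2 f.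
Proof.
move=> mp lf; have [mth thE] := mp.
have mf := measurable_int _ lf.
split.
  apply/integrableP; split; first exact: (measurableT_comp mf mth).
  have ma : measurable_fun setT (fun x => `|(f x)%:E|%E) by exact: measurableT_comp.
  rewrite (mpres_int mp ma)//.
  by move/integrableP : lf => [].
have mf' : measurable_fun setT (fun x => (f x)%:E) := mf.
rewrite /RI; congr fine; rewrite integralE [RHS]integralE; congr (_ - _)%E.
  rewrite -(mpres_int mp (measurable_funepos mf') (@funepos_ge0 _ _ _)).
  by apply: eq_integral => x _; rewrite !funeposE.
rewrite -(mpres_int mp (measurable_funeneg mf') (@funeneg_ge0 _ _ _)).
by apply: eq_integral => x _; rewrite !funenegE.
Qed.

End MeasurePreserving.

Section MeasurePreservingMaps.
Context d1 d2 (T1 : measurableType d1) (T2 : measurableType d2) (R : realType).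
Variables (m1 : {sigma_finite_measure set T1 -> \bar R})
          (m2 : {sigma_finite_measure set T2 -> \bar R}).

(** The section at [x] of the preimage of [A] is the preimage under [b x] of the section of [A].
    Shears are of this form, and the rotations and the change of variables of the gain operator are
    composed from such maps. *)
Lemma mpres_snd (b : T1 -> T2 -> T2) :
  measurable_fun setT (fun z : T1 * T2 => b z.1 z.2) ->
  (forall x, mpres m2 m2 (b x)) -> mpres (pm m1 m2) (pm m1 m2) (fun z => (z.1, b z.1 z.2)).
Proof.
move=> mb bp; split; first exact: measurable_fun_pair.
move=> A mA; rewrite /pm /= /pmeas /product_measure1.
apply: eq_integral => x _ /=.
rewrite -((bp x).2 (xsection A x) (measurable_xsection x mA)).
by congr (m2 _); apply/seteqP; split => y; rewrite /xsection /= !inE.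
Qed.

Lemma mpres_swap : mpres (pm m1 m2) (pm m2 m1) (fun z => (z.2, z.1)).
Proof.
have ms : measurable_fun setT (fun z : T1 * T2 => (z.2, z.1)).
  by apply: measurable_fun_pair.
split=> // A mA.
have [nu nuE] := pushforward_measure (pm m1 m2) ms.
rewrite -nuE; apply/esym; apply: (product_measure_unique (m' := nu)) => // B C mB mC.
rewrite nuE muleC -product_measure1E//.
by congr (_ _); apply/seteqP; split => -[x y] /= [].
Qed.

End MeasurePreservingMaps.

Section MeasurePreservingProd.
Context d1 d2 d3 d4 (T1 : measurableType d1) (T2 : measurableType d2)
  (T3 : measurableType d3) (T4 : measurableType d4) (R : realType).
Variables (m1 : {sigma_finite_measure set T1 -> \bar R})
  (m2 : {sigma_finite_measure set T2 -> \bar R})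
  (m3 : {sigma_finite_measure set T3 -> \bar R})
  (m4 : {sigma_finite_measure set T4 -> \bar R}).

Lemma mpres_prod (a : T1 -> T3) (b : T2 -> T4) : mpres m1 m3 a -> mpres m2 m4 b ->
  mpres (pm m1 m2) (pm m3 m4) (fun z => (a z.1, b z.2)).
Proof.
move=> [ma aE] [mb bE].
have mab : measurable_fun setT (fun z : T1 * T2 => (a z.1, b z.2)).
  by apply: measurable_fun_pair; [exact: measurable_fst_comp|exact: measurable_snd_comp].
split=> // A mA.
have [nu nuE] := pushforward_measure (pm m1 m2) mab.
rewrite -nuE; apply/esym; apply: (product_measure_unique (m' := nu)) => // B C mB mC.
rewrite nuE -aE// -bE// -product_measure1E//.
- by rewrite -[X in measurable X]setTI; exact: ma.
- by rewrite -[X in measurable X]setTI; exact: mb.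
Qed.

End MeasurePreservingProd.

Section MeasurePreservingComp.
Context d1 d2 d3 (T1 : measurableType d1) (T2 : measurableType d2)
  (T3 : measurableType d3) (R : realType).
Variables (m1 : {measure set T1 -> \bar R}) (m2 : {measure set T2 -> \bar R})
  (m3 : {measure set T3 -> \bar R}).

Lemma mpres_comp (f : T1 -> T2) (g : T2 -> T3) : mpres m1 m2 f -> mpres m2 m3 g ->
  mpres m1 m3 (fun x => g (f x)).
Proof.
move=> [mf fE] [mg gE]; split; first exact: measurableT_comp mg mf.
move=> A mA; rewrite -gE// -fE; first by [].
by rewrite -[X in measurable X]setTI; exact: mg.
Qed.

Lemma mpres_id : mpres m1 m1 id.
Proof. by split. Qed.

End MeasurePreservingComp.

(* The library's Lebesgue measure lives on a copy of [R] with its own display;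
   [leb1] is the same set function for the canonical measurable structure. *)
Section Lebesgue.
Context {R : realType}.

Definition leb1f : set R -> \bar R := @lebesgue_measure R.

Lemma leb1f0 : leb1f set0 = 0%E.
Proof. exact: (measure0 (@lebesgue_measure R)). Qed.

Lemma leb1f_ge0 A : (0 <= leb1f A)%E.
Proof. exact: (measure_ge0 (@lebesgue_measure R)). Qed.

Lemma leb1f_sigma_additive : semi_sigma_additive leb1f.
Proof. exact: (@measure_semi_sigma_additive _ _ _ (@lebesgue_measure R)). Qed.

HB.instance Definition _ := isMeasure.Build _ _ _ leb1f leb1f0 leb1f_ge0 leb1f_sigma_additive.

Lemma leb1f_sigma_finite : sigma_finite setT leb1f.
Proof. exact: (@sigma_finiteT _ _ _ (@lebesgue_measure R)). Qed.

HB.instance Definition _ := Measure_isSigmaFinite.Build _ _ _ leb1f leb1f_sigma_finite.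

Definition leb1 : {sigma_finite_measure set R -> \bar R} := leb1f.

Lemma mpres_leb1 : mpres (@lebesgue_measure R) leb1 id.
Proof. by split => // _ A; rewrite setTI. Qed.

End Lebesgue.

(** * Lebesgue measure on the line and on the space of velocities *)

Section RealLine.
Context {R : realType}.
Local Notation leb := (@leb1 R).

(** The inverse is continuous off 0, and 0, where it takes the value 0, is a measurable
    singleton. *)
Lemma measurable_inv : measurable_fun setT (@GRing.inv R).
Proof.
rewrite -(setvU [set (0:R)]); apply/measurable_funU => //; first exact: measurableC.
split; last exact: measurable_fun_set1.
apply: open_continuous_measurable_fun; first by apply: closed_openC; apply: accessible_closed_set1; apply: hausdorff_accessible; exact: Rhausdorff.
by move=> x; rewrite inE/= => /eqP x0; exact: inv_continuous.
Qed.

Lemma measurable_sqrt : measurable_fun setT (@Num.sqrt R).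
Proof. by apply: continuous_measurable_fun; exact: sqrt_continuous. Qed.

Lemma mpres_shift1 (c : R) : mpres leb leb (fun x => x + c).
Proof.
have ms0 : measurable_fun setT (fun x : R => x + c) by exact: measurable_funD.
have ms : measurable_fun setT ((fun x : R => x + c) : R -> measurableTypeR R) by exact: ms0.
split=> // A mA.
have [nu nuE] := pushforward_measure leb ms.
rewrite -nuE; apply/esym; refine (@lebesgue_measure_unique R nu _ A mA).
move=> _ [[a b] _ <-] /=; rewrite nuE.
rewrite (_ : _ @^-1` _ = `]a - c, b - c]%classic); last first.
  by apply/seteqP; split => x /=; rewrite !in_itv/= => /andP[h1 h2]; apply/andP; lra.
rewrite /leb1 /= /leb1f !lebesgue_measure_itv/= !lte_fin ltrD2r; case: ifP => // _.
by rewrite -!EFinB; congr EFin; lra.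
Qed.

Lemma mpres_opp1 : mpres leb leb (fun x => - x).
Proof.
have ms0 : measurable_fun setT (fun x : R => - x) by exact: oppr_measurable.
have ms : measurable_fun setT ((fun x : R => - x) : R -> measurableTypeR R) by exact: ms0.
split=> // A mA.
have [nu nuE] := pushforward_measure leb ms.
rewrite -nuE; apply/esym; refine (@lebesgue_measure_unique R nu _ A mA).
move=> _ [[a b] _ <-] /=; rewrite nuE.
(* The reflection turns []a, b]] into an interval closed on the other side, of the same length. *)
rewrite (_ : _ @^-1` _ = `[- b, - a[%classic); last first.
  by apply/seteqP; split => x /=; rewrite !in_itv/= => /andP[h1 h2]; apply/andP; lra.
rewrite /leb1 /= /leb1f !lebesgue_measure_itv/= !lte_fin ltrN2; case: ifP => // _.
by rewrite -!EFinB; congr EFin; lra.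
Qed.

End RealLine.

(** Coordinates are indexed by a three-element type: a statement for all [i] is proved by [case],
    and a sum over coordinates unfolds to three terms that [ring] can treat. *)
Inductive axis := ax1 | ax2 | ax3.

Section Space.
Context {R : realType}.
Local Notation V := (V3 R).
Local Notation leb := (@leb1 R).

(** The set function [leb3] rebuilt from [leb1] and [pm], so that the lemmas on products apply;
    [mpres_leb3] and [mpres_leb3'] transfer integrals in both directions. *)
Definition mu3 : {sigma_finite_measure set V -> \bar R} := pm (pm leb leb) leb.

Lemma mpres_leb3 : mpres (@leb3 R) mu3 id.
Proof.
have := mpres_prod (mpres_prod (@mpres_leb1 R) (@mpres_leb1 R)) (@mpres_leb1 R).
rewrite (_ : (fun z => _) = id)//.
by apply/funext => -[[x y] z].
Qed.

Definition cd (i : axis) (x : V) : R :=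
  match i with ax1 => v3x x | ax2 => v3y x | ax3 => v3z x end.
Definition ee (i : axis) : V :=
  match i with ax1 => e3_1 R | ax2 => e3_2 R | ax3 => e3_3 R end.
Definition sum3 (F : axis -> R) : R := F ax1 + F ax2 + F ax3.
Definition opp3 (x : V) : V := scale3 (-1) x.

Lemma v3P (x y : V) : (forall i, cd i x = cd i y) -> x = y.
Proof.
move: x y => [[a b] c] [[a' b'] c'] h.
by have := (h ax1, h ax2, h ax3); rewrite /cd /v3x /v3y /v3z /= => -[[-> ->] ->].
Qed.

Lemma measurable_cd i : measurable_fun setT (cd i).
Proof.
case: i; rewrite /cd /v3x /v3y /v3z; last exact: measurable_snd.
- by apply: (@measurableT_comp _ _ _ _ _ _ fst) => //; exact: measurable_fst.
- by apply: (@measurableT_comp _ _ _ _ _ _ snd) => //; exact: measurable_fst.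
Qed.

Lemma mu3_shift (c : V) : mpres mu3 mu3 (fun x => add3 x c).
Proof.
exact: (mpres_prod (mpres_prod (mpres_shift1 (v3x c)) (mpres_shift1 (v3y c)))
  (mpres_shift1 (v3z c))).
Qed.

Lemma mu3_opp : mpres mu3 mu3 opp3.
Proof.
have := mpres_prod (mpres_prod (@mpres_opp1 R) (@mpres_opp1 R)) (@mpres_opp1 R).
rewrite (_ : (fun z => _) = opp3)//.
by apply/funext => x; rewrite /opp3 /scale3 /mkV3 !mulN1r.
Qed.

End Space.

(** * Calculus in one and three variables *)

Section OneVariable.
Context {R : realType}.
Implicit Types (f g : R -> R).

Definition isd f (x d : R) := is_derive x (1 : R) f d.

Lemma isdP f x d : isd f x d <-> h^-1 * (f (x + h) - f x) @[h --> (0:R)^'] --> d.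
Proof.
have E : (fun h : R => h^-1 *: ((f \o shift x) (h *: (1:R)) - f x)) =
         (fun h => h^-1 * (f (x + h) - f x)).
  by apply/funext => h /=; rewrite [h%:A]mulr1 [h + x]addrC.
split.
  by move=> [df <-]; move: df; rewrite /derivable /derive E.
move=> c; have := c; rewrite -E => c'.
split; first by apply/cvg_ex; exists d.
exact: cvg_lim c'.
Qed.

Lemma isd_eq f g x d d' : isd f x d -> f =1 g -> d = d' -> isd g x d'.
Proof. by move=> h /funext <- <-. Qed.

Lemma isd_near f g x d : (\forall y \near x, f y = g y) -> isd f x d -> isd g x d.
Proof. exact: near_eq_is_derive. Qed.

Lemma isd_cst c x : isd (fun=> c) x 0.
Proof. exact: is_derive_cst. Qed.

Lemma isd_id x : isd id x 1.
Proof. exact: is_derive_id. Qed.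

Lemma isdD f g x a b : isd f x a -> isd g x b -> isd (fun t => f t + g t) x (a + b).
Proof. by move=> ? ?; exact: is_deriveD. Qed.

Lemma isdN f x a : isd f x a -> isd (fun t => - f t) x (- a).
Proof. by move=> ?; exact: is_deriveN. Qed.

Lemma isdB f g x a b : isd f x a -> isd g x b -> isd (fun t => f t - g t) x (a - b).
Proof. by move=> ? /isdN ?; exact: isdD. Qed.

Lemma isdM f g x a b : isd f x a -> isd g x b ->
  isd (fun t => f t * g t) x (a * g x + f x * b).
Proof.
move=> fa gb; have h : isd (f * g) x (f x *: b + g x *: a) by exact: is_deriveM.
apply: isd_eq h _ _ => //.
by rewrite /GRing.scale /= addrC mulrC.
Qed.

Lemma isdZ c f x a : isd f x a -> isd (fun t => c * f t) x (c * a).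
Proof. by move=> h; apply: isd_eq (isdM (isd_cst c x) h) _ _ => //; rewrite mul0r add0r. Qed.

Lemma isd_comp f g x a b : isd f x a -> isd g (f x) b -> isd (fun t => g (f t)) x (b * a).
Proof. by move=> ? ?; exact: is_derive1_comp. Qed.

Lemma isdV f x a : f x != 0 -> isd f x a -> isd (fun t => (f t)^-1) x (- a / f x ^+ 2).
Proof.
move=> fx0 [df <-]; split; first exact: derivableV.
rewrite deriveV//= /GRing.scale /= mulrC mulrN -mulNr; congr (_ * _).
Qed.

Lemma isd_continuous f x a : isd f x a -> {for x, continuous f}.
Proof. by move=> [df _]; apply/differentiable_continuous/derivable1_diffP. Qed.

Lemma isd_uniq f x a b : isd f x a -> isd f x b -> a = b.
Proof. by move=> [_ <-] [_ <-]. Qed.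

Lemma isd_shift f x c d : isd f (x + c) d -> isd (fun t => f (t + c)) x d.
Proof.
move=> h; have h2 : isd (fun t => t + c) x 1.
  by apply: isd_eq (isdD (isd_id x) (isd_cst c x)) _ _ => //; rewrite addr0.
by apply: isd_eq (isd_comp h2 h) _ _ => //; rewrite mulr1.
Qed.

(** The point [c] is located by two distances, so that the statement also covers [b < a]: increments
    of either sign occur below. *)
Lemma mean_value f df a b : (forall x, isd f x (df x)) ->
  exists c, `|c - a| <= `|b - a| /\ `|c - b| <= `|b - a| /\ f b - f a = df c * (b - a).
Proof.
move=> hf; have cf : continuous f by move=> x; exact: isd_continuous (hf x).
wlog ab : a b / a <= b.
  move=> H; have [ab|/ltW ba] := leP a b; first exact: H.
  have [c [h1 [h2 h3]]] := H b a ba; exists c.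
  by rewrite distrC [`|b - a|]distrC distrC; split=> //; split=> //; rewrite -opprB h3 -mulrN opprB.
have [c] := MVT_segment ab (fun x _ => hf x) (continuous_subspaceT cf).
rewrite in_itv /= => /andP[ac cb] e; exists c.
by rewrite !ler_norml; do 2?[split=> //]; apply/andP; rewrite ger0_norm ?subr_ge0//; lra.
Qed.

Lemma lipschitz_bound f df C a b : (forall x, isd f x (df x)) -> (forall x, `|df x| <= C) ->
  `|f b - f a| <= C * `|b - a|.
Proof.
by move=> hf hC; have [c [_ [_ ->]]] := mean_value a b hf; rewrite normrM ler_wpM2r.
Qed.

Lemma continuous_distP f x : {for x, continuous f} <->
  forall e, 0 < e -> exists2 dl, 0 < dl & forall y, `|y - x| < dl -> `|f y - f x| < e.
Proof.
split.
  move=> /cvgrPdist_lt cf e e0; have /nbhs_ballP[dl dl0 h] := cf e e0.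
  exists dl => // y yx; rewrite distrC; apply: h; rewrite /ball /= distrC//.
move=> h; apply/cvgrPdist_lt => e e0; have [dl dl0 hd] := h e e0.
apply/nbhs_ballP; exists dl => // y; rewrite /ball /= => yx.
by rewrite distrC; apply: hd; rewrite distrC.
Qed.

Lemma isd_dist f x d : (forall e, 0 < e -> exists2 dl, 0 < dl & forall h, `|h| < dl ->
    `|f (x + h) - f x - d * h| <= e * `|h|) -> isd f x d.
Proof.
move=> H; apply/isdP; apply/cvgrPdist_le => e e0; have [dl dl0 hd] := H e e0.
apply/nbhs_ballP; exists dl => // h; rewrite /ball /= sub0r normrN => hh hn0.
rewrite distrC -(ler_pM2r (x := `|h|)) ?normr_gt0// -normrM.
rewrite (_ : _ * h = f (x + h) - f x - d * h); first exact: hd.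
by field.
Qed.

Lemma isd_distP f x d : isd f x d -> forall e, 0 < e -> exists2 dl, 0 < dl & forall h, `|h| < dl ->
    `|f (x + h) - f x - d * h| <= e * `|h|.
Proof.
move=> /isdP /cvgrPdist_le H e e0; have /nbhs_ballP[dl dl0 hd] := H e e0.
exists dl => // h hh; have [->|hn0] := eqVneq h 0.
  by rewrite addr0 mulr0 subrr subr0 normr0 mulr0.
have := hd h; rewrite /ball /= sub0r normrN => /(_ hh hn0).
rewrite distrC -(ler_pM2r (x := `|h|)) ?normr_gt0// -normrM.
by rewrite (_ : (_ - d) * h = f (x + h) - f x - d * h)//; field.
Qed.

Lemma isd_seq f x d (h : nat -> R) : isd f x d -> (forall n, h n != 0) ->
  h n @[n --> \oo] --> 0 -> (h n)^-1 * (f (x + h n) - f x) @[n --> \oo] --> d.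
Proof. by move=> /isdP; move=> /cvgr_dnbhsP H hn0 h0; apply: (H h). Qed.

(* [ebump k] is [x^-k exp(-1/x)] for [x > 0]: this family is stable under
   differentiation, which makes products of such functions of the coordinates smooth. *)
Definition ebump (k : nat) (x : R) : R := if 0 < x then x^-1 ^+ k * expR (- x^-1) else 0.

(** With [y = x^-1], the bound [y^(k+2) / (k+2)! <= exp y] makes [y^k exp(-y)] of order [x^2], which
    gives the zero derivative at 0. *)
Lemma ebump_lin k x : `|ebump k x| <= k.+2`!%:R * x ^+ 2.
Proof.
rewrite /ebump; case: ifPn => [x0|_]; last by rewrite normr0 mulr_ge0 ?sqr_ge0.
rewrite ger0_norm ?mulr_ge0 ?expR_ge0 ?exprn_ge0 ?invr_ge0 ?(ltW x0)//.
have xi0 : 0 < x^-1 by rewrite invr_gt0.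
have /= := expR_ge1Dxn k.+1 (ltW xi0).
rewrite expRN ler_pdivrMr ?expR_gt0// => h.
have : x^-1 ^+ k.+2 / k.+2`!%:R <= expR x^-1 by rewrite (le_trans _ h)// lerDr.
rewrite ler_pdivrMr ?ltr0n ?fact_gt0// => h2.
rewrite -(@ler_pM2r _ (x^-1 ^+ 2)) ?exprn_gt0// -exprD addn2.
rewrite (le_trans h2)// (_ : _ * x^-1 ^+ 2 = expR x^-1 * k.+2`!%:R)//.
by field; rewrite gt_eqF.
Qed.

Lemma isd_ebump k x : isd (ebump k) x (- k%:R * ebump k.+1 x + ebump k.+2 x).
Proof.
have [x0|x0|->] := ltgtP x 0.
- rewrite /ebump !ltNge (ltW x0)/= mulr0 addr0.
  apply: (isd_near (f := fun=> 0)); last exact: isd_cst.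
  near=> y; rewrite ifF//; apply/negbTE; rewrite -leNgt.
  by apply/ltW; near: y; exact: lt_nbhsl.
- apply: (isd_near (f := fun x => x^-1 ^+ k * expR (- x^-1))).
    near=> y; rewrite /ebump ifT//; near: y; exact: lt_nbhsr.
  rewrite /ebump x0.
  have xn0 : x != 0 by rewrite gt_eqF.
  have h1 := isdV xn0 (isd_id x).
  have h2 : isd (fun x => x^-1 ^+ k) x ((k%:R * x^-1 ^+ k.-1) * (- 1 / x ^+ 2)).
    by apply: isd_eq (is_deriveX k h1) _ _ => // y; rewrite exprfctE.
  have h3 := isd_comp (isdN h1) (is_derive_expR (- x^-1)).
  apply: isd_eq (isdM h2 h3) _ _ => //.
  by case: (k) => [|m]; rewrite /= ?expr0 ?exprS; field.
- rewrite /ebump ltxx mulr0 addr0; apply: isd_dist => e e0.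
  exists (e / k.+2`!%:R); first by rewrite divr_gt0// ltr0n fact_gt0.
  move=> h hh; rewrite add0r ltxx subr0 mul0r subr0.
  apply: le_trans (ebump_lin k h) _.
  rewrite -real_normK ?num_real// expr2 mulrA ler_wpM2r// mulrC.
  by rewrite -ler_pdivlMr ?ltr0n ?fact_gt0// ltW.
Unshelve. all: by end_near. Qed.

Lemma ebump_continuous k : continuous (ebump k).
Proof. by move=> x; exact: isd_continuous (isd_ebump k x). Qed.

(** Smooth approximations of the indicator of a half-line; products of them in the coordinates
    approximate indicators of boxes. *)
Lemma ebump0_cvg (x : R) : ebump 0 (n.+1%:R * x) @[n --> \oo] --> (((0 < x)%R)%:R : R).
Proof.
have [x0|x0] := ltP 0 x; last first.
  rewrite (_ : (fun n => _) = fun=> 0); first exact: cvg_cst.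
  apply/funext => n; rewrite /ebump ifF//; apply/negbTE.
  by rewrite -leNgt pmulr_rle0 ?ltr0n.
rewrite (_ : (fun n => _) = fun n => expR (- (n.+1%:R^-1 * x^-1))); last first.
  by apply/funext => n; rewrite /ebump mulr_gt0 ?ltr0n// expr0 mul1r invfM.
have : - (n.+1%:R^-1 * x^-1) @[n --> \oo] --> (0 : R).
  rewrite -[X in _ --> X]oppr0 -[X in _ --> - X](mul0r x^-1).
  by apply: cvgN; apply: cvgM; [exact: cvg_harmonic|exact: cvg_cst].
rewrite -[true%:R]expR0 => h; exact: continuous_cvg (@continuous_expR R _) h.
Qed.

Lemma ebump0_itv x : 0 <= ebump 0 x <= 1.
Proof.
rewrite /ebump; case: ifPn => x0; last by rewrite lexx ler01.
by rewrite expr0 mul1r expR_ge0/= -expR0 ler_expR oppr_le0 invr_ge0 ltW.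
Qed.

End OneVariable.

(** * Topology and measurability on R^3 *)

Section Space3.
Context {R : realType}.
Local Notation V := (V3 R).

Definition close3 (dl : R) (x y : V) := forall i, `|cd i y - cd i x| < dl.

Lemma ball3P (x : V) dl y : ball x dl y <-> close3 dl x y.
Proof.
rewrite /ball /= /prod_ball /ball /= /prod_ball /ball /= /close3; split.
  by move=> [[h1 h2] h3] [] /=; rewrite distrC.
by move=> h; have := (h ax1, h ax2, h ax3) => -[[h1 h2] h3]; split; [split|];
  rewrite distrC.
Qed.

Lemma continuous3P (f : V -> R) x : {for x, continuous f} <->
  forall e, 0 < e -> exists2 dl, 0 < dl & forall y, close3 dl x y -> `|f y - f x| < e.
Proof.
split.
  move=> /cvgrPdist_lt cf e e0; have /nbhs_ballP[dl dl0 h] := cf e e0.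
  by exists dl => // y /ball3P yx; rewrite distrC; apply: h.
move=> h; apply/cvgrPdist_lt => e e0; have [dl dl0 hd] := h e e0.
have hb : nbhs x (ball x dl) by exact: nbhsx_ballx.
by apply: filterS hb => y /ball3P yx; rewrite distrC; apply: hd.
Qed.

Lemma continuous_cd i : continuous (@cd R i).
Proof. by move=> x; apply/continuous3P => e e0; exists e. Qed.

Lemma add3E (x y : V) : add3 x y = x + y. Proof. by []. Qed.
Lemma scale3E a (x : V) : scale3 a x = a *: x. Proof. by []. Qed.
Lemma sub3E (x y : V) : sub3 x y = x - y.
Proof. by rewrite /sub3 add3E scale3E scaleN1r. Qed.

Lemma cdD i (x y : V) : cd i (add3 x y) = cd i x + cd i y. Proof. by case: i. Qed.
Lemma cdZ i a (x : V) : cd i (scale3 a x) = a * cd i x. Proof. by case: i. Qed.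
Lemma cdB i (x y : V) : cd i (sub3 x y) = cd i x - cd i y.
Proof. by rewrite cdD cdZ mulN1r. Qed.

Lemma cd_ee i j : cd i (@ee R j) = (match i, j with
  | ax1, ax1 | ax2, ax2 | ax3, ax3 => 1 | _, _ => 0 end).
Proof. by case: i; case: j. Qed.

Lemma dot3E (x y : V) : dot3 x y = sum3 (fun i => cd i x * cd i y). Proof. by []. Qed.

Lemma pair_continuous (T U W : topologicalType) (f : T -> U) (g : T -> W) t :
  {for t, continuous f} -> {for t, continuous g} -> {for t, continuous (fun t => (f t, g t))}.
Proof.
move=> cf cg; exact: (@cvg_pair T U W (nbhs t) (nbhs (f t)) (nbhs (g t)) _ _ _ f g cf cg).
Qed.

Lemma mk3_continuous (T : topologicalType) (f g h : T -> R) : continuous f -> continuous g ->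
  continuous h -> continuous (fun t => mkV3 (f t) (g t) (h t) : V).
Proof. by move=> cf cg ch t; apply: pair_continuous; [apply: pair_continuous; [exact: cf|exact: cg]|exact: ch]. Qed.

Lemma eq3_continuous (T : topologicalType) (F : T -> V) :
  (forall i, continuous (fun t => cd i (F t))) -> continuous F.
Proof.
move=> h; rewrite (_ : F = fun t => mkV3 (cd ax1 (F t)) (cd ax2 (F t)) (cd ax3 (F t))).
  by apply: mk3_continuous; exact: h.
by apply/funext => t; apply: v3P => -[].
Qed.

Lemma continuous_sum3 (T : topologicalType) (F : axis -> T -> R) :
  (forall i, continuous (F i)) -> continuous (fun t => sum3 (fun i => F i t)).
Proof.
by move=> h t; rewrite /sum3; apply: cvgD; [apply: cvgD|]; exact: h.
Qed.

Lemma shift_continuous (c : V) : continuous (fun x => add3 x c).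
Proof.
apply: eq3_continuous => i x; under eq_fun do rewrite cdD.
by apply: cvgD; [exact: continuous_cd|exact: cvg_cst].
Qed.

Lemma dot3_continuous : continuous (fun x : V => dot3 x x).
Proof.
by apply: (@continuous_sum3 _ (fun i x => cd i x * cd i x)) => i x; apply: cvgM; exact: continuous_cd.
Qed.

Lemma norm3_continuous : continuous (@norm3 R).
Proof.
by move=> x; apply: continuous_cvg; [exact: sqrt_continuous|exact: dot3_continuous].
Qed.

Lemma dot3_ge0 (x : V) : 0 <= dot3 x x.
Proof. by rewrite /dot3 !addr_ge0// -expr2 sqr_ge0. Qed.

Lemma norm3_sqr (x : V) : norm3 x ^+ 2 = dot3 x x.
Proof. by rewrite sqr_sqrtr// dot3_ge0. Qed.

Lemma norm3_ge0 (x : V) : 0 <= norm3 x. Proof. exact: sqrtr_ge0. Qed.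

Lemma cd_norm3 i (x : V) : `|cd i x| <= norm3 x.
Proof.
rewrite -sqrtr_sqr ler_wsqrtr// dot3E /sum3; have a := sqr_ge0 (cd ax1 x).
have b := sqr_ge0 (cd ax2 x); have c := sqr_ge0 (cd ax3 x).
by case: i; nra.
Qed.

(** The constant 2 stands in for the sharp [sqrt 3], as [3 <= 4]. *)
Lemma norm3_le (x : V) r : (forall i, `|cd i x| <= r) -> norm3 x <= 2 * r.
Proof.
move=> h; have r0 : 0 <= r by apply: le_trans (h ax1).
rewrite -(ler_pXn2r (_ : 0 < 2)%N) ?nnegrE ?norm3_ge0 ?mulr_ge0// norm3_sqr.
have H i : cd i x ^+ 2 <= r ^+ 2 by rewrite -real_normK ?num_real// lerXn2r ?nnegrE.
by have := (H ax1, H ax2, H ax3) => -[[]]; rewrite dot3E /sum3; nra.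
Qed.

Definition cbox (r : R) : set V := [set x | forall i, `|cd i x| <= r].
Definition box (r : R) : set V := [set x | forall i, `|cd i x| < r].

Lemma cbox_compact r : compact (cbox r).
Proof.
have E : cbox r = (`[- r, r] `*` `[- r, r]) `*` `[- r, r].
  apply/seteqP; split => [x h|x [[h1 h2] h3]] /=.
    by have := (h ax1, h ax2, h ax3) => -[[]]; rewrite !in_itv /= -!ler_norml.
  by case; rewrite ler_norml; [move: h1|move: h2|move: h3]; rewrite /= in_itv.
by rewrite E; apply: compact_setX; [apply: compact_setX|]; exact: segment_compact.
Qed.

Lemma bounded_of_compact_support (f : V -> R) r : continuous f ->
  (forall x, ~ cbox r x -> f x = 0) -> exists M, forall x, `|f x| <= M.
Proof.
move=> cf f0.
have /compact_bounded[M [_ hM]] := continuous_compact (continuous_subspaceT cf) (@cbox_compact r).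
exists (`|M| + 1) => x; have [xb|/f0 ->] := pselect (cbox r x).
  by apply: hM; [rewrite (le_lt_trans (ler_norm M))// ltrDl|exists x].
by rewrite normr0 addr_ge0.
Qed.

Lemma measurable_mk3 d (T : measurableType d) (f g h : T -> R) : measurable_fun setT f ->
  measurable_fun setT g -> measurable_fun setT h ->
  measurable_fun setT (fun t => mkV3 (f t) (g t) (h t) : V).
Proof. by move=> mf mg mh; apply: measurable_fun_pair => //; exact: measurable_fun_pair. Qed.

Lemma measurable_eq3 d (T : measurableType d) (F : T -> V) :
  (forall i, measurable_fun setT (fun t => cd i (F t))) -> measurable_fun setT F.
Proof.
move=> h; rewrite (_ : F = fun t => mkV3 (cd ax1 (F t)) (cd ax2 (F t)) (cd ax3 (F t))).
  by apply: measurable_mk3; exact: h.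
by apply/funext => t; apply: v3P => -[].
Qed.

Lemma measurable_cd_comp d (T : measurableType d) (F : T -> V) i :
  measurable_fun setT F -> measurable_fun setT (fun t => cd i (F t)).
Proof. by move=> mF; apply: measurableT_comp => //; exact: measurable_cd. Qed.

Lemma measurable_sum3 d (T : measurableType d) (F : axis -> T -> R) :
  (forall i, measurable_fun setT (F i)) -> measurable_fun setT (fun t => sum3 (fun i => F i t)).
Proof. by move=> h; apply: measurable_funD; [apply: measurable_funD|]; exact: h. Qed.

Lemma measurable_dot3 d (T : measurableType d) (F G : T -> V) :
  measurable_fun setT F -> measurable_fun setT G -> measurable_fun setT (fun t => dot3 (F t) (G t)).
Proof.
move=> mF mG; apply: (@measurable_sum3 _ _ (fun i t => cd i (F t) * cd i (G t))) => i.
by apply: measurable_funM; exact: measurable_cd_comp.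
Qed.

Lemma measurable_add3 d (T : measurableType d) (F G : T -> V) :
  measurable_fun setT F -> measurable_fun setT G -> measurable_fun setT (fun t => add3 (F t) (G t)).
Proof.
move=> mF mG; apply: measurable_eq3 => i; under eq_fun do rewrite cdD.
by apply: measurable_funD; exact: measurable_cd_comp.
Qed.

Lemma measurable_scale3 d (T : measurableType d) (a : T -> R) (F : T -> V) :
  measurable_fun setT a -> measurable_fun setT F ->
  measurable_fun setT (fun t => scale3 (a t) (F t)).
Proof.
move=> ma mF; apply: measurable_eq3 => i; under eq_fun do rewrite cdZ.
by apply: measurable_funM => //; exact: measurable_cd_comp.
Qed.

Lemma measurable_sub3 d (T : measurableType d) (F G : T -> V) :
  measurable_fun setT F -> measurable_fun setT G -> measurable_fun setT (fun t => sub3 (F t) (G t)).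
Proof.
by move=> mF mG; apply: measurable_add3 => //; apply: measurable_scale3 => //; exact: measurable_cst.
Qed.

Lemma measurable_norm3 d (T : measurableType d) (F : T -> V) :
  measurable_fun setT F -> measurable_fun setT (fun t => norm3 (F t)).
Proof.
by move=> mF; apply: (measurableT_comp (@measurable_sqrt R)); exact: measurable_dot3.
Qed.

Lemma measurable_invr d (T : measurableType d) (f : T -> R) :
  measurable_fun setT f -> measurable_fun setT (fun t => (f t)^-1).
Proof. by move=> mf; exact: (measurableT_comp (@measurable_inv R)). Qed.

(* Caratheodory: the second variable is discretised by [floor (n y) / n]. *)
Lemma measurable_caratheodory d (T : measurableType d) (F : T * R -> R) :
  (forall y, measurable_fun setT (fun x => F (x, y))) ->
  (forall x, continuous (fun y => F (x, y))) -> measurable_fun setT F.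
Proof.
move=> mF cF.
pose g n (y : R) : R := (Num.floor (n.+1%:R * y))%:~R / n.+1%:R.
apply: (measurable_fun_cvg (h := fun n z => F (z.1, g n z.2))) => [n|[x y] _] /=; last first.
  apply: (@continuous_cvg _ _ _ _ _ (fun n => g n y) (fun y => F (x, y))); first exact: cF.
  apply/cvgrPdist_le => e e0; near=> n.
  have n0 : (0 : R) < n.+1%:R by rewrite ltr0n.
  have := floor_itv (n.+1%:R * y); rewrite intrD /g => /andP[h1 h2].
  have H1 : (Num.floor (n.+1%:R * y))%:~R / n.+1%:R <= y by rewrite ler_pdivrMr// [y * _]mulrC.
  rewrite ger0_norm ?subr_ge0// (@le_trans _ _ (n.+1%:R^-1))//; last first.
    by apply: ltW; near: n; exact: (near_infty_natSinv_lt (PosNum e0)).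
  by rewrite -[X in _ <= X]mul1r ler_pdivlMr// [_ * n.+1%:R]mulrC mulrBr [_ * (_ / _)]mulrCA mulfV ?gt_eqF// mulr1 lerBlDl ltW.
move=> _ A mA; rewrite setTI.
have -> : (fun z : T * R => F (z.1, g n z.2)) @^-1` A = \bigcup_(k : nat)
    (if (unpickle k : option int) is Some m then
       ((fun x => F (x, m%:~R / n.+1%:R)) @^-1` A) `*`
       ((fun y : R => Num.floor (n.+1%:R * y)) @^-1` [set m]) else set0).
  apply/seteqP; split => [[x y] /= h|[x y] /= [k _]].
    by exists (pickle (Num.floor (n.+1%:R * y))); [exact: I|rewrite pickleK].
  by case: (unpickle k) => //= m [/= h1 h2]; rewrite /g h2.
apply: bigcupT_measurable => k; case: (unpickle k) => [m|]; last exact: measurable0.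
apply: measurableX; first by rewrite -[X in measurable X]setTI; exact: mF.
have -> : (fun y : R => Num.floor (n.+1%:R * y)) @^-1` [set m] =
   `[m%:~R / n.+1%:R, (m + 1)%:~R / n.+1%:R[%classic.
  have n0 : (0 : R) < n.+1%:R by rewrite ltr0n.
  apply/seteqP; split => y /=; rewrite in_itv /=.
    by move=> <-; rewrite ler_pdivrMr// ltr_pdivlMr// [y * _]mulrC floor_itv.
  by rewrite ler_pdivrMr// ltr_pdivlMr// [y * _]mulrC => /floor_def.
exact: measurable_itv.
Unshelve. all: by end_near. Qed.

Lemma continuous_line (f : V -> R) (G : R -> V) : continuous f ->
  (forall i s t, `|cd i (G t) - cd i (G s)| <= `|t - s|) -> continuous (fun t => f (G t)).
Proof.
move=> cf hG x; apply/continuous_distP => e e0.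
have [dl dl0 h] := (continuous3P f (G x)).1 (cf _) e e0.
by exists dl => // y yx; apply: h => i; apply: le_lt_trans (hG i x y) yx.
Qed.

(** Measurability refers to the product sigma-algebra; it is obtained from continuity in each
    variable separately, by two applications of [measurable_caratheodory]. *)
Lemma continuous_measurable3 (f : V -> R) : continuous f -> measurable_fun setT f.
Proof.
move=> cf.
apply: measurable_caratheodory => [z|[x y]].
  apply: (@measurable_caratheodory _ _ (fun p : R * R => f (p, z))) => [y|x].
    apply: continuous_measurable_fun.
    by apply: (continuous_line (G := fun x => (x, y, z)) cf) => -[] s t; rewrite /= ?subrr ?normr0.
  by apply: (continuous_line (G := fun y => (x, y, z)) cf) => -[] s t; rewrite /= ?subrr ?normr0.
by apply: (continuous_line (G := fun z => (x, y, z)) cf) => -[] s t; rewrite /= ?subrr ?normr0.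
Qed.

End Space3.

(** * Differential calculus on R^3 and smooth test functions *)

Section Calculus3.
Context {R : realType}.
Local Notation V := (V3 R).
Implicit Types (f g : V -> R) (x a u : V).

(** A directional derivative is the derivative at 0 of a function of one variable, so the rules for
    [isd] transfer at once. *)
Definition isD f x a d := isd (fun t => f (add3 x (scale3 t a))) 0 d.

Lemma isD_is_derive f x a d : isD f x a d <-> is_derive x a f d.
Proof.
have E : (fun h : R => h^-1 *: ((f \o shift x) (h *: a) - f x)) =
   (fun h : R => h^-1 * (f (add3 x (scale3 (0 + h) a)) - f (add3 x (scale3 0 a)))).
  by apply/funext => h /=; rewrite !add3E !scale3E scale0r addr0 add0r [x + _]addrC.
rewrite /isD isdP; split; last first.
  by move=> [df <-]; move: df; rewrite /derivable /derive E.
move=> c; have := c; rewrite -E => c'.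
split; first by apply/cvg_ex; exists d.
exact: cvg_lim c'.
Qed.

Lemma isD_derive f x a d : isD f x a d -> 'D_a f x = d.
Proof. by move=> /isD_is_derive[]. Qed.

Lemma isD_line f df x a : (forall y, isD f y a (df y)) ->
  forall t, isd (fun t => f (add3 x (scale3 t a))) t (df (add3 x (scale3 t a))).
Proof.
move=> h t; have := h (add3 x (scale3 t a)); rewrite /isD => h2.
apply: isd_eq (isd_shift (c := - t) _) _ (erefl _); first by rewrite subrr; exact: h2.
move=> s /=; congr f; rewrite !add3E !scale3E scalerBl -addrA; congr (_ + _).
by rewrite addrC subrK.
Qed.

Lemma isD_eq f g x a d d' : isD f x a d -> f =1 g -> d = d' -> isD g x a d'.
Proof. by move=> h /funext <- <-. Qed.

Lemma isD_shift f x a c d : isD f (add3 x c) a d -> isD (fun y => f (add3 y c)) x a d.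
Proof.
move=> h; apply: isd_eq h _ (erefl _) => t /=; congr f.
by rewrite !add3E addrAC.
Qed.

Lemma isD_cst c x a : isD (fun=> c) x a 0.
Proof. exact: isd_cst. Qed.

Lemma add3_0 x a : add3 x (scale3 0 a) = x.
Proof. by rewrite add3E scale3E scale0r addr0. Qed.

Lemma isDD f g x a d e : isD f x a d -> isD g x a e -> isD (fun y => f y + g y) x a (d + e).
Proof. exact: isdD. Qed.

Lemma isDM f g x a d e : isD f x a d -> isD g x a e ->
  isD (fun y => f y * g y) x a (d * g x + f x * e).
Proof.
by move=> h1 h2; apply: isd_eq (isdM h1 h2) _ _ => //; rewrite !add3E !scale3E scale0r addr0.
Qed.

Lemma isD_comp f (p : R -> R) x a d e : isD f x a d -> isd p (f x) e ->
  isD (fun y => p (f y)) x a (e * d).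
Proof.
by move=> h1 h2; apply: isd_comp h1 _; rewrite add3E scale3E scale0r addr0.
Qed.

Lemma isD_cd i x a : isD (cd i) x a (cd i a).
Proof.
rewrite /isD; apply: isd_eq (isdD (isd_cst (cd i x) 0) (isdM (isd_id 0) (isd_cst (cd i a) 0))) _ _.
  by move=> t; rewrite cdD cdZ.
by rewrite mul1r mulr0 addr0 add0r.
Qed.

Definition bounded f := exists M, forall x, `|f x| <= M.

(** The partial derivatives are data and not values of ['D], so that explicit formulas can be
    supplied for them. This is the class of test fields in the dual functional. *)
Definition C1b f (df : axis -> V -> R) :=
  [/\ continuous f, bounded f, (forall i, continuous (df i)), (forall i, bounded (df i)) &
      (forall i x, isD f x (ee i) (df i x))].

Definition step3 i (y x : V) : V :=
  match i with
  | ax1 => x | ax2 => mkV3 (v3x y) (v3y x) (v3z x) | ax3 => mkV3 (v3x y) (v3y y) (v3z x)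
  end.

(* Change the coordinates one at a time and use the mean value theorem for each. *)
Lemma lin_approx f df : C1b f df -> forall x e, 0 < e -> exists2 dl, 0 < dl &
  forall y, close3 dl x y ->
    `|f y - f x - sum3 (fun i => df i x * (cd i y - cd i x))| <=
       e * sum3 (fun i => `|cd i y - cd i x|).
Proof.
move=> [cf _ cdf _ hD] x e e0.
have /(_ _ e e0) H i := (continuous3P (df i) x).1 (cdf i x).
have [d1 d10 h1] := H ax1; have [d2 d20 h2] := H ax2; have [d3 d30 h3] := H ax3.
pose dl := Num.min d1 (Num.min d2 d3).
have H2 i z : close3 dl x z -> `|df i z - df i x| < e.
  by move=> hz; case: i; [apply: h1|apply: h2|apply: h3] => j; apply: lt_le_trans (hz j) _;
    rewrite /dl !ge_min lexx ?orbT.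
exists dl; first by rewrite /dl !lt_min d10 d20.
move=> y hy.
have key i : exists2 z, close3 dl x z &
   f (add3 (step3 i y x) (scale3 (cd i y - cd i x) (ee i))) - f (step3 i y x) =
   df i z * (cd i y - cd i x).
  have [c [h4 [_ h5]]] := mean_value 0 (cd i y - cd i x) (isD_line (step3 i y x) (hD i)).
  rewrite !subr0 in h4 h5.
  exists (add3 (step3 i y x) (scale3 c (ee i))); last first.
    by rewrite -h5; congr (_ - f _); rewrite !add3E !scale3E scale0r addr0.
  have dl0 : 0 < dl by rewrite /dl !lt_min d10 d20.
  move=> j; rewrite cdD cdZ cd_ee; have hc := le_lt_trans h4 (hy i).
  have h0 : `|cd j x - cd j x| < dl by rewrite subrr normr0.
  case: i {H2 h5} h4 hc => h4 hc; case: j h0 => h0 /=; rewrite ?mulr1 ?mulr0 ?addr0 //;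
    rewrite ?[_ + c - _]addrAC ?subrr ?add0r//.
  - exact: (hy ax1).
  - exact: (hy ax1).
  - exact: (hy ax2).
have [z1 c1 e1] := key ax1; have [z2 c2 e2] := key ax2; have [z3 c3 e3] := key ax3.
have E : f y - f x = df ax1 z1 * (cd ax1 y - cd ax1 x) + df ax2 z2 * (cd ax2 y - cd ax2 x)
   + df ax3 z3 * (cd ax3 y - cd ax3 x).
  rewrite -e1 -e2 -e3.
  have -> : add3 (step3 ax1 y x) (scale3 (cd ax1 y - cd ax1 x) (ee ax1)) = step3 ax2 y x.
    by apply: v3P => -[]; rewrite cdD cdZ cd_ee /= /v3x /v3y /v3z /=; ring.
  have -> : add3 (step3 ax2 y x) (scale3 (cd ax2 y - cd ax2 x) (ee ax2)) = step3 ax3 y x.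
    by apply: v3P => -[]; rewrite cdD cdZ cd_ee /= /v3x /v3y /v3z /=; ring.
  have -> : add3 (step3 ax3 y x) (scale3 (cd ax3 y - cd ax3 x) (ee ax3)) = y.
    by apply: v3P => -[]; rewrite cdD cdZ cd_ee /= /v3x /v3y /v3z /=; ring.
  by rewrite /=; ring.
rewrite E /sum3.
rewrite (_ : _ - _ = (df ax1 z1 - df ax1 x) * (cd ax1 y - cd ax1 x) +
   (df ax2 z2 - df ax2 x) * (cd ax2 y - cd ax2 x) +
   (df ax3 z3 - df ax3 x) * (cd ax3 y - cd ax3 x)); last by ring.
rewrite [e * (_ + _)]mulrDr [e * (_ + _)]mulrDr; apply: (le_trans (ler_normD _ _)); apply: lerD; last first.
  by rewrite normrM ler_wpM2r// ltW// H2.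
by apply: (le_trans (ler_normD _ _)); apply: lerD; rewrite normrM ler_wpM2r// ltW// H2.
Qed.

Lemma chain3 f df (p : axis -> R -> R) (q : axis -> R) (F : R -> V) t : C1b f df ->
  (forall i s, cd i (F s) = p i s) -> (forall i, isd (p i) t (q i)) ->
  isd (fun s => f (F s)) t (sum3 (fun i => df i (F t) * q i)).
Proof.
move=> hf Fp hp; apply: isd_dist => e e0.
(* [C] bounds the total increment of the coordinates of [F] per unit of [h], and [D] is the size of
   the gradient. The linearisation errors of [f] and of the [p i] are each allotted half of [e]. *)
pose C := sum3 (fun i => `|q i| + 1); pose D := sum3 (fun i => `|df i (F t)|).
have D0 : 0 <= D by rewrite /D /sum3 !addr_ge0.
have C0 : 0 < C by rewrite /C /sum3 !ltr_wpDl// ?addr_ge0.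
have e1 : 0 < e / 2 / C by rewrite !divr_gt0.
have [dl dl0 hl] := lin_approx hf (F t) e1.
have e2 : 0 < e / 2 / (D + 1) by rewrite !divr_gt0// ltr_wpDl.
have H i : exists2 m, 0 < m & forall h, `|h| < m ->
   [/\ `|p i (t + h) - p i t - q i * h| <= e / 2 / (D + 1) * `|h|,
       `|p i (t + h) - p i t| <= (`|q i| + 1) * `|h| & `|p i (t + h) - p i t| < dl].
  have [m1 m10 h1] := isd_distP (hp i) e2.
  have [m2 m20 h2] := isd_distP (hp i) ltr01.
  have [m3 m30 h3] := (continuous_distP (p i) t).1 (isd_continuous (hp i)) _ dl0.
  exists (Num.min m1 (Num.min m2 m3)); first by rewrite !lt_min m10 m20.
  move=> h; rewrite !lt_min => /andP[hm1 /andP[hm2 hm3]]; split; first exact: h1.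
    have := h2 _ hm2; rewrite mul1r mulrDl mul1r -normrM => h4.
    rewrite -[X in `|X| <= _](subrK (q i * h)) addrC (le_trans (ler_normD _ _))//.
    by rewrite lerD2l.
  by have := h3 (t + h); rewrite addrAC subrr add0r; apply.
have [m1 m10 h1] := H ax1; have [m2 m20 h2] := H ax2; have [m3 m30 h3] := H ax3.
exists (Num.min m1 (Num.min m2 m3)); first by rewrite !lt_min m10 m20.
move=> h; rewrite !lt_min => /andP[hm1 /andP[hm2 hm3]].
have [a1 b1 c1] := h1 _ hm1; have [a2 b2 c2] := h2 _ hm2; have [a3 b3 c3] := h3 _ hm3.
have hcl : close3 dl (F t) (F (t + h)) by move=> i; rewrite !Fp; case: i.
have hA : `|f (F (t + h)) - f (F t) - sum3 (fun i => df i (F t) * (p i (t + h) - p i t))| <=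
    e / 2 / C * sum3 (fun i => `|p i (t + h) - p i t|).
  by have := hl _ hcl; rewrite /sum3 !Fp.
set A := f _ - f _ - _ in hA.
pose B := sum3 (fun i => df i (F t) * (p i (t + h) - p i t - q i * h)).
have -> : f (F (t + h)) - f (F t) - sum3 (fun i => df i (F t) * q i) * h = A + B.
  by rewrite /A /B /sum3; ring.
apply: (le_trans (ler_normD _ _)).
rewrite [e]splitr mulrDl; apply: lerD.
  have hS : sum3 (fun i => `|p i (t + h) - p i t|) <= C * `|h|.
    by rewrite /C /sum3 [X in _ <= X]mulrDl [X in _ <= X + _]mulrDl !lerD.
  apply: (le_trans hA); apply: le_trans (ler_wpM2l (ltW e1) hS) _.
  by rewrite mulrA divfK// gt_eqF.
rewrite /B /sum3; apply: (@le_trans _ _ (D * (e / 2 / (D + 1) * `|h|))).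
  rewrite /D /sum3 !mulrDl; apply: (le_trans (ler_normD _ _)); apply: lerD; last first.
    by rewrite normrM ler_wpM2l.
  by apply: (le_trans (ler_normD _ _)); apply: lerD; rewrite normrM ler_wpM2l.
rewrite mulrA ler_wpM2r// mulrCA -[X in _ <= X]mulr1 ler_wpM2l ?divr_ge0 ?ltW//.
by rewrite ltr_pdivrMr ?mul1r ?ltrDl// ltr_wpDl.
Qed.

Lemma C1b_isD f df x a : C1b f df -> isD f x a (sum3 (fun i => df i x * cd i a)).
Proof.
move=> hf; rewrite /isD.
have := chain3 (p := fun i t => cd i x + t * cd i a) (q := fun i => cd i a)
  (F := fun t => add3 x (scale3 t a)) (t := (0 : R)) hf.
have -> : add3 x (scale3 0 a) = x := add3_0 x a; apply.
  by move=> i s; rewrite cdD cdZ.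
move=> i; apply: isd_eq (isdD (isd_cst (cd i x) 0) (isdM (isd_id 0) (isd_cst (cd i a) 0))) _ _ => //.
by rewrite mul1r mulr0 addr0 add0r.
Qed.

(** An algebra closed under differentiation: membership, with a bounded support, yields
    [smooth_cpt], which quantifies over all iterated derivatives. *)
Inductive Sm : (V -> R) -> Prop :=
| Sm_cst (c : R) : Sm (fun=> c)
| Sm_ebump k i (a c : R) : Sm (fun x => ebump k (a * cd i x + c))
| SmD f g : Sm f -> Sm g -> Sm (fun x => f x + g x)
| SmM f g : Sm f -> Sm g -> Sm (fun x => f x * g x).

Lemma Sm_continuous f : Sm f -> continuous f.
Proof.
elim=> [c|k i a c|p q _ hp _ hq|p q _ hp _ hq] x.
- exact: cvg_cst.
- apply: (@continuous_comp _ _ _ (fun x => a * cd i x + c) (ebump k)); last exact: ebump_continuous.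
  apply: cvgD; last exact: cvg_cst.
  by apply: cvgM; [exact: cvg_cst|exact: continuous_cd].
- by apply: cvgD; [exact: hp|exact: hq].
- by apply: cvgM; [exact: hp|exact: hq].
Qed.

Lemma Sm_isD f u : Sm f -> exists2 g, Sm g & forall x, isD f x u (g x).
Proof.
elim=> [c|k i a c|p q sp [dp sdp hp] sq [dq sdq hq]|p q sp [dp sdp hp] sq [dq sdq hq]].
- by exists (fun=> 0); [exact: Sm_cst|move=> x; exact: isD_cst].
- exists (fun x => (- k%:R * ebump k.+1 (a * cd i x + c) + ebump k.+2 (a * cd i x + c)) * (a * cd i u)).
    apply: SmM; last exact: Sm_cst.
    by apply: SmD; [apply: SmM; [exact: Sm_cst|exact: Sm_ebump]|exact: Sm_ebump].
  move=> x; apply: (isD_comp (p := ebump k)); last exact: isd_ebump.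
  apply: isD_eq (isDD (isDM (isD_cst a x u) (isD_cd i x u)) (isD_cst c x u)) _ _ => //.
  by rewrite mul0r add0r addr0.
- by exists (fun x => dp x + dq x); [exact: SmD|move=> x; exact: isDD].
- exists (fun x => dp x * q x + p x * dq x); last by move=> x; exact: isDM.
  by apply: SmD; exact: SmM.
Qed.

Lemma Sm_iterD f l : Sm f -> Sm (Defs.iterD l f).
Proof.
move=> sf; elim: l => //= u l IH; have [g sg hg] := Sm_isD u IH.
by rewrite (_ : (fun x => _) = g)//; apply/funext => x; exact: isD_derive.
Qed.

Lemma Sm_smooth_cpt f r : Sm f -> (forall x, ~ cbox r x -> f x = 0) -> smooth_cpt f.
Proof.
move=> sf f0; split; first by move=> l; exact: Sm_continuous (Sm_iterD l sf).
split.
  move=> l x u; have [g _ hg] := Sm_isD u (Sm_iterD l sf).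
  by have /isD_is_derive[] := hg x.
exists (2 * r) => x hx; apply: f0 => /norm3_le; apply/negP; by rewrite -ltNge.
Qed.

Lemma smooth_isD f : smooth_cpt f -> forall x a, isD f x a ('D_a f x).
Proof. by move=> [_ [h _]] x a; apply/isD_is_derive; split=> //; exact: (h [::]). Qed.

Lemma smooth_C1b f : smooth_cpt f -> C1b f (fun i x => 'D_(ee i) f x).
Proof.
move=> sf; have [cf [df [M hM]]] := sf.
have c0 : continuous f := cf [::].
have f0 x : ~ cbox `|M| x -> f x = 0.
  move=> nb; apply: hM; rewrite ltNge; apply/negP => h; apply: nb => i.
  by rewrite (le_trans (cd_norm3 i x))// (le_trans h)// ler_norm.
split => //.
- exact: bounded_of_compact_support c0 f0.
- by move=> i; exact: (cf [:: ee i]).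
(* Off the enlarged box [f] vanishes on a whole segment around [x], so its derivative there is that
   of 0. *)
- move=> i; apply: (bounded_of_compact_support (r := `|M| + 1)); first exact: (cf [:: ee i]).
  move=> x nb; apply: isD_derive.
  apply: (isd_near (f := fun=> 0)); last exact: isd_cst.
  near=> t; rewrite f0// => h; apply: nb => j.
  have := h j; rewrite cdD cdZ => hj.
  have -> : cd j x = (cd j x + t * cd j (ee i)) - t * cd j (ee i) by rewrite addrK.
  rewrite (le_trans (ler_normB _ _))// lerD//.
  have : `|t| <= 1.
    near: t; have := nbhsx_ballx (0 : R) 1 ltr01.
    by apply: filterS => s; rewrite /ball /= sub0r normrN; exact: ltW.
  rewrite normrM cd_ee => t1.
  by clear -t1; case: j; case: i; rewrite ?normr1 ?mulr1 ?normr0 ?mulr0.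
- by move=> i x; exact: smooth_isD.
Unshelve. all: by end_near. Qed.

End Calculus3.

(** * Density of smooth functions *)

Section IntegralBounds.
Context d (T : measurableType d) (R : realType) (mu : {measure set T -> \bar R}).
Implicit Types F G : T -> R.

Lemma L1_dist F G : L1 mu F -> L1 mu G -> L1 mu (fun x => `|F x - G x|).
Proof. by move=> lF lG; apply: L1_abs; exact: L1B. Qed.

Lemma RID_le F G a b : L1 mu F -> L1 mu G -> RI mu F <= a -> RI mu G <= b ->
  RI mu (fun x => F x + G x) <= a + b.
Proof. by move=> lF lG h1 h2; rewrite RID; [exact: lerD|exact: lF|exact: lG]. Qed.

End IntegralBounds.

Lemma Sm_measurable (R : realType) (f : V3 R -> R) : Sm f -> measurable_fun setT f.
Proof. by move=> sf; apply: continuous_measurable3; exact: Sm_continuous. Qed.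

Section Density.
Context {R : realType}.
Local Notation V := (V3 R).
Variables (mu : {measure set V -> \bar R}) (r : R).
Implicit Types (f F G : V -> R) (th : nat -> V -> R).
Hypothesis box_fin : (mu (box r) < +oo)%E.

Lemma measurable_box s : measurable (@box R s).
Proof.
have h i : measurable ((fun x : V => `|cd i x|) @^-1` `]-oo, s[%classic).
  rewrite -[X in measurable X]setTI.
  exact: (measurableT_comp (@normr_measurable _ _) (measurable_cd i) measurableT (measurable_itv _)).
have -> : @box R s = ((fun x : V => `|cd ax1 x|) @^-1` `]-oo, s[%classic) `&`
    ((fun x : V => `|cd ax2 x|) @^-1` `]-oo, s[%classic) `&`
    ((fun x : V => `|cd ax3 x|) @^-1` `]-oo, s[%classic).
  apply/seteqP; split => [x hx|x [[h1 h2] h3] []] /=.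
    have := (hx ax1, hx ax2, hx ax3) => -[[? ?] ?].
    by split; [split|]; rewrite in_itv /=.
  - by move: h1; rewrite /= in_itv.
  - by move: h2; rewrite /= in_itv.
  - by move: h3; rewrite /= in_itv.
by apply: measurableI => //; apply: measurableI.
Qed.

Lemma measurable_indr d (T : measurableType d) (A : set T) : measurable A ->
  measurable_fun setT (\1_A : T -> R).
Proof. exact: measurable_indic. Qed.

Lemma L1_indic_box : L1 mu (\1_(box r)).
Proof.
apply/integrableP; split.
  by apply/measurable_EFinP; apply: measurable_indr; exact: measurable_box.
rewrite (_ : integral _ _ _ = mu (box r))//.
under eq_integral => x _ do rewrite /= ger0_norm//.
by rewrite integral_indic// ?setIT//; exact: measurable_box.
Qed.

Definition nullout (f : V -> R) := forall x, ~ box r x -> f x = 0.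

Lemma indic_in (A : set V) x : A x -> \1_A x = 1 :> R.
Proof. by move=> Ax; rewrite indicE mem_set. Qed.
Lemma indic_out (A : set V) x : ~ A x -> \1_A x = 0 :> R.
Proof. by move=> Ax; rewrite indicE memNset. Qed.

Lemma indic_itv (A : set V) x : 0 <= (\1_A x : R) <= 1.
Proof. by rewrite indicE; case: (_ \in _) => /=; rewrite ?lexx ler01. Qed.

Lemma indicI (A B : set V) x : \1_(A `&` B) x = \1_A x * \1_B x :> R.
Proof. by rewrite indicI. Qed.

Lemma nullout_dom f C : (forall x, `|f x| <= C) -> nullout f ->
  forall x, `|f x| <= C * \1_(box r) x.
Proof.
move=> fC f0 x; have [h|h] := pselect (box r x); first by rewrite indic_in// mulr1.
by rewrite f0// normr0 indic_out// mulr0.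
Qed.

Lemma L1_nullout f C : measurable_fun setT f -> (forall x, `|f x| <= C) -> nullout f -> L1 mu f.
Proof.
move=> mf fC f0; apply: (L1_dom mf (nullout_dom fC f0)); exact/L1Zl/L1_indic_box.
Qed.

Definition unit_test (t : V -> R) := [/\ Sm t, nullout t & forall x, 0 <= t x <= 1].

Lemma unit_test_L1 (t : V -> R) : unit_test t -> L1 mu t.
Proof.
move=> [s n h]; apply: (@L1_nullout _ 1) => //.
  exact: Sm_measurable.
by move=> x; have /andP[h1 h2] := h x; rewrite ger0_norm.
Qed.

(** The measure is any one that is finite on the box: the results are applied to [mu3] and, in
    [Bc_smooth_approx], to the law of a squared axial coordinate. *)
Definition approx (F : V -> R) := forall e, 0 < e -> exists2 th, unit_test th &
  RI mu (fun x => `|F x - th x|) <= e.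

Lemma approx_seq F th : measurable_fun setT F -> (forall x, 0 <= F x <= 1) ->
  nullout F -> (forall n, approx (th n)) -> (forall n, measurable_fun setT (th n)) ->
  (forall n x, 0 <= th n x <= 1) -> (forall n, nullout (th n)) ->
  (forall x, th ^~ x @ \oo --> F x) -> approx F.
Proof.
move=> mF F01 F0 ath mth th01 th0 cv e e0.
have e2 : 0 < e / 2 by rewrite divr_gt0.
have LF : L1 mu F.
  by apply: (@L1_nullout _ 1) => // x; have /andP[h1 h2] := F01 x; rewrite ger0_norm.
have Lth n : L1 mu (th n).
  by apply: (@L1_nullout _ 1) => // x; have /andP[h1 h2] := th01 n x; rewrite ger0_norm.
have [] := @RI_dct _ _ _ mu (fun n x => `|F x - th n x|) (fun=> 0) (fun x => 2 * \1_(box r) x).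
- by move=> n; apply: measurableT_comp => //; exact: measurable_funB.
- exact: measurable_cst.
- exact/L1Zl/L1_indic_box.
- move=> n x; rewrite normr_id; apply: (@nullout_dom (fun x => F x - th n x) 2) => [y|y hy].
    have /andP[h1 h2] := F01 y; have /andP[h3 h4] := th01 n y.
    by rewrite ler_norml; apply/andP; split; lra.
  by rewrite F0// th0// subrr.
- apply: aeW => x; rewrite -[X in _ --> X](normr0 R) -(subrr (F x)).
  by apply: cvg_norm; apply: cvgB; [exact: cvg_cst|exact: cv].
rewrite RI0 => _ /cvgrPdist_le /(_ _ e2) [n _ hn].
have := hn n (leqnn n); rewrite /= sub0r normrN ger0_norm; last exact: RI_ge0.
move=> h1; have [t ut h2] := ath n _ e2; exists t => //.
have Lt := unit_test_L1 ut.
apply: (@le_trans _ _ (RI mu (fun x => `|F x - th n x| + `|th n x - t x|))).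
  apply: RI_le; [exact: L1_dist|apply: L1D; exact: L1_dist|].
  by move=> x; rewrite -{1}(subrK (th n x) (F x)) -addrA ler_normD.
by rewrite [e]splitr; apply: RID_le => //; apply: L1_dist.
Qed.

Lemma approx_test (t : V -> R) : unit_test t -> approx t.
Proof.
move=> ut e e0; exists t => //.
by rewrite (@RI_eq _ _ _ mu _ (fun=> 0)) ?RI0 ?ltW// => x; rewrite subrr normr0.
Qed.

Lemma approxM F G : measurable_fun setT F -> measurable_fun setT G ->
  (forall x, 0 <= F x <= 1) -> (forall x, 0 <= G x <= 1) -> nullout F -> nullout G ->
  approx F -> approx G -> approx (fun x => F x * G x).
Proof.
move=> mF mG F01 G01 F0 G0 aF aG e e0.
have e2 : 0 < e / 2 by rewrite divr_gt0.
have [s [ss s0 s01] hs] := aF _ e2; have [t [st t0 t01] ht] := aG _ e2.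
have LF : L1 mu F.
  by apply: (@L1_nullout _ 1) => // x; have /andP[h1 h2] := F01 x; rewrite ger0_norm.
have LG : L1 mu G.
  by apply: (@L1_nullout _ 1) => // x; have /andP[h1 h2] := G01 x; rewrite ger0_norm.
have Ls := unit_test_L1 (And3 ss s0 s01); have Lt := unit_test_L1 (And3 st t0 t01).
have b1 (H : V -> R) x : (forall x, 0 <= H x <= 1) -> `|H x| <= 1.
  by move=> h; have /andP[h1 h2] := h x; rewrite ger0_norm.
exists (fun x => s x * t x).
  split; [exact: SmM|by move=> x /s0 ->; rewrite mul0r|].
  by move=> x; have /andP[? ?] := s01 x; have /andP[? ?] := t01 x;
    rewrite mulr_ge0// mulr_ile1.
apply: (@le_trans _ _ (RI mu (fun x => `|F x - s x| + `|G x - t x|))).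
  apply: RI_le; [apply: L1_dist|apply: L1D; exact: L1_dist|].
  - by apply: (L1_bd (C := 1)) => // x; exact: b1.
  - by apply: (L1_bd (C := 1)) => //; [exact: L1_meas Lt|move=> x; exact: b1].
  - move=> x; rewrite (_ : _ - _ = (F x - s x) * G x + s x * (G x - t x)); last by ring.
    rewrite (le_trans (ler_normD _ _))// !normrM lerD//.
      by rewrite ler_piMr// b1.
    by rewrite ler_piMl// b1.
by rewrite [e]splitr; apply: RID_le => //; apply: L1_dist.
Qed.

Definition cutoff n (x : V) : R :=
  (ebump 0 (n.+1%:R * (r - cd ax1 x)) * ebump 0 (n.+1%:R * (cd ax1 x + r))) *
  (ebump 0 (n.+1%:R * (r - cd ax2 x)) * ebump 0 (n.+1%:R * (cd ax2 x + r))) *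
  (ebump 0 (n.+1%:R * (r - cd ax3 x)) * ebump 0 (n.+1%:R * (cd ax3 x + r))).

Lemma Sm_aff i (a c : R) n : Sm (fun x : V => ebump 0 (n.+1%:R * (a * cd i x + c))).
Proof.
have := Sm_ebump 0 i (n.+1%:R * a) (n.+1%:R * c).
by under eq_fun do rewrite -mulrA -mulrDr.
Qed.

Lemma unit_test_cutoff n : unit_test (cutoff n).
Proof.
have S1 i : Sm (fun x : V => ebump 0 (n.+1%:R * (r - cd i x))).
  by have := Sm_aff i (-1) r n; under eq_fun do rewrite mulN1r addrC.
have S2 i : Sm (fun x : V => ebump 0 (n.+1%:R * (cd i x + r))).
  by have := Sm_aff i 1 r n; under eq_fun do rewrite mul1r.
split.
- by do !apply: SmM.
- move=> x nb.
  have z i : ~ `|cd i x| < r -> ebump 0 (n.+1%:R * (r - cd i x)) * ebump 0 (n.+1%:R * (cd i x + r)) = 0 :> R.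
    rewrite /ebump !pmulr_rgt0 ?ltr0n// => /negP; rewrite ltr_norml negb_and subr_gt0 -!leNgt.
    move=> /orP[h|h]; first by rewrite [X in _ * X]ifF ?mulr0//; apply/negbTE; rewrite -leNgt; lra.
    by rewrite ifF ?mul0r//; apply/negbTE; rewrite -leNgt.
  rewrite /cutoff; have [h1|/z ->] := pselect (`|cd ax1 x| < r); last by rewrite !mul0r.
  have [h2|/z ->] := pselect (`|cd ax2 x| < r); last by rewrite mulr0 mul0r.
  rewrite (z ax3) ?mulr0// => h3; apply: nb; by case.
- move=> x; rewrite /cutoff.
  have h (y : R) := @ebump0_itv R y.
  by rewrite !mulr_ge0 ?mulr_ile1 ?mulr_ge0 ?mulr_ile1//;
    (try by have /andP[] := h (n.+1%:R * (r - cd ax1 x)));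
    (try by have /andP[] := h (n.+1%:R * (cd ax1 x + r)));
    (try by have /andP[] := h (n.+1%:R * (r - cd ax2 x)));
    (try by have /andP[] := h (n.+1%:R * (cd ax2 x + r)));
    (try by have /andP[] := h (n.+1%:R * (r - cd ax3 x)));
    (try by have /andP[] := h (n.+1%:R * (cd ax3 x + r))).
Qed.

Lemma cutoff_cvg x : cutoff ^~ x @ \oo --> (\1_(box r) x : R).
Proof.
have -> : (\1_(box r) x : R) =
  ((0 < r - cd ax1 x)%R%:R * (0 < cd ax1 x + r)%R%:R) *
  ((0 < r - cd ax2 x)%R%:R * (0 < cd ax2 x + r)%R%:R) *
  ((0 < r - cd ax3 x)%R%:R * (0 < cd ax3 x + r)%R%:R).
  rewrite indicE -!natrM !mulnb; congr (_%:R); congr nat_of_bool.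
  have E i : (`|cd i x| < r) = (0 < r - cd i x) && (0 < cd i x + r).
    by rewrite ltr_norml subr_gt0 andbC; congr (_ && _); apply/idP/idP; lra.
  rewrite -!E; apply/idP/idP => [|/andP[/andP[h1 h2] h3]].
    by move=> /set_mem h; rewrite !h.
  by apply: mem_set => -[].
by rewrite /cutoff; do !apply: cvgM; exact: ebump0_cvg.
Qed.

Lemma approx_box : approx (\1_(box r)).
Proof.
apply: (@approx_seq _ cutoff).
- by apply: measurable_indr; exact: measurable_box.
- exact: indic_itv.
- by move=> x /indic_out.
- by move=> n; apply: approx_test; exact: unit_test_cutoff.
- by move=> n; apply: Sm_measurable; have [] := unit_test_cutoff n.
- by move=> n x; have [_ _] := unit_test_cutoff n.
- by move=> n; have [] := unit_test_cutoff n.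
- exact: cutoff_cvg.
Qed.

(** Good sets: they form a sigma-algebra ([apset_sigma]) that contains the half-spaces, hence every
    measurable set. *)
Definition apset : set (set V) := [set A | measurable A /\ approx (\1_(A `&` box r))].

Lemma measurable_ibox A : measurable A -> measurable_fun setT (\1_(A `&` box r) : V -> R).
Proof. by move=> mA; apply: measurable_indr; apply: measurableI => //; exact: measurable_box. Qed.

Lemma nullout_ibox A : nullout (\1_(A `&` box r)).
Proof. by move=> x nb; rewrite indic_out// => -[]. Qed.

Lemma apsetC A : apset A -> apset (~` A).
Proof.
move=> [mA aA]; split; first exact: measurableC.
move=> e e0; have e2 : 0 < e / 2 by rewrite divr_gt0.
have [s [ss s0 s01] hs] := approx_box e2; have [t [st t0 t01] ht] := aA _ e2.
have Ls := unit_test_L1 (And3 ss s0 s01); have Lt := unit_test_L1 (And3 st t0 t01).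
have LB := L1_indic_box.
have LA : L1 mu (\1_(A `&` box r)).
  apply: (@L1_nullout _ 1) => //; [exact: measurable_ibox| |exact: nullout_ibox].
  by move=> x; have /andP[h1 h2] := @indic_itv (A `&` box r) x; rewrite ger0_norm.
exists (fun x => s x * (1 + (-1) * t x)).
  split; [apply: SmM => //; apply: SmD; [exact: Sm_cst|apply: SmM => //; exact: Sm_cst]|
    by move=> x /s0 ->; rewrite mul0r|].
  move=> x; have /andP[? ?] := s01 x; have /andP[? ?] := t01 x; rewrite mulN1r.
  by rewrite mulr_ge0 ?subr_ge0// mulr_ile1 ?subr_ge0// gerBl.
apply: (@le_trans _ _ (RI mu (fun x => `|\1_(box r) x - s x| + `|\1_(A `&` box r) x - t x|))).
  apply: (le_trans (ler_norm _)); apply: RI_abs.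
  - apply: measurableT_comp => //; apply: measurable_funB.
      by apply: measurable_ibox; exact: measurableC.
    apply: measurable_funM; first exact: L1_meas Ls.
    apply: measurable_funD; first exact: measurable_cst.
    by apply: measurable_funM; [exact: measurable_cst|exact: L1_meas Lt].
  - by apply: L1D; exact: L1_dist.
  - move=> x; rewrite normr_id; have /andP[? ?] := s01 x; have /andP[? ?] := t01 x.
    have -> : \1_(~` A `&` box r) x = \1_(box r) x * (1 - \1_(A `&` box r) x) :> R.
      rewrite !indicI; have [h|h] := pselect (A x).
        rewrite (indic_in h) (indic_out (A := ~` A)); last by move=> /(_ h).
        have hB : \1_(box r) x * \1_(box r) x = \1_(box r) x :> R by rewrite -indicI setIid.
        by rewrite mul0r mul1r mulrBr mulr1 hB subrr.
      by rewrite (indic_in (A := ~` A))// (indic_out h); ring.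
    rewrite (_ : _ - _ = (\1_(box r) x - s x) * (1 - \1_(A `&` box r) x) +
       s x * - (\1_(A `&` box r) x - t x)); last by ring.
    have /andP[? ?] := @indic_itv (A `&` box r) x.
    rewrite (le_trans (ler_normD _ _))// !normrM normrN lerD//.
      by rewrite ler_piMr// ger0_norm ?subr_ge0// gerBl.
    by rewrite ler_piMl// ger0_norm.
by rewrite [e]splitr; apply: RID_le => //; apply: L1_dist.
Qed.

Lemma apsetI A B : apset A -> apset B -> apset (A `&` B).
Proof.
move=> [mA aA] [mB aB]; split; first exact: measurableI.
have -> : \1_((A `&` B) `&` box r) = (fun x => \1_(A `&` box r) x * \1_(B `&` box r) x) :> (V -> R).
  by apply/funext => x; rewrite -indicI; congr (\1_ _ x); rewrite setIACA setIid.
apply: approxM => //; try exact: measurable_ibox; try exact: nullout_ibox; exact: indic_itv.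
Qed.

Lemma apsetT : apset setT.
Proof. by split => //; rewrite setTI; exact: approx_box. Qed.

Lemma apset_cvg (F : (set V)^nat) A : (forall n, apset (F n)) -> measurable A ->
  (forall x, (\1_(F n) x : R) @[n --> \oo] --> (\1_A x : R)) -> apset A.
Proof.
move=> aF mA cv; split=> //.
apply: (@approx_seq _ (fun n => \1_(F n `&` box r))).
- exact: measurable_ibox.
- exact: indic_itv.
- exact: nullout_ibox.
- by move=> n; have [] := aF n.
- by move=> n; apply: measurable_ibox; have [] := aF n.
- by move=> n x; exact: indic_itv.
- by move=> n; exact: nullout_ibox.
- move=> x; rewrite indicI; under eq_fun do rewrite indicI.
  by apply: cvgM; [exact: cv|exact: cvg_cst].
Qed.

Lemma apset_sigma : sigma_algebra setT apset.
Proof.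
split.
- by have := apsetC apsetT; rewrite setCT.
- by move=> A /apsetC; rewrite setTD.
move=> F aF.
have U n : apset (\bigcup_(k in `I_n) F k).
  elim: n => [|n IH]; first by rewrite II0 bigcup_set0; have := apsetC apsetT; rewrite setCT.
  rewrite IIS bigcup_setU bigcup_set1 -[X in apset X]setCK setCU.
  by apply: apsetC; apply: apsetI; apply: apsetC.
apply: (apset_cvg U); first by apply: bigcupT_measurable => k; have [] := aF k.
move=> x; have [[k _ Fk]|nU] := pselect ((\bigcup_n F n) x).
  rewrite indic_in; last by exists k.
  apply: cvg_near_cst; near=> n; rewrite indic_in//; exists k => //=.
  by near: n; exact: nbhs_infty_gt.
rewrite indic_out//; apply: cvg_near_cst; near=> n.
by rewrite indic_out// => -[k _ Fk]; apply: nU; exists k.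
Unshelve. all: by end_near. Qed.

Lemma apset_preimage T (h : V -> T) (G : set (set T)) :
  (forall S, G S -> apset (h @^-1` S)) -> forall S, <<s G >> S -> apset (h @^-1` S).
Proof.
move=> hG; apply: (@smallest_sub _ _ G [set S | apset (h @^-1` S)]) => //.
have [h0 hC hU] := apset_sigma; split => /=.
- by rewrite preimage_set0.
- by move=> A /hC; rewrite !setTD preimage_setC.
- by move=> F hF; rewrite preimage_bigcup; exact: hU.
Qed.

Lemma apset_cd i (S : set R) : measurable S -> apset (cd i @^-1` S).
Proof.
move=> mS.
apply: (@apset_preimage R (cd i) (@RGenOInfty.G R)); last first.
  by have := mS; rewrite -[measurable S]/((R.-ocitv.-measurable).-sigma.-measurable S) RGenOInfty.measurableE.
move=> _ [a ->].
have mA : measurable (cd i @^-1` `]a, +oo[%classic).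
  by rewrite -[X in measurable X]setTI; exact: measurable_cd.
split=> //.
have S1 n : Sm (fun x : V => ebump 0 (n.+1%:R * (cd i x - a))).
  by have := Sm_aff i 1 (- a) n; under eq_fun do rewrite mul1r.
have ut n : unit_test (fun x => ebump 0 (n.+1%:R * (cd i x - a)) * cutoff n x).
  have [s0 s1 s2] := unit_test_cutoff n; split; first exact: SmM.
    by move=> x /s1 ->; rewrite mulr0.
  move=> x; have /andP[? ?] := s2 x; have /andP[? ?] := @ebump0_itv R (n.+1%:R * (cd i x - a)).
  by rewrite mulr_ge0// mulr_ile1.
apply: (@approx_seq _ (fun n x => ebump 0 (n.+1%:R * (cd i x - a)) * cutoff n x)).
- exact: measurable_ibox.
- exact: indic_itv.
- exact: nullout_ibox.
- by move=> n; exact: approx_test.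
- by move=> n; apply: Sm_measurable; have [] := ut n.
- by move=> n x; have [_ _] := ut n.
- by move=> n; have [] := ut n.
- move=> x; rewrite indicI; apply: cvgM; last exact: cutoff_cvg.
  have -> : (\1_(cd i @^-1` `]a, +oo[) x : R) = (0 < cd i x - a)%R%:R.
    rewrite indicE; congr (_%:R); congr nat_of_bool.
    rewrite subr_gt0; apply/idP/idP => [/set_mem|h]; first by rewrite /= in_itv/= andbT.
    by apply: mem_set; rewrite /= in_itv /= andbT.
  exact: ebump0_cvg.
Qed.

Lemma apset_measurable A : measurable A -> apset A.
Proof.
move=> mA; apply: (@apset_preimage _ id [set B `*` C | B in measurable & C in measurable]); last first.
  by have := mA; rewrite measurable_prod_measurableType.
move=> _ [B mB [C mC <-]].
have -> : id @^-1` (B `*` C) = (fst @^-1` B) `&` (cd ax3 @^-1` C) by apply/seteqP; split => -[].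
apply: apsetI; last exact: apset_cd.
apply: (@apset_preimage _ fst [set B `*` C | B in measurable & C in measurable]); last first.
  by have := mB; rewrite measurable_prod_measurableType.
move=> _ [B1 mB1 [B2 mB2 <-]].
have -> : fst @^-1` (B1 `*` B2) = (cd ax1 @^-1` B1) `&` (cd ax2 @^-1` B2) by apply/seteqP; split => -[[]].
by apply: apsetI; exact: apset_cd.
Qed.

(** The sum counts the integers from 1 to [n] that lie below [g], which is [g] up to 1. Applied to
    [N F], it writes [F] as a combination of indicators of level sets up to [1 / N]. *)
Lemma layer_cake (n : nat) (g : R) : 0 <= g <= n%:R ->
  `|g - \sum_(k < n) (k.+1%:R < g)%R%:R| <= 1.
Proof.
elim: n => [|n IH] /andP[g0 gn].
  by rewrite big_ord0 subr0 ger0_norm// (le_trans gn).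
rewrite big_ord_recr /= [(n.+1%:R < g)%R]ltNge gn addr0.
have [h|h] := leP g n%:R; first by apply: IH; rewrite g0.
have -> : \sum_(k < n) (k.+1%:R < g)%R%:R = n%:R :> R.
  rewrite (eq_bigr (fun=> 1)) ?sumr_const ?card_ord// => k _.
  by rewrite (le_lt_trans _ h)// ler_nat.
by rewrite ger0_norm ?subr_ge0 ?(ltW h)// lerBlDr -natr1 addrC in gn *.
Qed.

Lemma approx_sum (G : nat -> V -> R) n e : 0 < e -> (forall k, L1 mu (G k)) ->
  (forall k, approx (G k)) ->
  exists t, [/\ Sm t, nullout t, (forall x, 0 <= t x <= n%:R) &
    RI mu (fun x => `|\sum_(k < n) G k x - t x|) <= n%:R * e].
Proof.
move=> e0 LG aG; elim: n => [|n [t [st t0 tn ht]]].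
  exists (fun=> 0); split => //; first exact: Sm_cst.
    by move=> x; rewrite lexx.
  rewrite (@RI_eq _ _ _ mu _ (fun=> 0)) ?RI0 ?mul0r// => x.
  by rewrite big_ord0 subrr normr0.
have [s [ss s0 s01] hs] := aG n e e0.
have Ls := unit_test_L1 (And3 ss s0 s01).
have Lt : L1 mu t.
  apply: (@L1_nullout _ n%:R) => //; first exact: Sm_measurable.
  by move=> x; have /andP[h1 h2] := tn x; rewrite ger0_norm.
have LS m : L1 mu (fun x => \sum_(k < m) G k x).
  elim: m => [|m IH]; first by under eq_fun do rewrite big_ord0; exact: L1_0.
  by under eq_fun do rewrite big_ord_recr; exact: L1D.
exists (fun x => t x + s x); split.
- exact: SmD.
- by move=> x nb; rewrite t0// s0// addr0.
- move=> x; have /andP[? ?] := tn x; have /andP[? ?] := s01 x.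
  by rewrite addr_ge0// -natr1 lerD.
- apply: (@le_trans _ _ (RI mu (fun x => `|\sum_(k < n) G k x - t x| + `|G n x - s x|))).
    apply: RI_le; [by apply: L1_dist => //; exact: L1D|apply: L1D; exact: L1_dist|].
    move=> x; rewrite big_ord_recr /= opprD addrACA; exact: ler_normD.
  by rewrite -natr1 mulrDl mul1r; apply: RID_le => //; exact: L1_dist.
Qed.

Lemma approx_unit F : measurable_fun setT F -> (forall x, 0 <= F x <= 1) -> nullout F -> approx F.
Proof.
move=> mF F01 F0 e e0.
pose m := RI mu (\1_(box r)).
have m0 : 0 <= m by apply: RI_ge0 => x; have /andP[] := @indic_itv (box r) x.
(* The layer-cake error is at most [m / N] in L1; this [N] puts it below [e / 2]. *)
pose N := (Num.truncn (2 * m / e)).+1.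
have N0 : (0 : R) < N%:R by rewrite ltr0n.
have hN : N%:R^-1 * m <= e / 2.
  have : 2 * m / e < N%:R by rewrite truncnS_gt// divr_ge0 ?mulr_ge0// ltW.
  rewrite ltr_pdivrMr// => h; rewrite mulrC ler_pdivrMr// mulrAC ler_pdivlMr//.
  by rewrite mulrC [e * _]mulrC ltW.
have e2 : 0 < e / 2 by rewrite divr_gt0.
pose A k := [set x | (k.+1%:R / N%:R < F x)%R].
have mA k : measurable (A k).
  rewrite -[A k]setTI (_ : A k = F @^-1` `]k.+1%:R / N%:R, +oo[%classic); first exact: mF.
  by apply/seteqP; split => x; rewrite /A /= in_itv /= andbT.
pose G k : V -> R := \1_(A k `&` box r).
have LG k : L1 mu (G k).
  apply: (@L1_nullout _ 1); [exact: measurable_ibox| |exact: nullout_ibox].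
  by move=> x; have /andP[h1 h2] := @indic_itv (A k `&` box r) x; rewrite ger0_norm.
have aG k : approx (G k) by have [] := apset_measurable (mA k).
have [t [st t0 tn ht]] := approx_sum N e2 LG aG.
have Lt : L1 mu t.
  apply: (@L1_nullout _ N%:R) => //; first exact: Sm_measurable.
  by move=> x; have /andP[h1 h2] := tn x; rewrite ger0_norm.
have LS m' : L1 mu (fun x => \sum_(k < m') G k x).
  elim: m' => [|m' IH]; first by under eq_fun do rewrite big_ord0; exact: L1_0.
  by under eq_fun do rewrite big_ord_recr; exact: L1D.
have LF : L1 mu F.
  by apply: (@L1_nullout _ 1) => // x; have /andP[h1 h2] := F01 x; rewrite ger0_norm.
exists (fun x => N%:R^-1 * t x).
  split; [by apply: SmM => //; exact: Sm_cst|by move=> x /t0 ->; rewrite mulr0|].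
  move=> x; have /andP[? ?] := tn x.
  have h0 : 0 <= (N%:R : R)^-1 by rewrite invr_ge0 ltW.
  by rewrite mulr_ge0//= mulrC ler_pdivrMr// mul1r.
apply: (@le_trans _ _ (RI mu (fun x => N%:R^-1 * \1_(box r) x +
    N%:R^-1 * `|\sum_(k < N) G k x - t x|))).
  apply: RI_le.
  - by apply: L1_dist => //; exact: L1Zl.
  - apply: L1D; first by apply: L1Zl; exact: L1_indic_box.
    by apply: L1Zl; exact: L1_dist.
  - move=> x; have [xb|nb] := pselect (box r x); last first.
      have h1 : 0 <= (\1_(box r) x : R) by have /andP[] := @indic_itv (box r) x.
      have h2 : 0 <= (N%:R : R)^-1 by rewrite invr_ge0 ltW.
      by rewrite (F0 _ nb) (t0 _ nb) mulr0 subrr normr0 addr_ge0 ?mulr_ge0.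
    rewrite indic_in//.
    have E : \sum_(k < N) G k x = \sum_(k < N) (k.+1%:R < N%:R * F x)%R%:R.
      apply: eq_bigr => k _; rewrite /G indicE; congr (_%:R); congr nat_of_bool.
      rewrite -ltr_pdivrMl//; apply/idP/idP => [/set_mem[] //|h].
      by rewrite /A /= mulrC.
      by apply: mem_set; split => //; rewrite /A /= mulrC.
    have := @layer_cake N (N%:R * F x); rewrite -E.
    have /andP[f0 f1] := F01 x.
    rewrite mulr_ge0 ?(ltW N0)//= ger_pMr// f1 => /(_ isT) h.
    have E2 : F x - N%:R^-1 * t x = N%:R^-1 * (N%:R * F x - t x).
      by rewrite mulrBr mulKf// gt_eqF.
    rewrite -mulrDr E2.
    have i0 : 0 <= (N%:R : R)^-1 by rewrite invr_ge0 ltW.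
    rewrite normrM (ger0_norm i0); apply: ler_wpM2l => //.
    have -> : N%:R * F x - t x = (N%:R * F x - \sum_(k < N) G k x) + (\sum_(k < N) G k x - t x) by ring.
    by apply: (le_trans (ler_normD _ _)); rewrite lerD2r.
rewrite [e]splitr; apply: RID_le.
- by apply: L1Zl; exact: L1_indic_box.
- by apply: L1Zl; exact: L1_dist.
- by rewrite RIZl//; exact: L1_indic_box.
- rewrite RIZl; last exact: L1_dist.
  by rewrite mulrC ler_pdivrMr// mulrC.
Qed.

Lemma approx_scale F c e : measurable_fun setT F -> (forall x, 0 <= F x <= c) -> nullout F -> 0 < e ->
  exists t, [/\ Sm t, nullout t, (forall x, 0 <= t x <= c) & RI mu (fun x => `|F x - t x|) <= e].
Proof.
move=> mF Fc F0 e0.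
have c0 : 0 <= c by have /andP[] := Fc (mkV3 0 0 0); exact: le_trans.
have E x : F x = c * (F x / c).
  have [c00|cn0] := eqVneq c 0; last by rewrite mulrC divfK.
  by have := Fc x; rewrite c00 mul0r => /andP[? ?]; apply/eqP; rewrite eq_le; apply/andP.
have e1 : 0 < e / (c + 1) by rewrite divr_gt0// ltr_wpDl.
have [||| t [st t0 t01] ht] := @approx_unit (fun x => F x / c) _ _ _ _ e1.
- by apply: measurable_funM => //; exact: measurable_cst.
- move=> x; have /andP[h1 h2] := Fc x; rewrite divr_ge0//=.
  have [c00|cn0] := eqVneq c 0; first by rewrite c00 invr0 mulr0.
  by rewrite ler_pdivrMr ?mul1r// lt0r cn0.
- by move=> x /F0 ->; rewrite mul0r.
have LF : L1 mu (fun x => F x / c).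
  apply: (@L1_nullout _ (c / c)); [by apply: measurable_funM => //; exact: measurable_cst| |].
    move=> x; have /andP[h1 h2] := Fc x; rewrite ger0_norm ?divr_ge0//.
    by rewrite ler_wpM2r// invr_ge0.
  by move=> x /F0 ->; rewrite mul0r.
have Lt := unit_test_L1 (And3 st t0 t01).
exists (fun x => c * t x); split.
- by apply: SmM => //; exact: Sm_cst.
- by move=> x /t0 ->; rewrite mulr0.
- move=> x; have /andP[h1 h2] := t01 x; rewrite mulr_ge0//=.
  by rewrite -[X in _ <= X]mulr1 ler_wpM2l.
rewrite (@RI_eq _ _ _ mu _ (fun x => c * `|F x / c - t x|)); last first.
  by move=> x; rewrite {1}E -mulrBr normrM (ger0_norm c0).
rewrite RIZl; last exact: L1_dist.
apply: (le_trans (ler_wpM2l c0 ht)); rewrite mulrCA -[X in _ <= X]mulr1 ler_wpM2l ?(ltW e0)//.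
by rewrite ler_pdivrMr ?ltr_wpDl// mul1r lerDl.
Qed.

(** Positive and negative parts are approximated separately, so the approximants keep the bounds of
    [F]. In [hj_measurable] this keeps [1 + psi] away from 0. *)
Lemma smooth_dense F a b e : measurable_fun setT F -> (forall x, a <= F x <= b) -> a <= 0 <= b ->
  nullout F -> 0 < e ->
  exists t, [/\ smooth_cpt t, nullout t, (forall x, a <= t x <= b) &
     L1 mu (fun x => `|F x - t x|) /\ RI mu (fun x => `|F x - t x|) <= e].
Proof.
move=> mF Fab /andP[a0 b0] F0 e0; have e2 : 0 < e / 2 by rewrite divr_gt0.
have m0 : measurable_fun setT (fun _ : V => 0 : R) by exact: measurable_cst.
have mP : measurable_fun setT (fun x => Num.max (F x) 0) by exact: measurable_maxr.
have mN : measurable_fun setT (fun x => Num.max (- F x) 0).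
  by apply: measurable_maxr => //; exact: measurableT_comp.
have [|| s [ss s0 s01 hs]] := approx_scale (F := fun x => Num.max (F x) 0) (c := b) mP _ _ e2.
- by move=> x; have /andP[h1 h2] := Fab x; rewrite le_max lexx orbT /= ge_max h2.
- by move=> x /F0 ->; rewrite maxxx.
have [|| t [st t0 t01 ht]] := approx_scale (F := fun x => Num.max (- F x) 0) (c := - a) mN _ _ e2.
- by move=> x; have /andP[h1 h2] := Fab x; rewrite le_max lexx orbT /= ge_max lerN2 h1 oppr_ge0.
- by move=> x /F0 ->; rewrite oppr0 maxxx.
have L (G : V -> R) c : measurable_fun setT G -> (forall x, 0 <= G x <= c) -> nullout G -> L1 mu G.
  by move=> mG Gc G0; apply: (@L1_nullout _ c) => // x; have /andP[h1 h2] := Gc x; rewrite ger0_norm.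
have Ls := L _ _ (Sm_measurable ss) s01 s0; have Lt := L _ _ (Sm_measurable st) t01 t0.
have LP : L1 mu (fun x => Num.max (F x) 0).
  apply: (L _ b mP) => [x|x /F0 ->]; last by rewrite maxxx.
  by have /andP[h1 h2] := Fab x; rewrite le_max lexx orbT /= ge_max h2.
have LN : L1 mu (fun x => Num.max (- F x) 0).
  apply: (L _ (- a) mN) => [x|x /F0 ->]; last by rewrite oppr0 maxxx.
  by have /andP[h1 h2] := Fab x; rewrite le_max lexx orbT /= ge_max lerN2 h1 oppr_ge0.
have FE x : F x = Num.max (F x) 0 - Num.max (- F x) 0.
  by rewrite /Num.max; case: ltP => h1; case: ltP => h2; lra.
have LF : L1 mu F by apply: L1_eq (L1B LP LN) => x; rewrite -FE.
have sm : Sm (fun x => s x + (-1) * t x) by apply: SmD => //; apply: SmM => //; exact: Sm_cst.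
exists (fun x => s x + (-1) * t x); split.
- apply: (Sm_smooth_cpt (r := r)) => // x nb.
  have nb' : ~ box r x by move=> h; apply: nb => i; exact: ltW.
  by rewrite s0// t0// mulr0 addr0.
- by move=> x nb; rewrite s0// t0// mulr0 addr0.
- by move=> x; have /andP[? ?] := s01 x; have /andP[? ?] := t01 x; apply/andP; split; lra.
have Lst : L1 mu (fun x => s x + (-1) * t x) by apply: L1D => //; exact: L1Zl.
split; first exact: L1_dist.
apply: (@le_trans _ _ (RI mu (fun x => `|Num.max (F x) 0 - s x| + `|Num.max (- F x) 0 - t x|))).
  apply: RI_le; [exact: L1_dist|apply: L1D; exact: L1_dist|].
  move=> x; rewrite {1}FE (_ : _ - _ - _ = (Num.max (F x) 0 - s x) + - (Num.max (- F x) 0 - t x)); last by ring.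
  by rewrite (le_trans (ler_normD _ _))// normrN.
by rewrite [e]splitr; apply: RID_le => //; exact: L1_dist.
Qed.

End Density.

(** * Differentiation of integrals, the L2 norm and density in L2 *)

Section DiffUnderIntegral.
Context d (T : measurableType d) (R : realType) (mu : {measure set T -> \bar R}).

(** The derivative is the pointwise limit of difference quotients with steps [1 / (n + 1)]; its
    formula plays no part, which matters for the long derivatives of the collision field. *)
Lemma measurable_isd (F : R -> T -> R) (dF : T -> R) s :
  (forall t, measurable_fun setT (F t)) -> (forall x, isd (fun t => F t x) s (dF x)) ->
  measurable_fun setT dF.
Proof.
move=> mF dFE.
apply: (measurable_fun_cvg (h := fun n x => (n.+1%:R^-1)^-1 * (F (s + n.+1%:R^-1) x - F s x))).
  move=> n; apply: measurable_funM; first exact: measurable_cst.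
  by apply: measurable_funB.
move=> x _; apply: (isd_seq (h := fun n => n.+1%:R^-1) (dFE x)).
  by move=> n; rewrite invr_eq0 pnatr_eq0.
exact: cvg_harmonic.
Qed.

Lemma isd_RI (F : R -> T -> R) (dF G : T -> R) s : (forall t, L1 mu (F t)) -> L1 mu G ->
  (forall t x, `|t - s| <= 1 -> `|F t x - F s x| <= `|t - s| * G x) ->
  (forall x, isd (fun t => F t x) s (dF x)) ->
  L1 mu dF /\ isd (fun t => RI mu (F t)) s (RI mu dF).
Proof.
move=> LF LG FG dFE.
have mdF : measurable_fun setT dF.
  by apply: (measurable_isd (F := F) _ dFE) => t; exact: L1_meas (LF t).
have key (h : nat -> R) : (forall n, h n != 0) -> h n @[n --> \oo] --> 0 ->
    (forall n, `|h n| <= 1) ->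
    L1 mu dF /\ (h n)^-1 * (RI mu (F (s + h n)) - RI mu (F s)) @[n --> \oo] --> RI mu dF.
  move=> hn0 hcv h1.
  have [||||| L C] := @RI_dct _ _ _ mu (fun n x => (h n)^-1 * (F (s + h n) x - F s x)) dF G.
  - by move=> n; apply: L1_meas; apply: L1Zl; exact: L1B.
  - exact: mdF.
  - exact: LG.
  - move=> n x; rewrite normrM normfV mulrC ler_pdivrMr ?normr_gt0// [_ * `|h n|]mulrC.
    by have := FG (s + h n) x; rewrite addrAC subrr add0r; apply.
  - by apply: aeW => x; exact: (isd_seq (h := h) (dFE x)).
  split=> //; move: C; apply: cvg_trans; apply: near_eq_cvg; near=> n.
  by rewrite RIZl ?RIB//; exact: L1B.
split.
  by have [] := key (fun n => n.+1%:R^-1) (fun n => lt0r_neq0 (_ : 0 < n.+1%:R^-1)) (@cvg_harmonic R) _;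
    move=> n; rewrite ?invr_gt0 ?ltr0n// ger0_norm ?invr_ge0// invf_le1 ?ler1n ?ltr0n.
apply/isdP; apply/cvgr_dnbhsP => h [hn0 hcv].
(* Only increments of size at most 1 are dominated by [G], so the sequence is shifted until its
   terms are that small. *)
have [N _ hN] : \forall n \near \oo, `|h n| <= 1.
  by move/cvgrPdist_le : hcv => /(_ 1 ltr01); apply: filterS => n; rewrite sub0r normrN.
have := key (fun n => h (n + N)%N) (fun n => hn0 _).
rewrite (cvg_shiftn N h) => /(_ hcv) [].
  by move=> n; apply: hN; rewrite /= leq_addl.
by move=> _; rewrite (cvg_shiftn N (fun n => (h n)^-1 * (RI mu (F (s + h n)) - RI mu (F s)))).
Unshelve. all: by end_near. Qed.

End DiffUnderIntegral.

Section NormL2.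
Context d (T : measurableType d) (R : realType) (mu : {measure set T -> \bar R}).
Implicit Types f g : T -> R.

Definition n2 f : R := Num.sqrt (RI mu (fun x => f x ^+ 2)).

Lemma n2_ge0 f : 0 <= n2 f. Proof. exact: sqrtr_ge0. Qed.

Lemma n2_sqr f : n2 f ^+ 2 = RI mu (fun x => f x ^+ 2).
Proof. by rewrite sqr_sqrtr//; apply: RI_ge0 => x; exact: sqr_ge0. Qed.

Lemma n2_cs f g : L2 mu f -> L2 mu g -> `|RI mu (fun x => f x * g x)| <= n2 f * n2 g.
Proof. exact: cauchy_schwarz_sqrt. Qed.

Lemma n2D f g : L2 mu f -> L2 mu g -> n2 (fun x => f x + g x) <= n2 f + n2 g.
Proof.
move=> Lf Lg; have [mf lf] := Lf; have [mg lg] := Lg.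
rewrite -(ler_pXn2r (_ : 0 < 2)%N) ?nnegrE ?addr_ge0 ?n2_ge0// n2_sqr.
have -> : RI mu (fun x => (f x + g x) ^+ 2) =
   n2 f ^+ 2 + 2 * RI mu (fun x => f x * g x) + n2 g ^+ 2.
  have lfg := L2_mul Lf Lg.
  rewrite !n2_sqr -RIZl// -!RID//; first by apply: RI_eq => x; ring.
    by apply: L1D => //; exact: L1Zl.
  exact: L1Zl.
have := n2_cs Lf Lg; rewrite ler_norml => /andP[_ h].
by rewrite sqrrD; lra.
Qed.

End NormL2.

Section SpaceL2.
Context {R : realType}.
Local Notation V := (V3 R).
Local Notation mu := (@mu3 R).
Implicit Types (f g : V -> R).

Lemma mu3_box r : (mu (box r) < +oo)%E.
Proof.
have -> : @box R r = (`]- r, r[ `*` `]- r, r[) `*` `]- r, r[.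
  apply/seteqP; split => [x h|x [[h1 h2] h3]] /=.
    by have := (h ax1, h ax2, h ax3) => -[[]]; rewrite !in_itv /= -!ltr_norml.
  by case; rewrite ltr_norml; [move: h1|move: h2|move: h3]; rewrite /= in_itv.
rewrite /mu3 /pm /= /pmeas product_measure1E//=; last first.
  by apply: measurableX.
rewrite /pmeas product_measure1E//=.
have h : (leb1f (`](- r)%R, r[%classic) < +oo)%E.
  by rewrite /leb1f lebesgue_measure_itv /=; case: ifP => _; rewrite ?ltry// -EFinB ltry.
have hf : leb1f (`](- r)%R, r[%classic) \is a fin_num by rewrite ge0_fin_numE.
by rewrite -ge0_fin_numE ?mule_ge0// !fin_numM.
Qed.

Lemma L1_box r : L1 mu (\1_(box r)).
Proof. exact/L1_indic_box/mu3_box. Qed.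

Lemma L2_box r C f : measurable_fun setT f -> (forall x, `|f x| <= C) -> nullout r f -> L2 mu f.
Proof.
move=> mf fC f0; split => //.
apply: (@L1_nullout _ _ r (mu3_box r) _ (C ^+ 2)); first exact: measurable_funX.
  by move=> x; rewrite normrX lerXn2r ?nnegrE ?(le_trans _ (fC x)).
by move=> x /f0 ->; rewrite expr0n.
Qed.

Lemma smooth_nullout f : smooth_cpt f -> exists r, nullout r f.
Proof.
move=> [_ [_ [M hM]]]; exists (`|M| + 1) => x nb; apply: hM; rewrite ltNge; apply/negP => h.
apply: nb => i; rewrite (le_lt_trans (cd_norm3 i x))// (le_lt_trans h)//.
by rewrite (le_lt_trans (ler_norm M))// ltrDl.
Qed.

Lemma smooth_measurable f : smooth_cpt f -> measurable_fun setT f.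
Proof. by move=> [c _]; apply: continuous_measurable3; exact: (c [::]). Qed.

Lemma smooth_L2 f : smooth_cpt f -> L2 mu f.
Proof.
move=> sf; have [r f0] := smooth_nullout sf; have [_ [C fC] _ _ _] := smooth_C1b sf.
by apply: (L2_box (r := r) (C := C)) => //; exact: smooth_measurable.
Qed.

Lemma L2_dense f e : L2 mu f -> 0 < e -> exists2 t, smooth_cpt t & n2 mu (fun x => f x - t x) <= e.
Proof.
move=> [mf lf] e0.
have e2 : 0 < e ^+ 2 / 4 by rewrite divr_gt0// exprn_gt0.
pose A n : set V := box n%:R `&` (f @^-1` `[- n%:R, n%:R]).
have mA n : measurable (A n).
  apply: measurableI; first exact: measurable_box.
  by rewrite -[X in measurable X]setTI; apply: mf.
pose g n x := f x * \1_(A n) x.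
have [||||| _ ] := @RI_dct _ _ _ mu (fun n x => (f x - g n x) ^+ 2) (fun=> 0) (fun x => f x ^+ 2).
- move=> n; apply: measurable_funX; apply: measurable_funB => //.
  by apply: measurable_funM => //; exact: measurable_indr.
- exact: measurable_cst.
- exact: lf.
- move=> n x; rewrite /g indicE; case: (_ \in _); rewrite ?mulr1 ?subrr ?mulr0 ?subr0.
    by rewrite expr0n normr0 sqr_ge0.
  by rewrite ger0_norm ?sqr_ge0.
- apply: aeW => x; apply: cvg_near_cst; near=> n.
  have -> : g n x = f x; last by rewrite subrr expr0n.
  rewrite /g indic_in ?mulr1//; split.
    move=> i; apply: (le_lt_trans (cd_norm3 i x)).
    by near: n; exact: nbhs_infty_gtr.
  rewrite /= in_itv /= -ler_norml.
  by near: n; exact: nbhs_infty_ger.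
rewrite RI0 => /cvgrPdist_le /(_ _ e2) [n _ hn].
have := hn n (leqnn n); rewrite /= sub0r normrN ger0_norm; last by apply: RI_ge0 => x; exact: sqr_ge0.
move=> h1.
have gb x : - n%:R <= g n x <= n%:R.
  rewrite /g; have [hA|h] := pselect (A n x).
    have [_ h] := hA.
    by rewrite (indic_in hA) mulr1; move: h; rewrite /= in_itv.
  by rewrite indic_out// mulr0 oppr_le0 ler0n.
have mg : measurable_fun setT (g n) by apply: measurable_funM => //; exact: measurable_indr.
have g0 : nullout n%:R (g n).
  by move=> x nb; rewrite /g indic_out ?mulr0// => -[].
(* As [|g n - t| <= 2 n], the squared L2 distance is at most [2 n] times the L1 distance, and an L1
   approximation this close suffices. *)
have e3 : 0 < e ^+ 2 / 4 / (2 * n%:R + 1) by rewrite divr_gt0// ltr_wpDl// mulr_ge0.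
have [|t [st t0 tb [Lt ht]]] := smooth_dense (mu3_box n%:R) mg gb _ g0 e3.
  by rewrite oppr_le0 ler0n.
exists t => //.
have Lg : L2 mu (g n).
  apply: (L2_box (r := n%:R) (C := n%:R)) => // x; rewrite ler_norml; exact: gb.
have Lst := smooth_L2 st.
have Lf : L2 mu f by split.
have h2 : n2 mu (fun x => g n x - t x) <= e / 2.
  rewrite -(ler_pXn2r (_ : 0 < 2)%N) ?nnegrE ?n2_ge0 ?divr_ge0 ?(ltW e0)// n2_sqr.
  apply: (@le_trans _ _ ((2 * n%:R) * RI mu (fun x => `|g n x - t x|))).
    rewrite -RIZl//; apply: RI_le; [exact: (L2B Lg Lst).2|exact: L1Zl|].
    move=> x; have /andP[b1 b2] := gb x; have /andP[b3 b4] := tb x.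
    rewrite -real_normK ?num_real// expr2 ler_wpM2r// ler_norml; apply/andP; split; lra.
  rewrite exprMn expr2 exprVn -natrX.
  apply: (le_trans (ler_wpM2l (_ : 0 <= 2 * n%:R) ht)); first by rewrite mulr_ge0.
  rewrite mulrCA ger_pMr// ler_pdivrMr ?ltr_wpDl ?mulr_ge0// mul1r lerDl//.
have h3 : n2 mu (fun x => f x - g n x) <= e / 2.
  rewrite -(ler_pXn2r (_ : 0 < 2)%N) ?nnegrE ?n2_ge0 ?divr_ge0 ?(ltW e0)// n2_sqr.
  by rewrite exprMn exprVn -natrX.
rewrite [e]splitr; apply: le_trans (lerD h3 h2).
have := n2D (L2B Lf Lg) (L2B Lg Lst).
by rewrite (_ : (fun x => f x - g n x + (g n x - t x)) = (fun x => f x - t x))//; apply/funext => x; ring.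
Unshelve. all: by end_near. Qed.

Lemma L2_dual f C : L2 mu f -> 0 <= C ->
  (forall t, smooth_cpt t -> `|RI mu (fun x => f x * t x)| <= C * n2 mu t) -> n2 mu f <= C.
Proof.
move=> Lf C0 H; set N := n2 mu f; have N0 : 0 <= N by exact: n2_ge0.
have key e : 0 < e -> N ^+ 2 <= C * N + (N + C) * e.
  move=> e0; have [t st ht] := L2_dense Lf e0.
  have Lt := smooth_L2 st; have Lft := L2B Lf Lt.
  have -> : N ^+ 2 = RI mu (fun x => f x * (f x - t x)) + RI mu (fun x => f x * t x).
    rewrite n2_sqr -RID; [|exact: L2_mul|exact: L2_mul].
    by apply: RI_eq => x; ring.
  have h1 : RI mu (fun x => f x * (f x - t x)) <= N * e.
    apply: (le_trans (ler_norm _)); apply: (le_trans (n2_cs Lf Lft)).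
    by rewrite ler_wpM2l.
  have h2 : RI mu (fun x => f x * t x) <= C * (N + e).
    apply: (le_trans (ler_norm _)); apply: (le_trans (H t st)); rewrite ler_wpM2l//.
    have := n2D Lf (L2Zl (-1) Lft).
    rewrite (_ : (fun x => f x + -1 * (f x - t x)) = t); last by apply/funext => x; ring.
    move=> h; apply: (le_trans h); rewrite lerD2l.
    rewrite (_ : n2 _ _ = n2 mu (fun x => f x - t x))//.
    by congr Num.sqrt; apply: RI_eq => x; ring.
  by apply: (le_trans (lerD h1 h2)); rewrite mulrDr mulrDl; lra.
rewrite leNgt; apply/negP => CN.
(* If [C < N], then [key] asks [(N - C) N <= (N + C) e], while this [e] makes the right-hand side
   less than half of the left one. *)
have := key ((N - C) / (2 * (N + C + 1)) * N).
have NC : 0 < N - C by rewrite subr_gt0.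
have Np : 0 < N by exact: le_lt_trans CN.
have D0 : 0 < N + C + 1 by rewrite ltr_wpDl// addr_ge0.
have e0 : 0 < (N - C) / (2 * (N + C + 1)) * N.
  by apply: mulr_gt0 => //; apply: divr_gt0 => //; apply: mulr_gt0.
move=> /(_ e0).
apply/negP; rewrite -ltNge -ltrBrDl expr2 -mulrBl.
rewrite [X in X < _](_ : _ = (N - C) * N * ((N + C) / (2 * (N + C + 1)))); last by ring.
rewrite -[X in _ < X]mulr1 ltr_pM2l ?mulr_gt0// ltr_pdivrMr ?mulr_gt0// mul1r; lra.
Qed.

End SpaceL2.

(** * Weak derivatives and the dual form of the Fisher information *)

Lemma lim_uniq (R : realType) (u : nat -> R) (l l' : R) :
  u n @[n --> \oo] --> l -> u n @[n --> \oo] --> l' -> l = l'.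
Proof. by move=> h1 h2; rewrite -(cvg_lim (@Rhausdorff R) h1) (cvg_lim (@Rhausdorff R) h2). Qed.

Section SpaceL2Shift.
Context {R : realType}.
Local Notation V := (V3 R).
Local Notation mu := (@mu3 R).
Implicit Types (f g : V -> R).

Lemma smooth_shift f c : smooth_cpt f -> smooth_cpt (fun x => f (add3 x c)).
Proof.
move=> [cf [df [M hM]]].
have E l : Defs.iterD l (fun x => f (add3 x c)) = fun x => Defs.iterD l f (add3 x c).
  elim: l => //= u l ->; apply/funext => x.
  apply: isD_derive; apply: isD_shift; apply/isD_is_derive; split=> //; exact: df.
split.
  move=> l x; rewrite E.
  apply: (@continuous_comp _ _ _ (fun x => add3 x c) (Defs.iterD l f));
  [exact: shift_continuous|exact: cf].
split.
  move=> l x u; rewrite E.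
  suff /isD_is_derive[] : isD (fun x => Defs.iterD l f (add3 x c)) x u ('D_u (Defs.iterD l f) (add3 x c)) by [].
  by apply: isD_shift; apply/isD_is_derive; split=> //; exact: df.
exists (2 * (`|M| + norm3 c)) => x hx; apply: hM.
have hn : norm3 x <= 2 * (norm3 (add3 x c) + norm3 c).
  apply: norm3_le => i; have -> : cd i x = cd i (add3 x c) - cd i c by rewrite cdD addrK.
  by rewrite (le_trans (ler_normB _ _))// lerD ?cd_norm3.
by have := ler_norm M; lra.
Qed.

Lemma RI_shift f c : L1 mu f -> L1 mu (fun x => f (add3 x c)) /\ RI mu (fun x => f (add3 x c)) = RI mu f.
Proof. exact: (mpres_RI (mu3_shift c)). Qed.

Lemma L2_shift f c : L2 mu f -> L2 mu (fun x => f (add3 x c)) /\ n2 mu (fun x => f (add3 x c)) = n2 mu f.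
Proof.
move=> [mf lf]; have [l e] := RI_shift c lf.
split; last by rewrite /n2 e.
split => //; apply: (measurableT_comp mf); by have [] := mu3_shift c.
Qed.

Lemma smooth_lipschitz (t : V -> R) (e : V) : smooth_cpt t -> exists2 C, 0 <= C &
  forall s u x, `|t (add3 x (scale3 s e)) - t (add3 x (scale3 u e))| <= `|s - u| * C.
Proof.
move=> st; have hC := smooth_C1b st; have [_ _ _ bd _] := hC.
have [C1 h1] := bd ax1; have [C2 h2] := bd ax2; have [C3 h3] := bd ax3.
pose dt x := sum3 (fun i => 'D_(ee i) t x * cd i e).
pose C := C1 * `|cd ax1 e| + C2 * `|cd ax2 e| + C3 * `|cd ax3 e|.
have dtC x : `|dt x| <= C.
  rewrite /dt /sum3 (le_trans (ler_normD _ _))// lerD//; last by rewrite normrM ler_wpM2r.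
  by rewrite (le_trans (ler_normD _ _))// lerD// normrM ler_wpM2r.
exists C; first exact: le_trans (dtC (mkV3 0 0 0)).
move=> s u x; rewrite mulrC.
apply: (lipschitz_bound (f := fun s => t (add3 x (scale3 s e)))
  (df := fun s => dt (add3 x (scale3 s e)))) => // y.
by apply: (isD_line (df := dt)) => z; exact: (C1b_isD z e hC).
Qed.

End SpaceL2Shift.

Section WeakDerivative.
Context {R : realType}.
Local Notation V := (V3 R).
Local Notation mu := (@mu3 R).
Variables (a h : V -> R) (e : V).
Hypotheses (La : L2 mu a) (Lh : L2 mu h).
Hypothesis wk : forall t, smooth_cpt t ->
  RI mu (fun x => a x * 'D_e t x) = - RI mu (fun x => h x * t x).

Lemma isd_translate t s : smooth_cpt t ->
  L1 mu (fun x => a x * 'D_e (fun y => t (add3 y (scale3 s e))) x) /\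
  isd (fun s => RI mu (fun x => a x * t (add3 x (scale3 s e)))) s
      (RI mu (fun x => a x * 'D_e (fun y => t (add3 y (scale3 s e))) x)).
Proof.
move=> st.
have [r t0] := smooth_nullout st.
have [C C0 hC] := smooth_lipschitz e st.
have Dt x : isD t x e ('D_e t x) by exact: smooth_isD.
(* This box contains the supports of all translates of [t] by [u e] with [|u - s| <= 1]. *)
pose r' := `|r| + (`|s| + 1) * norm3 e.
have Lb : L1 mu (fun x => `|a x| * (C * \1_(box r') x)).
  apply: L2_mul; last first.
    apply: L2Zl; apply: (L2_box (r := r') (C := 1)).
    - by apply: measurable_indr; exact: measurable_box.
    - by move=> x; have /andP[? ?] := @indic_itv _ (box r') x; rewrite ger0_norm.
    - by move=> x nb; rewrite indic_out.
  split; first by apply: measurableT_comp => //; case: La.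
  by case: La => _; apply: L1_eq => x; rewrite real_normK ?num_real.
have [|||L] := @isd_RI _ _ _ mu (fun u x => a x * t (add3 x (scale3 u e)))
   (fun x => a x * 'D_e t (add3 x (scale3 s e))) _ s _ Lb.
- move=> u; apply: L2_mul => //; apply: smooth_L2; exact: smooth_shift.
- move=> u x us; rewrite -mulrBr normrM mulrCA ler_wpM2l//.
  have [hb|hb] := pselect (box r' x).
    by rewrite indic_in// mulr1.
  rewrite indic_out// !mulr0.
  have out v : `|v| <= `|s| + 1 -> t (add3 x (scale3 v e)) = 0.
    move=> hv; apply: t0 => hbx; apply: hb => i.
    have := hbx i; rewrite cdD cdZ => hi.
    have -> : cd i x = (cd i x + v * cd i e) - v * cd i e by rewrite addrK.
    rewrite (le_lt_trans (ler_normB _ _))// /r' ltr_leD//.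
      by rewrite (lt_le_trans hi)// ler_norm.
    by rewrite normrM ler_pM// cd_norm3.
  rewrite !out ?subrr ?normr0//; first by rewrite lerDl.
  have -> : u = (u - s) + s by rewrite subrK.
  by rewrite (le_trans (ler_normD _ _))// addrC lerD2l.
- move=> x; apply: isdZ.
  exact: (isD_line (df := fun x => 'D_e t x)).
- have E x : a x * 'D_e t (add3 x (scale3 s e)) = a x * 'D_e (fun y => t (add3 y (scale3 s e))) x.
    by congr (_ * _); apply/esym; apply: isD_derive; apply: isD_shift.
  move=> H; split; first exact: L1_eq E L.
  by refine (isd_eq H (fun=> erefl) _); exact: RI_eq.
Qed.

Lemma isd_weak t s : smooth_cpt t ->
  isd (fun s => RI mu (fun x => a x * t (add3 x (scale3 s e)))) s
      (- RI mu (fun x => h x * t (add3 x (scale3 s e)))).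
Proof.
move=> st; have sts := smooth_shift (scale3 s e) st.
by rewrite -(wk sts); exact: (isd_translate s st).2.
Qed.

Lemma weak_lipschitz t s : smooth_cpt t ->
  `|RI mu (fun x => a x * t (add3 x (scale3 s e))) - RI mu (fun x => a x * t x)| <=
    `|s| * n2 mu h * n2 mu t.
Proof.
move=> st; have H := lipschitz_bound (f := fun s => RI mu (fun x => a x * t (add3 x (scale3 s e))))
   (C := n2 mu h * n2 mu t) 0 s (fun y => isd_weak y st).
have E : RI mu (fun x => a x * t (add3 x (scale3 0 e))) = RI mu (fun x => a x * t x).
  by apply: RI_eq => x; rewrite add3_0.
rewrite (_ : `|s| * n2 mu h * n2 mu t = n2 mu h * n2 mu t * `|s|); last by ring.
move: H; rewrite subr0 E; apply => u; rewrite normrN.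
have Lt := smooth_L2 st.
have [L2s <-] := L2_shift (scale3 u e) Lt.
exact: n2_cs.
Qed.

Definition tr s (f : V -> R) x := f (add3 x (scale3 s e)).

Lemma tr_L2 s f : L2 mu f -> L2 mu (tr s f).
Proof. by move=> Lf; have [] := L2_shift (scale3 s e) Lf. Qed.

Lemma RI_tr s f g : L1 mu (fun x => tr (- s) f x * g x) ->
  RI mu (fun x => tr (- s) f x * g x) = RI mu (fun x => f x * tr s g x).
Proof.
move=> L; have [_ <-] := RI_shift (scale3 s e) L; apply: RI_eq => x; rewrite /tr; congr (f _ * _).
by rewrite !add3E !scale3E scaleNr addrK.
Qed.

Lemma RI_tr_sub s t : smooth_cpt t -> RI mu (fun x => (tr (- s) a x - a x) * t x) =
   RI mu (fun x => a x * t (add3 x (scale3 s e))) - RI mu (fun x => a x * t x).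
Proof.
move=> st; have Ls := tr_L2 (- s) La; have Lt := smooth_L2 st.
rewrite -[X in X - _](RI_tr (s := s) (f := a) (g := t)); last exact: L2_mul.
rewrite -RIB; [|exact: L2_mul|exact: L2_mul].
by apply: RI_eq => x; rewrite mulrBl.
Qed.

(** By duality the translation moves to the test function, where the pairing is Lipschitz in [s]
    with constant [n2 h n2 t]. *)
Lemma translate_bound s : n2 mu (fun x => tr (- s) a x - a x) <= `|s| * n2 mu h.
Proof.
have Ls := tr_L2 (- s) La.
apply: L2_dual; [exact: L2B|by rewrite mulr_ge0// n2_ge0|move=> t st].
by rewrite RI_tr_sub//; exact: weak_lipschitz.
Qed.

Let un (n : nat) : R := n.+1%:R^-1.
Let un0 n : un n != 0. Proof. by rewrite invr_eq0 pnatr_eq0. Qed.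
Let un_gt0 n : 0 < un n. Proof. by rewrite invr_gt0 ltr0n. Qed.
Let un_cvg : un n @[n --> \oo] --> 0. Proof. exact: cvg_harmonic. Qed.

(** Weak convergence of the difference quotients holds against smooth functions; the uniform bound
    [translate_bound] extends it to all of L2 by density. *)
Lemma difference_quotient_weak g : L2 mu g ->
  (un n)^-1 * RI mu (fun x => (tr (- un n) a x - a x) * g x) @[n --> \oo] -->
    - RI mu (fun x => h x * g x).
Proof.
move=> Lg; apply/cvgrPdist_le => eps eps0.
set C := n2 mu h; have C0 : 0 <= C by exact: n2_ge0.
have D0 : 0 < 2 * C + 1 by rewrite ltr_wpDl// mulr_ge0.
have e3 : 0 < eps / (2 * C + 1) / 2 by rewrite !divr_gt0.
have [t st ht] := L2_dense Lg e3; have Lt := smooth_L2 st; have Lgt := L2B Lg Lt.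
have c1 : (un n)^-1 * RI mu (fun x => (tr (- un n) a x - a x) * t x) @[n --> \oo] -->
    - RI mu (fun x => h x * t x).
  have := isd_seq (h := un) (isd_weak 0 st) un0 un_cvg.
  have -> : RI mu (fun x => h x * t (add3 x (scale3 0 e))) = RI mu (fun x => h x * t x).
    by apply: RI_eq => x; rewrite add3_0.
  apply: cvg_trans; apply: near_eq_cvg; near=> n.
  rewrite RI_tr_sub// add0r; congr (_ * (_ - _)).
  by apply: RI_eq => x; rewrite add3_0.
have eps2 : 0 < eps / 2 by rewrite divr_gt0.
move/cvgrPdist_le : c1 => /(_ _ eps2); apply: filterS => n hn.
have Ls := tr_L2 (- un n) La; have Ld := L2B Ls La.
have E2 : RI mu (fun x => (tr (- un n) a x - a x) * g x) =
   RI mu (fun x => (tr (- un n) a x - a x) * (g x - t x)) +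
   RI mu (fun x => (tr (- un n) a x - a x) * t x).
  rewrite -RID; [|exact: L2_mul|exact: L2_mul].
  by apply: RI_eq => x; ring.
have E3 : RI mu (fun x => h x * g x) = RI mu (fun x => h x * (g x - t x)) + RI mu (fun x => h x * t x).
  rewrite -RID; [|exact: L2_mul|exact: L2_mul].
  by apply: RI_eq => x; ring.
rewrite E2 E3.
set A := RI mu (fun x => h x * (g x - t x)); set B := RI mu (fun x => h x * t x) in hn *.
set A' := RI mu (fun x => _ * (g x - t x)); set B' := RI mu (fun x => _ * t x) in hn *.
rewrite (_ : _ - _ = (- B - (un n)^-1 * B') + (- A - (un n)^-1 * A')); last by ring.
rewrite (le_trans (ler_normD _ _))// [eps]splitr lerD//.
have d0 : 0 <= n2 mu (fun x => g x - t x) by exact: n2_ge0.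
have hA : `|A| <= C * (eps / (2 * C + 1) / 2).
  by rewrite (le_trans (n2_cs Lh Lgt))// ler_wpM2l.
have hA' : `|(un n)^-1 * A'| <= C * (eps / (2 * C + 1) / 2).
  rewrite normrM ger0_norm ?invr_ge0 ?(ltW (un_gt0 n))// mulrC ler_pdivrMr//.
  rewrite (le_trans (n2_cs Ld Lgt))//.
  have := translate_bound (un n); rewrite (ger0_norm (ltW (un_gt0 n))) => hb.
  by rewrite mulrAC [C * un n]mulrC ler_pM ?n2_ge0.
rewrite (le_trans (ler_normB _ _))// normrN (le_trans (lerD hA hA'))//.
have -> : C * (eps / (2 * C + 1) / 2) + C * (eps / (2 * C + 1) / 2) = (eps / 2) * ((2 * C) / (2 * C + 1)).
  by field; rewrite gt_eqF.
by rewrite ger_pMr// ler_pdivrMr// mul1r lerDl.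
Unshelve. all: by end_near. Qed.

(* [(a(x - t e)^2 - a(x)^2) / t = (a(x - t e) - a(x))^2 / t + 2 a (a(x - t e) - a(x)) / t],
   where the first term is [O(t)] in [L1]. *)
Lemma weak_square (Phi dPhi : V -> R) C C' : measurable_fun setT Phi ->
  (forall x, `|Phi x| <= C) -> (forall x, `|dPhi x| <= C') ->
  (forall x, isD Phi x e (dPhi x)) ->
  RI mu (fun x => a x ^+ 2 * dPhi x) = - RI mu (fun x => 2 * a x * h x * Phi x).
Proof.
move=> mP PC dC D.
have [ma la] := La.
have C0 : 0 <= C by exact: le_trans (PC (mkV3 0 0 0)).
have C0' : 0 <= C' by exact: le_trans (dC (mkV3 0 0 0)).
have mtr s : measurable_fun setT (tr s Phi).
  by apply: (measurableT_comp mP); have [] := mu3_shift (scale3 s e).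
have c1 : (un n)^-1 * RI mu (fun x => a x ^+ 2 * (tr (un n) Phi x - Phi x)) @[n --> \oo] -->
    RI mu (fun x => a x ^+ 2 * dPhi x).
  have md : measurable_fun setT dPhi.
    apply: (@measurable_isd _ _ _ (fun s x => Phi (add3 x (scale3 s e))) dPhi 0).
      by move=> s; exact: mtr.
    exact: D.
  have [||||| _] := @RI_dct _ _ _ mu (fun n x => (un n)^-1 * (a x ^+ 2 * (tr (un n) Phi x - Phi x)))
      (fun x => a x ^+ 2 * dPhi x) (fun x => C' * a x ^+ 2).
  - move=> n; apply: measurable_funM; first exact: measurable_cst.
    by apply: measurable_funM; [exact: measurable_funX|exact: measurable_funB].
  - by apply: measurable_funM => //; exact: measurable_funX.
  - exact: L1Zl.
  - move=> n x; rewrite normrM ger0_norm ?invr_ge0 ?(ltW (un_gt0 n))// mulrC ler_pdivrMr//.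
    rewrite normrM (ger0_norm (sqr_ge0 _)) (_ : C' * a x ^+ 2 * un n = a x ^+ 2 * (C' * un n)); last by ring.
    apply: ler_wpM2l; first exact: sqr_ge0.
    have := lipschitz_bound (f := fun s => Phi (add3 x (scale3 s e)))
       (df := fun s => dPhi (add3 x (scale3 s e))) 0 (un n) (isD_line x D) (fun y => dC _).
    by rewrite subr0 (ger0_norm (ltW (un_gt0 n))) add3_0.
  - apply: aeW => x.
    have := isd_seq (h := un) (D x) un0 un_cvg => H.
    have -> : (fun n => (un n)^-1 * (a x ^+ 2 * (tr (un n) Phi x - Phi x))) =
       (fun n => a x ^+ 2 * ((un n)^-1 * (Phi (add3 x (scale3 (0 + un n) e)) - Phi (add3 x (scale3 0 e))))).
      by apply/funext => n; rewrite /tr add0r add3_0; ring.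
    by apply: cvgM => //; exact: cvg_cst.
  apply: cvg_trans; apply: near_eq_cvg; near=> n.
  rewrite RIZl//; apply: (L1_bd (C := 2 * C)) => //; first exact: measurable_funB.
  by move=> x; rewrite (le_trans (ler_normB _ _))// mulr_natl mulr2n lerD// PC.
have Lap : L2 mu (fun x => a x * Phi x) by exact: (L2_bd (C := C)).
have c2 := difference_quotient_weak Lap.
have c3 : (un n)^-1 * RI mu (fun x => (tr (- un n) a x - a x) ^+ 2 * Phi x) @[n --> \oo] --> 0.
  apply/cvgrPdist_le => eps eps0.
  have K0 : 0 < C * n2 mu h ^+ 2 + 1 by rewrite ltr_wpDl// mulr_ge0// sqr_ge0.
  have /cvgrPdist_le /(_ _ (divr_gt0 eps0 K0)) := un_cvg; apply: filterS => n.
  rewrite sub0r normrN (ger0_norm (ltW (un_gt0 n))) ler_pdivlMr// => hn.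
  have Ld := L2B (tr_L2 (- un n) La) La; have [md ld] := Ld.
  rewrite sub0r normrN normrM ger0_norm ?invr_ge0 ?(ltW (un_gt0 n))// mulrC ler_pdivrMr//.
  apply: (@le_trans _ _ (RI mu (fun x => C * (tr (- un n) a x - a x) ^+ 2))).
    apply: RI_abs; [by apply: measurable_funM => //; exact: measurable_funX|exact: L1Zl|].
    by move=> x; rewrite normrM mulrC (ger0_norm (sqr_ge0 _)) ler_wpM2r ?sqr_ge0.
  rewrite RIZl// -n2_sqr.
  have h1 : n2 mu (fun x => tr (- un n) a x - a x) ^+ 2 <= (un n * n2 mu h) ^+ 2.
    rewrite lerXn2r ?nnegrE ?n2_ge0 ?mulr_ge0 ?n2_ge0 ?(ltW (un_gt0 n))//.
    by have := translate_bound (un n); rewrite (ger0_norm (ltW (un_gt0 n))).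
  apply: (le_trans (ler_wpM2l C0 h1)); rewrite exprMn mulrCA expr2 -mulrA [eps * _]mulrC.
  rewrite ler_wpM2l ?(ltW (un_gt0 n))//; apply: le_trans hn.
  by rewrite ler_wpM2l ?(ltW (un_gt0 n))// lerDl.
have c4 : (un n)^-1 * RI mu (fun x => (tr (- un n) a x - a x) ^+ 2 * Phi x) +
     2 * ((un n)^-1 * RI mu (fun x => (tr (- un n) a x - a x) * (a x * Phi x))) @[n --> \oo] -->
     0 + 2 * - RI mu (fun x => h x * (a x * Phi x)).
  by apply: cvgD => //; apply: cvgM => //; exact: cvg_cst.
have E : (fun n => (un n)^-1 * RI mu (fun x => a x ^+ 2 * (tr (un n) Phi x - Phi x))) =
   (fun n => (un n)^-1 * RI mu (fun x => (tr (- un n) a x - a x) ^+ 2 * Phi x) +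
     2 * ((un n)^-1 * RI mu (fun x => (tr (- un n) a x - a x) * (a x * Phi x)))).
  apply/funext => n; have Ls := tr_L2 (- un n) La; have Ld := L2B Ls La.
  rewrite mulrCA -mulrDr; congr (_ * _).
  have l1 : L1 mu (fun x => (tr (- un n) a x - a x) ^+ 2 * Phi x).
    by apply: (L1_bd (C := C)) => //; exact: Ld.2.
  have l2 := L2_mul Ld Lap.
  rewrite -RIZl// -RID//; last exact: L1Zl.
  have l3 : L1 mu (fun x => tr (- un n) (fun y => a y ^+ 2) x * Phi x).
    by apply: (L1_bd (C := C)) => //; exact: Ls.2.
  have l4 : L1 mu (fun x => a x ^+ 2 * Phi x) by exact: (L1_bd (C := C)).
  have l5 : L1 mu (fun x => a x ^+ 2 * tr (un n) Phi x).
    by apply: (L1_bd (C := C)) => // x; exact: PC.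
  transitivity (RI mu (fun x => a x ^+ 2 * tr (un n) Phi x) - RI mu (fun x => a x ^+ 2 * Phi x)).
    by rewrite -RIB//; apply: RI_eq => x; rewrite mulrBr.
  rewrite -(RI_tr l3) -RIB//; apply: RI_eq => x; rewrite /tr; ring.
rewrite E in c1.
have -> := @lim_uniq R _ _ _ c1 c4; rewrite add0r mulrN; congr (- _).
have Lhp : L1 mu (fun x => h x * (a x * Phi x)) by exact: L2_mul.
by rewrite -RIZl//; apply: RI_eq => x; ring.
Unshelve. all: by end_near. Qed.

End WeakDerivative.

(** * Mean values on an interval and operations on test functions *)

Section IntervalCalculus.
Context {R : realType}.

Lemma mean_value_itv (f df : R -> R) a b : a < b ->
  (forall x, a < x < b -> isd f x (df x)) ->
  (exists C, forall x y, `|f x - f y| <= C * `|x - y|) ->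
  exists2 c, a < c < b & f b - f a = df c * (b - a).
Proof.
move=> ab hf [C hC].
have cf : continuous f.
  move=> x; apply/continuous_distP => e e0.
  have C0 : 0 < `|C| + 1 by rewrite ltr_wpDl.
  exists (e / (`|C| + 1)); first by rewrite divr_gt0.
  move=> y; rewrite ltr_pdivlMr// => h; apply: (le_lt_trans (hC y x)).
  apply: (le_lt_trans _ h); rewrite mulrC ler_wpM2l// (le_trans (ler_norm C))// lerDl//.
have [|c] := MVT ab (f := f) (df := df) _ (continuous_subspaceT cf).
  by move=> x; rewrite in_itv /=; exact: hf.
by rewrite in_itv /= => h1 h2; exists c.
Qed.

Lemma lipschitz_itv (f df : R -> R) C a b : a <= b ->
  (forall x, a <= x <= b -> isd f x (df x)) -> (forall x, a <= x <= b -> `|df x| <= C) ->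
  `|f b - f a| <= C * (b - a).
Proof.
move=> ab hf hC.
have cf : {within `[a, b], continuous f}.
  apply: derivable_within_continuous => x; rewrite in_itv /= => /hf[].
  by [].
have [x|c] := MVT_segment (f := f) (df := df) ab _ cf.
  by rewrite in_itv /= => /andP[/ltW h1 /ltW h2]; apply: hf; rewrite h1.
rewrite in_itv /= => hc ->; rewrite normrM (ger0_norm (_ : 0 <= b - a)) ?subr_ge0//.
by rewrite ler_wpM2r ?subr_ge0// hC.
Qed.

(** Freezing the time outside [[0, t]] turns a flow that exists only on that interval into a
    Lipschitz family over all of R, as differentiation under the integral asks. *)
Definition clamp (t s : R) := Num.max 0 (Num.min s t).

Lemma clamp_itv (t s : R) : 0 <= t -> 0 <= clamp t s <= t.
Proof. by move=> t0; rewrite /clamp le_max lexx /= ge_max t0 /= ge_min lexx orbT. Qed.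

Lemma clamp_id (t s : R) : 0 <= s <= t -> clamp t s = s.
Proof. by rewrite /clamp => /andP[h1 h2]; rewrite min_l// max_r. Qed.

Lemma clamp_lipschitz (t s u : R) : 0 <= t -> `|clamp t s - clamp t u| <= `|s - u|.
Proof.
move=> t0; wlog us : s u / u <= s.
  by move=> H; have [us|/ltW su] := leP u s; [exact: H|rewrite distrC [`|s - u|]distrC; exact: H].
rewrite (ger0_norm (_ : 0 <= s - u)) ?subr_ge0// ler_norml /clamp /Num.max /Num.min.
by apply/andP; case: (ltP s t) => ?; case: (ltP u t) => ?; split; repeat case: ltP => ?; lra.
Qed.

End IntervalCalculus.

Section C1bClosure.
Context {R : realType}.
Local Notation V := (V3 R).
Implicit Types (f g : V -> R).

Lemma C1b_shift f df c : C1b f df -> C1b (fun x => f (add3 x c)) (fun i x => df i (add3 x c)).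
Proof.
move=> [cf [M hM] cdf bdf D]; split.
- by move=> x; apply: (@continuous_comp _ _ _ (fun x => add3 x c) f);
    [exact: shift_continuous|exact: cf].
- by exists M.
- by move=> i x; apply: (@continuous_comp _ _ _ (fun x => add3 x c) (df i));
    [exact: shift_continuous|exact: cdf].
- by move=> i; have [N hN] := bdf i; exists N.
- by move=> i x; exact: isD_shift.
Qed.

Lemma C1b_scale f df c : C1b f df -> C1b (fun x => c * f x) (fun i x => c * df i x).
Proof.
move=> [cf [M hM] cdf bdf D]; split.
- by move=> x; apply: cvgM; [exact: cvg_cst|exact: cf].
- by exists (`|c| * M) => x; rewrite normrM ler_wpM2l.
- by move=> i x; apply: cvgM; [exact: cvg_cst|exact: cdf].
- by move=> i; have [N hN] := bdf i; exists (`|c| * N) => x; rewrite normrM ler_wpM2l.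
- move=> i x; apply: isD_eq (isDM (isD_cst c x (ee i)) (D i x)) _ _ => //.
  by rewrite mul0r add0r.
Qed.

(** The function [k |-> z / (1 + k z)] solves [w' = - w^2] with [w(0) = z]: this is the explicit
    Hamilton-Jacobi flow. *)
Lemma C1b_mobius f df k dl : C1b f df -> 0 < dl -> (forall x, dl <= 1 + k * f x) ->
  C1b (fun x => f x / (1 + k * f x)) (fun i x => df i x / (1 + k * f x) ^+ 2).
Proof.
move=> [cf [M hM] cdf bdf D] dl0 hk.
have p0 x : 0 < 1 + k * f x by exact: lt_le_trans (hk x).
have cd1 : continuous (fun x => 1 + k * f x).
  by move=> x; apply: cvgD; [exact: cvg_cst|apply: cvgM; [exact: cvg_cst|exact: cf]].
have ci : continuous (fun x => (1 + k * f x)^-1).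
  by move=> x; apply: cvgV; [rewrite gt_eqF|exact: cd1].
have bi x : `|(1 + k * f x)^-1| <= dl^-1.
  by rewrite normfV gtr0_norm// lef_pV2 ?posrE.
split.
- by move=> x; apply: cvgM; [exact: cf|exact: ci].
- by exists (M / dl) => x; rewrite normrM ler_pM.
- move=> i x; apply: cvgM; first exact: cdf.
  under [X in X @ _ --> _]eq_fun do rewrite expr2 invfM.
  by rewrite expr2 invfM; apply: cvgM; exact: ci.
- move=> i; have [N hN] := bdf i; exists (N * (dl^-1 * dl^-1)) => x.
  by rewrite expr2 invfM normrM ler_pM// normrM ler_pM.
- move=> i x; have p0' : 1 + k * f x != 0 by rewrite gt_eqF.
  have h : isd (fun y => y / (1 + k * y)) (f x) ((1 + k * f x) ^- 2).
    have hd : isd (fun y => 1 + k * y) (f x) k.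
      by apply: isd_eq (isdD (isd_cst 1 (f x)) (isdZ k (isd_id (f x)))) _ _ => //; rewrite add0r mulr1.
    apply: isd_eq (isdM (isd_id (f x)) (isdV (f := fun y : R => 1 + k * y) p0' hd)) _ _ => //.
    by field.
  by apply: isD_eq (isD_comp (D i x) h) _ _ => //; rewrite mulrC.
Qed.

End C1bClosure.

(** * From the dual bound to translations of sqrt g *)

Section ScoreBound.
Context {R : realType}.
Local Notation V := (V3 R).
Local Notation mu := (@mu3 R).
Variables (g : V -> R) (j : axis) (K : R).
Hypotheses (g0 : forall x, 0 <= g x) (Lg : L1 mu g).

(* The quadratic (dual) form of the bound [int (d_j g)^2 / g <= K]. *)
Definition score_bound := forall phi dphi, C1b phi dphi ->
  - RI mu (fun x => g x * (2 * dphi j x + phi x ^+ 2)) <= K.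

Hypothesis JB : score_bound.

(* The test function is transported by the Hamilton-Jacobi flow
   [d_s phi = - phi^2 / t] while [g] is translated. *)
Lemma hamilton_jacobi phi dphi (t dl : R) : C1b phi dphi -> 0 < t -> 0 < dl -> dl <= 1 ->
  (forall x, -1 + dl <= phi x) ->
  RI mu (fun x => g x * (phi (add3 x (scale3 (- t) (ee j))) / (1 + phi (add3 x (scale3 (- t) (ee j))))))
    - RI mu (fun x => g x * phi x) <= t ^+ 2 * K / 4.
Proof.
move=> hphi t0 dl0 dl1 lb; have [cphi [M hM] cd bd D] := hphi; have [N hN] := bd j.
(* With this speed the flow reaches [phi / (1 + phi)] exactly at time [t]. *)
pose c := t^-1; have c0 : 0 < c by rewrite invr_gt0.
have M0 : 0 <= M by exact: le_trans (hM (mkV3 0 0 0)).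
have N0 : 0 <= N by exact: le_trans (hN (mkV3 0 0 0)).
have den (s : R) y : 0 <= s <= t -> dl <= 1 + c * s * phi y.
  move=> /andP[s0 st]; have cs0 : 0 <= c * s by rewrite mulr_ge0// ltW.
  have cs1 : c * s <= 1 by rewrite mulrC ler_pdivrMr// mul1r.
  by have := lb y => h; nra.
pose pos (s : R) (x : V) := add3 x (scale3 (- s) (ee j)).
pose rho s x := phi (pos s x) / (1 + c * s * phi (pos s x)).
pose drho s x := - (dphi j (pos s x) + c * phi (pos s x) ^+ 2) / (1 + c * s * phi (pos s x)) ^+ 2.
have isd_pos s x : isd (fun s => phi (pos s x)) s (- dphi j (pos s x)).
  have h := isd_comp (isdN (isd_id s)) (isD_line x (D j) (- s)).
  by apply: isd_eq h _ _ => //; rewrite mulrN1.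
have isd_rho (s : R) x : 0 <= s <= t -> isd (fun s => rho s x) s (drho s x).
  move=> hs; have p0 : 1 + c * s * phi (pos s x) != 0.
    by rewrite gt_eqF// (lt_le_trans dl0)// den.
  have hd : isd (fun s => 1 + c * s * phi (pos s x)) s (c * phi (pos s x) + c * s * - dphi j (pos s x)).
    apply: isd_eq (isdD (isd_cst 1 s) (isdM (isdZ c (isd_id s)) (isd_pos s x))) _ _ => //.
    by rewrite add0r mulr1.
  apply: isd_eq (isdM (isd_pos s x) (isdV (f := fun s : R => 1 + c * s * phi (pos s x)) p0 hd)) _ _ => //.
  by rewrite /drho; field.
pose L := (N + c * M ^+ 2) / dl ^+ 2.
have L0 : 0 <= L by rewrite /L divr_ge0 ?exprn_ge0 ?(ltW dl0)// addr_ge0// mulr_ge0 ?(ltW c0)// exprn_ge0.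
have drhoL (s : R) x : 0 <= s <= t -> `|drho s x| <= L.
  move=> hs; have h := den s (pos s x) hs.
  rewrite /drho /L normrM normrN; apply: ler_pM => //.
    rewrite (le_trans (ler_normD _ _))// lerD// normrM (gtr0_norm c0) ler_wpM2l ?(ltW c0)//.
    by rewrite normrX lerXn2r ?nnegrE.
  rewrite normfV lef_pV2 ?posrE ?normr_gt0 ?exprn_gt0 ?expf_neq0 ?gt_eqF ?(lt_le_trans dl0 h)//.
  by rewrite normrX lerXn2r ?nnegrE ?(ltW dl0)// ger0_norm// (le_trans (ltW dl0)).
have rho_lip (s u : R) x : 0 <= s <= t -> 0 <= u <= t -> `|rho s x - rho u x| <= L * `|s - u|.
  wlog us : s u / u <= s.
    move=> H hs hu; have [us|/ltW su] := leP u s; first exact: H.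
    by rewrite distrC [`|s - u|]distrC; exact: H.
  move=> /andP[s0 st] /andP[u0 ut]; rewrite (ger0_norm (_ : 0 <= s - u)) ?subr_ge0//.
  apply: (lipschitz_itv (f := fun s => rho s x) (df := fun s => drho s x)) => // y /andP[y1 y2].
    by apply: isd_rho; rewrite (le_trans u0)// (le_trans y2).
  by apply: drhoL; rewrite (le_trans u0)// (le_trans y2).
have ct s : 0 <= clamp t s <= t by apply: clamp_itv; exact: ltW.
have mphi : measurable_fun setT phi by exact: continuous_measurable3.
have mpos s : measurable_fun setT (fun x => phi (pos s x)).
  by apply: (measurableT_comp mphi); have [] := mu3_shift (scale3 (- s) (ee j)).
have mrho s : measurable_fun setT (rho s).
  apply: measurable_funM => //; apply: measurable_invr; apply: measurable_funD; first exact: measurable_cst.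
  by apply: measurable_funM => //; exact: measurable_cst.
have brho (s : R) x : 0 <= s <= t -> `|rho s x| <= M / dl.
  move=> hs; have h := den s (pos s x) hs.
  rewrite /rho normrM ler_pM// normfV lef_pV2 ?posrE ?normr_gt0 ?gt_eqF ?(lt_le_trans dl0 h)//.
  by rewrite ger0_norm// (le_trans (ltW dl0)).
pose F s x := g x * rho (clamp t s) x.
have LF s : L1 mu (F s) by apply: (L1_bd (C := M / dl)) => // x; exact: brho.
have LG : L1 mu (fun x => g x * L).
  by apply: L1_eq (L1Zl L Lg) => x; rewrite mulrC.
have Flip s u x : `|F s x - F u x| <= `|s - u| * (g x * L).
  rewrite /F -mulrBr normrM (ger0_norm (g0 x)) mulrCA ler_wpM2l//.
  apply: (le_trans (rho_lip _ _ _ (ct s) (ct u))); rewrite mulrC; apply: ler_wpM2r => //; apply: clamp_lipschitz; exact: ltW.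
pose m s := RI mu (F s).
have dmL (s : R) : 0 < s < t -> L1 mu (fun x => g x * drho s x) /\
    isd m s (RI mu (fun x => g x * drho s x)).
  move=> /andP[s0 st]; have hs : 0 <= s <= t by rewrite !ltW.
  apply: (isd_RI LF LG) => [u x _|x]; first exact: Flip.
  apply: isdZ; apply: (isd_near _ (isd_rho s x hs)).
  near=> u; rewrite clamp_id//; apply/andP; split; apply: ltW; near: u.
    exact: lt_nbhsr.
  exact: lt_nbhsl.
have dm (s : R) (hs : 0 < s < t) := (dmL s hs).2.
have mlip : exists C, forall s u, `|m s - m u| <= C * `|s - u|.
  exists (RI mu (fun x => g x * L)) => s u.
  rewrite /m -RIB// mulrC -RIZl//; apply: RI_abs; [exact: L1_meas (L1B _ _)|exact: L1Zl|].
  by move=> x; exact: Flip.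
have [s hs E] := mean_value_itv t0 dm mlip.
have [s0 st] := andP hs; have hs' : 0 <= s <= t by rewrite !ltW.
have m0 : m 0 = RI mu (fun x => g x * phi x).
  apply: RI_eq => x; rewrite /F clamp_id ?lexx ?ltW// /rho /pos oppr0 add3_0.
  by rewrite mulr0 mul0r addr0 divr1.
have mt : m t = RI mu (fun x => g x * (phi (add3 x (scale3 (- t) (ee j))) / (1 + phi (add3 x (scale3 (- t) (ee j)))))).
  apply: RI_eq => x; rewrite /F clamp_id ?lexx ?ltW// /rho /pos /c mulVf ?gt_eqF// mul1r//.
rewrite -mt -m0 E subr0.
have hden x : dl <= 1 + c * s * phi x by exact: den.
(* For the test function [2 c rho], twice the derivative plus the square equals [- 4 c drho]; the
   score bound becomes [4 c A <= K], whence the factor 1/4. *)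
have T := C1b_shift (scale3 (- s) (ee j)) (C1b_scale (2 * c) (C1b_mobius hphi dl0 hden)).
have := JB T => /=.
set A := RI mu (fun x => g x * drho s x).
have -> : RI mu (fun x => g x *
      (2 * (2 * c * (dphi j (add3 x (scale3 (- s) (ee j))) / (1 + c * s * phi (add3 x (scale3 (- s) (ee j)))) ^+ 2)) +
       (2 * c * (phi (add3 x (scale3 (- s) (ee j))) / (1 + c * s * phi (add3 x (scale3 (- s) (ee j)))))) ^+ 2))
   = - (4 * c) * A.
  have LA := (dmL s hs).1.
  rewrite -RIZl//; apply: RI_eq => x; rewrite /drho -/(pos s x).
  have p0 : 1 + c * s * phi (pos s x) != 0 by rewrite gt_eqF// (lt_le_trans dl0)// den.
  by field.
rewrite mulNr opprK => h.
rewrite -[t ^+ 2 * K / 4]mulrA [K / 4]mulrC expr2 -mulrA [A * t]mulrC ler_wpM2l ?(ltW t0)//.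
rewrite -(ler_pM2l (x := 4 * c)) ?mulr_gt0//; apply: (le_trans h).
rewrite [X in _ <= X](_ : _ = K) //; rewrite /c; field.
by rewrite gt_eqF.
Unshelve. all: by end_near. Qed.

End ScoreBound.

Lemma lim_norm_le (R : realType) (u : nat -> R) (l C : R) :
  u n @[n --> \oo] --> l -> (forall n, `|u n| <= C) -> `|l| <= C.
Proof.
move=> ul uC; have c : `|u n| @[n --> \oo] --> `|l| by exact: cvg_norm.
by rewrite -(cvg_lim (@Rhausdorff _) c); apply: limr_le; [exact: cvgP c|exact: nearW].
Qed.

Section L1Weak.
Context d (T : measurableType d) (R : realType) (mu : {measure set T -> \bar R}).

Lemma RI_tail (g : T -> R) : L1 mu g -> forall e, 0 < e -> exists m : nat,
  L1 mu (fun x => `|g x| * (m%:R < `|g x|)%R%:R) /\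
  RI mu (fun x => `|g x| * (m%:R < `|g x|)%R%:R) <= e.
Proof.
move=> Lg e e0; have mg := L1_meas Lg.
have mG (m : nat) : measurable_fun setT (fun x => `|g x| * (m%:R < `|g x|)%R%:R).
  apply: measurable_funM; first exact: measurableT_comp.
  have -> : (fun x => (m%:R < `|g x|)%R%:R) = \1_((fun x => `|g x|) @^-1` `]m%:R, +oo[%classic) :> (T -> R).
    apply/funext => x; rewrite indicE; congr (_%:R); congr nat_of_bool.
    by apply/idP/idP => [h|/set_mem]; [apply: mem_set|]; rewrite /= in_itv /= andbT.
  apply: measurable_indr; rewrite -[X in measurable X]setTI.
  exact: (measurableT_comp (@normr_measurable _ _) mg measurableT (measurable_itv _)).
have b (m : nat) x : `| `|g x| * (m%:R < `|g x|)%R%:R| <= `|g x|.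
  by case: (_ < _)%R; rewrite ?mulr1 ?mulr0 ?normr0 ?normr_id.
have [||||| _] := @RI_dct _ _ _ mu (fun m x => `|g x| * (m%:R < `|g x|)%R%:R) (fun=> 0) (fun x => `|g x|).
- exact: mG.
- exact: measurable_cst.
- exact: L1_abs.
- exact: b.
- apply: aeW => x; apply: cvg_near_cst; near=> m.
  rewrite ltNge (_ : `|g x| <= m%:R) ?mulr0//.
  by near: m; exact: nbhs_infty_ger.
rewrite RI0 => /cvgrPdist_le /(_ _ e0) [m _ hm]; exists m; split.
  by apply: L1_dom (L1_abs Lg).
by have := hm m (leqnn m); rewrite /= sub0r normrN; apply: le_trans; exact: ler_norm.
Unshelve. all: by end_near. Qed.

(** Passes from smallness for [mu] to smallness for the density [|g|]: where [|g| <= m] the integral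
    is at most [m RI (G n)], and elsewhere at most [C] times a tail of [g]. *)
Lemma L1_weak (g : T -> R) (G : nat -> T -> R) C : L1 mu g -> (forall n, L1 mu (G n)) ->
  (forall n x, 0 <= G n x <= C) -> (forall n, RI mu (G n) <= n.+1%:R^-1) ->
  forall e, 0 < e -> exists n, L1 mu (fun x => `|g x| * G n x) /\ RI mu (fun x => `|g x| * G n x) <= e.
Proof.
move=> Lg LG GC hG e e0; have mg := L1_meas Lg.
(* On an empty space [C] could be negative, so this case is separate. *)
have [x0|] := pselect (inhabited T); last first.
  move=> nT; exists 0%N; have E : (fun x => `|g x| * G 0%N x) = (fun=> 0).
    by apply/funext => x; exfalso; apply: nT; split.
  by rewrite E; split; [exact: L1_0|rewrite RI0 ltW].
have C0 : 0 <= C by case: x0 => x; have /andP[h1 h2] := GC 0%N x; exact: le_trans h2.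
have C1 : 0 < C + 1 by rewrite ltr_wpDl.
have e1 : 0 < e / 2 / (C + 1) by rewrite !divr_gt0.
have [m [Lm hm]] := RI_tail Lg e1.
pose n := Num.truncn (2 * m%:R / e).
have hn : m%:R * n.+1%:R^-1 <= e / 2.
  have : 2 * m%:R / e < n.+1%:R by rewrite truncnS_gt// divr_ge0 ?mulr_ge0// ltW.
  rewrite ltr_pdivrMr// => h; rewrite ler_pdivrMr ?ltr0n// mulrAC ler_pdivlMr//.
  by rewrite mulrC [e * _]mulrC ltW.
have LgG : L1 mu (fun x => `|g x| * G n x).
  apply: (L1_bd (C := C)); [exact: L1_abs|exact: L1_meas|].
  by move=> x; have /andP[h1 h2] := GC n x; rewrite ger0_norm.
exists n; split => //.
apply: (@le_trans _ _ (RI mu (fun x => m%:R * G n x + C * (`|g x| * (m%:R < `|g x|)%R%:R)))).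
  apply: RI_le => //; first by apply: L1D; exact: L1Zl.
  move=> x; have /andP[h1 h2] := GC n x; have [h|h] := leP `|g x| m%:R.
    by rewrite !mulr0 addr0 ler_wpM2r.
  rewrite mulr1 [C * _]mulrC (le_trans (ler_wpM2l _ h2))// lerDr mulr_ge0//.
rewrite [e]splitr; apply: RID_le; [exact: L1Zl|exact: L1Zl| |]; rewrite RIZl//.
  by apply: le_trans hn; rewrite ler_wpM2l.
apply: (le_trans (ler_wpM2l C0 hm)); rewrite mulrCA ger_pMr ?divr_gt0//.
by rewrite ler_pdivrMr// mul1r lerDl.
Qed.

End L1Weak.

Section Hellinger.
Context {R : realType}.
Local Notation V := (V3 R).
Local Notation mu := (@mu3 R).
Variables (g : V -> R) (j : axis) (K : R).
Hypotheses (g0 : forall x, 0 <= g x) (Lg : L1 mu g) (K0 : 0 <= K).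
Hypothesis JB : score_bound g j K.

(** The optimal test function in [hellinger_bound] is a quotient of square roots of [g], which is
    only measurable; smoothness is removed here by density, and the translation is moved from the
    test function to [g]. *)
Lemma hj_measurable psi (t dl b r : R) : 0 < t -> 0 < dl -> dl <= 1 -> 0 <= b ->
  measurable_fun setT psi -> nullout r psi -> (forall x, -1 + dl <= psi x <= b) ->
  RI mu (fun x => tr (ee j) t g x * (psi x / (1 + psi x))) - RI mu (fun x => g x * psi x)
    <= t ^+ 2 * K / 4.
Proof.
move=> t0 dl0 dl1 b0 mpsi psi0 hpsi.
set g' := tr (ee j) t g.
have [Lg' _] : L1 mu g' /\ RI mu g' = RI mu g := RI_shift (scale3 t (ee j)) Lg.
have g'0 x : 0 <= g' x by exact: g0.
have dl2 : 0 < dl ^- 2 by rewrite invr_gt0 exprn_gt0.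
have H n : exists th, [/\ smooth_cpt th, (forall x, -1 + dl <= th x <= b) &
   L1 mu (fun x => `|psi x - th x|) /\ RI mu (fun x => `|psi x - th x|) <= n.+1%:R^-1].
  have [||th [h1 h2 h3 h4]] := smooth_dense (mu3_box r) mpsi hpsi _ psi0 (_ : 0 < n.+1%:R^-1).
  - by rewrite b0 andbT; lra.
  - by rewrite invr_gt0.
  - by exists th.
have [th hth] := choice H.
pose q (y : R) := y / (1 + y).
have qb (y : R) : -1 + dl <= y <= b -> `|q y| <= (1 + b) / dl.
  move=> /andP[h1 h2]; rewrite /q normrM; apply: ler_pM => //.
    by rewrite ler_norml; apply/andP; split; lra.
  by rewrite normfV lef_pV2 ?posrE ?normr_gt0 ?ger0_norm//; lra.
have ql (y z : R) : -1 + dl <= y <= b -> -1 + dl <= z <= b -> `|q y - q z| <= dl ^- 2 * `|y - z|.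
  move=> /andP[h1 h2] /andP[h3 h4].
  have p1 : dl <= 1 + y by lra.
  have p2 : dl <= 1 + z by lra.
  have nz1 : 1 + y != 0 by rewrite gt_eqF// (lt_le_trans dl0).
  have nz2 : 1 + z != 0 by rewrite gt_eqF// (lt_le_trans dl0).
  have -> : q y - q z = (y - z) * ((1 + y)^-1 * (1 + z)^-1) by rewrite /q; field; rewrite nz1 nz2.
  rewrite normrM mulrC ler_wpM2r// normrM !normfV expr2 invfM.
  by apply: ler_pM; rewrite ?invr_ge0// lef_pV2 ?posrE ?normr_gt0//; rewrite ger0_norm//; lra.
have mq f : measurable_fun setT f -> measurable_fun setT (fun x : V => q (f x)).
  move=> mf; apply: measurable_funM => //; apply: measurable_invr.
  by apply: measurable_funD => //; exact: measurable_cst.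
have bb (y : R) : -1 + dl <= y <= b -> `|y| <= 1 + b.
  by move=> /andP[h1 h2]; rewrite ler_norml; apply/andP; split; lra.
rewrite leNgt; apply/negP => lt.
set A := RI mu (fun x => g' x * q (psi x)); set B := RI mu (fun x => g x * psi x).
have e0 : 0 < (A - B - t ^+ 2 * K / 4) / 2 by rewrite divr_gt0// subr_gt0.
set e := _ / 2 in e0.
have C0 : 0 < dl ^- 2 + 1 by rewrite ltr_wpDl// ltW.
(* One density controls both errors: [dl^-2] is a Lipschitz constant of [q] on [[-1 + dl, b]], used
   with the weight [g'], and the linear term carries the weight [g]. *)
have L2g : L1 mu (fun x => g x + dl ^- 2 * g' x) by apply: L1D => //; exact: L1Zl.
have [|||n [Ln hn]] := L1_weak L2g (G := fun n x => `|psi x - th n x|) (C := 2 * (1 + b)) _ _ _ e0.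
- by move=> n; have [_ _ []] := hth n.
- move=> n x; rewrite normr_ge0 /= (le_trans (ler_normB _ _))// mulr_natl mulr2n lerD// bb//.
  by have [_ h _] := hth n.
- by move=> n; have [_ _ []] := hth n.
have [sth thb [Ld _]] := hth n.
have hC := smooth_C1b sth.
have lbth x : -1 + dl <= th n x by have /andP[] := thb x.
have := hamilton_jacobi g0 Lg JB hC t0 dl0 dl1 lbth.
have mth := smooth_measurable sth.
have Lq : L1 mu (fun x => g' x * q (th n x)).
  apply: (L1_bd (C := (1 + b) / dl)) => //; first exact: mq.
  by move=> x; exact: qb.
have LA : L1 mu (fun x => g' x * q (psi x)).
  apply: (L1_bd (C := (1 + b) / dl)) => //; first exact: mq.
  by move=> x; exact: qb.
have LB : L1 mu (fun x => g x * psi x) by apply: (L1_bd (C := 1 + b)) => // x; exact: bb.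
have LB' : L1 mu (fun x => g x * th n x) by apply: (L1_bd (C := 1 + b)) => // x; exact: bb.
rewrite -(RI_tr (e := ee j) (s := - t) (f := g) (g := fun x => q (th n x))); last by rewrite opprK.
rewrite opprK -/g' => h.
have key : A - B <= RI mu (fun x => g' x * q (th n x)) - RI mu (fun x => g x * th n x) + e.
  have E : A - B - (RI mu (fun x => g' x * q (th n x)) - RI mu (fun x => g x * th n x)) =
     RI mu (fun x => (g' x * q (psi x) - g' x * q (th n x)) - (g x * psi x - g x * th n x)).
    rewrite RIB ?RIB//; [rewrite /A /B; ring|exact: L1B|exact: L1B].
  rewrite -lerBlDl E; apply: le_trans hn; apply: RI_le => //.
    by apply: L1B; exact: L1B.
  move=> x; rewrite -!mulrBr ger0_norm; last by rewrite addr_ge0// mulr_ge0// ltW.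
  have h1 := ql _ _ (hpsi x) (thb x).
  have h2 := ler_norm (q (psi x) - q (th n x)).
  have h3 := ler_norm (- (psi x - th n x)); rewrite normrN in h3.
  have h4 : g' x * (q (psi x) - q (th n x)) <= g' x * (dl ^- 2 * `|psi x - th n x|).
    by apply: ler_wpM2l => //; exact: le_trans h1.
  have h5 : g x * - (psi x - th n x) <= g x * `|psi x - th n x| by apply: ler_wpM2l.
  lra.
have : A - B <= t ^+ 2 * K / 4 + e by apply: (le_trans key); rewrite lerD2r.
have Ee : e + e = A - B - t ^+ 2 * K / 4 by rewrite -splitr.
by clearbody e A B; move: (t ^+ 2 * K / 4) Ee e0 => X; lra.
Qed.

(** Pointwise, [g' psi / (1 + psi) - g psi] is maximal for [1 + psi = sqrt g' / sqrt g], with value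
    [(sqrt g' - sqrt g)^2]. The [psi n] regularise this quotient by [k n] and truncate it to [E n];
    Fatou's lemma gives the limit. *)
Lemma hellinger_bound t : 0 < t ->
  L2 mu (fun x => Num.sqrt (tr (ee j) t g x) - Num.sqrt (g x)) /\
  n2 mu (fun x => Num.sqrt (tr (ee j) t g x) - Num.sqrt (g x)) ^+ 2 <= t ^+ 2 * K / 4.
Proof.
move=> t0; set g' := tr (ee j) t g.
have [Lg' _] : L1 mu g' /\ RI mu g' = RI mu g := RI_shift (scale3 t (ee j)) Lg.
have g'0 x : 0 <= g' x by exact: g0.
pose a (x : V) : R := Num.sqrt (g x); pose b (x : V) : R := Num.sqrt (g' x).
have a0 x : 0 <= a x by exact: sqrtr_ge0.
have b0 x : 0 <= b x by exact: sqrtr_ge0.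
have a2 x : a x ^+ 2 = g x by rewrite sqr_sqrtr.
have b2 x : b x ^+ 2 = g' x by rewrite sqr_sqrtr.
have ma : measurable_fun setT a by exact: (measurableT_comp (@measurable_sqrt R) (L1_meas Lg)).
have mb : measurable_fun setT b by exact: (measurableT_comp (@measurable_sqrt R) (L1_meas Lg')).
have mba : measurable_fun setT (fun x => b x - a x) by exact: measurable_funB.
pose E n : set V := box n%:R `&` ((a @^-1` `]-oo, n%:R]) `&` (b @^-1` `]-oo, n%:R])).
have mE n : measurable (E n).
  apply: measurableI; first exact: measurable_box.
  by apply: measurableI; rewrite -[X in measurable X]setTI; [apply: ma|apply: mb].
pose k n : R := n.+1%:R^-1.
have k0 n : 0 < k n by rewrite invr_gt0.
pose psi n x := ((b x + k n) / (a x + k n) - 1) * \1_(E n) x.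
pose F n x := (b x - a x) * (b x ^+ 2 / (b x + k n) - a x ^+ 2 / (a x + k n)) * \1_(E n) x.
have ap n x : 0 < a x + k n by rewrite ltr_wpDl.
have bp n x : 0 < b x + k n by rewrite ltr_wpDl.
have FE n x : F n x = g' x * (psi n x / (1 + psi n x)) - g x * psi n x.
  rewrite /F /psi -a2 -b2; have an := lt0r_neq0 (ap n x); have bn := lt0r_neq0 (bp n x).
  rewrite indicE; case: (_ \in _); rewrite /= ?mulr1 ?mulr0.
    by rewrite [1 + _]addrC subrK; field; rewrite an bn.
  by rewrite mul0r mulr0 subr0.
have mpsi n : measurable_fun setT (psi n).
  apply: measurable_funM; last exact: measurable_indr.
  apply: measurable_funB; last exact: measurable_cst.
  have mc : measurable_fun setT (fun _ : V => k n) by exact: measurable_cst.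
  by apply: measurable_funM; [exact: measurable_funD|apply: measurable_invr; exact: measurable_funD].
(* On [E n] both roots lie between 0 and [n], so [1 + psi n = (b + k n) / (a + k n)] is at least
   [dl n]. *)
pose dl n : R := k n / (n%:R + k n).
have nk n : 0 < n%:R + k n by rewrite ltr_wpDl.
have dl0 n : 0 < dl n by rewrite divr_gt0.
have dl1 n : dl n <= 1 by rewrite ler_pdivrMr// mul1r lerDr.
have psib n x : -1 + dl n <= psi n x <= (n%:R + k n) / k n.
  rewrite /psi; have [hE|nE] := pselect (E n x); last first.
    have q0 : 0 <= (n%:R + k n) / k n by apply: divr_ge0; apply: ltW.
    by rewrite indic_out// mulr0; apply/andP; split => //; have := dl1 n; lra.
  have [_ [ha hb]] := hE; rewrite /= !in_itv /= in ha hb.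
  rewrite indic_in// mulr1; apply/andP; split.
    rewrite addrC lerD2r /dl ler_pdivrMr// mulrAC ler_pdivlMr// mulrC.
    by rewrite [X in X <= _]mulrC; apply: ler_pM; [exact: ltW|exact: ltW|rewrite lerDr|rewrite lerD2r].
  apply: (@le_trans _ _ ((b x + k n) / (a x + k n))); first by rewrite gerBl.
  apply: ler_pM; rewrite ?invr_ge0 ?(ltW (bp n x)) ?(ltW (ap n x))//; first by rewrite lerD2r.
  by rewrite lef_pV2 ?posrE// lerDr.
have psi0 n : nullout n%:R (psi n).
  by move=> x nb; rewrite /psi indic_out ?mulr0// => -[].
have Lpsi n : L1 mu (fun x => g x * psi n x).
  apply: (L1_bd (C := 1 + (n%:R + k n) / k n)) => // x; have /andP[h1 h2] := psib n x.
  have := dl0 n; have : 0 <= (n%:R + k n) / k n by rewrite divr_ge0 ?ltW.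
  by move=> ? ?; rewrite ler_norml; apply/andP; split; lra.
have Lq n : L1 mu (fun x => g' x * (psi n x / (1 + psi n x))).
  apply: (L1_bd (C := (1 + (n%:R + k n) / k n) / dl n)) => //.
    apply: measurable_funM => //; apply: measurable_invr.
    by apply: measurable_funD => //; exact: measurable_cst.
  move=> x; have /andP[h1 h2] := psib n x; have d0 := dl0 n.
  have nk0 : 0 <= (n%:R + k n) / k n by rewrite divr_ge0 ?ltW.
  rewrite normrM; apply: ler_pM => //.
    by rewrite ler_norml; apply/andP; split; lra.
  by rewrite normfV lef_pV2 ?posrE ?normr_gt0 ?ger0_norm//; lra.
have LF n : L1 mu (F n).
  by rewrite (_ : F n = fun x => g' x * (psi n x / (1 + psi n x)) - g x * psi n x);
    [exact: L1B|apply/funext => x].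
have F0 n x : 0 <= F n x.
  rewrite /F; apply: mulr_ge0; last by have /andP[] := @indic_itv _ (E n) x.
  have -> : b x ^+ 2 / (b x + k n) - a x ^+ 2 / (a x + k n) =
    (b x - a x) * ((a x * b x + k n * (a x + b x)) / ((a x + k n) * (b x + k n))).
    by field; rewrite !gt_eqF.
  rewrite mulrA -expr2; apply: mulr_ge0; first exact: sqr_ge0.
  by apply: divr_ge0; rewrite ?addr_ge0 ?mulr_ge0 ?addr_ge0 ?(ltW (k0 n)).
have FK n : RI mu (F n) <= t ^+ 2 * K / 4.
  rewrite (@RI_eq _ _ _ mu _ _ (FE n)) RIB//.
  apply: (hj_measurable t0 (dl0 n) (dl1 n) _ (mpsi n) (psi0 n) (psib n)).
  by rewrite divr_ge0 ?ltW.
have kc : k n @[n --> \oo] --> 0 by exact: cvg_harmonic.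
have sq (z : R) : 0 <= z -> z ^+ 2 / (z + k n) @[n --> \oo] --> z.
  move=> z0; have [->|zn0] := eqVneq z 0.
    by rewrite expr0n; under eq_fun do rewrite mul0r; exact: cvg_cst.
  rewrite -[X in _ --> X](_ : z ^+ 2 / (z + 0) = z); last by rewrite addr0; field.
  apply: cvgM; first exact: cvg_cst.
  apply: cvgV; first by rewrite addr0.
  by apply: cvgD => //; exact: cvg_cst.
have [||||| L2f hf] := @RI_fatou _ _ _ mu F (fun x => (b x - a x) ^+ 2) (t ^+ 2 * K / 4) LF.
- exact: measurable_funX.
- exact: F0.
- by move=> x; exact: sqr_ge0.
- exact: FK.
- apply: aeW => x.
  rewrite -[X in _ --> X]mulr1; apply: cvgM.
    rewrite expr2; apply: cvgM; first exact: cvg_cst.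
    by apply: cvgB; exact: sq.
  apply: cvg_near_cst; near=> n; rewrite indic_in//; split.
    move=> i; apply: (le_lt_trans (cd_norm3 i x)).
    by near: n; exact: nbhs_infty_gtr.
  split; rewrite /= in_itv /=; near: n; exact: nbhs_infty_ger.
by split; [split|rewrite n2_sqr].
Unshelve. all: by end_near. Qed.

Lemma sqrt_weak_bound phi : smooth_cpt phi ->
  `|RI mu (fun x => Num.sqrt (g x) * 'D_(ee j) phi x)| <= Num.sqrt (K / 4) * n2 mu phi.
Proof.
move=> sp; pose a (x : V) : R := Num.sqrt (g x).
have La : L2 mu a.
  split; first exact: (measurableT_comp (@measurable_sqrt R) (L1_meas Lg)).
  by apply: L1_eq Lg => x; rewrite sqr_sqrtr.
pose h n : R := - n.+1%:R^-1.
have hn0 n : h n != 0 by rewrite oppr_eq0 invr_eq0 pnatr_eq0.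
have hc : h n @[n --> \oo] --> 0.
  by rewrite -oppr0; apply: cvgN; exact: cvg_harmonic.
have := isd_seq (isd_translate (ee j) La 0 sp).2 hn0 hc.
have -> : (fun y => phi (add3 y (scale3 0 (ee j)))) = phi.
  by apply/funext => y; exact: congr1 (add3_0 _ _).
move=> c.
suff bd (n : nat) : `|(h n)^-1 * (RI mu (fun x => a x * phi (add3 x (scale3 (0 + h n) (ee j)))) -
    RI mu (fun x => a x * phi (add3 x (scale3 0 (ee j)))))| <= Num.sqrt (K / 4) * n2 mu phi.
  exact: lim_norm_le c bd.
have -> : RI mu (fun x => a x * phi (add3 x (scale3 0 (ee j)))) = RI mu (fun x => a x * phi x).
  by apply: RI_eq => x; congr (_ * _); exact: congr1 (add3_0 _ _).
rewrite add0r -(RI_tr_sub (ee j) La (h n) sp).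
have u0 : 0 < n.+1%:R^-1 :> R by rewrite invr_gt0.
have [L hb] := hellinger_bound u0.
have Lp := smooth_L2 sp.
have L' : L2 mu (fun x => tr (ee j) (- h n) a x - a x) by rewrite opprK; exact: L.
have hb' : n2 mu (fun x => tr (ee j) (- h n) a x - a x) ^+ 2 <= n.+1%:R^-1 ^+ 2 * K / 4.
  by rewrite opprK; exact: hb.
have hb2 : n2 mu (fun x => tr (ee j) (- h n) a x - a x) <= n.+1%:R^-1 * Num.sqrt (K / 4).
  rewrite -(ler_sqr (n2_ge0 _ _)) ?nnegrE ?mulr_ge0 ?sqrtr_ge0 ?(ltW u0)//.
  rewrite exprMn (@sqr_sqrtr _ (K / 4)); last by rewrite divr_ge0.
  by apply: (le_trans hb'); rewrite mulrA.
have := n2_cs L' Lp; rewrite normrM normfV normrN (gtr0_norm u0) invrK => hc'.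
rewrite mulrC -ler_pdivlMr ?ltr0n// (le_trans hc')//.
apply: (le_trans (ler_wpM2r (n2_ge0 _ _) hb2)).
by rewrite -mulrA mulrC.
Qed.

End Hellinger.

(** * Completeness of L2 and representation of functionals *)

Section L2Complete.
Context d (T : measurableType d) (R : realType) (mu : {measure set T -> \bar R}).

Lemma n2_abs (f : T -> R) : n2 mu (fun x => `|f x|) = n2 mu f.
Proof. by rewrite /n2; congr Num.sqrt; apply: RI_eq => x; rewrite real_normK// num_real. Qed.

Lemma n2_eq (f g : T -> R) : (forall x, f x = g x) -> n2 mu f = n2 mu g.
Proof. by move=> fg; rewrite /n2; congr Num.sqrt; apply: RI_eq => x; rewrite fg. Qed.

Lemma L2_eq (f g : T -> R) : (forall x, f x = g x) -> L2 mu f -> L2 mu g.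
Proof. by move=> /funext ->. Qed.

Lemma L2_abs (f : T -> R) : L2 mu f -> L2 mu (fun x => `|f x|).
Proof.
move=> [mf Lf]; split; first exact: measurableT_comp.
by apply: L1_eq Lf => x; rewrite real_normK// num_real.
Qed.

(** By monotone convergence the limit is integrable, hence finite almost everywhere. The good set
    [A] is returned explicitly, since its indicator is used to define a limit everywhere. *)
Lemma ae_cvg_of_bounded (S : nat -> T -> R) C : (forall n, L1 mu (S n)) ->
  (forall n x, 0 <= S n x) -> (forall n x, S n x <= S n.+1 x) -> (forall n, RI mu (S n) <= C) ->
  exists A, [/\ measurable A, mu (~` A) = 0%E & forall x, A x -> exists M, forall n, S n x <= M].
Proof.
move=> LS S0 Si SC.
pose g n x := (S n x)%:E; pose f x := limn (g ^~ x).
have mg n : measurable_fun setT (g n) by apply/measurable_EFinP; exact: L1_meas.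
have nd x : nondecreasing_seq (g ^~ x).
  by apply/nondecreasing_seqP => n; rewrite lee_fin.
have fc x : g ^~ x @ \oo --> f x by exact: ereal_nondecreasing_is_cvgn.
have mf : measurable_fun setT f by apply: emeasurable_fun_cvg mg _ => x _; exact: fc.
have f0 x : (0 <= f x)%E by apply: lime_ge; [exact: cvgP (fc x)|apply: nearW => n; rewrite lee_fin].
have If : (\int[mu]_x f x <= C%:E)%E.
  rewrite (@monotone_convergence _ _ _ mu setT measurableT g).
  - apply: lime_le.
      apply: ereal_nondecreasing_is_cvgn; apply/nondecreasing_seqP => n.
      by apply: ge0_le_integral => // x _; rewrite lee_fin.
    by apply: nearW => n; rewrite /g RI_E// lee_fin.
  - exact: mg.
  - by move=> n x _; rewrite lee_fin.
  - by move=> x _; exact: nd.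
have intf : mu.-integrable setT f.
  apply/integrableP; split => //; under eq_integral do rewrite gee0_abs//.
  by apply: le_lt_trans If _; rewrite ltry.
exists (f @^-1` [set x | x < +oo]%E); split.
- by rewrite -[X in measurable X]setTI; apply: emeasurable_fun_infty_o => //; exact: mf.
- have [N [mN N0 hN]] := integrable_ae measurableT intf.
  apply: subset_measure0 N0 => //.
    apply: measurableC; rewrite -[X in measurable X]setTI; apply: emeasurable_fun_infty_o => //; exact: mf.
  apply: subset_trans hN => x /= h1 h2; apply: h1; have := h2 I; rewrite fin_numElt => /andP[_ h]; exact: h.
- move=> x /= fx; have ff : f x \is a fin_num by rewrite ge0_fin_numE.
  exists (fine (f x)) => n; rewrite -lee_fin fineK//.
  apply: (@le_trans _ _ (ereal_sup (range (g ^~ x)))); first by apply: ereal_sup_ubound; exists n.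
  have := ereal_nondecreasing_cvgn (nd x) => c.
  by rewrite /f (cvg_lim _ c).
Qed.

Lemma cvg_of_summable (u : nat -> R) M : (forall n, `|u 0%N| + \sum_(k < n) `|u k.+1 - u k| <= M) ->
  cvgn u.
Proof.
move=> h.
have c : cvgn (series (fun k => u k.+1 - u k)).
  apply: normed_cvg; apply: (@nondecreasing_is_cvgn _ (fun n => \sum_(0 <= k < n) `|u k.+1 - u k|)).
    by apply/nondecreasing_seqP => n; rewrite big_nat_recr//= lerDl.
  exists M => _ [n _ <-]; rewrite /= big_mkord; apply: le_trans (h n).
  by rewrite lerDr.
suff -> : u = (fun n => u 0%N + series (fun k => u k.+1 - u k) n).
  by apply: is_cvgD => //; exact: is_cvg_cst.
by apply/funext => n; rewrite /series /= telescope_sumr// addrC subrK.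
Qed.

(** The sum [S n] of the absolute increments stays bounded in L2, so the sequence converges almost
    everywhere. The factor 2 is the sum of the geometric tail, passed to the limit by Fatou's
    lemma. *)
Lemma L2_complete (f : nat -> T -> R) : (forall n, L2 mu (f n)) ->
  (forall n, n2 mu (fun x => f n.+1 x - f n x) <= 2^-1 ^+ n) ->
  exists2 h, L2 mu h & forall n, n2 mu (fun x => f n x - h x) <= 2 * 2^-1 ^+ n.
Proof.
move=> Lf hf.
have L2d n : L2 mu (fun x => f n.+1 x - f n x) by exact: L2B.
pose S n x := `|f 0%N x| + \sum_(k < n) `|f k.+1 x - f k x|.
have L2S n : L2 mu (S n).
  elim: n => [|n IH].
    by apply: L2_eq (L2_abs (Lf 0%N)) => x; rewrite /S big_ord0 addr0.
  by apply: L2_eq (L2D IH (L2_abs (L2d n))) => x; rewrite /S big_ord_recr addrA.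
have half n : 2^-1 ^+ n.+1 + 2^-1 ^+ n.+1 = 2^-1 ^+ n :> R.
  by rewrite exprS; lra.
have nS n : n2 mu (S n) <= n2 mu (f 0%N) + 2 - 2 * 2^-1 ^+ n.
  elim: n => [|n IH].
    rewrite expr0 mulr1 addrK (_ : n2 mu (S 0%N) = n2 mu (f 0%N))//.
    by rewrite -(n2_abs (f 0%N)); apply: n2_eq => x; rewrite /S big_ord0 addr0.
  have -> : n2 mu (S n.+1) = n2 mu (fun x => S n x + `|f n.+1 x - f n x|).
    by apply: n2_eq => x; rewrite /S big_ord_recr addrA.
  apply: (le_trans (n2D (L2S n) (L2_abs (L2d n)))); rewrite n2_abs.
  have := hf n; have := half n; lra.
pose C := n2 mu (f 0%N) + 2.
have C0 : 0 <= C by rewrite addr_ge0// n2_ge0.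
have S0 n x : 0 <= S n x by rewrite addr_ge0// sumr_ge0.
have [A [mA A0 hA]] := @ae_cvg_of_bounded (fun n x => S n x ^+ 2) (C ^+ 2) (fun n => (L2S n).2)
  (fun n x => sqr_ge0 _) (fun n x => ltac:(by rewrite ler_sqr ?nnegrE// /S big_ord_recr addrA lerDl))
  (fun n => ltac:(by rewrite -n2_sqr ler_sqr ?nnegrE ?n2_ge0//; apply: (le_trans (nS n)); rewrite gerBl mulr_ge0)).
pose g n x := f n x * \1_A x.
have mg n : measurable_fun setT (g n).
  by apply: measurable_funM; [exact: (Lf n).1|exact: measurable_indr].
have gc x : cvgn (g ^~ x).
  have [Ax|nAx] := pselect (A x).
    have [M hM] := hA x Ax.
    have -> : g ^~ x = f ^~ x by apply/funext => n; rewrite /g indicE mem_set// mulr1.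
    apply: (@cvg_of_summable _ (M + 1)) => n; have h1 := hM n.
    (* From [S^2 <= M] one gets [S <= S^2 + 1/4 <= M + 1]. *)
    have h2 := S0 n x; have : (S n x - 1/2) ^+ 2 >= 0 by exact: sqr_ge0.
    rewrite -/(S n x); move: h1 h2; rewrite !expr2; nra.
  have -> : g ^~ x = fun=> 0 by apply/funext => n; rewrite /g indicE memNset// mulr0.
  exact: is_cvg_cst.
pose h x := limn (g ^~ x).
have mh : measurable_fun setT h by apply: measurable_fun_cvg mg _ => x _; exact: gc.
have fh : {ae mu, forall x, f ^~ x @ \oo --> h x}.
  exists (~` A); split => //; first exact: measurableC.
  move=> x /= nc Ax; apply: nc; have := gc x; rewrite /h.
  by have -> : g ^~ x = f ^~ x by apply/funext => n; rewrite /g indicE mem_set// mulr1.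
have dist n m : L2 mu (fun x => f (m + n)%N x - f n x) /\
    n2 mu (fun x => f (m + n)%N x - f n x) <= 2 * 2^-1 ^+ n - 2 * 2^-1 ^+ (m + n).
  elim: m => [|m [L IH]].
    split; first exact: L2B.
    rewrite add0n subrr (n2_eq (g := fun=> 0)); last by move=> x; rewrite subrr.
    by rewrite /n2 (@RI_eq _ _ _ _ _ (fun=> 0)) ?RI0 ?sqrtr0// => x; rewrite expr0n.
  split; first exact: L2B.
  rewrite (n2_eq (g := fun x => (f (m + n)%N x - f n x) + (f (m + n).+1 x - f (m + n)%N x))).
    have := n2D L (L2d (m + n)%N); have := hf (m + n)%N; have := half (m + n)%N.
    rewrite addSn; lra.
  by move=> x; rewrite addSn; ring.
have key n : L1 mu (fun x => (f n x - h x) ^+ 2) /\ RI mu (fun x => (f n x - h x) ^+ 2) <= (2 * 2^-1 ^+ n) ^+ 2.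
  apply: (@RI_fatou _ _ _ mu (fun m x => (f (m + n)%N x - f n x) ^+ 2)).
  - by move=> m; exact: (dist n m).1.2.
  - by apply: measurable_funX; apply: measurable_funB => //; exact: (Lf n).1.
  - by move=> m x; exact: sqr_ge0.
  - by move=> x; exact: sqr_ge0.
  - move=> m; rewrite -n2_sqr ler_sqr ?nnegrE ?n2_ge0 ?mulr_ge0 ?exprn_ge0//.
    by apply: (le_trans (dist n m).2); rewrite gerBl mulr_ge0// exprn_ge0.
  - apply: filterS fh => x c.
    have c1 : f (m + n)%N x @[m --> \oo] --> h x by rewrite (cvg_shiftn n (f ^~ x)).
    have c2 : (f (m + n)%N x - f n x) @[m --> \oo] --> h x - f n x.
      by apply: cvgB => //; exact: cvg_cst.
    rewrite -[X in _ --> X](_ : (h x - f n x) * (h x - f n x) = _); last first.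
      by rewrite -expr2 -sqrrN opprB.
    exact: cvgM.
have L2n n : L2 mu (fun x => f n x - h x).
  by split; [apply: measurable_funB => //; exact: (Lf n).1|exact: (key n).1].
exists h.
  apply: L2_eq (L2B (Lf 0%N) (L2n 0%N)) => x; by rewrite opprB addrC subrK.
move=> n; rewrite -ler_sqr ?nnegrE ?n2_ge0 ?mulr_ge0 ?exprn_ge0//.
by rewrite n2_sqr; exact: (key n).2.
Qed.

End L2Complete.

Section Riesz.
Context {R : realType}.
Local Notation V := (V3 R).
Local Notation mu := (@mu3 R).
Implicit Types (s t : V -> R).

Lemma smooth_lin s t (c : R) : smooth_cpt s -> smooth_cpt t -> smooth_cpt (fun x => s x + c * t x).
Proof.
move=> ss st.
have dl f l (x u : V) : smooth_cpt f -> isD (Defs.iterD l f) x u ('D_u (Defs.iterD l f) x).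
  by move=> [_ [df _]]; apply/isD_is_derive; apply: DeriveDef => //; exact: df.
have E l : Defs.iterD l (fun x => s x + c * t x) = fun x => Defs.iterD l s x + c * Defs.iterD l t x.
  elim: l => // u l IH; apply/funext => x /=; rewrite IH; apply: isD_derive.
  apply: isDD; first exact: dl.
  by apply: (isD_eq (isDM (isD_cst c x u) (dl t l x u st))) => //; rewrite mul0r add0r.
have [cs [_ [M1 h1]]] := ss; have [ct [_ [M2 h2]]] := st.
split; [|split].
- move=> l; rewrite E => x; apply: (@continuousD _ _ _ (Defs.iterD l s) (fun x => c * Defs.iterD l t x)).
    exact: cs.
  by apply: continuousM; [exact: cvg_cst|exact: ct].
- move=> l x u; rewrite E; have : isD (fun x => Defs.iterD l s x + c * Defs.iterD l t x) x u
    ('D_u (Defs.iterD l s) x + (0 * Defs.iterD l t x + c * 'D_u (Defs.iterD l t) x)).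
    by apply: isDD; [exact: dl|apply: isDM; [exact: isD_cst|exact: dl]].
  by move/isD_is_derive => [].
- exists (Num.max M1 M2) => x; rewrite gt_max => /andP[a b].
  by rewrite h1// h2// mulr0 addr0.
Qed.

Lemma smooth_0 : smooth_cpt (fun=> 0 : R).
Proof. by apply: (@Sm_smooth_cpt _ _ 0); [exact: Sm_cst|]. Qed.

Lemma n2_lin s t (c : R) : L2 mu s -> L2 mu t ->
  n2 mu (fun x => s x + c * t x) ^+ 2 = n2 mu s ^+ 2 + 2 * c * RI mu (fun x => s x * t x) + c ^+ 2 * n2 mu t ^+ 2.
Proof.
move=> Ls Lt; rewrite !n2_sqr.
rewrite (@RI_eq _ _ _ _ _ (fun x => s x ^+ 2 + (2 * c * (s x * t x) + c ^+ 2 * t x ^+ 2))).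
  have L12 := L2_mul Ls Lt.
  rewrite (RID Ls.2 (L1D (L1Zl _ L12) (L1Zl _ Lt.2))).
  by rewrite (RID (L1Zl _ L12) (L1Zl _ Lt.2)) (RIZl _ L12) (RIZl _ Lt.2) addrA.
by move=> x; ring.
Qed.

(* The representing function is the limit of a maximising sequence of
   [J t = 2 L t - |t|^2], Cauchy in [L2] by the parallelogram identity. *)
Lemma riesz (L : (V -> R) -> R) (C : R) : 0 <= C ->
  (forall s t (c : R), smooth_cpt s -> smooth_cpt t -> L (fun x => s x + c * t x) = L s + c * L t) ->
  (forall t, smooth_cpt t -> `|L t| <= C * n2 mu t) ->
  exists h, [/\ L2 mu h, n2 mu h <= C & forall t, smooth_cpt t -> L t = RI mu (fun x => h x * t x)].
Proof.
move=> C0 Ll Lb; pose J t := 2 * L t - n2 mu t ^+ 2.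
have JC t : smooth_cpt t -> J t <= C ^+ 2.
  move=> st; rewrite /J; have h1 := Lb t st; have h2 := ler_norm (L t).
  have : (n2 mu t - C) ^+ 2 >= 0 by exact: sqr_ge0.
  move: (n2 mu t) h1 => n h1; rewrite !expr2; nra.
pose E := [set J t | t in smooth_cpt (R := R)].
have E0 : has_sup E.
  split; first by exists (J (fun=> 0)); exists (fun=> 0) => //; exact: smooth_0.
  by exists (C ^+ 2) => _ [t st <-]; exact: JC.
pose M := sup E.
have JM t : smooth_cpt t -> J t <= M by move=> st; apply: (ub_le_sup E0.2); exists t.
(* Then [2 (dl n + dl (n + 1)) <= (2^-n)^2], the rate asked by [L2_complete]. *)
pose dl n : R := (2^-1 ^+ n.+1) ^+ 2.
have dl0 n : 0 < dl n by rewrite !exprn_gt0// invr_gt0.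
have H n : exists t, smooth_cpt t /\ M - dl n <= J t.
  have [_ [t st <-] h] := sup_adherent (dl0 n) E0.
  by exists t; split => //; exact: ltW.
have [u hu] := choice H.
have su n : smooth_cpt (u n) := (hu n).1.
have Lu n := smooth_L2 (su n).
have half n : 2^-1 ^+ n.+1 + 2^-1 ^+ n.+1 = 2^-1 ^+ n :> R.
  by rewrite exprS; lra.
have dlS n : dl n.+1 <= dl n.
  rewrite /dl ler_sqr ?nnegrE ?exprn_ge0 ?invr_ge0// -(half n.+1) lerDr.
  by rewrite exprn_ge0// invr_ge0.
have Ju n m : n2 mu (fun x => u m x + (-1) * u n x) ^+ 2 <= 2 * (dl n + dl m).
  have sm : smooth_cpt (fun x => u m x + (-1) * u n x) by exact: smooth_lin.
  (* This is the midpoint of [u m] and [u n]; [J] is at most [M] there, and exceeds the mean of its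
     two values by a quarter of the squared distance. *)
  have sh : smooth_cpt (fun x => u m x + (- 2^-1) * (u m x + (-1) * u n x)) by exact: smooth_lin.
  have hJ := JM _ sh; rewrite /J Ll// Ll// (n2_lin _ (Lu m) (smooth_L2 sm)) in hJ.
  have E1 : RI mu (fun x => u m x * (u m x + -1 * u n x)) = n2 mu (u m) ^+ 2 - RI mu (fun x => u m x * u n x).
    rewrite n2_sqr -RIB; [|exact: (Lu m).2|exact: (L2_mul (Lu m) (Lu n))].
    by apply: RI_eq => x; ring.
  rewrite E1 (n2_lin _ (Lu m) (Lu n)) in hJ; rewrite (n2_lin _ (Lu m) (Lu n)).
  have := (hu n).2; have := (hu m).2; rewrite /J; move: hJ.
  move: (L (u n)) (L (u m)) (n2 mu (u n) ^+ 2) (n2 mu (u m) ^+ 2) (RI _ _) (dl n) (dl m) => a b c d' e f g.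
  lra.
have [|h Lh hh] := L2_complete Lu.
  move=> n; rewrite -ler_sqr ?nnegrE ?n2_ge0 ?exprn_ge0 ?invr_ge0//.
  rewrite (@n2_eq _ _ _ _ _ (fun x => u n.+1 x + (-1) * u n x)); last by move=> x; rewrite mulN1r.
  apply: (le_trans (Ju n n.+1)); rewrite -(half n) /dl; have := dlS n; rewrite /dl.
  by move: (2^-1 ^+ n.+1) ((2^-1 ^+ n.+2) ^+ 2) => p q; rewrite !expr2; lra.
have zc : (2^-1 ^+ n : R) @[n --> \oo] --> (0:R).
  by apply: cvg_expr; rewrite ger0_norm ?invr_ge0// invf_lt1// ltr1n.
have dlc : dl n @[n --> \oo] --> 0.
  have z1 : (2^-1 ^+ n.+1 : R) @[n --> \oo] --> (0:R).
    by have := zc; rewrite -(cvg_shiftS (fun n => 2^-1 ^+ n : R)).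
  by rewrite -(mulr0 0); under eq_fun do rewrite /dl expr2; exact: cvgM.
have rep t : smooth_cpt t -> L t = RI mu (fun x => h x * t x).
  move=> st; have Lt := smooth_L2 st.
  have rc : RI mu (fun x => u n x * t x) @[n --> \oo] --> RI mu (fun x => h x * t x).
    apply/cvgrPdist_le => e e0.
    have : (2 * 2^-1 ^+ n) * n2 mu t @[n --> \oo] --> (2 * 0) * n2 mu t.
      by apply: cvgM; [apply: cvgM; [exact: cvg_cst|exact: zc]|exact: cvg_cst].
    rewrite mulr0 mul0r => /cvgrPdist_le /(_ _ e0); apply: filterS => n.
    rewrite sub0r normrN => he; apply: le_trans he; rewrite [X in _ <= X]ger0_norm; last first.
      by rewrite !mulr_ge0 ?n2_ge0 ?exprn_ge0 ?invr_ge0.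
    rewrite distrC -RIB; [|exact: L2_mul|exact: L2_mul].
    rewrite (@RI_eq _ _ _ _ _ (fun x => (u n x - h x) * t x)); last by move=> x; rewrite mulrBl.
    apply: (le_trans (n2_cs (L2B (Lu n) Lh) Lt)); apply: ler_wpM2r; [exact: n2_ge0|exact: hh].
  (* First variation: [J (u n + s t) <= M] in the limit. As [s] is free, the coefficient of the
     linear term has to vanish. *)
  have ineq (s : R) : 2 * s * (L t - RI mu (fun x => h x * t x)) <= s ^+ 2 * n2 mu t ^+ 2.
    have c1 : 2 * s * (L t - RI mu (fun x => u n x * t x)) - dl n @[n --> \oo] -->
        2 * s * (L t - RI mu (fun x => h x * t x)) - 0.
      apply: cvgB => //; apply: cvgM; first exact: cvg_cst.
      by apply: cvgB => //; exact: cvg_cst.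
    rewrite -[X in X <= _]subr0 -(cvg_lim (@Rhausdorff _) c1).
    apply: limr_le; first exact: cvgP c1.
    apply: nearW => n; have := JM _ (smooth_lin s (su n) st).
    rewrite /J Ll// (n2_lin _ (Lu n) Lt); have := (hu n).2; rewrite /J.
    by move: (s ^+ 2 * _) => X; lra.
  apply/eqP; rewrite -subr_eq0; apply/negPn/negP => nz.
  set D := _ - _ in nz ineq; set N := n2 mu t ^+ 2 in ineq.
  have N0 : 0 <= N by exact: sqr_ge0.
  (* For [D] nonzero this [s] makes the left-hand side [2 D^2 / (N + 1)] larger than the right-hand
     side [D^2 N / (N + 1)^2]. *)
  have := ineq (D / (N + 1)); have D2 : 0 < D ^+ 2 by rewrite lt0r sqrf_eq0 nz sqr_ge0.
  have N1 : 0 < N + 1 by rewrite ltr_wpDl.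
  have -> : 2 * (D / (N + 1)) * D = (2 * D ^+ 2 * (N + 1)) / (N + 1) ^+ 2 by field; rewrite gt_eqF.
  have -> : (D / (N + 1)) ^+ 2 * N = (D ^+ 2 * N) / (N + 1) ^+ 2 by field; rewrite gt_eqF.
  rewrite ler_pM2r ?invr_gt0 ?exprn_gt0// => h2; move: D2 h2 N0; clear; move: (D ^+ 2) => X; nra.
exists h; split => //; apply: L2_dual => // t st; by rewrite -rep//; exact: Lb.
Qed.

Lemma score_weak_derivative (g : V -> R) (j : axis) (K : R) : (forall x, 0 <= g x) -> L1 mu g ->
  0 <= K -> score_bound g j K -> exists h, [/\ L2 mu h, 4 * n2 mu h ^+ 2 <= K &
    forall t, smooth_cpt t ->
      RI mu (fun x => Num.sqrt (g x) * 'D_(ee j) t x) = - RI mu (fun x => h x * t x)].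
Proof.
move=> g0 Lg K0 JB.
pose a (x : V) : R := Num.sqrt (g x).
have La : L2 mu a.
  split; first exact: (measurableT_comp (@measurable_sqrt R) (L1_meas Lg)).
  by apply: L1_eq Lg => x; rewrite sqr_sqrtr.
have LD (t : V -> R) : smooth_cpt t -> L1 mu (fun x => a x * 'D_(ee j) t x).
  move=> st; have [L _] := isd_translate (ee j) La 0 st.
  apply: L1_eq L => x; congr (_ * _).
  by have -> : (fun y => t (add3 y (scale3 0 (ee j)))) = t by apply/funext => y; exact: congr1 (add3_0 _ _).
have [||| h [Lh hC rep]] := @riesz (fun t => - RI mu (fun x => a x * 'D_(ee j) t x)) (Num.sqrt (K / 4)).
- exact: sqrtr_ge0.
- move=> s t c ss st; rewrite mulrN -opprD; congr (- _).
  rewrite -RIZl ?LD// -RID; [|exact: LD|by apply: L1Zl; exact: LD].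
  apply: RI_eq => x; rewrite (isD_derive (d := 'D_(ee j) s x + c * 'D_(ee j) t x)); first by ring.
  apply: isDD; first exact: smooth_isD.
  by apply: (isD_eq (isDM (isD_cst c x _) (smooth_isD st x _))) => //; rewrite mul0r add0r.
- by move=> t st; rewrite normrN; exact: sqrt_weak_bound.
exists h; split => //.
  rewrite -ler_pdivlMl// mulrC -(@sqr_sqrtr _ (K / 4)) ?divr_ge0//.
  by rewrite ler_sqr ?nnegrE ?n2_ge0 ?sqrtr_ge0.
by move=> t st; rewrite -rep// opprK.
Qed.

End Riesz.

(** * The Fisher information and its dual functional *)

Section LebBridge.
Context {R : realType}.
Local Notation V := (V3 R).
Local Notation mu := (@mu3 R).
Local Notation leb := (@leb3 R).

Lemma mpres_leb1' : mpres (@leb1 R) (@lebesgue_measure R) id.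
Proof. by split => // _ A; rewrite setTI. Qed.

Lemma mpres_leb3' : mpres mu leb id.
Proof.
have := mpres_prod (mpres_prod mpres_leb1' mpres_leb1') mpres_leb1'.
rewrite (_ : (fun z => _) = id)//.
by apply/funext => -[[x y] z].
Qed.

Lemma L1_leb f : L1 mu f -> L1 leb f /\ RI leb f = RI mu f.
Proof. exact: (mpres_RI (@mpres_leb3 R)). Qed.

Lemma L1_mu f : L1 leb f -> L1 mu f /\ RI mu f = RI leb f.
Proof. exact: (mpres_RI mpres_leb3'). Qed.

Lemma measurable_nball (r : R) : measurable [set x : V | norm3 x <= r].
Proof.
have -> : [set x : V | norm3 x <= r] = @norm3 R @^-1` `]-oo, r].
  by apply/seteqP; split => x; rewrite /= in_itv.
rewrite -[X in measurable X]setTI.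
by apply: (continuous_measurable3 (@norm3_continuous R)).
Qed.

Lemma indic_nball_L2 (r : R) : L2 mu (\1_[set x : V | norm3 x <= r]).
Proof.
apply: (L2_box (r := r + 1) (C := 1)).
- by apply: measurable_indr; exact: measurable_nball.
- by move=> x; have /andP[? ?] := @indic_itv _ [set x : V | norm3 x <= r] x; rewrite ger0_norm.
- move=> x nb; rewrite indic_out//= => h; apply: nb => i.
  by rewrite (le_lt_trans (cd_norm3 i x))// (le_lt_trans h)// ltrDl.
Qed.

Lemma restrict_indic (D : set V) (f : V -> R) :
  ((fun x => (f x)%:E) \_ D) = EFin \o (fun x => f x * \1_D x).
Proof.
apply/funext => x; rewrite patchE /= indicE; case: (_ \in _); first by rewrite mulr1.
by rewrite mulr0.
Qed.

Lemma nball_mkcond (r : R) (f : V -> R) :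
  leb.-integrable [set x : V | norm3 x <= r] (fun x => (f x)%:E) <->
  L1 leb (fun x => f x * \1_[set x : V | norm3 x <= r] x).
Proof.
have := @integrable_mkcond _ _ _ leb [set x : V | norm3 x <= r] (fun x => (f x)%:E) (measurable_nball r).
by rewrite restrict_indic.
Qed.

Lemma loc_integrable_L2 f : L2 mu f -> loc_integrable f.
Proof.
move=> Lf r; apply/nball_mkcond.
exact: (L1_leb (L2_mul Lf (indic_nball_L2 r))).1.
Qed.

Lemma loc_integrable_measurable f : loc_integrable f -> measurable_fun setT (f : V -> R).
Proof.
move=> lf.
have m n : measurable_fun setT (fun x : V => f x * \1_[set x : V | norm3 x <= n%:R] x).
  have /nball_mkcond h := lf n%:R.
  by have [L _] := L1_mu h; exact: L1_meas L.
apply: measurable_fun_cvg m _ => x _; apply: cvg_near_cst; near=> n.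
rewrite indic_in ?mulr1//=; near: n; exact: nbhs_infty_ger.
Unshelve. all: by end_near. Qed.

Lemma L1_smooth_deriv (a t : V -> R) i : L2 mu a -> smooth_cpt t -> L1 mu (fun x => a x * 'D_(ee i) t x).
Proof.
move=> La st; have [L _] := isd_translate (ee i) La 0 st.
apply: L1_eq L => x; congr (_ * _).
by have -> : (fun y => t (add3 y (scale3 0 (ee i)))) = t by apply/funext => y; exact: congr1 (add3_0 _ _).
Qed.

Definition weak_deriv (a h : V -> R) i := forall t, smooth_cpt t ->
  RI mu (fun x => a x * 'D_(ee i) t x) = - RI mu (fun x => h x * t x).

Lemma weak_deriv_int (a h t : V -> R) i : L2 mu a -> L2 mu h -> weak_deriv a h i -> smooth_cpt t ->
  (\int[leb]_x (a x * 'D_(ee i) t x)%:E = - \int[leb]_x (h x * t x)%:E)%E.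
Proof.
move=> La Lh w st; have := w t st.
have [L1a <-] := L1_leb (L1_smooth_deriv i La st).
have [L2a <-] := L1_leb (L2_mul Lh (smooth_L2 st)) => E.
by rewrite (RI_E L1a) (RI_E L2a) E.
Qed.

Lemma int_weak_deriv (a h t : V -> R) i : L2 mu a -> L2 mu h -> smooth_cpt t ->
  (\int[leb]_x (a x * 'D_(ee i) t x)%:E = - \int[leb]_x (h x * t x)%:E)%E ->
  RI mu (fun x => a x * 'D_(ee i) t x) = - RI mu (fun x => h x * t x).
Proof.
move=> La Lh st E.
have [_ <-] := L1_leb (L1_smooth_deriv i La st).
have [_ <-] := L1_leb (L2_mul Lh (smooth_L2 st)).
by rewrite /RI E fineN.
Qed.

Lemma sqrt_L2 (g : V -> R) : (forall x, 0 <= g x) -> L1 mu g -> L2 mu (fun x => Num.sqrt (g x)).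
Proof.
move=> g0 Lg; split; first exact: (measurableT_comp (@measurable_sqrt R) (L1_meas Lg)).
by apply: L1_eq Lg => x; rewrite sqr_sqrtr.
Qed.

Lemma fisher_le_score (g : V -> R) (K : axis -> R) : (forall x, 0 <= g x) -> L1 mu g ->
  (forall i, 0 <= K i) -> (forall i, score_bound g i (K i)) -> (fisher g <= (sum3 K)%:E)%E.
Proof.
move=> g0 Lg K0 JB.
have H i : exists h, [/\ L2 mu h, 4 * n2 mu h ^+ 2 <= K i & weak_deriv (fun x => Num.sqrt (g x)) h i].
  exact: score_weak_derivative.
have La := sqrt_L2 g0 Lg.
have [h1 [L1h B1 W1]] := H ax1; have [h2 [L2h B2 W2]] := H ax2; have [h3 [L3h B3 W3]] := H ax3.
pose h x := mkV3 (h1 x) (h2 x) (h3 x) : V.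
have hd : (\int[leb]_x (dot3 (h x) (h x))%:E = (n2 mu h1 ^+ 2 + n2 mu h2 ^+ 2 + n2 mu h3 ^+ 2)%:E)%E.
  have L : L1 mu (fun x => h1 x ^+ 2 + h2 x ^+ 2 + h3 x ^+ 2).
    by apply: L1D; [apply: L1D; [exact: L1h.2|exact: L2h.2]|exact: L3h.2].
  have [L' E] := L1_leb L.
  transitivity (\int[leb]_x (h1 x ^+ 2 + h2 x ^+ 2 + h3 x ^+ 2)%:E)%E.
    by apply: eq_integral => x _; congr EFin; rewrite /dot3 /= !expr2.
  rewrite (RI_E L') E; congr EFin; rewrite !n2_sqr.
  by rewrite (RID (L1D L1h.2 L2h.2) L3h.2) (RID L1h.2 L2h.2).
apply: (@le_trans _ _ (4%:E * \int[leb]_x (dot3 (h x) (h x))%:E)%E); last first.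
  rewrite hd -EFinM lee_fin /sum3; lra.
apply: ereal_inf_lbound; exists h => //.
split; first exact: loc_integrable_L2.
split; first exact: loc_integrable_L2.
split; first exact: loc_integrable_L2.
split; first exact: loc_integrable_L2.
move=> t st; split.
- exact: (weak_deriv_int La L1h W1 st).
- exact: (weak_deriv_int La L2h W2 st).
- exact: (weak_deriv_int La L3h W3 st).
Qed.

(** Strictness provides a member of the set whose infimum is [fisher f]; the finite bound on its
    integral is what puts that weak gradient in L2. *)
Lemma fisher_weak (f : V -> R) (K : R) : (forall x, 0 <= f x) -> L1 mu f -> (fisher f < K%:E)%E ->
  exists h : axis -> V -> R, [/\ forall i, L2 mu (h i),
    forall i, weak_deriv (fun x => Num.sqrt (f x)) (h i) i & 4 * sum3 (fun i => n2 mu (h i) ^+ 2) <= K].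
Proof.
move=> f0 Lf /ereal_inf_lt [_ [h [_ [l1 [l2 [l3 W]]]] <-] hK].
have La := sqrt_L2 f0 Lf.
have mh i : measurable_fun setT (fun x => cd i (h x)).
  by case: i; exact: loc_integrable_measurable.
have mhh : measurable_fun setT (fun x => dot3 (h x) (h x)).
  have -> : (fun x => dot3 (h x) (h x)) = (fun x => sum3 (fun i => cd i (h x) * cd i (h x))).
    by apply/funext => x; rewrite dot3E.
  by apply: measurable_sum3 => i; exact: measurable_funM.
have hE : (\int[leb]_x (dot3 (h x) (h x))%:E = \int[mu]_x (dot3 (h x) (h x))%:E)%E.
  apply: (mpres_int (@mpres_leb3 R) (f := fun x => (dot3 (h x) (h x))%:E)).
    exact/measurable_EFinP.
  by move=> x; rewrite lee_fin dot3_ge0.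
have hb : (\int[mu]_x (dot3 (h x) (h x))%:E <= (K / 4)%:E)%E.
  rewrite -hE -(@lee_pmul2l _ 4%:E)//; apply: (le_trans (ltW hK)).
  by rewrite -EFinM mulrC divfK.
have [Ld hd] := L1_bound mhh (fun x => dot3_ge0 (h x)) hb.
have Lh i : L2 mu (fun x => cd i (h x)).
  split; first exact: mh.
  apply: L1_dom Ld; first exact: measurable_funX.
  move=> x; rewrite ger0_norm ?sqr_ge0// -norm3_sqr -(real_normK (num_real (cd i (h x)))).
  by rewrite ler_sqr ?nnegrE ?norm3_ge0// cd_norm3.
exists (fun i x => cd i (h x)); split => //.
  move=> i t st; apply: int_weak_deriv => //.
  by have [] := W t st; case: i.
rewrite -ler_pdivlMl// mulrC; apply: le_trans hd; rewrite le_eqVlt; apply/orP; left; apply/eqP.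
rewrite /sum3 !n2_sqr -(RID (Lh ax1).2 (Lh ax2).2) -(RID (L1D (Lh ax1).2 (Lh ax2).2) (Lh ax3).2).
by apply: RI_eq => x; rewrite dot3E /sum3 !expr2.
Qed.

(** With [a = sqrt f], [weak_square] turns [- 2 f dphi] into [4 a h phi], and
    [4 a h phi - a^2 phi^2 <= 4 h^2]. *)
Lemma weak_score (f h : V -> R) i : (forall x, 0 <= f x) -> L1 mu f -> L2 mu h ->
  weak_deriv (fun x => Num.sqrt (f x)) h i -> score_bound f i (4 * n2 mu h ^+ 2).
Proof.
move=> f0 Lf Lh W phi dphi [cp [C hC] cd' bd hd].
have La := sqrt_L2 f0 Lf; pose a (x : V) := Num.sqrt (f x).
have [C' hC'] := bd i.
have mp := continuous_measurable3 cp; have md := continuous_measurable3 (cd' i).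
have ws := weak_square La Lh W mp hC hC' (hd i).
have a2 x : a x ^+ 2 = f x by rewrite sqr_sqrtr.
have Lfd : L1 mu (fun x => f x * dphi i x) by apply: L1_bd hC'.
have Lfp : L1 mu (fun x => f x * phi x ^+ 2).
  apply: (L1_bd (C := C ^+ 2)) => //; first exact: measurable_funX.
  by move=> x; rewrite normrX lerXn2r ?nnegrE// (le_trans _ (hC x)).
have Lahp : L1 mu (fun x => 2 * a x * h x * phi x).
  by apply: L1_bd hC => //; apply: L1_eq (L1Zl 2 (L2_mul La Lh)) => x; rewrite mulrA.
have -> : RI mu (fun x => f x * (2 * dphi i x + phi x ^+ 2)) =
   2 * RI mu (fun x => a x ^+ 2 * dphi i x) + RI mu (fun x => f x * phi x ^+ 2).
  rewrite (@RI_eq _ _ _ _ (fun x => a x ^+ 2 * dphi i x) (fun x => f x * dphi i x)); last by move=> x; rewrite a2.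
  rewrite -RIZl// -RID//; last exact: L1Zl.
  by apply: RI_eq => x; ring.
rewrite ws n2_sqr mulrN opprD opprK -(RIZl _ Lahp) -(RIZl _ Lh.2).
rewrite -RIB//; last exact: L1Zl.
apply: RI_le; [by apply: L1B => //; exact: L1Zl|by apply: L1Zl; exact: Lh.2|].
move=> x; rewrite -a2; have : 0 <= (2 * h x - a x * phi x) ^+ 2 by exact: sqr_ge0.
by move: (a x) (h x) (phi x) => u v w; rewrite !expr2; nra.
Qed.

(** Only the sum over the three directions is bounded: a collision mixes the directions, and the
    quadratic form of the gain operator is estimated after summation over [j]. *)
Definition total_score (f : V -> R) (K : R) := forall phi (dphi : axis -> axis -> V -> R),
  (forall i, C1b (phi i) (dphi i)) ->
  sum3 (fun i => - RI mu (fun x => f x * (2 * dphi i i x + phi i x ^+ 2))) <= K.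

Lemma total_score_of (f : V -> R) (K : axis -> R) : (forall i, score_bound f i (K i)) -> total_score f (sum3 K).
Proof. by move=> h phi dphi c; rewrite /sum3 !lerD// ; exact: h. Qed.

Lemma C1b_0 : C1b (fun=> 0 : R) (fun _ => fun=> 0 : R).
Proof.
split; [exact: cst_continuous|exists 0 => x; by rewrite normr0|by move=> i; exact: cst_continuous| |].
  by move=> i; exists 0 => x; rewrite normr0.
by move=> i x; exact: isD_cst.
Qed.

(** The three fields vary independently, so the supremum of the sum is the sum of the suprema, and
    these are the [k i]. *)
Lemma total_score_split (f : V -> R) (K : R) : total_score f K ->
  exists k : axis -> R, [/\ forall i, 0 <= k i, forall i, score_bound f i (k i) & sum3 k <= K].
Proof.
move=> H.
pose J i := [set y : R | exists phi dphi, C1b phi dphi /\ y = - RI mu (fun x => f x * (2 * dphi i x + phi x ^+ 2))].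
have J0 i : J i 0.
  exists (fun=> 0), (fun _ => fun=> 0); split; first exact: C1b_0.
  rewrite (@RI_eq _ _ _ _ _ (fun=> 0)) ?RI0 ?oppr0// => x.
  by rewrite expr0n /= mulr0 addr0 mulr0.
have JK y1 y2 y3 : J ax1 y1 -> J ax2 y2 -> J ax3 y3 -> y1 + y2 + y3 <= K.
  move=> [p1 [d1 [c1 ->]]] [p2 [d2 [c2 ->]]] [p3 [d3 [c3 ->]]].
  have := H (fun i => match i with ax1 => p1 | ax2 => p2 | ax3 => p3 end)
    (fun i => match i with ax1 => d1 | ax2 => d2 | ax3 => d3 end); apply.
  by case.
have ub i : has_ubound (J i).
  exists K => y hy; case: i hy => hy.
  - by have := JK _ _ _ hy (J0 _) (J0 _); rewrite !addr0.
  - by have := JK _ _ _ (J0 _) hy (J0 _); rewrite addr0 add0r.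
  - by have := JK _ _ _ (J0 _) (J0 _) hy; rewrite !add0r.
have hs i : has_sup (J i) by split => //; exists 0.
exists (fun i => sup (J i)); split.
- by move=> i; apply: (ub_le_sup (ub i)).
- by move=> i phi dphi c; apply: (ub_le_sup (ub i)); exists phi, dphi.
rewrite /sum3; apply/ler_addgt0Pr => e e0.
have e3 : 0 < e / 3 by rewrite divr_gt0.
have [y1 h1 l1] := sup_adherent e3 (hs ax1).
have [y2 h2 l2] := sup_adherent e3 (hs ax2).
have [y3 h3 l3] := sup_adherent e3 (hs ax3).
have := JK _ _ _ h1 h2 h3; lra.
Qed.

Lemma total_score_le (f : V -> R) (K L : R) : total_score f K -> K <= L -> total_score f L.
Proof. by move=> h KL phi dphi c; apply: le_trans KL; exact: h. Qed.

Lemma fisher_le_total (g : V -> R) (K : R) : (forall x, 0 <= g x) -> L1 mu g ->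
  total_score g K -> (fisher g <= K%:E)%E.
Proof.
move=> g0 Lg /total_score_split[k [k0 sk kK]].
by apply: (le_trans (fisher_le_score g0 Lg k0 sk)); rewrite lee_fin.
Qed.

Lemma total_of_fisher (f : V -> R) (K : R) : (forall x, 0 <= f x) -> L1 mu f ->
  (fisher f < K%:E)%E -> total_score f K.
Proof.
move=> f0 Lf /(fisher_weak f0 Lf)[h [Lh W hK]].
apply: total_score_le hK; rewrite /sum3 !mulrDr -/(sum3 (fun i => 4 * n2 mu (h i) ^+ 2)).
by apply: total_score_of => i; exact: weak_score.
Qed.

End LebBridge.

(** * Rotations and Archimedes' theorem *)

Section Rotations.
Context {R : realType}.
Local Notation V := (V3 R).
Local Notation leb := (@leb1 R).
Local Notation mu := (@mu3 R).

Lemma mpres_eq d1 d2 (T1 : measurableType d1) (T2 : measurableType d2)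
  (m1 : {measure set T1 -> \bar R}) (m2 : {measure set T2 -> \bar R}) (f g : T1 -> T2) :
  (forall x, f x = g x) -> mpres m1 m2 f -> mpres m1 m2 g.
Proof. by move=> /funext ->. Qed.

Lemma shear_y (c : R) : mpres (pm leb leb) (pm leb leb) (fun z => (z.1, z.2 + c * z.1)).
Proof.
apply: (@mpres_snd _ _ _ _ R leb leb (fun x y => y + c * x)).
  apply: measurable_funD; first exact: measurable_snd.
  by apply: measurable_funM; [exact: measurable_cst|exact: measurable_fst].
by move=> x; exact: mpres_shift1.
Qed.

Lemma shear_x (c : R) : mpres (pm leb leb) (pm leb leb) (fun z => (z.1 + c * z.2, z.2)).
Proof. exact: (mpres_comp (mpres_comp (mpres_swap leb leb) (shear_y c)) (mpres_swap leb leb)). Qed.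

(* A rotation is a product of three shears unless it is a half-turn. *)
Lemma rotation2 (c s : R) : c ^+ 2 + s ^+ 2 = 1 ->
  mpres (pm leb leb) (pm leb leb) (fun z => (c * z.1 + s * z.2, - s * z.1 + c * z.2)).
Proof.
move=> cs; have [s0|s0] := eqVneq s 0.
  have : (c == 1) || (c == -1) by rewrite -sqrf_eq1 -cs s0 expr0n addr0.
  case/orP => /eqP ->.
    apply: mpres_eq (mpres_id (pm leb leb)) => -[x y] /=.
    by rewrite s0 !mul0r oppr0 mul0r !mul1r addr0 add0r.
  apply: mpres_eq (mpres_prod (@mpres_opp1 R) (@mpres_opp1 R)) => -[x y] /=.
  by rewrite s0 !mul0r oppr0 mul0r !mulN1r addr0 add0r.
pose t := (1 - c) / s.
apply: mpres_eq (mpres_comp (mpres_comp (shear_x t) (shear_y (- s))) (shear_x t)) => -[x y] /=.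
have c2 : c ^+ 2 = 1 - s ^+ 2 by rewrite -cs addrK.
rewrite /t; congr pair; last by field.
apply: (mulIf s0); transitivity ((s * x + (1 - c) * y) + (1 - c) * (y + - s * x) - (1 - c) ^+ 2 * y).
  by field.
have -> : (c * x + s * y) * s = c * s * x + (1 - c ^+ 2) * y by rewrite c2; ring.
ring.
Qed.

Lemma shear_z (c : R) : mpres mu mu (fun v => (v.1.1, v.1.2, v.2 + c * v.1.1)).
Proof.
apply: mpres_eq (@mpres_snd _ _ _ _ R (pm leb leb) leb (fun p z => z + c * p.1) _ _) => [[[x y] z]//||].
  apply: measurable_funD; first exact: measurable_snd.
  apply: measurable_funM; first exact: measurable_cst.
  exact: (measurableT_comp measurable_fst measurable_fst).
by move=> x; exact: mpres_shift1.
Qed.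

Lemma shear_xz (c : R) : mpres mu mu (fun v => (v.1.1 + c * v.2, v.1.2, v.2)).
Proof.
have h : mpres (pm leb (pm leb leb)) (pm leb (pm leb leb)) (fun z => (z.1, (z.2.1 + c * z.1, z.2.2))).
  apply: (@mpres_snd _ _ _ _ R leb (pm leb leb) (fun z p => (p.1 + c * z, p.2))).
    apply/measurable_fun_pair.
      apply: measurable_funD.
        exact: (measurableT_comp measurable_fst measurable_snd).
      by apply: measurable_funM; [exact: measurable_cst|exact: measurable_fst].
    exact: (measurableT_comp measurable_snd measurable_snd).
  by move=> x; exact: (mpres_prod (@mpres_shift1 R (c * x)) (@mpres_id _ _ _ leb)).
apply: mpres_eq (mpres_comp (mpres_comp (mpres_swap (pm leb leb) leb) h) (mpres_swap leb (pm leb leb))).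
by move=> [[x y] z].
Qed.

Lemma rotation_xy (c s : R) : c ^+ 2 + s ^+ 2 = 1 ->
  mpres mu mu (fun v => (c * v.1.1 + s * v.1.2, - s * v.1.1 + c * v.1.2, v.2)).
Proof.
move=> cs; apply: mpres_eq (mpres_prod (rotation2 cs) (mpres_id leb)) => -[[x y] z] //.
Qed.

Lemma rotation_xz (c s : R) : c ^+ 2 + s ^+ 2 = 1 ->
  mpres mu mu (fun v => (c * v.1.1 - s * v.2, v.1.2, s * v.1.1 + c * v.2)).
Proof.
move=> cs; have [s0|s0] := eqVneq s 0.
  have : (c == 1) || (c == -1) by rewrite -sqrf_eq1 -cs s0 expr0n addr0.
  case/orP => /eqP ->.
    apply: mpres_eq (mpres_id mu) => -[[x y] z] /=.
    by rewrite s0 !mul0r !mul1r subr0 add0r.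
  apply: mpres_eq (mpres_prod (mpres_prod (@mpres_opp1 R) (mpres_id leb)) (@mpres_opp1 R)) => -[[x y] z] /=.
  by rewrite s0 !mul0r !mulN1r subr0 add0r.
pose t := (1 - c) / s.
apply: mpres_eq (mpres_comp (mpres_comp (shear_z t) (shear_xz (- s))) (shear_z t)) => -[[x y] z] /=.
have c2 : c ^+ 2 = 1 - s ^+ 2 by rewrite -cs addrK.
rewrite /t; congr pair; first by congr pair; field.
apply: (mulIf s0); transitivity ((s * z + (1 - c) * x) + (1 - c) * (x + - s * z) - (1 - c) ^+ 2 * x).
  by field.
have -> : (s * x + c * z) * s = c * s * z + (1 - c ^+ 2) * x by rewrite c2; ring.
ring.
Qed.

(** A rotation about the z axis brings [k] into the xz plane, and a rotation in that plane brings it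
    to the axis. Here [r] is the distance of [k] from the axis; when it is 0, the angle of the first
    rotation is arbitrary and taken to be 0. *)
Lemma isometry_to_axis (k : V) : dot3 k k = 1 -> exists T : V -> V,
  [/\ mpres mu mu T, forall y, norm3 (T y) = norm3 y & forall y, v3z (T y) = dot3 y k].
Proof.
move=> k1; pose r := Num.sqrt (v3x k ^+ 2 + v3y k ^+ 2).
have r2 : r ^+ 2 = v3x k ^+ 2 + v3y k ^+ 2 by rewrite sqr_sqrtr// addr_ge0 ?sqr_ge0.
have [c [s [cs c1 s1]]] : exists c s : R, [/\ c ^+ 2 + s ^+ 2 = 1, r * c = v3x k & r * s = v3y k].
  have [r0|r0] := eqVneq r 0.
    exists 1, 0; rewrite expr1n expr0n addr0 r0 !mul0r; split => //.
      by apply/esym/eqP; rewrite -sqrf_eq0; have := r2; rewrite r0 expr0n /= => /esym/eqP; rewrite paddr_eq0 ?sqr_ge0// => /andP[].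
    by apply/esym/eqP; rewrite -sqrf_eq0; have := r2; rewrite r0 expr0n /= => /esym/eqP; rewrite paddr_eq0 ?sqr_ge0// => /andP[].
  exists (v3x k / r), (v3y k / r); split; [|by field|by field].
  by rewrite !expr_div_n -mulrDl -r2 divff// expf_neq0.
have kr : v3z k ^+ 2 + r ^+ 2 = 1.
  by rewrite r2 -k1 /dot3 !expr2; ring.
pose T1 (v : V) : V := (c * v.1.1 + s * v.1.2, - s * v.1.1 + c * v.1.2, v.2).
pose T2 (v : V) : V := (v3z k * v.1.1 - r * v.2, v.1.2, r * v.1.1 + v3z k * v.2).
exists (fun v => T2 (T1 v)); split.
- exact: (mpres_comp (rotation_xy cs) (rotation_xz kr)).
- move=> y; rewrite /norm3; congr Num.sqrt.
  have n1 v : dot3 (T1 v) (T1 v) = dot3 v v.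
    rewrite /dot3 /T1 /v3x /v3y /v3z /=.
    transitivity ((c ^+ 2 + s ^+ 2) * (v.1.1 * v.1.1 + v.1.2 * v.1.2) + v.2 * v.2); first by ring.
    by rewrite cs mul1r.
  have n2 v : dot3 (T2 v) (T2 v) = dot3 v v.
    rewrite /dot3 /T2 /v3x /v3y /=.
    transitivity ((v3z k ^+ 2 + r ^+ 2) * (v.1.1 * v.1.1 + v.2 * v.2) + v.1.2 * v.1.2).
      ring.
    by rewrite kr mul1r /v3z; ring.
  by rewrite n2 n1.
- move=> y; rewrite /dot3 /T2 /T1 {1}/v3z /= -c1 -s1.
  by rewrite {3}/v3z /v3x /v3y; ring.
Qed.

Definition hat (y : V) : V := scale3 (norm3 y)^-1 y.
Definition uball : set V := [set y | norm3 y <= 1].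

Lemma measurable_hat d (T : measurableType d) (F : T -> V) :
  measurable_fun setT F -> measurable_fun setT (fun t => hat (F t)).
Proof. by move=> mF; apply: measurable_scale3 => //; apply: measurable_invr; exact: measurable_norm3. Qed.

Lemma dotZl a (x y : V) : dot3 (scale3 a x) y = a * dot3 x y.
Proof. by rewrite !dot3E /sum3 !cdZ; ring. Qed.

Lemma dotC (x y : V) : dot3 x y = dot3 y x.
Proof. by rewrite /dot3; ring. Qed.

Lemma cauchy3 (x y : V) : dot3 x y ^+ 2 <= dot3 x x * dot3 y y.
Proof.
rewrite -subr_ge0; have -> : dot3 x x * dot3 y y - dot3 x y ^+ 2 =
  (v3x x * v3y y - v3y x * v3x y) ^+ 2 + (v3x x * v3z y - v3z x * v3x y) ^+ 2 +
  (v3y x * v3z y - v3z x * v3y y) ^+ 2 by rewrite /dot3; ring.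
by rewrite !addr_ge0 ?sqr_ge0.
Qed.

Lemma hat_dot_itv (y k : V) : dot3 k k = 1 -> -1 <= dot3 (hat y) k <= 1.
Proof.
move=> k1; rewrite -ler_norml -(@ler_sqr _ `|_|) ?nnegrE// real_normK ?num_real// expr1n.
apply: (le_trans (cauchy3 _ _)); rewrite k1 mulr1 /hat dotZl dotC dotZl -norm3_sqr.
have [->|n0] := eqVneq (norm3 y) 0; first by rewrite invr0 mul0r.
by rewrite expr2 mulKf// mulVf.
Qed.

(** In the cone representation of the surface measure, the integral of [G (n . k)] over the sphere
    is three times the integral of this function of [y]. *)
Definition ball_avg (G : R -> R) (k y : V) : R := \1_uball y * G (dot3 (hat y) k).

Lemma measurable_ball_avg d (T : measurableType d) (G : R -> R) (F H : T -> V) :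
  measurable_fun setT G -> measurable_fun setT F -> measurable_fun setT H ->
  measurable_fun setT (fun t => ball_avg G (F t) (H t)).
Proof.
move=> mG mF mH; apply: measurable_funM.
  have m1 : measurable_fun setT (\1_uball : V -> R) by apply: measurable_indr; exact: measurable_nball.
  exact: (measurableT_comp m1 mH).
by apply: (measurableT_comp mG); apply: measurable_dot3 => //; exact: measurable_hat.
Qed.

Lemma ball_rotation (G : R -> R) k : measurable_fun setT G -> dot3 k k = 1 ->
  L1 mu (ball_avg G (ee ax3)) ->
  L1 mu (ball_avg G k) /\ RI mu (ball_avg G k) = RI mu (ball_avg G (ee ax3)).
Proof.
move=> mG k1 L; have [T [mT nT zT]] := isometry_to_axis k1.
have [L' E] := mpres_RI mT L.
have H y : ball_avg G (ee ax3) (T y) = ball_avg G k y.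
  rewrite /ball_avg !dotZl nT (_ : \1_uball (T y) = \1_uball y); last first.
    by rewrite !indicE; congr (_%:R); congr nat_of_bool; apply/idP/idP => /set_mem h; apply/mem_set; move: h; rewrite /uball /= nT.
  by rewrite -zT (_ : dot3 (T y) (ee ax3) = v3z (T y))// dot3E /sum3 !cd_ee !mulr0 !add0r mulr1.
by split; [exact: L1_eq H L'|rewrite -E; apply: RI_eq => y; rewrite H].
Qed.

End Rotations.

(** * Integrals on the line and the area of a disc *)

Section LineIntegrals.
Context {R : realType}.
Local Notation leb := (@leb1 R).

Lemma RI_indic d (T : measurableType d) (m : {measure set T -> \bar R}) A : measurable A ->
  (m A < +oo)%E -> L1 m (\1_A) /\ RI m (\1_A) = fine (m A).
Proof.
move=> mA fA; have E : (\int[m]_x (\1_A x)%:E = m A)%E by rewrite integral_indic ?setIT.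
split; last by rewrite /RI E.
have [||//] := @L1_bound _ _ _ m (\1_A) (fine (m A)) (measurable_indr mA).
- by move=> x; rewrite indicE.
- by rewrite E fineK// ge0_fin_numE.
Qed.

Lemma L1_leb1 (f : R -> R) : L1 (@lebesgue_measure R) f -> L1 leb f /\ RI leb f = RI (@lebesgue_measure R) f.
Proof. exact: (mpres_RI (@mpres_leb1' R)). Qed.

Lemma L1_leb1_on (f : R -> R) (D : set R) : measurable D -> (@lebesgue_measure R).-integrable D (fun x => (f x)%:E) ->
  L1 leb (fun x => f x * \1_D x) /\
  (\int[@lebesgue_measure R]_(x in D) (f x)%:E = (RI leb (fun x => f x * \1_D x))%:E)%E.
Proof.
move=> mD I.
have := (@integrable_mkcond _ _ _ (@lebesgue_measure R) D (fun x => (f x)%:E) mD).1 I.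
rewrite restrict_EFin patch_indic => L.
have [L' E] := L1_leb1 L; split; first exact: L'.
rewrite integral_mkcond restrict_EFin patch_indic.
transitivity (RI (@lebesgue_measure R) (f \* \1_D))%:E; first exact: RI_E.
by rewrite -E.
Qed.

Lemma ftc_isd (f F : R -> R) a b : a < b -> continuous f -> (forall x, isd F x (f x)) ->
  L1 leb (fun x => f x * \1_(`[a, b]%classic) x) /\ RI leb (fun x => f x * \1_(`[a, b]%classic) x) = F b - F a.
Proof.
move=> ab cf dF.
have cf' : {within `[a, b], continuous (f : R -> R^o)} by apply: continuous_subspaceT.
have I := continuous_compact_integrable (@segment_compact _ a b) cf'.
have [L E] := L1_leb1_on (measurable_itv `[a, b]%R) I; split => //.
have cF x : {for x, continuous F} by exact: isd_continuous (dF x).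
have H : (\int[@lebesgue_measure R]_(x in `[a, b]) (f x)%:E = (F b)%:E - (F a)%:E)%E.
  apply: continuous_FTC2 => //.
    split; first by move=> x _; have [] := dF x.
      by apply: cvg_at_right_filter; exact: cF.
    by apply: cvg_at_left_filter; exact: cF.
  by move=> x _; rewrite derive1E; have [_ ->] := dF x.
by move: H; rewrite E -EFinB => -[].
Qed.

Lemma isd_pow n (x : R) : isd (fun t => t ^+ n.+1) x (n.+1%:R * x ^+ n).
Proof.
elim: n => [|n IH]; first by refine (isd_eq (isd_id x) (fun t => esym (expr1 t)) _); rewrite expr0 mulr1.
refine (isd_eq (isdM (isd_id x) IH) (fun t => esym (exprS t n.+1)) _).
by rewrite mul1r !exprS -[n.+2]addn1 natrD; ring.
Qed.

Lemma parabola_integral (r : R) : 0 <= r ->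
  L1 leb (fun x => (r ^+ 2 - x ^+ 2) * \1_(`[- r, r]%classic) x) /\
  RI leb (fun x => (r ^+ 2 - x ^+ 2) * \1_(`[- r, r]%classic) x) = 4 / 3 * r ^+ 3.
Proof.
rewrite le_eqVlt => /orP[/eqP<-|r0].
  have E x : (0 : R) = (0 ^+ 2 - x ^+ 2) * \1_(`[- 0, 0]%classic) x.
    have [h|h] := pselect ((`[- 0, 0]%classic : set R) x).
      move: h; rewrite /= in_itv /= oppr0 => h; have -> : x = 0 by apply/eqP; rewrite eq_le andbC.
      by rewrite expr0n subr0 mul0r.
    by rewrite indicE memNset// mulr0.
  split; first exact: L1_eq E (L1_0 _).
  by rewrite -(@RI_eq _ _ _ _ _ _ E) RI0 expr0n mulr0.
have [|||L ->] := @ftc_isd (fun x => r ^+ 2 - x ^+ 2) (fun x => r ^+ 2 * x - 3^-1 * x ^+ 3) (- r) r.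
- by rewrite gtrN.
- move=> x; apply: (@isd_continuous _ _ _ (0 - 2 * x ^+ 1)); apply: isdB; [exact: isd_cst|exact: isd_pow].
- move=> x; refine (isd_eq (isdB (isdZ (r ^+ 2) (isd_id x)) (isdZ 3^-1 (isd_pow 2 x))) (fun=> erefl) _).
  by rewrite mulr1 mulrA mulVf// mul1r.
by split => //; field.
Qed.

Lemma half_disc_integral (t : R) :
  L1 leb (fun x => 2 * Num.sqrt (t - x ^+ 2)) /\
  RI leb (fun x => 2 * Num.sqrt (t - x ^+ 2)) = pi * Num.max t 0.
Proof.
have [t0|t0] := leP t 0.
  have E x : (0 : R) = 2 * Num.sqrt (t - x ^+ 2).
    by rewrite ler0_sqrtr ?mulr0// subr_le0 (le_trans t0)// sqr_ge0.
  split; first exact: L1_eq E (L1_0 _).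
  by rewrite -(@RI_eq _ _ _ _ _ _ E) RI0 mulr0.
pose r := Num.sqrt t; have r0 : 0 < r by rewrite sqrtr_gt0.
have r2 : r ^+ 2 = t by rewrite sqr_sqrtr// ltW.
pose G x := Num.sqrt (t - x ^+ 2).
(* Substitution [r sin x], which leads to the integral of [t cos^2] with primitive
   [(t / 2) (x + sin x cos x)]. *)
pose F (x : R) := r * sin x.
have dF (x : R) : isd F x (r * cos x) by apply: isdZ; exact: is_derive_sin.
have F' : F^`() = (fun x => r * cos x).
  by apply/funext => x; rewrite derive1E; have [_ ->] := dF x.
have p2 : 0 < pi / 2 :> R by rewrite divr_gt0// pi_gt0.
have Fb : F (pi / 2) = r by rewrite /F sin_pihalf mulr1.
have Fa : F (- (pi / 2)) = - r by rewrite /F sinN sin_pihalf mulrN1.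
have cF x : {for x, continuous F} by exact: isd_continuous (dF x).
have cF' x : {for x, continuous (fun x => r * cos x)}.
  by apply: (@isd_continuous _ _ _ (r * - sin x)); apply: isdZ; exact: is_derive_cos.
have cG : continuous G.
  move=> x; apply: continuous_comp; last exact: sqrt_continuous.
  by apply: (@isd_continuous _ _ _ (0 - 2 * x ^+ 1)); apply: isdB; [exact: isd_cst|exact: isd_pow].
have pp : - (pi / 2) < pi / 2 :> R by rewrite gtrN.
have S := @integration_by_substitution_increasing R F G (- (pi / 2)) (pi / 2) (ltW pp).
have S' : (\int[@lebesgue_measure R]_(x in `[(- r)%R, r]) (G x)%:E =
  \int[@lebesgue_measure R]_(x in `[(- (pi / 2))%R, (pi / 2)%R]) ((G (F x) * (r * cos x)))%:E)%E.
  move: S; rewrite Fa Fb F' => S; apply: S.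
  - move=> x y hx hy xy; rewrite /F ltr_pM2l// ltr_sin//; by move: hx hy.
  - by move=> x _; exact: cF'.
  - apply: (cvgP (r * cos (- (pi / 2)))); exact: (cvg_at_right_filter (cF' _)).
  - apply: (cvgP (r * cos (pi / 2))); exact: (cvg_at_left_filter (cF' _)).
  - split; first by move=> x _; have [] := dF x.
      by apply: cvg_at_right_filter; exact: cF.
    by apply: cvg_at_left_filter; exact: cF.
  - by apply: continuous_subspaceT.
have cG' : {within `[- r, r], continuous (G : R -> R^o)} by apply: continuous_subspaceT.
have I := continuous_compact_integrable (@segment_compact _ (- r) r) cG'.
have [L E] := L1_leb1_on (measurable_itv `[- r, r]%R) I.
have GE x : G x * \1_(`[- r, r]%classic) x = G x.
  have [h|h] := pselect ((`[- r, r]%classic : set R) x); first by rewrite indicE mem_set// mulr1.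
  rewrite indicE memNset// mulr0 /G ler0_sqrtr// -r2 subr_le0.
  rewrite -[x ^+ 2]real_normK ?num_real// ler_sqr ?nnegrE// ?ltW//.
  by rewrite ltNge; apply/negP => hx; apply: h; rewrite /= in_itv /= -ler_norml.
have L' : L1 leb G by exact: L1_eq GE L.
split; first exact: L1Zl.
rewrite RIZl// -(@RI_eq _ _ _ _ _ _ GE).
have K : (\int[@lebesgue_measure R]_(x in `[(- (pi / 2))%R, (pi / 2)%R]) ((G (F x) * (r * cos x)))%:E =
   \int[@lebesgue_measure R]_(x in `[(- (pi / 2))%R, (pi / 2)%R]) (t * cos x ^+ 2)%:E)%E.
  apply: eq_integral => x; rewrite inE /= in_itv /= => hx; congr EFin.
  have c0 : 0 <= cos x by exact: cos_ge0_pihalf.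
  rewrite /G /F exprMn r2 -[X in X - _]mulr1 -mulrBr.
  have -> : 1 - sin x ^+ 2 = cos x ^+ 2 by rewrite -(cos2Dsin2 x) addrK.
  rewrite -r2 -exprMn sqrtr_sqr ger0_norm ?mulr_ge0// ?(ltW r0)//; ring.
have [|||L2 E2] := @ftc_isd (fun x => t * cos x ^+ 2) (fun x => (t / 2) * (x + sin x * cos x)) (- (pi / 2)) (pi / 2).
- exact: pp.
- move=> x; apply: (@isd_continuous _ _ _ (t * ((- sin x) * cos x + cos x * (- sin x)))); apply: isdZ.
  by apply: isdM; exact: is_derive_cos.
- move=> x; refine (isd_eq (isdZ (t / 2) (isdD (isd_id x) (isdM (is_derive_sin x) (is_derive_cos x)))) (fun=> erefl) _).
  have -> : sin x * - sin x = cos x ^+ 2 - 1 by have := cos2Dsin2 x; rewrite mulrN -expr2; lra.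
  by field.
have I2 : {within `[- (pi / 2), pi / 2], continuous ((fun x => t * cos x ^+ 2) : R -> R^o)}.
  apply: continuous_subspaceT => x; apply: (@isd_continuous _ _ _ (t * ((- sin x) * cos x + cos x * (- sin x)))); apply: isdZ.
  by apply: isdM; exact: is_derive_cos.
have [_ E3] := L1_leb1_on (measurable_itv `[- (pi / 2), pi / 2]%R) (continuous_compact_integrable (@segment_compact _ _ _) I2).
move: S'; rewrite E K E3 E2 => -[->].
by rewrite sinN cosN cos_pihalf; field.
Qed.

(** The form [max t 0] covers negative [t], where the disc is empty, so that areas of slices can be
    integrated over all heights. *)
Lemma disc_area (t : R) :
  L1 (pm leb leb) (\1_[set p | p.1 ^+ 2 + p.2 ^+ 2 <= t]) /\
  RI (pm leb leb) (\1_[set p | p.1 ^+ 2 + p.2 ^+ 2 <= t]) = pi * Num.max t 0.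
Proof.
have [L E] := half_disc_integral t; rewrite -E.
have mD : measurable [set p : R * R | p.1 ^+ 2 + p.2 ^+ 2 <= t].
  have -> : [set p : R * R | p.1 ^+ 2 + p.2 ^+ 2 <= t] = (fun p => p.1 ^+ 2 + p.2 ^+ 2) @^-1` `]-oo, t].
    by apply/seteqP; split => x; rewrite /= in_itv.
  rewrite -[X in measurable X]setTI.
  have m : measurable_fun setT (fun p : R * R => p.1 ^+ 2 + p.2 ^+ 2).
    by apply: measurable_funD; apply: measurable_funX; [exact: measurable_fst|exact: measurable_snd].
  exact: m.
have sec (x y : R) : t - x ^+ 2 >= 0 ->
    \1_[set p : R * R | p.1 ^+ 2 + p.2 ^+ 2 <= t] (x, y) =
    \1_(`[- Num.sqrt (t - x ^+ 2), Num.sqrt (t - x ^+ 2)]%classic) y :> R.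
  move=> h; rewrite !indicE; congr (_%:R); congr nat_of_bool.
  apply/idP/idP => /set_mem /=.
    rewrite -lerBrDl => h2; apply/mem_set; rewrite /= in_itv /= -ler_norml -ler_sqr ?nnegrE ?sqrtr_ge0//.
    by rewrite real_normK ?num_real// sqr_sqrtr.
  rewrite in_itv /= -ler_norml => h2; apply/mem_set; rewrite /= -lerBrDl.
  by rewrite -[y ^+ 2]real_normK ?num_real// -(sqr_sqrtr h) ler_sqr ?nnegrE ?sqrtr_ge0.
have sec0 (x y : R) : t - x ^+ 2 < 0 -> \1_[set p : R * R | p.1 ^+ 2 + p.2 ^+ 2 <= t] (x, y) = 0 :> R.
  move=> h; rewrite indicE memNset//= -lerBrDl => h2; have := le_trans (sqr_ge0 y) h2.
  by rewrite leNgt h.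
have itvm (s : R) : 0 <= s -> L1 leb (\1_(`[- s, s]%classic)) /\ RI leb (\1_(`[- s, s]%classic)) = 2 * s.
  move=> s0; have E1 : leb `[- s, s]%classic = (2 * s)%:E.
    transitivity (@lebesgue_measure R `[- s, s]%classic) => //.
    rewrite lebesgue_measure_itv /= lte_fin; case: ltP => h; last first.
      by have -> : s = 0; [lra|rewrite mulr0].
    by rewrite -EFinB; congr EFin; ring.
  have [|L1s ->] := @RI_indic _ _ leb `[- s, s]%classic (measurable_itv _).
    by apply: le_lt_trans (ltry (2 * s)); rewrite le_eqVlt; apply/orP; left; apply/eqP; exact: E1.
  by split => //; exact: (congr1 fine E1).
apply: tonelli_x => //.
- move=> x; have [h|h] := leP 0 (t - x ^+ 2).
    by apply: L1_eq (itvm _ (sqrtr_ge0 (t - x ^+ 2))).1 => y; rewrite sec.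
  by apply: L1_eq (L1_0 _) => y; rewrite sec0.
- move=> x; have [h|h] := leP 0 (t - x ^+ 2).
    by rewrite -(itvm _ (sqrtr_ge0 (t - x ^+ 2))).2; apply: RI_eq => y; rewrite sec.
  by rewrite ler0_sqrtr ?ltW// mulr0 -(RI0 leb); apply: RI_eq => y; rewrite sec0.
Qed.

End LineIntegrals.

Lemma measure_indic d (T : measurableType d) (R : realType) (m : {measure set T -> \bar R}) (A : set T) :
  measurable A -> L1 m (\1_A) -> m A = (RI m (\1_A))%:E.
Proof. by move=> mA L; rewrite -RI_E// integral_indic// setIT. Qed.

(** * Volumes of sectors and the law of the axial coordinate *)

Section Archimedes.
Context {R : realType}.
Local Notation V := (V3 R).
Local Notation leb := (@leb1 R).
Local Notation mu := (@mu3 R).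

(** The second alternative admits an empty slice where [T z <= 0]: a sector with [c > 0] has one at
    height 0, where the disc of squared radius [T 0 = 0] would be a point. *)
Lemma slice_volume (W : set V) (T : R -> R) : measurable W ->
  (forall z, (forall p, W (p, z) <-> p.1 ^+ 2 + p.2 ^+ 2 <= T z) \/ (T z <= 0 /\ forall p, ~ W (p, z))) ->
  L1 leb (fun z => pi * Num.max (T z) 0) ->
  L1 mu (\1_W) /\ RI mu (\1_W) = RI leb (fun z => pi * Num.max (T z) 0).
Proof.
move=> mW hW LT; apply: tonelli_y => //.
- move=> z; have [h|[_ h]] := hW z.
    apply: L1_eq (disc_area (T z)).1 => p; rewrite !indicE; congr (_%:R); congr nat_of_bool.
    by apply/idP/idP => /set_mem hp; apply/mem_set; apply/(h p).
  by apply: L1_eq (L1_0 _) => p; rewrite indicE memNset.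
- move=> z; have [h|[T0 h]] := hW z.
    rewrite -(disc_area (T z)).2; apply: RI_eq => p; rewrite !indicE; congr (_%:R); congr nat_of_bool.
    by apply/idP/idP => /set_mem hp; apply/mem_set; apply/(h p).
  rewrite max_r// mulr0 -(RI0 (pm leb leb)); apply: RI_eq => p.
  by rewrite indicE memNset.
Qed.

Definition axial (y : V) : R := `|dot3 (hat y) (ee ax3)|.

Lemma measurable_axial : measurable_fun setT axial.
Proof.
apply: measurableT_comp => //; apply: measurable_dot3; last exact: measurable_cst.
exact: measurable_hat.
Qed.

Lemma axialE y : axial y = `|v3z y| / norm3 y.
Proof.
rewrite /axial /hat dotZl dot3E /sum3 !cd_ee !mulr0 !add0r mulr1 normrM.
by rewrite normfV [`|norm3 y|]ger0_norm ?norm3_ge0// mulrC.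
Qed.

Definition sector (c : R) : set V := [set y | norm3 y <= 1 /\ c <= axial y].

Lemma measurable_sector c : measurable (sector c).
Proof.
have -> : sector c = uball `&` axial @^-1` `[c, +oo[.
  by apply/seteqP; split => x; rewrite /sector /= in_itv /= andbT.
apply: measurableI; first exact: measurable_nball.
by rewrite -[X in measurable X]setTI; exact: (measurable_axial measurableT (measurable_itv _)).
Qed.

Lemma norm3_le1 (p : R * R) (z : R) : (norm3 ((p, z) : V) <= 1) = (p.1 ^+ 2 + p.2 ^+ 2 <= 1 - z ^+ 2).
Proof.
rewrite -(ler_sqr (norm3_ge0 _)) ?nnegrE// norm3_sqr expr1n lerBrDr /dot3 /v3x /v3y /v3z /=.
by rewrite !expr2.
Qed.

Lemma parabola_max (r z : R) : 0 <= r ->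
  Num.max (r ^+ 2 - z ^+ 2) 0 = (r ^+ 2 - z ^+ 2) * \1_(`[- r, r]%classic) z.
Proof.
move=> r0; have E : (r ^+ 2 - z ^+ 2 >= 0) = (- r <= z <= r).
  by rewrite subr_ge0 -ler_norml -[z ^+ 2]real_normK ?num_real// ler_sqr ?nnegrE.
rewrite indicE; case: (boolP (- r <= z <= r)) => h.
  by rewrite mem_set ?mulr1 ?max_l ?E//= in_itv.
rewrite memNset ?mulr0; last by rewrite /= in_itv /=; exact/negP.
by rewrite max_r// ltW// ltNge E.
Qed.

Lemma ball_volume : L1 mu (\1_uball) /\ RI mu (\1_uball) = 4 * pi / 3.
Proof.
have [L E] := @parabola_integral R 1 ler01.
have H (z : R) : pi * ((1 ^+ 2 - z ^+ 2) * \1_(`[- 1, 1]%classic) z) = pi * Num.max (1 - z ^+ 2) 0.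
  by rewrite -parabola_max ?ler01// expr1n.
have [||L' ->] := @slice_volume uball (fun z => 1 - z ^+ 2) (measurable_nball 1).
- by move=> z; left => p; rewrite /uball /= norm3_le1.
- by apply: L1_eq H _; exact: L1Zl.
split => //; rewrite -(@RI_eq _ _ _ leb _ _ H) (RIZl _ L) E expr1n mulr1.
by rewrite mulrA [pi * 4]mulrC.
Qed.

Lemma sector_volume (c : R) : 0 <= c <= 1 ->
  L1 mu (\1_(sector c)) /\ RI mu (\1_(sector c)) = 4 * pi / 3 * (1 - c).
Proof.
move=> /andP[]; rewrite le_eqVlt => /orP[/eqP<- _|c0 c1].
  have [L E] := ball_volume; have -> : sector 0 = uball.
    by apply/seteqP; split => y; [case|move=> h; split => //; exact: normr_ge0].
  by rewrite E subr0 mulr1.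
have c2 : 0 < c ^+ 2 by rewrite exprn_gt0.
have [L1' E1] := @parabola_integral R 1 ler01.
have [L2' E2] := @parabola_integral R c (ltW c0).
(* Squared radius of the slice: bounded by the ball for [|z| >= c] and by the cone for [|z| <= c].
   Its positive part is a difference of two truncated parabolas. *)
pose T z := Num.min (1 - z ^+ 2) (((c ^+ 2)^-1 - 1) * z ^+ 2).
have k0 : 0 <= (c ^+ 2)^-1 - 1 by rewrite subr_ge0 invf_ge1// expr_le1// ltW.
have H (z : R) : pi * ((1 ^+ 2 - z ^+ 2) * \1_(`[- 1, 1]%classic) z - (c ^+ 2)^-1 * ((c ^+ 2 - z ^+ 2) * \1_(`[- c, c]%classic) z))
   = pi * Num.max (T z) 0.
  congr (_ * _); rewrite -!parabola_max ?ler01 ?(ltW c0)// expr1n /T.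
  have X : (c ^+ 2)^-1 * (c ^+ 2 - z ^+ 2) = 1 - (c ^+ 2)^-1 * z ^+ 2 by rewrite mulrBr mulVf// gt_eqF.
  have z0 : 0 <= z ^+ 2 by exact: sqr_ge0.
  have kz : 0 <= ((c ^+ 2)^-1 - 1) * z ^+ 2 by rewrite mulr_ge0.
  have cc : c ^+ 2 <= 1 by rewrite expr_le1// ltW.
  have [h|h] := leP (c ^+ 2 - z ^+ 2) 0.
    have X0 : (c ^+ 2)^-1 * (c ^+ 2 - z ^+ 2) <= 0 by rewrite pmulr_rle0// invr_gt0.
    rewrite mulr0 subr0 min_l//.
    move: X X0; rewrite mulrBl mul1r; lra.
  have X0 : 0 < (c ^+ 2)^-1 * (c ^+ 2 - z ^+ 2) by rewrite pmulr_rgt0// invr_gt0.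
  rewrite (max_l (_ : 0 <= 1 - z ^+ 2)); last by move: h cc; lra.
  rewrite min_r; last by move: X X0; rewrite mulrBl mul1r; lra.
  by rewrite max_l// X mulrBl mul1r; lra.
have L : L1 leb (fun z => pi * Num.max (T z) 0).
  apply: L1_eq H _; apply: L1Zl; apply: L1B => //; exact: L1Zl.
have [|L' ->] := @slice_volume (sector c) T (measurable_sector c) _ L.
- move=> z; have [->|z0] := eqVneq z 0.
    right; split; first by rewrite /T expr0n mulr0 ge_min lexx orbT.
    move=> p [_]; rewrite axialE /v3z /= normr0 mul0r; apply/negP; by rewrite -ltNge.
  left => p; rewrite /sector /= axialE norm3_le1 /T le_min.
  have np : 0 < norm3 ((p, z) : V).
    rewrite lt_neqAle norm3_ge0 andbT eq_sym; apply: contra_neq z0 => n0.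
    by have := cd_norm3 ax3 ((p, z) : V); rewrite n0 /= normr_le0 => /eqP.
  have -> : (c <= `|v3z ((p, z) : V)| / norm3 ((p, z) : V)) = (p.1 ^+ 2 + p.2 ^+ 2 <= ((c ^+ 2)^-1 - 1) * z ^+ 2).
    rewrite ler_pdivlMr// -(@ler_sqr _ (c * _)) ?nnegrE ?mulr_ge0 ?(ltW c0) ?norm3_ge0//.
    rewrite exprMn norm3_sqr real_normK ?num_real// mulrBl mul1r lerBrDr.
    rewrite -[in RHS](ler_pM2l c2) mulrA divff ?gt_eqF// mul1r /dot3 /v3x /v3y /v3z /=.
    by rewrite !expr2.
  by split => [[-> ->]|/andP[]].
split => //; rewrite -(@RI_eq _ _ _ leb _ _ H) (RIZl _ (L1B L1' (L1Zl _ L2'))) (RIB L1' (L1Zl _ L2')).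
by rewrite (RIZl _ L2') E1 E2 expr1n mulr1; field; rewrite gt_eqF.
Qed.

(** The minus sign turns sectors into preimages of left half-lines. Points off the ball are sent to
    1, outside the interval []-1, 0]] on which the law is computed. *)
Let foot (y : V) : R := if norm3 y <= 1 then - axial y else 1.

Let measurable_foot : measurable_fun setT foot.
Proof.
apply: measurable_fun_if => //.
- by apply: (@measurable_fun_bool _ _ setT _ true); rewrite setTI; exact: measurable_nball.
- rewrite setTI; apply: measurable_funTS; exact: (measurableT_comp (@mpres_opp1 R).1 measurable_axial).
Qed.

(* Archimedes: the axial coordinate of a uniform direction is uniform. *)
Lemma foot_law (A : set R) : measurable A -> A `<=` `]-1, 0] ->
  mu (foot @^-1` A) = ((4 * pi / 3)%:E * leb A)%E.
Proof.
have [nu hnu] := pushforward_measure mu measurable_foot.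
have p0 : 0 < 4 * pi / 3 :> R by rewrite divr_gt0// mulr_gt0// pi_gt0.
have low (b : R) : -1 <= b <= 0 -> nu `]-oo, b]%classic = (4 * pi / 3 * (1 + b))%:E.
  move=> /andP[b1 b0]; rewrite hnu.
  have -> : foot @^-1` `]-oo, b] = sector (- b).
    apply/seteqP; split => y; rewrite /sector /foot /= in_itv /=.
      case: ifP => h hb; first by split => //; rewrite lerNl.
      by have := le_trans hb b0; rewrite ler10.
    by move=> [-> h]; rewrite lerNl.
  have [|L E] := @sector_volume (- b); first by apply/andP; split; lra.
  transitivity (RI mu (\1_(sector (- b))))%:E; first exact: (measure_indic (@measurable_sector _)).
  by rewrite E opprK.
have oc (a b : R) : -1 <= a -> a <= b -> b <= 0 -> nu `]a, b]%classic = (4 * pi / 3 * (b - a))%:E.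
  move=> a1 ab b0; have -> : `]a, b]%classic = `]-oo, b]%classic `\` `]-oo, a]%classic :> set R.
    apply/seteqP; split => x; rewrite /= !in_itv /=.
      by move=> /andP[h1 h2]; split => //; apply/negP; rewrite -ltNge.
    by move=> [-> /negP]; rewrite -ltNge => ->.
  rewrite measureD//; last first.
    by apply: le_lt_trans (ltry (4 * pi / 3 * (1 + b))); rewrite le_eqVlt; apply/orP; left; apply/eqP; apply: low; rewrite (le_trans a1).
  have -> : `]-oo, b]%classic `&` `]-oo, a]%classic = `]-oo, a]%classic :> set R.
    by rewrite setIC setIidl// => x; rewrite /= !in_itv /= => /le_trans; apply.
  transitivity ((4 * pi / 3 * (1 + b))%:E - (4 * pi / 3 * (1 + a))%:E)%E.
    by congr (_ - _)%E; apply: low; rewrite ?a1 ?b0 ?(le_trans a1) ?(le_trans ab).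
  by rewrite -EFinB; congr EFin; ring.
pose D : set R := `]-1, 0]%classic.
have mD : measurable D by exact: measurable_itv.
have k0 : 0 <= (4 * pi / 3)^-1 :> R by rewrite invr_ge0 ltW.
pose k := NngNum k0.
(* The rescaled law on [D] glued to Lebesgue measure off [D]. It agrees with Lebesgue measure on
   half-open intervals, and uniqueness extends this to all Borel sets. *)
pose m1 : {measure set R -> \bar R} := measure_add (mscale k (mrestr nu mD)) (mrestr leb (measurableC mD)).
have m1E (E : set R) : m1 E = (((4 * pi / 3)^-1)%:E * nu (E `&` D) + leb (E `&` ~` D))%E.
  exact: measure_addE.
have U X : ocitv X -> @lebesgue_measure R X = m1 X.
  move=> [[a b] _ <-] /=; rewrite m1E.
  have mX : measurable (`]a, b]%classic : set R) by exact: measurable_itv.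
  have S : @lebesgue_measure R `]a, b]%classic =
     (@lebesgue_measure R (`]a, b]%classic `&` D) + leb (`]a, b]%classic `&` ~` D))%E.
    by rewrite addeC -setDE; exact: (@measureDI _ _ _ leb _ _ mX mD).
  rewrite S; congr (_ + _)%E.
  have -> : `]a, b]%classic `&` D = `]Num.max a (-1), Num.min b 0]%classic :> set R.
    apply/seteqP; split => x; rewrite /D /= !in_itv /= gt_max le_min.
      by move=> [/andP[-> ->] /andP[-> ->]].
    by move=> /andP[/andP[-> ->] /andP[-> ->]].
  have [h|h] := leP (Num.min b 0) (Num.max a (-1)).
    by rewrite set_itv_ge ?measure0 ?mule0// -leNgt bnd_simp.
  rewrite oc ?le_max ?ge_min ?lexx ?orbT ?ltW//.
  by rewrite lebesgue_measure_itv /= lte_fin h -EFinB -EFinM mulrA mulVf ?gt_eqF// mul1r.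
move=> mA sA; rewrite -hnu.
have [m2 hm2] := pushforward_measure m1 (@mpres_leb1' R).1.
have := @lebesgue_measure_unique R m2 (fun X hX => etrans (U X hX) (esym (hm2 X))) A mA; rewrite hm2 m1E.
have -> : A `&` D = A by apply: setIidl.
have -> : A `&` ~` D = set0 by apply/seteqP; split => x // [/sA].
rewrite measure0 adde0 => E.
have -> : leb A = (((4 * pi / 3)^-1)%:E * nu A)%E by exact: E.
by rewrite muleA -EFinM divff ?gt_eqF// mul1e.
Qed.

Lemma archimedes (G : R -> R) : measurable_fun setT G -> (forall s, 0 <= G s) ->
  (forall s, G (- s) = G s) -> (forall s, ~~ (-1 <= s <= 1) -> G s = 0) -> L1 leb G ->
  L1 mu (ball_avg G (ee ax3)) /\ RI mu (ball_avg G (ee ax3)) = 2 * pi / 3 * RI leb G.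
Proof.
move=> mG G0 Ge Gs LG.
pose D : set R := `]-1, 0]%classic.
have mD : measurable D by exact: measurable_itv.
have DE x : (x \in D) = (-1 < x <= 0).
  by apply/idP/idP => [/set_mem|h]; [|apply/mem_set]; rewrite /D /= in_itv.
pose H (s : R) := G s * \1_D s.
have mH : measurable_fun setT H by apply: measurable_funM => //; exact: measurable_indr.
have H0 s : 0 <= H s by rewrite mulr_ge0// indicE.
have LH : L1 leb H.
  apply: L1_dom LG => // s; rewrite ger0_norm// /H indicE.
  by case: (_ \in _); rewrite ?mulr1 ?mulr0.
have E2 : RI leb G = 2 * RI leb H.
  have [LH' EH'] := mpres_RI (@mpres_opp1 R) LH.
  transitivity (RI leb (fun s => H s + H (- s))); last by rewrite (RID LH LH') EH'; ring.
  have [|//] := @L1_ae _ _ _ leb (fun s => H s + H (- s)) G mG _ (L1D LH LH').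
  (* Folding [G] onto []-1, 0]] counts the point 0 twice and misses -1 and 1, hence the null set of
     exceptions. *)
  have c : countable [set -1; 0; 1 : R] by apply: finite_set_countable; rewrite !finite_setU; split; [split|]; exact: finite_set1.
  exists [set -1; 0; 1]; split.
  - by apply: measurableU; [apply: measurableU|]; exact: measurable_set1.
  - exact: countable_lebesgue_measure0.
  move=> s /= ns; apply: contrapT => h; apply: ns.
  have n1 : s != -1 by apply/eqP => e; apply: h; left; left.
  have n2 : s != 0 by apply/eqP => e; apply: h; left; right.
  have n3 : s != 1 by apply/eqP => e; apply: h; right.
  rewrite /H Ge -mulrDr; have [s1|s1] := boolP (-1 <= s <= 1); last by rewrite Gs// mul0r.
  rewrite -[RHS]mulr1; congr (_ * _); rewrite !indicE.
  have [sn|sp|e] := ltgtP s 0; last by rewrite e eqxx in n2.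
    rewrite !DE; have sm : -1 < s by rewrite lt_neqAle eq_sym n1; case/andP: s1.
  have sl : s < 1 by rewrite lt_neqAle n3; case/andP: s1.
    by rewrite sm (ltW sn) oppr_le0 leNgt sn andbF addr0.
  rewrite !DE; have sl : s < 1 by rewrite lt_neqAle n3; case/andP: s1.
  by rewrite [s <= 0]leNgt sp andbF ltrN2 sl oppr_le0 (ltW sp) add0r.
have [nu hnu] := pushforward_measure mu measurable_foot.
have K (y : V) : axial y <= 1.
  rewrite axialE; have [n0|n0] := eqVneq (norm3 y) 0; first by rewrite n0 invr0 mulr0.
  by rewrite ler_pdivrMr ?mul1r ?(cd_norm3 ax3 y)// lt_neqAle eq_sym n0 norm3_ge0.
have p0 : 0 <= 4 * pi / 3 :> R by rewrite divr_ge0// mulr_ge0// pi_ge0.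
have I1 : (\int[mu]_y (H (foot y))%:E = (4 * pi / 3 * RI leb H)%:E)%E.
  rewrite (@mpres_int _ _ _ _ R mu nu foot (fun s => (H s)%:E)); last 3 first.
  - by split => // A mA; rewrite hnu.
  - exact/measurable_EFinP.
  - by move=> s; rewrite lee_fin.
  have -> : (\int[nu]_x (H x)%:E = \int[nu]_(x in D) (G x)%:E)%E.
    by rewrite [RHS]integral_mkcond restrict_EFin patch_indic; apply: eq_integral.
  have -> : (\int[nu]_(x in D) (G x)%:E = \int[mscale (NngNum p0) leb]_(x in D) (G x)%:E)%E.
    by apply: eq_measure_integral => A mA sA; transitivity (mu (foot @^-1` A)); [exact: hnu|exact: foot_law].
  rewrite ge0_integral_mscale//; last first.
  - by move=> x _; rewrite lee_fin.
  - by apply/measurable_EFinP; apply: measurable_funTS.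
  have -> : (\int[leb]_(x in D) (G x)%:E = \int[leb]_x (H x)%:E)%E.
    by rewrite [LHS]integral_mkcond restrict_EFin patch_indic; apply: eq_integral.
  by rewrite RI_E// -EFinM.
have mF : measurable_fun setT (fun y => H (foot y)) by exact: measurableT_comp.
have [||LF EF] := @L1_bound _ _ _ mu (fun y => H (foot y)) (4 * pi / 3 * RI leb H) mF.
- by move=> y; exact: H0.
- by rewrite I1.
have EI : RI mu (fun y => H (foot y)) = 4 * pi / 3 * RI leb H by rewrite /RI I1.
have mB : measurable_fun setT (ball_avg G (ee ax3)).
  by apply: (measurable_ball_avg mG (measurable_cst _)); exact: measurable_id.
have S1 : mu (sector 1) = 0%E.
  have [|L E] := @sector_volume 1; first by rewrite ler01 lexx.
  transitivity (RI mu (\1_(sector 1)))%:E; first exact: (measure_indic (@measurable_sector _)).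
  by rewrite E subrr mulr0.
have Gabs s : G s = G (- `|s|).
  by rewrite Ge; have [h|h] := leP 0 s; [rewrite ger0_norm|rewrite ltr0_norm ?Ge].
have [|L E] := @L1_ae _ _ _ mu (fun y => H (foot y)) (ball_avg G (ee ax3)) mB _ LF; last first.
  by split => //; rewrite E EI E2; ring.
(* Where the axial coordinate is 1, [foot] is -1 and falls outside [D]; this sector has volume 0. *)
exists (sector 1); split => //; first exact: measurable_sector.
move=> y /= ny; apply: contrapT => h; apply: ny.
rewrite /H /foot /ball_avg; case: (boolP (norm3 y <= 1)) => hy; last first.
  rewrite !indicE memNset ?mulr0 ?memNset ?mul0r//=; first exact/negP.
  by rewrite /D /= in_itv /= ler10 andbF.
have -> : G (dot3 (hat y) (ee ax3)) = G (- axial y) by exact: Gabs.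
rewrite mulrC !indicE (mem_set (A := uball))//.
have a1 : axial y < 1.
  by rewrite ltNge; apply/negP => ha; apply: h; split.
by rewrite DE ltrN2 a1 oppr_le0 normr_ge0.
Qed.

End Archimedes.

(** * The collision integral *)

Section CollisionMeasure.
Context {R : realType}.
Local Notation V := (V3 R).
Local Notation leb := (@leb1 R).
Local Notation mu := (@mu3 R).

Definition m2 : {sigma_finite_measure set (V * V)%type -> \bar R} := pm mu mu.
Definition m3 : {sigma_finite_measure set (V * V * V)%type -> \bar R} := pm m2 mu.

Lemma L1_point1 (a : R) : L1 leb (\1_[set a]) /\ RI leb (\1_[set a]) = 0.
Proof.
have E : leb [set a] = 0%E by exact: lebesgue_measure_set1.
have [|L ->] := @RI_indic _ _ _ leb [set a] (measurable_set1 a).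
  by apply: le_lt_trans (ltry 0); rewrite le_eqVlt; apply/orP; left; apply/eqP; exact: E.
by split => //; exact: (congr1 fine E).
Qed.

Lemma L1_point (a : V) : L1 mu (\1_[set a]) /\ RI mu (\1_[set a]) = 0.
Proof.
case: a => [[a b] c].
have [L1a E1] := L1_point1 a; have [L1b E2] := L1_point1 b; have [L1c E3] := L1_point1 c.
have [L12 E12] := L1_tensor L1a L1b; have [L123 E123] := L1_tensor L12 L1c.
have H (z : V) : \1_[set a] z.1.1 * \1_[set b] z.1.2 * \1_[set c] z.2 = \1_[set (a, b, c)] z :> R.
  have [->|n] := eqVneq z (a, b, c); first by rewrite !indicE !mem_set//= !mulr1.
  rewrite [RHS]indicE memNset ?mulr0//; last exact/eqP.
  rewrite !indicE; case: z n => [[x y] z] /= n.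
  have [ea|ea] := eqVneq x a; last by rewrite memNset ?mul0r//; exact/eqP.
  have [eb|eb] := eqVneq y b; last by rewrite (memNset (A := [set b])) ?mulr0 ?mul0r//; exact/eqP.
  rewrite (memNset (A := [set c])) ?mulr0//; apply/eqP; apply: contraNneq n => ->.
  by rewrite ea eb.
split; first by apply: L1_eq H _; exact: L123.
transitivity (RI mu (fun z : V => \1_[set a] z.1.1 * \1_[set b] z.1.2 * \1_[set c] z.2)).
  by apply: RI_eq => z; rewrite H.
by transitivity (RI (pm leb leb) (fun z => \1_[set a] z.1 * \1_[set b] z.2) * RI leb (\1_[set c])); [exact: E123|rewrite E3 mulr0].
Qed.

Definition diag : set (V * V)%type := [set p | norm3 (sub3 p.1 p.2) = 0].

Lemma measurable_rel : measurable_fun setT (fun p : V * V => sub3 p.1 p.2).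
Proof. by apply: measurable_sub3; [exact: measurable_fst|exact: measurable_snd]. Qed.

Lemma measurable_diag : measurable diag.
Proof.
have -> : diag = (fun p => norm3 (sub3 p.1 p.2)) @^-1` [set 0] by [].
rewrite -[X in measurable X]setTI.
by apply: (measurable_norm3 measurable_rel measurableT); exact: measurable_set1.
Qed.

Lemma norm3_eq0 (x : V) : norm3 x = 0 -> x = 0 :> V.
Proof.
move=> h; apply: v3P => i; have := cd_norm3 i x; rewrite h normr_le0 => /eqP ->.
by case: i.
Qed.

Lemma diagP (p : V * V) : diag p -> p.2 = p.1.
Proof. by rewrite /diag /= => /norm3_eq0; rewrite sub3E => /subr0_eq. Qed.

Lemma L1_diag : L1 m2 (\1_diag) /\ RI m2 (\1_diag) = 0.
Proof.
have S v w : \1_diag (v, w) = \1_[set v] w :> R.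
  rewrite !indicE; congr (_%:R); congr nat_of_bool; apply/idP/idP => /set_mem h; apply/mem_set.
    exact: (diagP h).
  by rewrite h /diag /= sub3E subrr /norm3 /dot3 /v3x /v3y /v3z /= !mulr0 !addr0 sqrtr0.
have [||||L ->] := @tonelli_x _ _ _ _ R mu mu (\1_diag) (fun=> 0) _ (fun z => ltac:(by rewrite indicE)).
- by apply: measurable_indr; exact: measurable_diag.
- by move=> v; apply: L1_eq (L1_point v).1 => w; rewrite S.
- by move=> v; rewrite -(L1_point v).2; apply: RI_eq => w; rewrite S.
- exact: L1_0.
by rewrite RI0.
Qed.

(** [rel_dir v v] is the zero vector. An arbitrary unit vector on the diagonal makes the angular
    integral of the kernel the same for all pairs. *)
Definition kdir (v w : V) : V := if norm3 (sub3 v w) == 0 then ee ax3 else rel_dir v w.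

Lemma kdir_unit v w : dot3 (kdir v w) (kdir v w) = 1.
Proof.
rewrite /kdir; case: eqP => [_|/eqP n0]; first by rewrite dot3E /sum3 !cd_ee; ring.
by rewrite /rel_dir dotZl dotC dotZl -norm3_sqr expr2 mulKf// mulVf.
Qed.

Lemma measurable_kdir : measurable_fun setT (fun p : V * V => kdir p.1 p.2).
Proof.
apply: measurable_fun_if => //.
- have := measurable_diag; rewrite /diag => m.
  apply: (@measurable_fun_bool _ _ setT _ true); rewrite setTI.
  rewrite (_ : _ @^-1` _ = [set p : V * V | norm3 (sub3 p.1 p.2) = 0])//.
  by apply/seteqP; split => p /=; [move=> /eqP|move=> ->; rewrite eqxx].
- apply: measurable_funTS; apply: measurable_scale3; last exact: measurable_rel.
  by apply: measurable_invr; apply: measurable_norm3; exact: measurable_rel.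
Qed.

Definition ker (G : R -> R) (z : V * V * V) : R := ball_avg G (kdir z.1.1 z.1.2) z.2.

Lemma measurable_ker G : measurable_fun setT G -> measurable_fun setT (ker G).
Proof.
move=> mG; apply: (measurable_ball_avg mG _ (@measurable_snd _ _ _ _)).
exact: (measurableT_comp measurable_kdir measurable_fst).
Qed.

Section KerIntegral.
Variables (G : R -> R).
Hypotheses (mG : measurable_fun setT G) (LG : L1 mu (ball_avg G (ee ax3))).
Let cG := RI mu (ball_avg G (ee ax3)).

Lemma ker_section p : L1 mu (fun y => ker G (p, y)) /\ RI mu (fun y => ker G (p, y)) = cG.
Proof. exact: (ball_rotation mG (kdir_unit p.1 p.2) LG). Qed.

(** By rotation invariance the integral in [y] is [cG] for every pair, so it factors out. *)
Lemma ker_tensor_ge0 (F : V * V -> R) : (forall s, 0 <= G s) -> (forall p, 0 <= F p) -> L1 m2 F ->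
  L1 m3 (fun z => ker G z * F z.1) /\ RI m3 (fun z => ker G z * F z.1) = cG * RI m2 F.
Proof.
move=> G0 F0 LF; rewrite -RIZl//.
apply: (@tonelli_x _ _ _ _ R m2 mu).
- apply: measurable_funM; first exact: measurable_ker.
  exact: (measurableT_comp (L1_meas LF) measurable_fst).
- by move=> z; rewrite mulr_ge0// mulr_ge0// indicE.
- move=> p; have [L _] := ker_section p.
  by apply: L1_eq (L1Zl (F p) L) => y; rewrite mulrC.
- move=> p; have [L <-] := ker_section p; rewrite -[RHS]mulrC -RIZl//.
  by apply: RI_eq => y; rewrite mulrC.
- exact: L1Zl.
Qed.

End KerIntegral.

Lemma ker_bound (G : R -> R) (F : V * V * V -> R) (K : V * V -> R) :
  measurable_fun setT G -> L1 mu (ball_avg G (ee ax3)) -> (forall s, 0 <= G s) ->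
  measurable_fun setT F -> L1 m2 K -> (forall z, `|F z| <= K z.1) ->
  L1 m3 (fun z => ker G z * F z).
Proof.
move=> mG LG G0 mF LK FK.
have K0 p : 0 <= K p by apply: le_trans (FK (p, p.1)).
have [L _] := ker_tensor_ge0 mG LG G0 K0 LK.
apply: L1_dom L; first by apply: measurable_funM => //; exact: measurable_ker.
move=> z; rewrite normrM ger0_norm; last by rewrite mulr_ge0// indicE.
by apply: ler_wpM2l (FK z); rewrite mulr_ge0// indicE.
Qed.

End CollisionMeasure.

Section Kernel.
Context {R : realType}.
Local Notation V := (V3 R).
Local Notation leb := (@leb1 R).
Local Notation mu := (@mu3 R).
Variable B : R -> R.
Hypothesis hB : kernel_hyp B.

(** [kernel_hyp] leaves [B] free outside [[-1, 1]]; extension by 0 gives an even, nonnegative,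
    measurable function on the whole line. *)
Definition Bc (s : R) : R := B s * \1_(`[-1, 1]%classic) s.

Lemma BcE s : -1 <= s <= 1 -> Bc s = B s.
Proof. by move=> h; rewrite /Bc indicE mem_set ?mulr1//= in_itv. Qed.

Lemma Bc_out s : ~~ (-1 <= s <= 1) -> Bc s = 0.
Proof. by move=> h; rewrite /Bc indicE memNset ?mulr0//= in_itv; exact/negP. Qed.

Lemma Bc_ge0 s : 0 <= Bc s.
Proof.
have [h|h] := boolP (-1 <= s <= 1); last by rewrite Bc_out.
by rewrite BcE// ltW//; case: hB => h1 _; exact: h1.
Qed.

Lemma BcN s : Bc (- s) = Bc s.
Proof.
have E : (-1 <= - s <= 1) = (-1 <= s <= 1).
  by rewrite lerN2 lerNl andbC.
have [h|h] := boolP (-1 <= s <= 1); last by rewrite !Bc_out// E.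
by rewrite !BcE ?E//; case: hB => _ [_ [h3 _]]; exact: h3.
Qed.

Lemma Bc_L1 : L1 leb Bc /\ RI leb Bc = 2.
Proof.
case: hB => _ [h2 [_ h4]].
have [L E] := L1_leb1_on (measurable_itv `[-1, 1]%R) h2.
split; first exact: L.
by move: h4; rewrite E => -[].
Qed.

Lemma Bc_ball : L1 mu (ball_avg Bc (ee ax3)) /\ RI mu (ball_avg Bc (ee ax3)) = 4 * pi / 3.
Proof.
have [L E] := Bc_L1.
have [L' ->] := archimedes (L1_meas L) Bc_ge0 BcN Bc_out L.
by rewrite E; split => //; rewrite mulrC !mulrA; congr (_ * _ / _); rewrite -natrM.
Qed.

Lemma measurable_Bc : measurable_fun setT Bc.
Proof. exact: L1_meas Bc_L1.1. Qed.

Section CollInt.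
Variables (f : V -> R) (psi : V -> V -> V -> R) (C : R).
Hypotheses (f0 : forall v, 0 <= f v) (Lf : L1 mu f).
Let Psi (z : V * V * V) := psi z.1.1 z.1.2 (hat z.2).
Hypotheses (mPsi : measurable_fun setT Psi) (bPsi : forall v w n, `|psi v w n| <= C).

Lemma L1_ff : L1 (@m2 R) (fun p => f p.1 * f p.2).
Proof. exact: (L1_tensor Lf Lf).1. Qed.

(** The iterated extended integrals become one real integral on the product space. The factor 3 is
    that of the cone measure; [rel_dir] and [kdir] differ on the diagonal only, which is null. *)
Lemma coll_int_RI : coll_int B f psi =
  ((4 * pi)^-1 * (3 * RI m3 (fun z => ker Bc z * (f z.1.1 * f z.1.2 * Psi z))))%:E.
Proof.
have mff : measurable_fun setT (fun z : V * V * V => f z.1.1 * f z.1.2 * Psi z).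
  apply: measurable_funM => //; exact: (measurableT_comp (L1_meas L1_ff) measurable_fst).
have C0 : 0 <= C by apply: le_trans (bPsi 0 0 0).
have bff z : `|f z.1.1 * f z.1.2 * Psi z| <= C * (f z.1.1 * f z.1.2).
  rewrite normrM mulrC [X in _ * X]ger0_norm ?mulr_ge0//.
  by apply: ler_wpM2r; [rewrite mulr_ge0|exact: bPsi].
have [LB EB] := Bc_ball.
have LF0 : L1 m3 (fun z => ker Bc z * (f z.1.1 * f z.1.2 * Psi z)).
  exact: (@ker_bound _ _ _ (fun p => C * (f p.1 * f p.2)) measurable_Bc LB Bc_ge0 mff (L1Zl C L1_ff) bff).
pose F (z : V * V * V) := ball_avg Bc (rel_dir z.1.1 z.1.2) z.2 * (f z.1.1 * f z.1.2 * Psi z).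
have mF : measurable_fun setT F.
  apply: measurable_funM mff; apply: measurable_ball_avg; [exact: measurable_Bc| |exact: measurable_snd].
  have mr : measurable_fun setT (fun z : V * V * V => sub3 z.1.1 z.1.2).
    exact: (measurableT_comp (@measurable_rel R) measurable_fst).
  by apply: measurable_scale3 => //; apply: measurable_invr; exact: measurable_norm3.
have Nn : @m3 R ((fst @^-1` diag) `&` (snd @^-1` uball)) = 0%E.
  have [L E] := L1_tensor L1_diag.1 (@ball_volume R).1.
  rewrite L1_diag.2 mul0r in E.
  have mN : measurable ((fst @^-1` diag) `&` (snd @^-1` uball) : set (V * V * V)%type).
    apply: measurableI; rewrite -[X in measurable X]setTI.
      by apply: (measurable_fst measurableT); exact: measurable_diag.
    by apply: (measurable_snd measurableT); exact: measurable_nball.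
  have H (z : V * V * V) : \1_diag z.1 * \1_uball z.2 = \1_((fst @^-1` diag) `&` (snd @^-1` uball)) z :> R.
    rewrite !indicE -natrM mulnb; congr (_%:R); congr nat_of_bool.
    apply/idP/idP => [/andP[/set_mem h1 /set_mem h2]|/set_mem[h1 h2]]; first exact/mem_set.
    by rewrite !mem_set.
  refine (etrans (measure_indic mN (L1_eq H L)) _); congr EFin.
  by rewrite -E; apply: RI_eq => z; rewrite H.
have [|LF EF] := @L1_ae _ _ _ m3 _ F mF _ LF0.
  exists ((fst @^-1` diag) `&` (snd @^-1` uball)); split => //.
    apply: measurableI; rewrite -[X in measurable X]setTI.
      by apply: (measurable_fst measurableT); exact: measurable_diag.
    by apply: (measurable_snd measurableT); exact: measurable_nball.
  move=> z /= nz; apply: contrapT => h; apply: nz; rewrite /F /ker /kdir.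
  case: eqP => // e; have hb : ~ uball z.2 by move=> hb; apply: h; split.
  by rewrite /ball_avg !indicE !memNset// !mul0r.
rewrite -EF.
have rd v w y : -1 <= dot3 (hat y) (rel_dir v w) <= 1.
  have [n0|n0] := eqVneq (norm3 (sub3 v w)) 0.
    by rewrite /rel_dir n0 invr0 dotC dotZl mul0r lerN10 ler01.
  by apply: hat_dot_itv; have := kdir_unit v w; rewrite /kdir (negbTE n0).
have Ls p : L1 mu (fun y => ball_avg Bc (rel_dir p.1 p.2) y).
  have [n0|n0] := eqVneq (norm3 (sub3 p.1 p.2)) 0.
    apply: L1_eq (L1Zl (Bc 0) (@ball_volume R).1) => y; rewrite /ball_avg /rel_dir n0 invr0.
    by rewrite [dot3 (hat y) _]dotC dotZl mul0r mulrC.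
  have [] := ball_rotation (k := rel_dir p.1 p.2) measurable_Bc _ LB => //.
  by have := kdir_unit p.1 p.2; rewrite /kdir (negbTE n0).
(* Every section has to be bounded, those on the diagonal included, where [rel_dir] is 0; the second
   summand is for them. *)
pose M : R := 4 * pi / 3 + `|RI mu (ball_avg Bc (scale3 0 (ee ax3)))|.
have Mb p : RI mu (fun y => ball_avg Bc (rel_dir p.1 p.2) y) <= M.
  have [n0|n0] := eqVneq (norm3 (sub3 p.1 p.2)) 0.
    apply: ler_wpDl; first by rewrite divr_ge0// mulr_ge0// pi_ge0.
    apply: le_trans (ler_norm _); rewrite le_eqVlt; apply/orP; left; apply/eqP.
    apply: RI_eq => y; rewrite /ball_avg /rel_dir n0 invr0.
    by rewrite ![dot3 (hat y) _]dotC !dotZl !mul0r.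
  have [|_ E] := ball_rotation (k := rel_dir p.1 p.2) measurable_Bc _ LB.
    by have := kdir_unit p.1 p.2; rewrite /kdir (negbTE n0).
  by rewrite E EB lerDl.
have FB p y : `|F (p, y)| <= (C * (f p.1 * f p.2)) * ball_avg Bc (rel_dir p.1 p.2) y.
  have b0 : 0 <= ball_avg Bc (rel_dir p.1 p.2) y by apply: mulr_ge0 (Bc_ge0 _); rewrite indicE.
  rewrite /F /= normrM (ger0_norm b0) mulrC; apply: ler_wpM2r => //.
  exact: (bff (p, y)).
have LFs p : L1 mu (fun y => F (p, y)).
  apply: (@L1_dom _ _ _ _ _ (fun y => (C * (f p.1 * f p.2)) * ball_avg Bc (rel_dir p.1 p.2) y)).
  - exact: measurable_xsec mF.
  - exact: FB.
  - exact: L1Zl.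
have [LH EH] := fubini_x LF LFs.
set H := (fun p => RI mu (fun y => F (p, y))) in LH EH.
have Hb p : `|H p| <= (C * M) * (f p.1 * f p.2).
  apply: (@le_trans _ _ (RI mu (fun y => (C * (f p.1 * f p.2)) * ball_avg Bc (rel_dir p.1 p.2) y))).
    apply: RI_abs; [exact: measurable_xsec mF|exact: L1Zl|].
    exact: FB.
  rewrite (RIZl _ (Ls p)) [leRHS]mulrAC; apply: ler_wpM2l; last exact: Mb.
  by rewrite !mulr_ge0.
have LHv v : L1 mu (fun w => H (v, w)).
  apply: (@L1_dom _ _ _ _ _ (fun w => (C * M * f v) * f w)); last exact: L1Zl.
    exact: (measurable_xsec v (L1_meas LH)).
  by move=> w; rewrite -mulrA; exact: (Hb (v, w)).
have [LHH EHH] := fubini_x LH LHv.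
rewrite EH EHH /coll_int EFinM; congr (_ * _)%E.
have inner v w : sphere_int (fun n => (B (dot3 n (rel_dir v w)) * f v * f w * psi v w n)%:E) = (3 * H (v, w))%:E.
  rewrite /sphere_int EFinM; congr (_ * _)%E.
  have [L' E'] := L1_leb (LFs (v, w)); rewrite /H -E' -RI_E//.
  rewrite [LHS]integral_mkcond; apply: eq_integral => y _; rewrite patchE; case: ifPn => hy.
    rewrite /F /ball_avg /= indicE hy mul1r BcE ?rd//; congr EFin; rewrite /Psi /= -/(hat y); ring.
  by rewrite /F /ball_avg /= indicE (negbTE hy) !mul0r.
have middle v : (\int[@leb3 R]_w sphere_int (fun n => (B (dot3 n (rel_dir v w)) * f v * f w * psi v w n)%:E) =
   (3 * RI mu (fun w => H (v, w)))%:E)%E.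
  under eq_integral do rewrite inner.
  have [L' E'] := L1_leb (L1Zl 3 (LHv v)); rewrite (RI_E L') E' RIZl//.
under eq_integral do rewrite middle.
by have [L' E'] := L1_leb (L1Zl 3 LHH); rewrite (RI_E L') E' RIZl.
Qed.

End CollInt.
End Kernel.

(** * Iterated integrals and integration by parts in one variable *)

Section IteratedIntegrals.
Context {R : realType}.
Local Notation V := (V3 R).
Local Notation mu := (@mu3 R).
Local Notation T3 := (V * V * V)%type.

Lemma L1_tensor3 (K1 K2 k : V -> R) : L1 mu K1 -> L1 mu K2 -> L1 mu k ->
  L1 m3 (fun z : T3 => K1 z.1.1 * K2 z.1.2 * k z.2) /\
  RI m3 (fun z : T3 => K1 z.1.1 * K2 z.1.2 * k z.2) = RI mu K1 * RI mu K2 * RI mu k.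
Proof.
move=> L1K L2K Lk; have [L12 E12] := L1_tensor L1K L2K.
by have [L E] := L1_tensor L12 Lk; split; [exact: L|rewrite -E12].
Qed.

Section Dominated.
Variables (F : T3 -> R) (K1 K2 k : V -> R).
Hypotheses (mF : measurable_fun setT F) (LK1 : L1 mu K1) (LK2 : L1 mu K2) (Lk : L1 mu k).
Hypothesis FK : forall z, `|F z| <= K1 z.1.1 * K2 z.1.2 * k z.2.

Lemma L1_dom3 : L1 m3 F.
Proof. exact: L1_dom mF FK (L1_tensor3 LK1 LK2 Lk).1. Qed.

Lemma L1_sec12 y : L1 (@m2 R) (fun p => F (p, y)).
Proof.
apply: (@L1_dom _ _ _ _ _ (fun p => k y * (K1 p.1 * K2 p.2))); first exact: measurable_ysec mF.
- by move=> p; rewrite mulrC; exact: (FK (p, y)).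
- by apply: L1Zl; exact: (L1_tensor LK1 LK2).1.
Qed.

Lemma L1_sec1 w y : L1 mu (fun v => F (v, w, y)).
Proof.
apply: (@L1_dom _ _ _ _ _ (fun v => (K2 w * k y) * K1 v)).
- exact: (measurable_ysec w (measurable_ysec y mF)).
- by move=> v; apply: (le_trans (FK (v, w, y))); rewrite /= -mulrA mulrC.
- exact: L1Zl.
Qed.

Lemma L1_sec2 v y : L1 mu (fun w => F (v, w, y)).
Proof.
apply: (@L1_dom _ _ _ _ _ (fun w => (K1 v * k y) * K2 w)).
- exact: (measurable_xsec v (measurable_ysec y mF)).
- by move=> w; apply: (le_trans (FK (v, w, y))); rewrite /= mulrAC.
- exact: L1Zl.
Qed.

Lemma L1_sec3 p : L1 mu (fun y => F (p, y)).
Proof.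
apply: (@L1_dom _ _ _ _ _ (fun y => (K1 p.1 * K2 p.2) * k y)).
- exact: measurable_xsec mF.
- by move=> y; exact: (FK (p, y)).
- exact: L1Zl.
Qed.

Lemma RI3_v : RI m3 F = RI mu (fun y => RI mu (fun w => RI mu (fun v => F (v, w, y)))).
Proof.
have [_ E] := fubini_y L1_dom3 L1_sec12; refine (etrans E _); apply: RI_eq => y.
have [_ E'] := fubini_y (L1_sec12 y) (fun w => L1_sec1 w y); exact: E'.
Qed.

Lemma RI3_w : RI m3 F = RI mu (fun y => RI mu (fun v => RI mu (fun w => F (v, w, y)))).
Proof.
have [_ E] := fubini_y L1_dom3 L1_sec12; refine (etrans E _); apply: RI_eq => y.
have [_ E'] := fubini_x (L1_sec12 y) (fun v => L1_sec2 v y); exact: E'.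
Qed.

Lemma RI3_y : RI m3 F = RI (@m2 R) (fun p => RI mu (fun y => F (p, y))).
Proof. by have [_ E] := fubini_x L1_dom3 L1_sec3; exact: E. Qed.

End Dominated.

Lemma ee_norm i : norm3 (@ee R i) = 1.
Proof.
have e1 : dot3 (@ee R i) (ee i) = 1 by rewrite dot3E /sum3; case: i; rewrite !cd_ee; ring.
by rewrite /norm3 e1 sqrtr1.
Qed.

(** By translation invariance the integral of the translate by [s] is constant in [s], and its
    derivative at 0 is [RI dPhi]. *)
Lemma RI_isD0 (Phi dPhi : V -> R) i C C' : measurable_fun setT Phi ->
  (forall x, `|Phi x| <= C * \1_uball x) -> (forall x, `|dPhi x| <= C') ->
  (forall x, isD Phi x (ee i) (dPhi x)) -> L1 mu dPhi /\ RI mu dPhi = 0.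
Proof.
move=> mP bP bd dP.
have LP : L1 mu Phi by apply: L1_dom (L1Zl C (@ball_volume R).1).
have Lsh (s : R) := RI_shift (scale3 s (ee i)) LP.
have lip (x : V) (s : R) : `|Phi (add3 x (scale3 s (ee i))) - Phi x| <= C' * `|s|.
  have := lipschitz_bound 0 s (isD_line x dP) (fun t => bd _).
  by rewrite add3_0 subr0.
have C0 : 0 <= C' by exact: le_trans (bd 0).
have [||||L] := @isd_RI _ _ _ mu (fun s x => Phi (add3 x (scale3 s (ee i)))) dPhi (fun x => C' * \1_(box 3) x) 0.
- by move=> s; exact: (Lsh s).1.
- by apply: L1Zl; exact: L1_box.
- move=> t x; rewrite subr0 add3_0 => t1.
  have [hb|hb] := pselect (box 3 x).
    by rewrite indic_in// mulr1 mulrC; exact: lip.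
  have P0 y : ~ uball y -> Phi y = 0.
    by move=> hy; apply/eqP; rewrite -normr_le0; apply: le_trans (bP y) _; rewrite indic_out// mulr0.
  have out (s : R) : `|s| <= 1 -> Phi (add3 x (scale3 s (ee i))) = 0.
    move=> s1; apply: P0 => hu; apply: hb => l.
    have hl := le_trans (cd_norm3 l _) hu; rewrite cdD cdZ in hl.
    have -> : cd l x = (cd l x + s * cd l (ee i)) - s * cd l (ee i) by rewrite addrK.
    have he : `|s * cd l (ee i)| <= 1.
      by rewrite normrM mulr_ile1//; have := cd_norm3 l (@ee R i); rewrite ee_norm.
    apply: (le_lt_trans (ler_normB _ _)); move: hl he; move: `|_ + _| `|_ * _| => p q; lra.
  by rewrite out// -{1}(add3_0 x (ee i)) out ?normr0// subrr normr0 !mulr_ge0// indicE.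
- move=> x; exact: dP.
move=> H; split => //.
have H0 : isd (fun s : R => RI mu (fun x => Phi (add3 x (scale3 s (ee i))))) 0 0.
  by refine (isd_eq (isd_cst (RI mu Phi) 0) _ erefl) => s; rewrite (Lsh s).2.
exact: isd_uniq H H0.
Qed.

Section IntegrationByParts.
Variables (f : V -> R) (h : axis -> V -> R).
Hypotheses (f0 : forall v, 0 <= f v) (Lf : L1 mu f).
Let a v := Num.sqrt (f v).
Hypotheses (Lh : forall i, L2 mu (h i)) (wh : forall i, weak_deriv a (h i) i).
Let La : L2 mu a := sqrt_L2 f0 Lf.
Let a2 v : a v ^+ 2 = f v. Proof. by rewrite sqr_sqrtr. Qed.
Variables (i : axis) (Phi dPhi : T3 -> R) (C : R).
Hypotheses (mPhi : measurable_fun setT Phi) (mdPhi : measurable_fun setT dPhi).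
Hypotheses (bPhi : forall z, `|Phi z| <= C * \1_uball z.2) (bdPhi : forall z, `|dPhi z| <= C * \1_uball z.2).

Lemma L1_ah : L1 mu (fun v => 2 * a v * h i v).
Proof. by apply: L1_eq (L1Zl 2 (L2_mul La (Lh i))) => v; rewrite mulrA. Qed.

Let kk (y : V) := C * \1_uball y.
Let Lk : L1 mu (fun y => C * \1_uball y).
Proof. by apply: L1Zl; exact: (@ball_volume R).1. Qed.

Let C1 (y : V) : C * \1_uball y <= `|C|.
Proof. by rewrite indicE; case: (_ \in _); rewrite ?mulr1 ?mulr0 ?ler_norm. Qed.

Let mff : measurable_fun setT (fun z : T3 => f z.1.1 * f z.1.2).
Proof. exact: (measurableT_comp (L1_meas (L1_tensor Lf Lf).1) measurable_fst). Qed.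

Lemma ff_dom (F : T3 -> R) : measurable_fun setT F -> (forall z, `|F z| <= C * \1_uball z.2) ->
  measurable_fun setT (fun z => f z.1.1 * f z.1.2 * F z) /\
  forall z, `|f z.1.1 * f z.1.2 * F z| <= f z.1.1 * f z.1.2 * (C * \1_uball z.2).
Proof.
move=> mF bF; split; first exact: measurable_funM.
by move=> z; rewrite normrM [X in X * _]ger0_norm ?mulr_ge0//; apply: ler_wpM2l; rewrite ?mulr_ge0.
Qed.

(** For fixed [w] and [y] this is [weak_square] in [v]; domination by a product of functions of one
    variable each allows integration in this order. *)
Lemma ibp_v : (forall v w y, isD (fun v => Phi (v, w, y)) v (ee i) (dPhi (v, w, y))) ->
  [/\ L1 m3 (fun z => f z.1.1 * f z.1.2 * dPhi z),
      L1 m3 (fun z => 2 * a z.1.1 * h i z.1.1 * f z.1.2 * Phi z) &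
      RI m3 (fun z => f z.1.1 * f z.1.2 * dPhi z) =
        - RI m3 (fun z => 2 * a z.1.1 * h i z.1.1 * f z.1.2 * Phi z)].
Proof.
move=> dP; have [m1 b1] := ff_dom mdPhi bdPhi.
have m2' : measurable_fun setT (fun z : T3 => 2 * a z.1.1 * h i z.1.1 * f z.1.2 * Phi z).
  apply: measurable_funM => //.
  exact: (measurableT_comp (L1_meas (L1_tensor L1_ah Lf).1) measurable_fst).
have b2 z : `|2 * a z.1.1 * h i z.1.1 * f z.1.2 * Phi z| <=
    `|2 * a z.1.1 * h i z.1.1| * f z.1.2 * (C * \1_uball z.2).
  rewrite normrM [X in X * _]normrM [`|f _|]ger0_norm//.
  by apply: ler_wpM2l; rewrite ?mulr_ge0.
have La' := L1_abs L1_ah.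
split; [exact: L1_dom3 m1 Lf Lf Lk b1|exact: L1_dom3 m2' La' Lf Lk b2|].
rewrite (RI3_v m1 Lf Lf Lk b1) (RI3_v m2' La' Lf Lk b2).
rewrite -mulN1r -RIZl; last first.
  have [L _] := fubini_y (L1_dom3 m2' La' Lf Lk b2) (L1_sec12 (k := kk) m2' La' Lf b2).
  apply: L1_eq L => y.
  by have [_ E] := fubini_y (L1_sec12 (k := kk) m2' La' Lf b2 y) (fun w => L1_sec1 (k := kk) m2' La' b2 w y); exact: E.
apply: RI_eq => y; rewrite mulN1r -RIN; last first.
  by have [L _] := fubini_y (L1_sec12 (k := kk) m2' La' Lf b2 y) (fun w => L1_sec1 (k := kk) m2' La' b2 w y).
apply: RI_eq => w /=.
have mP : measurable_fun setT (fun v => Phi (v, w, y)) := measurable_ysec w (measurable_ysec y mPhi).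
have ws := weak_square La (Lh i) (@wh i) mP (fun v => le_trans (bPhi (v, w, y)) (C1 y))
  (fun v => le_trans (bdPhi (v, w, y)) (C1 y)) (fun v => dP v w y).
have Ld : L1 mu (fun v => a v ^+ 2 * dPhi (v, w, y)).
  apply: L1_eq (L1_bd Lf (measurable_ysec w (measurable_ysec y mdPhi)) (fun v => le_trans (bdPhi (v, w, y)) (C1 y))) => v.
  by rewrite a2.
have Lp : L1 mu (fun v => 2 * a v * h i v * Phi (v, w, y)).
  exact: (L1_bd L1_ah mP (fun v => le_trans (bPhi (v, w, y)) (C1 y))).
transitivity (f w * RI mu (fun v => a v ^+ 2 * dPhi (v, w, y))).
  by rewrite -RIZl//; apply: RI_eq => v; rewrite a2; ring.
rewrite ws mulrN -RIZl//; congr (- _); apply: RI_eq => v; ring.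
Qed.

Lemma ibp_w : (forall v w y, isD (fun w => Phi (v, w, y)) w (ee i) (dPhi (v, w, y))) ->
  [/\ L1 m3 (fun z => f z.1.1 * f z.1.2 * dPhi z),
      L1 m3 (fun z => 2 * a z.1.2 * h i z.1.2 * f z.1.1 * Phi z) &
      RI m3 (fun z => f z.1.1 * f z.1.2 * dPhi z) =
        - RI m3 (fun z => 2 * a z.1.2 * h i z.1.2 * f z.1.1 * Phi z)].
Proof.
move=> dP; have [m1 b1] := ff_dom mdPhi bdPhi.
have m2' : measurable_fun setT (fun z : T3 => 2 * a z.1.2 * h i z.1.2 * f z.1.1 * Phi z).
  apply: measurable_funM => //.
  have := measurableT_comp (L1_meas (L1_tensor Lf L1_ah).1) (@measurable_fst _ _ (V * V)%type V).
  by apply: eq_measurable_fun => z _ /=; rewrite mulrC.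
have b2 z : `|2 * a z.1.2 * h i z.1.2 * f z.1.1 * Phi z| <=
    f z.1.1 * `|2 * a z.1.2 * h i z.1.2| * (C * \1_uball z.2).
  rewrite normrM [X in X * _]normrM [`|f _|]ger0_norm// [X in X * _ <= _]mulrC.
  by apply: ler_wpM2l; rewrite ?mulr_ge0.
have La' := L1_abs L1_ah.
split; [exact: L1_dom3 m1 Lf Lf Lk b1|exact: L1_dom3 m2' Lf La' Lk b2|].
rewrite (RI3_w m1 Lf Lf Lk b1) (RI3_w m2' Lf La' Lk b2).
rewrite -mulN1r -RIZl; last first.
  have [L _] := fubini_y (L1_dom3 m2' Lf La' Lk b2) (L1_sec12 (k := kk) m2' Lf La' b2).
  apply: L1_eq L => y.
  by have [_ E] := fubini_x (L1_sec12 (k := kk) m2' Lf La' b2 y) (fun v => L1_sec2 (k := kk) m2' La' b2 v y); exact: E.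
apply: RI_eq => y; rewrite mulN1r -RIN; last first.
  by have [L _] := fubini_x (L1_sec12 (k := kk) m2' Lf La' b2 y) (fun v => L1_sec2 (k := kk) m2' La' b2 v y).
apply: RI_eq => v /=.
have mP : measurable_fun setT (fun w => Phi (v, w, y)) := measurable_xsec v (measurable_ysec y mPhi).
have ws := weak_square La (Lh i) (@wh i) mP (fun w => le_trans (bPhi (v, w, y)) (C1 y))
  (fun w => le_trans (bdPhi (v, w, y)) (C1 y)) (fun w => dP v w y).
have Ld : L1 mu (fun w => a w ^+ 2 * dPhi (v, w, y)).
  apply: L1_eq (L1_bd Lf (measurable_xsec v (measurable_ysec y mdPhi)) (fun w => le_trans (bdPhi (v, w, y)) (C1 y))) => w.
  by rewrite a2.
have Lp : L1 mu (fun w => 2 * a w * h i w * Phi (v, w, y)).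
  exact: (L1_bd L1_ah mP (fun w => le_trans (bPhi (v, w, y)) (C1 y))).
transitivity (f v * RI mu (fun w => a w ^+ 2 * dPhi (v, w, y))).
  by rewrite -RIZl//; apply: RI_eq => w; rewrite a2; ring.
rewrite ws mulrN -RIZl//; congr (- _); apply: RI_eq => w; ring.
Qed.

(** The density does not depend on [y], so a derivative in [y] integrates to 0. *)
Lemma ibp_y : (forall v w y, isD (fun y => Phi (v, w, y)) y (ee i) (dPhi (v, w, y))) ->
  L1 m3 (fun z => f z.1.1 * f z.1.2 * dPhi z) /\ RI m3 (fun z => f z.1.1 * f z.1.2 * dPhi z) = 0.
Proof.
move=> dP; have [m1 b1] := ff_dom mdPhi bdPhi.
split; first exact: L1_dom3 m1 Lf Lf Lk b1.
rewrite (RI3_y m1 Lf Lf Lk b1) -[RHS](RI0 (@m2 R)); apply: RI_eq => -[v w] /=.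
have [L E] := RI_isD0 (measurable_xsec (v, w) mPhi) (fun y => bPhi (v, w, y))
  (fun y => le_trans (bdPhi (v, w, y)) (C1 y)) (fun y => dP v w y).
by rewrite RIZl// E mulr0.
Qed.

End IntegrationByParts.
End IteratedIntegrals.

(** * Integration by parts along the collision field *)

Section Cutoffs.
Context {R : realType}.
Implicit Types (eps x : R).

Lemma isd_measurable (f df : R -> R) : (forall x, isd f x (df x)) ->
  measurable_fun setT f /\ measurable_fun setT df.
Proof.
move=> d; have cf : continuous f by move=> x; exact: isd_continuous (d x).
have mf : measurable_fun setT f by exact: continuous_measurable_fun.
split => //; apply: (@measurable_isd _ R R (fun t x => f (t + x)) df 0).
  move=> t; apply: (measurableT_comp mf); apply: measurable_funD; first exact: measurable_cst.
  exact: measurable_id.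
move=> x; apply: isd_eq (isd_shift (c := x) (d := df x) _) _ _ => //.
by rewrite add0r.
Qed.

(** The square makes the positive part C^1, which is all that the cut-offs need. *)
Definition sqpos x := Num.max x 0 ^+ 2.

Lemma isd_sqpos x : isd sqpos x (2 * Num.max x 0).
Proof.
apply: isd_dist => e e0; exists e => // h he; rewrite /sqpos.
apply: (@le_trans _ _ (h ^+ 2)).
  have [x0|x0] := leP 0 x; have [y0|y0] := leP 0 (x + h);
    rewrite ?(max_l x0) ?(max_l y0) ?(max_r (ltW x0)) ?(max_r (ltW y0)) ler_norml !expr2; apply/andP; split; nra.
by rewrite -real_normK ?num_real// expr2; apply: ler_wpM2r => //; exact: ltW.
Qed.

(* A [C^1] extension of the inverse function from [eps <= x]. *)
Definition rinv eps x := if eps <= x then x^-1 else 2 / eps - x / eps ^+ 2.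
Definition drinv eps x := if eps <= x then - x^-1 ^+ 2 else - (eps ^- 2).

Lemma isd_rinv eps x : 0 < eps -> isd (rinv eps) x (drinv eps x).
Proof.
move=> e0; have lin (y : R) : isd (fun t => 2 / eps - t / eps ^+ 2) y (- (eps ^- 2)).
  refine (isd_eq (isdB (isd_cst (2 / eps) y) (isdM (isd_id y) (isd_cst (eps ^- 2) y))) (fun=> erefl) _).
  by rewrite mul1r mulr0 addr0 sub0r.
have [h|h|h] := ltgtP x eps.
- rewrite /drinv leNgt h /=; apply: isd_near (lin x).
  have := @lt_nbhsl _ _ _ h; apply: filterS => y hy; by rewrite /rinv leNgt hy.
- have x0 : 0 < x by exact: lt_trans h.
  rewrite /drinv ltW//; apply: (@isd_near _ (fun y => y^-1)).
    have := @lt_nbhsr _ _ _ h; apply: filterS => y hy; by rewrite /rinv ltW.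
  refine (isd_eq (isdV (f := fun y => y) (lt0r_neq0 x0) (isd_id x)) (fun=> erefl) _).
  by rewrite exprVn mulN1r.
rewrite h /drinv lexx; apply: isd_dist => e e1; exists (e * eps ^+ 3).
  by rewrite mulr_gt0// exprn_gt0.
move=> k hk; rewrite /rinv lexx; have ne := lt0r_neq0 e0.
have [hl|hl] := leP eps (eps + k).
  have k0 : 0 <= k by move: hl; rewrite lerDl.
  have p0 : 0 < eps + k by rewrite ltr_wpDr.
  have -> : (eps + k)^-1 - eps^-1 - - eps^-1 ^+ 2 * k = k * (k / (eps ^+ 2 * (eps + k))).
    by field; rewrite ne gt_eqF.
  rewrite normrM mulrC; apply: ler_wpM2r => //.
  rewrite ger0_norm; last by rewrite divr_ge0// mulr_ge0// ?(ltW p0)// sqr_ge0.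
  rewrite ler_pdivrMr ?mulr_gt0 ?exprn_gt0//.
  apply: (le_trans (ler_norm k)); apply: (le_trans (ltW hk)); apply: ler_wpM2l; first exact: ltW.
  by rewrite exprSr; apply: ler_wpM2l; [exact: sqr_ge0|rewrite lerDl].
have -> : 2 / eps - (eps + k) / eps ^+ 2 - eps^-1 - - eps^-1 ^+ 2 * k = 0 by field.
by rewrite normr0 mulr_ge0// ltW.
Qed.

Lemma rinvE eps x : eps <= x -> rinv eps x = x^-1.
Proof. by rewrite /rinv => ->. Qed.

Lemma drinvE eps x : eps <= x -> drinv eps x = - rinv eps x ^+ 2.
Proof. by move=> h; rewrite rinvE// /drinv h. Qed.

Lemma rinv_bound eps x : 0 < eps -> 0 <= x -> `|rinv eps x| <= 2 / eps /\ `|drinv eps x| <= eps ^- 2.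
Proof.
move=> e0 x0; rewrite /rinv /drinv; have e2 : 0 < eps ^- 2 by rewrite invr_gt0 exprn_gt0.
have [h|h] := leP eps x.
  have xp : 0 < x by exact: lt_le_trans h.
  have hi : x^-1 <= eps^-1 by rewrite lef_pV2.
  have x1 : 0 <= x^-1 by rewrite invr_ge0.
  have e1 : 0 < eps^-1 by rewrite invr_gt0.
  split; first by rewrite ger0_norm//; lra.
  by rewrite normrN normrX ger0_norm// -exprVn; apply: lerXn2r; rewrite ?nnegrE// ltW.
split; last by rewrite normrN gtr0_norm.
have h2 : x / eps ^+ 2 <= eps^-1.
  by rewrite ler_pdivrMr ?exprn_gt0// expr2 mulKf ?lt0r_neq0// ltW.
have h3 : 0 <= x / eps ^+ 2 by rewrite divr_ge0// sqr_ge0.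
have e1 : 0 < eps^-1 by rewrite invr_gt0.
by rewrite ler_norml; apply/andP; split; lra.
Qed.

(** For positive [x] this is the square of the positive part of [1 - eps / x]: it vanishes up to
    [eps], tends to 1 as [eps] tends to 0, and its derivative is at most [2 / x] whatever [eps]
    is. *)
Definition cutlow eps x := sqpos (x - eps) * rinv eps x ^+ 2.
Definition dcutlow eps x := 2 * Num.max (x - eps) 0 * rinv eps x ^+ 2 +
  sqpos (x - eps) * (2 * rinv eps x * drinv eps x).

Lemma isd_cutlow eps x : 0 < eps -> isd (cutlow eps) x (dcutlow eps x).
Proof.
move=> e0; have r := isd_rinv x e0.
have s : isd (fun t => sqpos (t - eps)) x (2 * Num.max (x - eps) 0).
  by apply: isd_shift; exact: isd_sqpos.
have E t : sqpos (t - eps) * (rinv eps t * rinv eps t) = cutlow eps t by rewrite -expr2.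
refine (isd_eq (isdM s (isdM r r)) E _).
by rewrite /dcutlow expr2; ring.
Qed.

Lemma cutlow_le eps x : x <= eps -> cutlow eps x = 0 /\ dcutlow eps x = 0.
Proof.
move=> h; rewrite /cutlow /dcutlow /sqpos max_r ?subr_le0// expr0n /=.
by split; ring.
Qed.

Lemma cutlowE eps x : 0 < eps -> eps <= x ->
  cutlow eps x = (1 - eps / x) ^+ 2 /\ dcutlow eps x = 2 * (1 - eps / x) * (eps / x ^+ 2).
Proof.
move=> e0 h; have x0 : x != 0 by rewrite gt_eqF// (lt_le_trans e0).
rewrite /cutlow /dcutlow /sqpos max_l ?subr_ge0// drinvE// rinvE//.
by split; field.
Qed.

Lemma cutlow_itv eps x : 0 < eps -> 0 <= cutlow eps x <= 1.
Proof.
move=> e0; have [h|/ltW h] := leP x eps; first by rewrite (cutlow_le h).1 lexx ler01.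
have x0 : 0 < x by exact: lt_le_trans h.
have r0 : 0 < eps / x by rewrite divr_gt0.
have r1 : eps / x <= 1 by rewrite ler_pdivrMr// mul1r.
rewrite (cutlowE e0 h).1 sqr_ge0 expr_le1 ?subr_ge0//; lra.
Qed.

Lemma dcutlow_itv eps x : 0 < eps -> 0 < x -> 0 <= dcutlow eps x <= 2 / x /\
  dcutlow eps x <= 2 * eps / x ^+ 2.
Proof.
move=> e0 x0; have x2 : 0 < x^-1 by rewrite invr_gt0.
have e2 : 0 <= 2 * eps / x ^+ 2 by rewrite divr_ge0 ?sqr_ge0// mulr_ge0// ltW.
have [h|/ltW h] := leP x eps.
  by rewrite (cutlow_le h).2 lexx e2 divr_ge0// ltW.
have r0 : 0 < eps / x by rewrite divr_gt0.
have r1 : eps / x <= 1 by rewrite ler_pdivrMr// mul1r.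
rewrite (cutlowE e0 h).2.
have -> : 2 * (1 - eps / x) * (eps / x ^+ 2) = 2 * (1 - eps / x) * (eps / x) * x^-1.
  by field; rewrite gt_eqF.
have -> : 2 * eps / x ^+ 2 = 2 * (eps / x) * x^-1 by field; rewrite gt_eqF.
move: r0 r1 x2; move: (eps / x) x^-1 => r y r0 r1 y0; split; first (apply/andP; split).
- by apply: mulr_ge0; [apply: mulr_ge0; [lra|exact: ltW]|exact: ltW].
- by apply: ler_wpM2r; [exact: ltW|nra].
- by apply: ler_wpM2r; [exact: ltW|nra].
Qed.

Lemma cutlow_cvg (e : nat -> R) x : (forall n, 0 < e n) -> e n @[n --> \oo] --> 0 -> 0 < x ->
  cutlow (e n) x @[n --> \oo] --> (1 : R).
Proof.
move=> e0 ec x0.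
have c : (1 - e n / x) * (1 - e n / x) @[n --> \oo] --> (1 - 0 / x) * (1 - 0 / x).
  by apply: cvgM; (apply: cvgB; [exact: cvg_cst|apply: cvgM => //; exact: cvg_cst]).
rewrite mul0r subr0 mulr1 in c; apply: cvg_trans c; apply: near_eq_cvg.
have /cvgrPdist_lt /(_ _ x0) := ec; apply: filterS => n.
rewrite sub0r normrN => h; rewrite (cutlowE (e0 n) _).1 ?expr2//.
by apply: ltW; apply: le_lt_trans h; exact: ler_norm.
Qed.

(** Cut-offs to be applied to squared lengths: [cutY] keeps [|y|^2] between [eps] and [1 - eps],
    [cutR] keeps [|u|^2] between [eps] and [1 / eps]. *)
Definition cutY eps x := cutlow eps x * cutlow eps (1 - x).
Definition dcutY eps x := dcutlow eps x * cutlow eps (1 - x) - cutlow eps x * dcutlow eps (1 - x).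
Definition cutR eps x := cutlow eps x * sqpos (1 - eps * x).
Definition dcutR eps x := dcutlow eps x * sqpos (1 - eps * x) - cutlow eps x * (2 * eps * Num.max (1 - eps * x) 0).

Lemma isd_cutY eps x : 0 < eps -> isd (cutY eps) x (dcutY eps x).
Proof.
move=> e0; have s : isd (fun t : R => 1 - t) x (0 - 1) by apply: isdB; [exact: isd_cst|exact: isd_id].
refine (isd_eq (isdM (isd_cutlow x e0) (isd_comp s (isd_cutlow (1 - x) e0))) (fun=> erefl) _).
by rewrite /dcutY sub0r mulrN1 mulrN.
Qed.

Lemma isd_cutR eps x : 0 < eps -> isd (cutR eps) x (dcutR eps x).
Proof.
move=> e0; have s : isd (fun t : R => 1 - eps * t) x (0 - eps * 1) by apply: isdB; [exact: isd_cst|apply: isdZ; exact: isd_id].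
refine (isd_eq (isdM (isd_cutlow x e0) (isd_comp s (isd_sqpos (1 - eps * x)))) (fun=> erefl) _).
by rewrite /dcutR; ring.
Qed.

Lemma cutY_out eps x : (x <= eps) || (1 - eps <= x) -> cutY eps x = 0 /\ dcutY eps x = 0.
Proof.
move=> /orP[h|h]; rewrite /cutY /dcutY.
  by rewrite (cutlow_le h).1 (cutlow_le h).2 !mul0r subr0.
have h' : 1 - x <= eps by lra.
by rewrite (cutlow_le h').1 (cutlow_le h').2 !mulr0 subr0.
Qed.

Lemma cutR_out eps x : (x <= eps) || (1 <= eps * x) -> cutR eps x = 0 /\ dcutR eps x = 0.
Proof.
move=> /orP[h|h]; rewrite /cutR /dcutR.
  by rewrite (cutlow_le h).1 (cutlow_le h).2 !mul0r subr0.
by rewrite /sqpos max_r ?subr_le0// expr0n /= !mulr0 subr0.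
Qed.

Lemma sqpos_itv x : x <= 1 -> 0 <= sqpos x <= 1.
Proof.
move=> x1; rewrite /sqpos sqr_ge0 expr_le1 ?le_max ?lexx ?orbT//.
by rewrite ge_max x1 ler01.
Qed.

Lemma cutY_itv eps x : 0 < eps -> 0 <= cutY eps x <= 1.
Proof.
move=> e0; have /andP[a b] := cutlow_itv x e0; have /andP[c d] := cutlow_itv (1 - x) e0.
by rewrite /cutY mulr_ge0// mulr_ile1.
Qed.

Lemma cutR_itv eps x : 0 < eps -> 0 <= x -> 0 <= cutR eps x <= 1.
Proof.
move=> e0 x0; have /andP[a b] := cutlow_itv x e0.
have /andP[c d] : 0 <= sqpos (1 - eps * x) <= 1.
  by apply: sqpos_itv; rewrite gerBl mulr_ge0// ltW.
by rewrite /cutR mulr_ge0// mulr_ile1.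
Qed.

(** For [x = |u|^2] the first bound is uniform in [eps] and becomes an integrable majorant by
    [hardy]; the second tends to 0 with [eps]. Dominated convergence in [limit_identity] uses
    both. *)
Lemma dcutR_bound eps x : 0 < eps -> eps <= 1 -> 0 < x ->
  `|dcutR eps x| * Num.sqrt x <= 2 / Num.sqrt x + 2 /\
  `|dcutR eps x| <= 2 * eps / x ^+ 2 + 2 * eps.
Proof.
move=> e0 e1 x0; have [h|h] := leP 1 (eps * x).
  have -> : dcutR eps x = 0 by exact: (cutR_out (x := x) (eps := eps) (introT orP (or_intror h))).2.
  rewrite normr0 mul0r; split; first by rewrite addr_ge0// divr_ge0// sqrtr_ge0.
  by rewrite addr_ge0 ?divr_ge0 ?sqr_ge0 ?mulr_ge0 ?(ltW e0).
have /andP[a b] := cutlow_itv x e0.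
have [/andP[c d] d'] := dcutlow_itv e0 x0.
have ex0 : 0 < eps * x by rewrite mulr_gt0.
have /andP[s0 s1] : 0 <= sqpos (1 - eps * x) <= 1 by apply: sqpos_itv; lra.
have m1 : Num.max (1 - eps * x) 0 = 1 - eps * x by rewrite max_l// subr_ge0 ltW.
have B : `|dcutR eps x| <= dcutlow eps x + 2 * eps.
  apply: (le_trans (ler_normB _ _)); apply: lerD.
    by rewrite (ger0_norm (mulr_ge0 c s0)) -{2}[dcutlow eps x]mulr1; exact: (ler_wpM2l c s1).
  have k1 : 0 <= 1 - eps * x by lra.
  rewrite m1 (ger0_norm (mulr_ge0 a (mulr_ge0 (mulr_ge0 (ler0n _ 2) (ltW e0)) k1))).
  have : cutlow eps x * (1 - eps * x) <= 1 by rewrite mulr_ile1//; lra.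
  by move: (cutlow eps x) => k; nra.
split; last by apply: (le_trans B); rewrite lerD2r.
have q0 : 0 < Num.sqrt x by rewrite sqrtr_gt0.
have q2 : Num.sqrt x ^+ 2 = x by rewrite sqr_sqrtr// ltW.
apply: (@le_trans _ _ ((2 / x + 2 * eps) * Num.sqrt x)).
  by apply: ler_wpM2r; [exact: ltW|apply: (le_trans B); rewrite lerD2r].
rewrite mulrDl; apply: lerD.
  by rewrite -{1}q2 expr2 invfM -!mulrA mulVf ?mulr1// gt_eqF.
have : eps * Num.sqrt x <= 1.
  have ex : eps * Num.sqrt x * (eps * Num.sqrt x) <= 1.
    have -> : eps * Num.sqrt x * (eps * Num.sqrt x) = eps * (eps * x) by rewrite -{3}q2; ring.
    by rewrite mulr_ile1 ?(ltW e0) ?(ltW ex0) ?(ltW h).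
  have : 0 <= eps * Num.sqrt x by rewrite mulr_ge0// ltW.
  by move: ex; move: (eps * Num.sqrt x) => k; nra.
by rewrite -mulrA; lra.
Qed.

End Cutoffs.

(* The vector field [dv . d_v + dw . d_w + dy . d_y] below is divergence free, leaves
   [S = (u . y)^2 / (|u|^2 |y|^2)] and [|y|] invariant, and translates the
   post-collisional velocity [v - (b/2) ((u . y) / |y|^2) y] in the direction [j]. *)
Section TestField.
Context {R : realType}.
Local Notation V := (V3 R).
Variables (b eps : R) (j : axis).
Hypothesis eps0 : 0 < eps.
Implicit Types (u y v p q pv : axis -> R).

Definition kd (i l : axis) : R := cd i (ee l).

Lemma kd_sum i x : sum3 (fun l => kd i l * x l) = x i.
Proof. by rewrite /sum3 /kd; case: i; rewrite !cd_ee; ring. Qed.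

Lemma kdC i l : kd i l = kd l i.
Proof. by rewrite /kd !cd_ee; case: i; case: l. Qed.

Definition ip u y := sum3 (fun l => u l * y l).
(** [|u|^-2] on the region kept by the cut-offs, continued as a C^1 function elsewhere. *)
Definition fX u := rinv eps (ip u u).
Definition fS u y := ip u y ^+ 2 * fX u * fX y.
(** Components of the field: [fdu] moves the relative velocity [u = v - w], [fdz] the centre of mass
    [(v + w) / 2], and [fdy] the point [y]. The parameter [b] will be [1 + e]. *)
Definition fdu u y i := (1 - b * fS u y) * kd i j + b * (ip u y * fX u * fX y) * (u j * y i - y j * u i).
Definition fdz u y i := (1 + b * (2 - b) * fS u y) / 2 * kd i j.
Definition fdy u y i := fX u * ((1 - b) * ip u y * kd i j - y j * u i + b * (ip u y * fX y) * (y j * y i)).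
Definition fvp u y v l := v l - b / 2 * (ip u y * fX y) * y l.

(** From here on, a name in [g] is the derivative of the corresponding name in [f] (or of [ip]) when
    [u], [y], [v] move with velocities [p], [q], [pv]. *)
Definition gip u y p q := sum3 (fun l => p l * y l + u l * q l).
Definition gX u p := drinv eps (ip u u) * (2 * ip u p).
Definition gS u y p q := 2 * ip u y * gip u y p q * fX u * fX y + ip u y ^+ 2 * gX u p * fX y +
  ip u y ^+ 2 * fX u * gX y q.
Definition gdu u y p q i := - (b * gS u y p q) * kd i j +
  b * (gip u y p q * fX u * fX y + ip u y * gX u p * fX y + ip u y * fX u * gX y q) * (u j * y i - y j * u i) +
  b * (ip u y * fX u * fX y) * (p j * y i + u j * q i - (q j * u i + y j * p i)).
Definition gdz u y p q i := b * (2 - b) * gS u y p q / 2 * kd i j.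
Definition gdy u y p q i := gX u p * ((1 - b) * ip u y * kd i j - y j * u i + b * (ip u y * fX y) * (y j * y i)) +
  fX u * ((1 - b) * gip u y p q * kd i j - (q j * u i + y j * p i) +
     (b * (gip u y p q * fX y + ip u y * gX y q) * (y j * y i) + b * (ip u y * fX y) * (q j * y i + y j * q i))).
Definition gvp u y pv p q l := pv l - (b / 2 * (gip u y p q * fX y + ip u y * gX y q) * y l + b / 2 * (ip u y * fX y) * q l).

Section Curve.
Variables (U Y W : R -> axis -> R) (p q pv : axis -> R) (t : R).
Hypotheses (dU : forall l, isd (fun s => U s l) t (p l)) (dY : forall l, isd (fun s => Y s l) t (q l)).
Hypothesis (dW : forall l, isd (fun s => W s l) t (pv l)).

Lemma isd_sum3 (F : R -> axis -> R) (dF : axis -> R) : (forall l, isd (fun s => F s l) t (dF l)) ->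
  isd (fun s => sum3 (F s)) t (sum3 dF).
Proof. by move=> h; apply: isdD; [apply: isdD|]; exact: h. Qed.

Lemma isd_ip : isd (fun s => ip (U s) (Y s)) t (gip (U t) (Y t) p q).
Proof. by apply: isd_sum3 => l; exact: isdM. Qed.

Lemma isd_fX (Z : R -> axis -> R) r : (forall l, isd (fun s => Z s l) t (r l)) ->
  isd (fun s => fX (Z s)) t (gX (Z t) r).
Proof.
move=> dZ; have h : isd (fun s => ip (Z s) (Z s)) t (2 * ip (Z t) r).
  refine (isd_eq (isd_sum3 (F := fun s l => Z s l * Z s l) (fun l => isdM (dZ l) (dZ l))) (fun=> erefl) _).
  by rewrite /ip /sum3; ring.
exact: isd_comp h (isd_rinv _ eps0).
Qed.

Lemma isd_ipXX : isd (fun s => ip (U s) (Y s) * fX (U s) * fX (Y s)) t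
  (gip (U t) (Y t) p q * fX (U t) * fX (Y t) + ip (U t) (Y t) * gX (U t) p * fX (Y t) +
   ip (U t) (Y t) * fX (U t) * gX (Y t) q).
Proof.
refine (isd_eq (isdM (isdM isd_ip (isd_fX dU)) (isd_fX dY)) (fun=> erefl) _).
by rewrite mulrDl.
Qed.

Lemma isd_fS : isd (fun s => fS (U s) (Y s)) t (gS (U t) (Y t) p q).
Proof.
refine (isd_eq (isdM (isdM (isdM isd_ip isd_ip) (isd_fX dU)) (isd_fX dY)) _ _).
  by move=> s; rewrite /fS expr2.
by rewrite /gS; ring.
Qed.

Lemma isd_fdu i : isd (fun s => fdu (U s) (Y s) i) t (gdu (U t) (Y t) p q i).
Proof.
refine (isd_eq (isdD (isdM (isdB (isd_cst 1 t) (isdZ b isd_fS)) (isd_cst (kd i j) t))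
  (isdM (isdZ b isd_ipXX) (isdB (isdM (dU j) (dY i)) (isdM (dY j) (dU i))))) (fun=> erefl) _).
by rewrite /gdu; ring.
Qed.

Lemma isd_fdz i : isd (fun s => fdz (U s) (Y s) i) t (gdz (U t) (Y t) p q i).
Proof.
refine (isd_eq (isdM (isdM (isdD (isd_cst 1 t) (isdZ (b * (2 - b)) isd_fS)) (isd_cst 2^-1 t)) (isd_cst (kd i j) t)) (fun=> erefl) _).
by rewrite /gdz; ring.
Qed.

Lemma isd_ipX : isd (fun s => ip (U s) (Y s) * fX (Y s)) t
  (gip (U t) (Y t) p q * fX (Y t) + ip (U t) (Y t) * gX (Y t) q).
Proof. exact: isdM isd_ip (isd_fX dY). Qed.

Lemma isd_fdy i : isd (fun s => fdy (U s) (Y s) i) t (gdy (U t) (Y t) p q i).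
Proof.
refine (isd_eq (isdM (isd_fX dU) (isdD (isdB (isdM (isdZ (1 - b) isd_ip) (isd_cst (kd i j) t)) (isdM (dY j) (dU i)))
  (isdM (isdZ b isd_ipX) (isdM (dY j) (dY i))))) (fun=> erefl) _).
by rewrite /gdy; ring.
Qed.

Lemma isd_fvp l : isd (fun s => fvp (U s) (Y s) (W s) l) t (gvp (U t) (Y t) pv p q l).
Proof.
refine (isd_eq (isdB (dW l) (isdM (isdZ (b / 2) isd_ipX) (dY l))) (fun=> erefl) _).
by rewrite /gvp; ring.
Qed.

End Curve.

Variables (be dbe : R -> R) (phi : V -> R) (dphi : axis -> V -> R).
Hypotheses (hbe : forall x, isd be x (dbe x)) (hphi : C1b phi dphi).

Definition mk (x : axis -> R) : V := mkV3 (x ax1) (x ax2) (x ax3).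
Definition fG u y v := cutY eps (ip y y) * cutR eps (ip u u) * be (fS u y) * phi (mk (fvp u y v)).
Definition gG u y v pv p q :=
  dcutY eps (ip y y) * (2 * ip y q) * cutR eps (ip u u) * be (fS u y) * phi (mk (fvp u y v)) +
  cutY eps (ip y y) * (dcutR eps (ip u u) * (2 * ip u p)) * be (fS u y) * phi (mk (fvp u y v)) +
  cutY eps (ip y y) * cutR eps (ip u u) * (dbe (fS u y) * gS u y p q) * phi (mk (fvp u y v)) +
  cutY eps (ip y y) * cutR eps (ip u u) * be (fS u y) *
    sum3 (fun l => dphi l (mk (fvp u y v)) * gvp u y pv p q l).

Lemma isd_fG (U Y W : R -> axis -> R) (p q pv : axis -> R) (t : R) :
  (forall l, isd (fun s => U s l) t (p l)) -> (forall l, isd (fun s => Y s l) t (q l)) ->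
  (forall l, isd (fun s => W s l) t (pv l)) ->
  isd (fun s => fG (U s) (Y s) (W s)) t (gG (U t) (Y t) (W t) pv p q).
Proof.
move=> dU dY dW.
have sq (Z : R -> axis -> R) r : (forall l, isd (fun s => Z s l) t (r l)) -> isd (fun s => ip (Z s) (Z s)) t (2 * ip (Z t) r).
  move=> dZ; refine (isd_eq (isd_sum3 (F := fun s l => Z s l * Z s l) (fun l => isdM (dZ l) (dZ l))) (fun=> erefl) _).
  by rewrite /ip /sum3; ring.
have dphi' : isd (fun s => phi (mk (fvp (U s) (Y s) (W s)))) t
    (sum3 (fun l => dphi l (mk (fvp (U t) (Y t) (W t))) * gvp (U t) (Y t) pv p q l)).
  apply: (chain3 (p := fun l s => fvp (U s) (Y s) (W s) l) hphi); first by case.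
  by move=> l; exact: isd_fvp.
refine (isd_eq (isdM (isdM (isdM (isd_comp (sq _ _ dY) (isd_cutY _ eps0)) (isd_comp (sq _ _ dU) (isd_cutR _ eps0)))
  (isd_comp (isd_fS dU dY) (hbe _))) dphi') (fun=> erefl) _).
by rewrite /gG; ring.
Qed.

Definition zero3 : axis -> R := fun=> 0.
Definition neg3 (x : axis -> R) : axis -> R := fun l => - x l.

Section Algebra.
Variables (u y v : axis -> R).
Local Notation D := (ip u y).
Local Notation X := (fX u).
Local Notation Z := (fX y).
Local Notation S := (fS u y).
Hypotheses (hR : eps <= ip u u) (hY : eps <= ip y y).

Let XR : X * ip u u = 1.
Proof. by rewrite /fX rinvE// mulVf// gt_eqF// (lt_le_trans eps0). Qed.
Let ZY : Z * ip y y = 1.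
Proof. by rewrite /fX rinvE// mulVf// gt_eqF// (lt_le_trans eps0). Qed.

Let Xp : 0 < X.
Proof. by rewrite /fX rinvE// invr_gt0 (lt_le_trans eps0). Qed.
Let Zp : 0 < Z.
Proof. by rewrite /fX rinvE// invr_gt0 (lt_le_trans eps0). Qed.
(** Squared lengths are expressed through [X] and [Z], the inverses that occur in the field, so that
    [field] can close the identities below. *)
Let R1 : ip u u = X^-1.
Proof. by rewrite -[LHS]mul1r -{1}(mulVf (lt0r_neq0 Xp)) -mulrA XR mulr1. Qed.
Let Y1 : ip y y = Z^-1.
Proof. by rewrite -[LHS]mul1r -{1}(mulVf (lt0r_neq0 Zp)) -mulrA ZY mulr1. Qed.

Lemma lin_sum (s t : R) (x : axis -> R) : sum3 (fun i => (s * kd i j + t * (u j * y i - y j * u i)) * x i) =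
  s * x j + t * (u j * ip y x - y j * ip u x).
Proof. by rewrite /sum3 /ip /sum3 /kd; case: j; rewrite !cd_ee; ring. Qed.

Lemma lin_sumy (r s t : R) (x : axis -> R) : sum3 (fun i => r * (s * kd i j - y j * u i + t * (y j * y i)) * x i) =
  r * (s * x j - y j * ip u x + t * (y j * ip y x)).
Proof. by rewrite /sum3 /ip /sum3 /kd; case: j; rewrite !cd_ee; ring. Qed.

Let ipC (x x' : axis -> R) : ip x x' = ip x' x.
Proof. by rewrite /ip /sum3; ring. Qed.

Lemma gip_u i : gip u y (kd i) zero3 = y i.
Proof. by rewrite -[RHS](kd_sum i y) /gip /zero3 /sum3; ring. Qed.
Lemma gip_y i : gip u y zero3 (kd i) = u i.
Proof. by rewrite -[RHS](kd_sum i u) /gip /zero3 /sum3; ring. Qed.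
Lemma gip_n i : gip u y (neg3 (kd i)) zero3 = - y i.
Proof. by rewrite -[in RHS](kd_sum i y) /gip /zero3 /neg3 /sum3; ring. Qed.
Lemma ip_kd (x : axis -> R) i : ip x (kd i) = x i.
Proof. by rewrite ipC /ip kd_sum. Qed.
Lemma ip_nkd (x : axis -> R) i : ip x (neg3 (kd i)) = - x i.
Proof. by rewrite -[in RHS](ip_kd x i) /ip /neg3 /sum3; ring. Qed.
Lemma ip_0 (x : axis -> R) : ip x zero3 = 0.
Proof. by rewrite /ip /zero3 /sum3; ring. Qed.

Lemma gX0 (x : axis -> R) : gX x zero3 = 0.
Proof. by rewrite /gX ip_0 !mulr0. Qed.
Lemma gXu i : gX u (kd i) = - X ^+ 2 * (2 * u i).
Proof. by rewrite /gX ip_kd drinvE. Qed.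
Lemma gXn i : gX u (neg3 (kd i)) = X ^+ 2 * (2 * u i).
Proof. by rewrite /gX ip_nkd drinvE// -/(fX u); ring. Qed.
Lemma gXy i : gX y (kd i) = - Z ^+ 2 * (2 * y i).
Proof. by rewrite /gX ip_kd drinvE. Qed.

Lemma gS_u i : gS u y (kd i) zero3 = 2 * D * X * Z * y i - 2 * D ^+ 2 * X ^+ 2 * Z * u i.
Proof. by rewrite /gS gip_u gXu gX0; ring. Qed.
Lemma gS_n i : gS u y (neg3 (kd i)) zero3 = - gS u y (kd i) zero3.
Proof. by rewrite gS_u /gS gip_n gXn gX0; ring. Qed.
Lemma gS_y i : gS u y zero3 (kd i) = 2 * D * X * Z * u i - 2 * D ^+ 2 * X * Z ^+ 2 * y i.
Proof. by rewrite /gS gip_y gXy gX0; ring. Qed.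

Lemma du_sum (x : axis -> R) : sum3 (fun i => fdu u y i * x i) =
  (1 - b * S) * x j + b * (D * X * Z) * (u j * ip y x - y j * ip u x).
Proof. exact: lin_sum. Qed.

Lemma dy_sum (x : axis -> R) : sum3 (fun i => fdy u y i * x i) =
  X * ((1 - b) * D * x j - y j * ip u x + b * (D * Z) * (y j * ip y x)).
Proof. exact: lin_sumy. Qed.

Lemma dy_y : sum3 (fun i => fdy u y i * y i) = 0.
Proof. by rewrite dy_sum Y1; field; exact: lt0r_neq0 Zp. Qed.

(** [S] is a first integral of the field, so the weight [be S] is transported and [dbe] drops out of
    [field_identity]: this is why the regularity of the kernel leaves no trace in the estimate. *)
Lemma field_S : sum3 (fun i => fdu u y i * gS u y (kd i) zero3 + fdy u y i * gS u y zero3 (kd i)) = 0.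
Proof.
transitivity (2 * D * X * Z * sum3 (fun i => fdu u y i * y i) - 2 * D ^+ 2 * X ^+ 2 * Z * sum3 (fun i => fdu u y i * u i) +
  2 * D * X * Z * sum3 (fun i => fdy u y i * u i) - 2 * D ^+ 2 * X * Z ^+ 2 * sum3 (fun i => fdy u y i * y i)).
  by rewrite /sum3 !gS_u !gS_y; ring.
rewrite dy_y !du_sum !dy_sum R1 Y1 [ip y u]ipC /fS; field.
by rewrite !lt0r_neq0.
Qed.

Lemma sum_gdu (c1 c2 c3 c4 c5 : R) :
  sum3 (fun i => - (b * (c1 * y i - c2 * u i)) * kd i j + b * (c3 * y i + c4 * u i) * (u j * y i - y j * u i) +
    c5 * (kd i j * y i - y j * kd i i)) =
  - (b * (c1 * y j - c2 * u j)) + b * (c3 * (u j * ip y y - y j * D) + c4 * (u j * D - y j * ip u u)) - 2 * c5 * y j.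
Proof. by rewrite /sum3 /ip /sum3 /kd; case: j; rewrite !cd_ee; ring. Qed.

Lemma sum_gdy (c1 c2 c3 c4 : R) :
  sum3 (fun i => (c1 * u i * kd i j - kd i j * u i + ((c2 * u i + c3 * y i) * (y j * y i) + c4 * (kd i j * y i + y j * kd i i)))) =
  (c1 - 1) * u j + y j * (c2 * D + c3 * ip y y) + 4 * c4 * y j.
Proof. by rewrite /sum3 /ip /sum3 /kd; case: j; rewrite !cd_ee; ring. Qed.

Lemma field_div : sum3 (fun i => gdu u y (kd i) zero3 i + gdy u y zero3 (kd i) i) = 0.
Proof.
transitivity (sum3 (fun i => - (b * (2 * D * X * Z * y i - 2 * D ^+ 2 * X ^+ 2 * Z * u i)) * kd i j +
    b * (X * Z * y i + (- 2 * D * X ^+ 2 * Z) * u i) * (u j * y i - y j * u i) +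
    b * (D * X * Z) * (kd i j * y i - y j * kd i i)) +
  X * sum3 (fun i => ((1 - b) * u i * kd i j - kd i j * u i + ((b * Z * u i + (- 2 * b * D * Z ^+ 2) * y i) * (y j * y i) +
     b * (D * Z) * (kd i j * y i + y j * kd i i))))).
  by rewrite /sum3 /gdu /gdy !gS_u !gip_u !gip_y !gX0 !gXu !gXy /zero3; ring.
rewrite sum_gdu sum_gdy R1 Y1; field.
by rewrite !lt0r_neq0.
Qed.

Lemma field_vp l : fdz u y l + fdu u y l / 2 - b / 2 * Z * y l * sum3 (fun i => fdu u y i * y i) -
   b / 2 * (Z * y l * sum3 (fun i => fdy u y i * u i) + D * Z * fdy u y l) = kd l j.
Proof.
rewrite du_sum dy_sum [ip y u]ipC Y1 R1 /fdz /fdu /fdy /fS; field.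
by rewrite !lt0r_neq0.
Qed.

Lemma gvp_v i l : gvp u y (kd i) (kd i) zero3 l = kd i l - b / 2 * Z * y i * y l.
Proof. by rewrite /gvp gip_u gX0 /zero3; ring. Qed.
Lemma gvp_w i l : gvp u y zero3 (neg3 (kd i)) zero3 l = b / 2 * Z * y i * y l.
Proof. by rewrite /gvp gip_n gX0 /zero3; ring. Qed.
Lemma gvp_y i l : gvp u y zero3 zero3 (kd i) l =
  - (b / 2 * (Z * u i * y l - 2 * D * Z ^+ 2 * y i * y l + D * Z * kd i l)).
Proof. by rewrite /gvp gip_y gXy /zero3; ring. Qed.

Lemma gdu_n i : gdu u y (neg3 (kd i)) zero3 i = - gdu u y (kd i) zero3 i.
Proof. by rewrite /gdu !gS_n gip_n gip_u gXn gXu gX0 /neg3 /zero3; ring. Qed.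
Lemma gdz_n i : gdz u y (neg3 (kd i)) zero3 i = - gdz u y (kd i) zero3 i.
Proof. by rewrite /gdz !gS_n; ring. Qed.

End Algebra.

(** Velocities of [v] and [w], which are the centre of mass plus and minus [u / 2]. *)
Definition cv u y i := fdz u y i + fdu u y i / 2.
Definition cw u y i := fdz u y i - fdu u y i / 2.
Definition gcv u y p q i := gdz u y p q i + gdu u y p q i / 2.
Definition gcw u y p q i := gdz u y p q i - gdu u y p q i / 2.

Definition dPv u y v i := gcv u y (kd i) zero3 i * fG u y v + cv u y i * gG u y v (kd i) (kd i) zero3.
Definition dPw u y v i := gcw u y (neg3 (kd i)) zero3 i * fG u y v + cw u y i * gG u y v zero3 (neg3 (kd i)) zero3.
Definition dPy u y v i := gdy u y zero3 (kd i) i * fG u y v + fdy u y i * gG u y v zero3 zero3 (kd i).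

(** Divergence of the weighted field. The field has no divergence and leaves [|y|] and [S]
    invariant, so only the derivative of [phi] along [v'] and that of the cut-off in [|u|]
    remain. *)
Lemma field_identity u y v : sum3 (fun i => dPv u y v i + dPw u y v i + dPy u y v i) =
  cutY eps (ip y y) * cutR eps (ip u u) * be (fS u y) * dphi j (mk (fvp u y v)) +
  cutY eps (ip y y) * (dcutR eps (ip u u) * (2 * sum3 (fun i => fdu u y i * u i))) * be (fS u y) * phi (mk (fvp u y v)).
Proof.
(* Where a cut-off vanishes so does its derivative, and both sides are 0; elsewhere [rinv] is the
   true inverse and the identities above apply. *)
have [hR|/ltW hR] := leP (ip u u) eps.
  have [c d] := @cutR_out _ eps (ip u u) (introT orP (or_introl hR)).
  by rewrite /dPv /dPw /dPy /fG /gG c d /sum3; ring.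
have [hY|/ltW hY] := leP (ip y y) eps.
  have [c d] := @cutY_out _ eps (ip y y) (introT orP (or_introl hY)).
  by rewrite /dPv /dPw /dPy /fG /gG c d /sum3; ring.
have L l := field_vp hR hY l.
have dyy : sum3 (fun i => fdy u y i * y i) = 0 by exact: dy_y.
set k0 := dcutY eps (ip y y) * cutR eps (ip u u) * be (fS u y) * phi (mk (fvp u y v)).
set k1 := cutY eps (ip y y) * dcutR eps (ip u u) * be (fS u y) * phi (mk (fvp u y v)).
set k2 := cutY eps (ip y y) * cutR eps (ip u u) * dbe (fS u y) * phi (mk (fvp u y v)).
set k3 := cutY eps (ip y y) * cutR eps (ip u u) * be (fS u y).
have GE pv p q : gG u y v pv p q = k0 * (2 * ip y q) + k1 * (2 * ip u p) + k2 * gS u y p q +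
   k3 * sum3 (fun l => dphi l (mk (fvp u y v)) * gvp u y pv p q l).
  by rewrite /gG /k0 /k1 /k2 /k3; ring.
(* Terms are collected by their factors [fG], [k0], [k1], [k2], [k3]. All these sums except the one
   with [k1] are given by [field_div], [dy_y], [field_S] and [field_vp]. *)
transitivity (fG u y v * sum3 (fun i => gdu u y (kd i) zero3 i + gdy u y zero3 (kd i) i) +
  k0 * (2 * sum3 (fun i => fdy u y i * y i)) + k1 * (2 * sum3 (fun i => fdu u y i * u i)) +
  k2 * sum3 (fun i => fdu u y i * gS u y (kd i) zero3 + fdy u y i * gS u y zero3 (kd i)) +
  k3 * sum3 (fun l => dphi l (mk (fvp u y v)) * (fdz u y l + fdu u y l / 2 -
    b / 2 * fX y * y l * sum3 (fun i => fdu u y i * y i) -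
    b / 2 * (fX y * y l * sum3 (fun i => fdy u y i * u i) + ip u y * fX y * fdy u y l)) +
    b * ip u y * fX y ^+ 2 * (dphi l (mk (fvp u y v)) * y l * sum3 (fun i => fdy u y i * y i)))).
  have E1 i : sum3 (fun l => dphi l (mk (fvp u y v)) * gvp u y (kd i) (kd i) zero3 l) =
     dphi i (mk (fvp u y v)) - b / 2 * fX y * y i * sum3 (fun l => dphi l (mk (fvp u y v)) * y l).
    rewrite -{1}(kd_sum i (fun l => dphi l (mk (fvp u y v)))) /sum3 !gvp_v//; ring.
  have E2 i : sum3 (fun l => dphi l (mk (fvp u y v)) * gvp u y zero3 (neg3 (kd i)) zero3 l) =
     b / 2 * fX y * y i * sum3 (fun l => dphi l (mk (fvp u y v)) * y l).
    by rewrite /sum3 !gvp_w//; ring.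
  have E3 i : sum3 (fun l => dphi l (mk (fvp u y v)) * gvp u y zero3 zero3 (kd i) l) =
     - (b / 2 * ((fX y * u i - 2 * ip u y * fX y ^+ 2 * y i) * sum3 (fun l => dphi l (mk (fvp u y v)) * y l) +
       ip u y * fX y * dphi i (mk (fvp u y v)))).
    by rewrite -(kd_sum i (fun l => dphi l (mk (fvp u y v)))) /sum3 !gvp_y//; field.
  set P := sum3 (fun l => dphi l (mk (fvp u y v)) * y l).
  have GV i : gG u y v (kd i) (kd i) zero3 = k1 * (2 * u i) + k2 * gS u y (kd i) zero3 +
      k3 * (dphi i (mk (fvp u y v)) - b / 2 * fX y * y i * P).
    by rewrite GE (E1 i) -/P (ip_kd u i) (ip_0 y); ring.
  have GW i : gG u y v zero3 (neg3 (kd i)) zero3 = - k1 * (2 * u i) - k2 * gS u y (kd i) zero3 +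
      k3 * (b / 2 * fX y * y i * P).
    by rewrite GE (E2 i) -/P (ip_nkd u i) (ip_0 y) (gS_n y hR i); ring.
  have GY i : gG u y v zero3 zero3 (kd i) = k0 * (2 * y i) + k2 * gS u y zero3 (kd i) -
      k3 * (b / 2 * ((fX y * u i - 2 * ip u y * fX y ^+ 2 * y i) * P + ip u y * fX y * dphi i (mk (fvp u y v)))).
    by rewrite GE (E3 i) -/P (ip_kd y i) (ip_0 u); ring.
  have CW i : gcw u y (neg3 (kd i)) zero3 i = - gcv u y (kd i) zero3 i + gdu u y (kd i) zero3 i.
    by rewrite /gcw /gcv (gdu_n y hR i) (gdz_n y hR i); field.
  have E i : dPv u y v i + dPw u y v i + dPy u y v i =
    fG u y v * (gdu u y (kd i) zero3 i + gdy u y zero3 (kd i) i) +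
    fdu u y i * (k1 * (2 * u i) + k2 * gS u y (kd i) zero3) +
    k3 * (fdz u y i * dphi i (mk (fvp u y v)) + fdu u y i * (dphi i (mk (fvp u y v)) / 2 - b / 2 * fX y * y i * P)) +
    fdy u y i * (k0 * (2 * y i) + k2 * gS u y zero3 (kd i) -
      k3 * (b / 2 * ((fX y * u i - 2 * ip u y * fX y ^+ 2 * y i) * P + ip u y * fX y * dphi i (mk (fvp u y v))))).
    by rewrite /dPv /dPw /dPy (GV i) (GW i) (GY i) (CW i) /cv /cw; field.
  rewrite {1}/sum3 (E ax1) (E ax2) (E ax3) /P; clear.
  move: (fG u y v) k0 k1 k2 k3 => g0 q0 q1 q2 q3.
  by rewrite /sum3; field.
rewrite dyy field_div// field_S// /sum3 !L -/(sum3 (fun i => fdu u y i * u i)).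
have K (x : axis -> R) : x ax1 * kd ax1 j + x ax2 * kd ax2 j + x ax3 * kd ax3 j = x j.
  by have := kd_sum j x; rewrite /sum3 ![kd j _]kdC => <-; ring.
rewrite -(K (fun l => dphi l (mk (fvp u y v)))) /k1 /k3; ring.
Qed.

End TestField.

(** * The integrated field identity, with cut-offs *)

Section FieldIntegral.
Context {R : realType}.
Local Notation V := (V3 R).
Local Notation mu := (@mu3 R).
Local Notation T3 := (V * V * V)%type.

Definition cU (z : T3) : axis -> R := fun l => cd l (sub3 z.1.1 z.1.2).
Definition cY (z : T3) : axis -> R := fun l => cd l z.2.
Definition cW (z : T3) : axis -> R := fun l => cd l z.1.1.

Lemma measurable_cU l : measurable_fun setT (fun z => cU z l).
Proof.
apply: measurable_cd_comp; exact: (measurableT_comp (@measurable_rel R) measurable_fst).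
Qed.
Lemma measurable_cY l : measurable_fun setT (fun z => cY z l).
Proof. by apply: measurable_cd_comp; exact: measurable_snd. Qed.
Lemma measurable_cW l : measurable_fun setT (fun z => cW z l).
Proof. by apply: measurable_cd_comp; exact: (measurableT_comp measurable_fst measurable_fst). Qed.

Lemma ip_ge0 (x : axis -> R) : 0 <= ip x x.
Proof. by rewrite /ip /sum3 !addr_ge0// -expr2 sqr_ge0. Qed.

Lemma ip_coord (x : axis -> R) l M : ip x x <= M -> `|x l| <= 1 + M.
Proof.
move=> h; have h2 : x l ^+ 2 <= M.
  apply: le_trans h; rewrite /ip /sum3; have h1 := sqr_ge0 (x ax1); have h2 := sqr_ge0 (x ax2); have h3 := sqr_ge0 (x ax3).
  by rewrite !expr2 in h1 h2 h3; case: l; rewrite expr2; lra.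
have : 0 <= (`|x l| - 1) ^+ 2 by exact: sqr_ge0.
by move: h2; rewrite -[x l ^+ 2]real_normK ?num_real// !expr2; move: `|x l| => k; have := normr_ge0 (x l); nra.
Qed.

Lemma ip_norm (x : V) : ip (fun l => cd l x) (fun l => cd l x) = norm3 x ^+ 2.
Proof. by rewrite norm3_sqr dot3E. Qed.

Section Bounded.
Variable P : T3 -> Prop.
Implicit Types (F G : T3 -> R).

(** For fixed [eps] the size of the bound is immaterial; the existential form lets bounds on the
    long derivative formulas be assembled by following their syntax. *)
Definition bd F := exists C, forall z, P z -> `|F z| <= C.

Lemma bd_cst (c : R) : bd (fun=> c).
Proof. by exists `|c|. Qed.
Lemma bdD F G : bd F -> bd G -> bd (fun z => F z + G z).
Proof.
by move=> [C h] [C' h']; exists (C + C') => z Pz; rewrite (le_trans (ler_normD _ _))// lerD ?h ?h'.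
Qed.
Lemma bdN F : bd F -> bd (fun z => - F z).
Proof. by move=> [C h]; exists C => z Pz; rewrite normrN h. Qed.
Lemma bdM F G : bd F -> bd G -> bd (fun z => F z * G z).
Proof.
by move=> [C h] [C' h']; exists (C * C') => z Pz; rewrite normrM ler_pM ?h ?h'.
Qed.
Lemma bdX F n : bd F -> bd (fun z => F z ^+ n).
Proof.
by move=> [C h]; exists (C ^+ n) => z Pz; rewrite normrX lerXn2r ?nnegrE ?h// (le_trans _ (h z Pz)).
Qed.
Lemma bd_sum (F : T3 -> axis -> R) : (forall l, bd (fun z => F z l)) -> bd (fun z => sum3 (F z)).
Proof. by move=> h; apply: bdD; [apply: bdD|]; exact: h. Qed.
Lemma bd_comp (g : R -> R) F C : (forall x, `|g x| <= C) -> bd (fun z => g (F z)).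
Proof. by move=> h; exists C => z _. Qed.

End Bounded.

Variables (b eps : R) (j : axis) (be dbe : R -> R) (phi : V -> R) (dphi : axis -> V -> R) (Cb : R).
Hypotheses (eps0 : 0 < eps) (hbe : forall x, isd be x (dbe x)) (hphi : C1b phi dphi).
Hypotheses (bbe : forall x, `|be x| <= Cb) (bdbe : forall x, `|dbe x| <= Cb).

(** Off this set the cut-offs and their derivatives vanish ([out_zero]); on it the coordinates of
    [u] and [y] are bounded. *)
Let P z := ip (cU z) (cU z) <= eps^-1 /\ ip (cY z) (cY z) <= 1.

Lemma bd_cU l : bd P (fun z => cU z l).
Proof. by exists (1 + eps^-1) => z [h _]; exact: ip_coord. Qed.
Lemma bd_cY l : bd P (fun z => cY z l).
Proof. by exists (1 + 1) => z [_ h]; exact: ip_coord. Qed.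
Lemma bd_fXU : bd P (fun z => fX eps (cU z)).
Proof. by exists (2 / eps) => z _; exact: (rinv_bound eps0 (ip_ge0 _)).1. Qed.
Lemma bd_fXY : bd P (fun z => fX eps (cY z)).
Proof. by exists (2 / eps) => z _; exact: (rinv_bound eps0 (ip_ge0 _)).1. Qed.
Lemma bd_drU : bd P (fun z => drinv eps (ip (cU z) (cU z))).
Proof. by exists (eps ^- 2) => z _; exact: (rinv_bound eps0 (ip_ge0 _)).2. Qed.
Lemma bd_drY : bd P (fun z => drinv eps (ip (cY z) (cY z))).
Proof. by exists (eps ^- 2) => z _; exact: (rinv_bound eps0 (ip_ge0 _)).2. Qed.

Lemma dcutlow_bound (x : R) : `|dcutlow eps x| <= 2 / eps.
Proof.
have e1 : 0 <= 2 / eps by rewrite divr_ge0// ltW.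
have [h|h] := leP x eps; first by rewrite (cutlow_le h).2 normr0.
have x0 : 0 < x by exact: lt_trans h.
have [/andP[c d] _] := dcutlow_itv eps0 x0.
by rewrite ger0_norm// (le_trans d)// ler_wpM2l// lef_pV2 ?posrE// ltW.
Qed.

Lemma bd_cutY : bd P (fun z => cutY eps (ip (cY z) (cY z))).
Proof. by exists 1 => z _; have /andP[h1 h2] := cutY_itv (ip (cY z) (cY z)) eps0; rewrite ger0_norm. Qed.
Lemma bd_cutR : bd P (fun z => cutR eps (ip (cU z) (cU z))).
Proof. by exists 1 => z _; have /andP[h1 h2] := cutR_itv eps0 (ip_ge0 (cU z)); rewrite ger0_norm. Qed.

Let bd_low (g : T3 -> R) : bd P (fun z => cutlow eps (g z)).
Proof. by exists 1 => z _; have /andP[h1 h2] := cutlow_itv (g z) eps0; rewrite ger0_norm. Qed.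
Let bd_dlow (g : T3 -> R) : bd P (fun z => dcutlow eps (g z)).
Proof. by exists (2 / eps) => z _; exact: dcutlow_bound. Qed.

Lemma bd_dcutY : bd P (fun z => dcutY eps (ip (cY z) (cY z))).
Proof. by apply: bdD; [|apply: bdN]; apply: bdM; (exact: bd_low || exact: bd_dlow). Qed.
Lemma bd_dcutR : bd P (fun z => dcutR eps (ip (cU z) (cU z))).
Proof.
have h z : 1 - eps * ip (cU z) (cU z) <= 1 by rewrite gerBl mulr_ge0 ?ip_ge0// ltW.
apply: bdD; last apply: bdN; apply: bdM; [exact: bd_dlow| |exact: bd_low|].
  by exists 1 => z _; have /andP[h1 h2] := sqpos_itv (h z); rewrite ger0_norm.
apply: bdM; first exact: bd_cst.
exists 1 => z _; rewrite ger0_norm ?le_max ?lexx ?orbT// ge_max ler01 andbT; exact: h.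
Qed.

Lemma bd_phi : bd P (fun z => phi (mk (fvp b eps (cU z) (cY z) (cW z)))).
Proof. by have [_ [C h] _ _ _] := hphi; exists C. Qed.
Lemma bd_dphi l : bd P (fun z => dphi l (mk (fvp b eps (cU z) (cY z) (cW z)))).
Proof. by have [_ _ _ h _] := hphi; have [C hC] := h l; exists C. Qed.
Lemma bd_be : bd P (fun z => be (fS eps (cU z) (cY z))).
Proof. exact: bd_comp bbe. Qed.
Lemma bd_dbe : bd P (fun z => dbe (fS eps (cU z) (cY z))).
Proof. exact: bd_comp bdbe. Qed.

Local Ltac bdtac := repeat first
  [ exact: bd_cU | exact: bd_cY | exact: bd_fXU | exact: bd_fXY | exact: bd_drU | exact: bd_drY
  | exact: bd_cutY | exact: bd_cutR | exact: bd_dcutY | exact: bd_dcutR | exact: bd_phi | exact: bd_dphi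
  | exact: bd_be | exact: bd_dbe | exact: bd_cst
  | apply: bdD | apply: bdN | apply: bdM | apply: bdX | (apply: bd_sum => ?) ].

Lemma bd_gip (p q : axis -> R) : bd P (fun z => gip (cU z) (cY z) p q).
Proof. by rewrite /gip; bdtac. Qed.
Lemma bd_ip : bd P (fun z => ip (cU z) (cY z)).
Proof. by rewrite /ip; bdtac. Qed.
Lemma bd_gXU (p : axis -> R) : bd P (fun z => gX eps (cU z) p).
Proof. by rewrite /gX; apply: bdM; [exact: bd_drU|rewrite /ip; bdtac]. Qed.
Lemma bd_gXY (p : axis -> R) : bd P (fun z => gX eps (cY z) p).
Proof. by rewrite /gX; apply: bdM; [exact: bd_drY|rewrite /ip; bdtac]. Qed.

Local Ltac bdtac2 := repeat first
  [ exact: bd_gip | exact: bd_ip | exact: bd_gXU | exact: bd_gXY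
  | exact: bd_cU | exact: bd_cY | exact: bd_fXU | exact: bd_fXY
  | exact: bd_cutY | exact: bd_cutR | exact: bd_dcutY | exact: bd_dcutR | exact: bd_phi | exact: bd_dphi
  | exact: bd_be | exact: bd_dbe | exact: bd_cst
  | apply: bdD | apply: bdN | apply: bdM | apply: bdX | (apply: bd_sum => ?) ].

Lemma bd_fS : bd P (fun z => fS eps (cU z) (cY z)).
Proof. by rewrite /fS; bdtac2. Qed.
Lemma bd_gS (p q : axis -> R) : bd P (fun z => gS eps (cU z) (cY z) p q).
Proof. by rewrite /gS; bdtac2. Qed.
Lemma bd_fdu i : bd P (fun z => fdu b eps j (cU z) (cY z) i).
Proof. by rewrite /fdu; have h := bd_fS; bdtac2; exact: h. Qed.
Lemma bd_fdz i : bd P (fun z => fdz b eps j (cU z) (cY z) i).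
Proof. by rewrite /fdz; have h := bd_fS; bdtac2; exact: h. Qed.
Lemma bd_fdy i : bd P (fun z => fdy b eps j (cU z) (cY z) i).
Proof. by rewrite /fdy; bdtac2. Qed.
Lemma bd_gdu (p q : axis -> R) i : bd P (fun z => gdu b eps j (cU z) (cY z) p q i).
Proof. by rewrite /gdu; have h := bd_gS p q; bdtac2; exact: h. Qed.
Lemma bd_gdz (p q : axis -> R) i : bd P (fun z => gdz b eps j (cU z) (cY z) p q i).
Proof. by rewrite /gdz; have h := bd_gS p q; bdtac2; exact: h. Qed.
Lemma bd_gdy (p q : axis -> R) i : bd P (fun z => gdy b eps j (cU z) (cY z) p q i).
Proof. by rewrite /gdy; bdtac2. Qed.
Lemma bd_fG : bd P (fun z => fG b eps be phi (cU z) (cY z) (cW z)).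
Proof. by rewrite /fG; bdtac2. Qed.
Lemma bd_gG (pv p q : axis -> R) : bd P (fun z => gG b eps be dbe phi dphi (cU z) (cY z) (cW z) pv p q).
Proof.
have hg := bd_gS p q.
have hv l : bd P (fun z => gvp b eps (cU z) (cY z) pv p q l) by rewrite /gvp; bdtac2.
have h1 : bd P (fun z => ip (cY z) q) by rewrite /ip; bdtac2.
have h2 : bd P (fun z => ip (cU z) p) by rewrite /ip; bdtac2.
by rewrite /gG; bdtac2; (exact: hg || exact: hv || exact: h1 || exact: h2).
Qed.

Lemma bd_cv i : bd P (fun z => cv b eps j (cU z) (cY z) i).
Proof. by rewrite /cv; apply: bdD; [exact: bd_fdz|apply: bdM; [exact: bd_fdu|exact: bd_cst]]. Qed.
Lemma bd_cw i : bd P (fun z => cw b eps j (cU z) (cY z) i).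
Proof. by rewrite /cw; apply: bdD; [exact: bd_fdz|apply: bdN; apply: bdM; [exact: bd_fdu|exact: bd_cst]]. Qed.
Lemma bd_dPv i : bd P (fun z => dPv b eps j be dbe phi dphi (cU z) (cY z) (cW z) i).
Proof.
apply: bdD; apply: bdM; [|exact: bd_fG|exact: bd_cv|exact: bd_gG].
by apply: bdD; [exact: bd_gdz|apply: bdM; [exact: bd_gdu|exact: bd_cst]].
Qed.
Lemma bd_dPw i : bd P (fun z => dPw b eps j be dbe phi dphi (cU z) (cY z) (cW z) i).
Proof.
apply: bdD; apply: bdM; [|exact: bd_fG|exact: bd_cw|exact: bd_gG].
by apply: bdD; [exact: bd_gdz|apply: bdN; apply: bdM; [exact: bd_gdu|exact: bd_cst]].
Qed.
Lemma bd_dPy i : bd P (fun z => dPy b eps j be dbe phi dphi (cU z) (cY z) (cW z) i).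
Proof. by apply: bdD; apply: bdM; [exact: bd_gdy|exact: bd_fG|exact: bd_fdy|exact: bd_gG]. Qed.

Lemma out_zero z : ~ P z -> fG b eps be phi (cU z) (cY z) (cW z) = 0 /\
  forall pv p q, gG b eps be dbe phi dphi (cU z) (cY z) (cW z) pv p q = 0.
Proof.
move=> nP; have [hR|/ltW hR] := leP (eps * ip (cU z) (cU z)) 1; last first.
  have [c d] := @cutR_out _ eps (ip (cU z) (cU z)) (introT orP (or_intror hR)).
  by rewrite /fG; split=> [|pv p q]; rewrite ?/gG c ?d; ring.
have [hY|/ltW hY] := leP (ip (cY z) (cY z)) 1.
  by exfalso; apply: nP; split => //; rewrite -[leRHS]mul1r ler_pdivlMr// mulrC.
have hY' : 1 - eps <= ip (cY z) (cY z) by apply: le_trans hY; rewrite gerBl ltW.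
have [c d] := @cutY_out _ eps (ip (cY z) (cY z)) (introT orP (or_intror hY')).
by rewrite /fG; split=> [|pv p q]; rewrite ?/gG c ?d; ring.
Qed.

Lemma bd_ball (F : T3 -> R) : bd P F -> (forall z, ~ P z -> F z = 0) ->
  exists C, forall z, `|F z| <= C * \1_uball z.2.
Proof.
move=> [C hC] h0; exists `|C| => z; have [Pz|nP] := pselect (P z); last first.
  by rewrite h0// normr0 mulr_ge0// indicE.
have hb : uball z.2.
  by rewrite /uball /= -(ler_sqr (norm3_ge0 _)) ?nnegrE// expr1n -ip_norm; exact: Pz.2.
by rewrite indicE mem_set// mulr1 (le_trans (hC z Pz))// ler_norm.
Qed.

Lemma measurable_ip2 (F G : T3 -> axis -> R) : (forall l, measurable_fun setT (fun z => F z l)) ->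
  (forall l, measurable_fun setT (fun z => G z l)) -> measurable_fun setT (fun z => ip (F z) (G z)).
Proof. by move=> mF mG; apply: measurable_sum3 => l; exact: measurable_funM. Qed.

Let m_comp (g dg : R -> R) (F : T3 -> R) : (forall x, isd g x (dg x)) -> measurable_fun setT F ->
  measurable_fun setT (fun z => g (F z)).
Proof. by move=> d mF; exact: (measurableT_comp (isd_measurable d).1 mF). Qed.

Lemma m_ip : measurable_fun setT (fun z => ip (cU z) (cY z)).
Proof. by apply: measurable_ip2; [exact: measurable_cU|exact: measurable_cY]. Qed.
Lemma m_ipU : measurable_fun setT (fun z => ip (cU z) (cU z)).
Proof. by apply: measurable_ip2; exact: measurable_cU. Qed.
Lemma m_ipY : measurable_fun setT (fun z => ip (cY z) (cY z)).
Proof. by apply: measurable_ip2; exact: measurable_cY. Qed.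
Lemma m_fXU : measurable_fun setT (fun z => fX eps (cU z)).
Proof. exact: m_comp (fun x => isd_rinv x eps0) m_ipU. Qed.
Lemma m_fXY : measurable_fun setT (fun z => fX eps (cY z)).
Proof. exact: m_comp (fun x => isd_rinv x eps0) m_ipY. Qed.

Local Ltac mtac := repeat first
  [ exact: m_ip | exact: m_fXU | exact: m_fXY | exact: measurable_cU | exact: measurable_cY | exact: measurable_cW
  | exact: measurable_cst | apply: measurable_funB | apply: measurable_funD | apply: measurable_funM | apply: measurable_funX ].

Lemma m_fS : measurable_fun setT (fun z => fS eps (cU z) (cY z)).
Proof. by rewrite /fS; mtac. Qed.
Lemma m_fdu i : measurable_fun setT (fun z => fdu b eps j (cU z) (cY z) i).
Proof. by rewrite /fdu; have h := m_fS; mtac; exact: h. Qed.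
Lemma m_fdz i : measurable_fun setT (fun z => fdz b eps j (cU z) (cY z) i).
Proof. by rewrite /fdz; have h := m_fS; mtac; exact: h. Qed.
Lemma m_fdy i : measurable_fun setT (fun z => fdy b eps j (cU z) (cY z) i).
Proof. by rewrite /fdy; mtac. Qed.
Lemma m_vp : measurable_fun setT (fun z => mk (fvp b eps (cU z) (cY z) (cW z)) : V).
Proof. by apply: measurable_mk3; rewrite /fvp; mtac. Qed.
Lemma m_phi : measurable_fun setT (fun z => phi (mk (fvp b eps (cU z) (cY z) (cW z)))).
Proof. by have [c _ _ _ _] := hphi; exact: (measurableT_comp (continuous_measurable3 c) m_vp). Qed.
Lemma m_fG : measurable_fun setT (fun z => fG b eps be phi (cU z) (cY z) (cW z)).
Proof.
apply: measurable_funM; last exact: m_phi.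
apply: measurable_funM; last exact: m_comp hbe m_fS.
apply: measurable_funM; first exact: m_comp (fun x => isd_cutY x eps0) m_ipY.
exact: m_comp (fun x => isd_cutR x eps0) m_ipU.
Qed.

Lemma m_cv i : measurable_fun setT (fun z => cv b eps j (cU z) (cY z) i).
Proof.
apply: measurable_funD; first exact: m_fdz.
by apply: measurable_funM; [exact: m_fdu|exact: measurable_cst].
Qed.
Lemma m_cw i : measurable_fun setT (fun z => cw b eps j (cU z) (cY z) i).
Proof.
apply: measurable_funB; first exact: m_fdz.
by apply: measurable_funM; [exact: m_fdu|exact: measurable_cst].
Qed.

Definition Pv i z := cv b eps j (cU z) (cY z) i * fG b eps be phi (cU z) (cY z) (cW z).
Definition Pw i z := cw b eps j (cU z) (cY z) i * fG b eps be phi (cU z) (cY z) (cW z).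
Definition Py i z := fdy b eps j (cU z) (cY z) i * fG b eps be phi (cU z) (cY z) (cW z).
Definition dPv' i z := dPv b eps j be dbe phi dphi (cU z) (cY z) (cW z) i.
Definition dPw' i z := dPw b eps j be dbe phi dphi (cU z) (cY z) (cW z) i.
Definition dPy' i z := dPy b eps j be dbe phi dphi (cU z) (cY z) (cW z) i.

Let isd_cd (x : V) (i l : axis) (c : R) : isd (fun t => cd l (add3 x (scale3 t (ee i))) - c) 0 (kd i l).
Proof.
refine (isd_eq (isdB (isdD (isd_cst (cd l x) 0) (isdM (isd_id 0) (isd_cst (cd l (ee i)) 0))) (isd_cst c 0)) _ _).
  by move=> t; rewrite cdD cdZ.
by rewrite subr0 add0r mulr0 addr0 mul1r kdC.
Qed.

Lemma isD_Pv i v w y : isD (fun v => Pv i (v, w, y)) v (ee i) (dPv' i (v, w, y)).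
Proof.
have dU l : isd (fun t => cU (add3 v (scale3 t (ee i)), w, y) l) 0 (kd i l).
  by refine (isd_eq (isd_cd v i l (cd l w)) _ erefl) => t; rewrite /cU cdB.
have dY l : isd (fun t => cY (add3 v (scale3 t (ee i)), w, y) l) 0 (zero3 (R := R) l) by exact: (isd_cst (cd l y) 0).
have dW l : isd (fun t => cW (add3 v (scale3 t (ee i)), w, y) l) 0 (kd i l).
  by refine (isd_eq (isd_cd v i l 0) _ erefl) => t; rewrite subr0.
refine (isd_eq (isdM (isdD (isd_fdz b j eps0 dU dY i) (isdM (isd_fdu b j eps0 dU dY i) (isd_cst 2^-1 0)))
  (isd_fG b eps0 hbe hphi dU dY dW)) (fun=> erefl) _).
by rewrite (add3_0 v (ee i)) mulr0 addr0.
Qed.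

Lemma isD_Pw i v w y : isD (fun w => Pw i (v, w, y)) w (ee i) (dPw' i (v, w, y)).
Proof.
have dU l : isd (fun t => cU (v, add3 w (scale3 t (ee i)), y) l) 0 (neg3 (kd i) l).
  by refine (isd_eq (isdN (isd_cd w i l (cd l v))) _ erefl) => t; rewrite /cU cdB opprB.
have dY l : isd (fun t => cY (v, add3 w (scale3 t (ee i)), y) l) 0 (zero3 (R := R) l) by exact: (isd_cst (cd l y) 0).
have dW l : isd (fun t => cW (v, add3 w (scale3 t (ee i)), y) l) 0 (zero3 (R := R) l) by exact: (isd_cst (cd l v) 0).
refine (isd_eq (isdM (isdB (isd_fdz b j eps0 dU dY i) (isdM (isd_fdu b j eps0 dU dY i) (isd_cst 2^-1 0)))
  (isd_fG b eps0 hbe hphi dU dY dW)) (fun=> erefl) _).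
by rewrite (add3_0 w (ee i)) mulr0 addr0.
Qed.

Lemma isD_Py i v w y : isD (fun y => Py i (v, w, y)) y (ee i) (dPy' i (v, w, y)).
Proof.
have dU l : isd (fun t => cU (v, w, add3 y (scale3 t (ee i))) l) 0 (zero3 (R := R) l) by exact: (isd_cst (cd l (sub3 v w)) 0).
have dY l : isd (fun t => cY (v, w, add3 y (scale3 t (ee i))) l) 0 (kd i l).
  by refine (isd_eq (isd_cd y i l 0) _ erefl) => t; rewrite subr0.
have dW l : isd (fun t => cW (v, w, add3 y (scale3 t (ee i))) l) 0 (zero3 (R := R) l) by exact: (isd_cst (cd l v) 0).
refine (isd_eq (isdM (isd_fdy b j eps0 dU dY i) (isd_fG b eps0 hbe hphi dU dY dW)) (fun=> erefl) _).
by rewrite (add3_0 y (ee i)).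
Qed.

Let m_sh t i : measurable_fun setT (fun x : V => add3 x (scale3 t (ee i))).
Proof. exact: (mu3_shift (scale3 t (ee i))).1. Qed.

Lemma m_Pv i : measurable_fun setT (Pv i) /\ measurable_fun setT (dPv' i).
Proof.
have m : measurable_fun setT (Pv i) by apply: measurable_funM; [exact: m_cv|exact: m_fG].
split => //; apply: (@measurable_isd _ T3 R (fun t z => Pv i (add3 z.1.1 (scale3 t (ee i)), z.1.2, z.2)) _ 0).
  move=> t; apply: (measurableT_comp m); apply/measurable_fun_pair; last exact: measurable_snd.
  apply/measurable_fun_pair; last exact: (measurableT_comp measurable_snd measurable_fst).
  exact: (measurableT_comp (m_sh t i) (measurableT_comp measurable_fst measurable_fst)).
by move=> [[v w] y]; exact: isD_Pv.
Qed.

Lemma m_Pw i : measurable_fun setT (Pw i) /\ measurable_fun setT (dPw' i).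
Proof.
have m : measurable_fun setT (Pw i) by apply: measurable_funM; [exact: m_cw|exact: m_fG].
split => //; apply: (@measurable_isd _ T3 R (fun t z => Pw i (z.1.1, add3 z.1.2 (scale3 t (ee i)), z.2)) _ 0).
  move=> t; apply: (measurableT_comp m); apply/measurable_fun_pair; last exact: measurable_snd.
  apply/measurable_fun_pair; first exact: (measurableT_comp measurable_fst measurable_fst).
  exact: (measurableT_comp (m_sh t i) (measurableT_comp measurable_snd measurable_fst)).
by move=> [[v w] y]; exact: isD_Pw.
Qed.

Lemma m_Py i : measurable_fun setT (Py i) /\ measurable_fun setT (dPy' i).
Proof.
have m : measurable_fun setT (Py i) by apply: measurable_funM; [exact: m_fdy|exact: m_fG].
split => //; apply: (@measurable_isd _ T3 R (fun t z => Py i (z.1, add3 z.2 (scale3 t (ee i)))) _ 0).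
  move=> t; apply: (measurableT_comp m); apply/measurable_fun_pair; first exact: measurable_fst.
  exact: (measurableT_comp (m_sh t i) measurable_snd).
by move=> [[v w] y]; exact: isD_Py.
Qed.

Let uniform (F G : T3 -> R) : bd P F -> bd P G -> (forall z, ~ P z -> F z = 0) -> (forall z, ~ P z -> G z = 0) ->
  exists C, (forall z, `|F z| <= C * \1_uball z.2) /\ (forall z, `|G z| <= C * \1_uball z.2).
Proof.
move=> bF bG F0 G0; have [C hC] := bd_ball bF F0; have [C' hC'] := bd_ball bG G0.
exists (Num.max C C'); split => z.
  by apply: (le_trans (hC z)); apply: ler_wpM2r; rewrite ?indicE// le_max lexx.
by apply: (le_trans (hC' z)); apply: ler_wpM2r; rewrite ?indicE// le_max lexx orbT.
Qed.

Variables (f : V -> R) (h : axis -> V -> R).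
Hypotheses (f0 : forall v, 0 <= f v) (Lf : L1 mu f).
Let a (v : V) := Num.sqrt (f v).
Hypotheses (Lh : forall i, L2 mu (h i)) (wh : forall i, weak_deriv a (h i) i).

Definition main_term (z : T3) := cutY eps (ip (cY z) (cY z)) * cutR eps (ip (cU z) (cU z)) *
  be (fS eps (cU z) (cY z)) * dphi j (mk (fvp b eps (cU z) (cY z) (cW z))).
Definition error_term (z : T3) := cutY eps (ip (cY z) (cY z)) * (dcutR eps (ip (cU z) (cU z)) *
  (2 * sum3 (fun i => fdu b eps j (cU z) (cY z) i * cU z i))) * be (fS eps (cU z) (cY z)) * phi (mk (fvp b eps (cU z) (cY z) (cW z))).
Definition score_term (z : T3) := sum3 (fun i => 2 * a z.1.1 * h i z.1.1 * f z.1.2 * cv b eps j (cU z) (cY z) i +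
    2 * a z.1.2 * h i z.1.2 * f z.1.1 * cw b eps j (cU z) (cY z) i) * fG b eps be phi (cU z) (cY z) (cW z).

Lemma RI_sum3 (F : axis -> T3 -> R) : (forall i, L1 m3 (F i)) ->
  L1 m3 (fun z => sum3 (fun i => F i z)) /\ RI m3 (fun z => sum3 (fun i => F i z)) = sum3 (fun i => RI m3 (F i)).
Proof.
move=> LF; split; first by apply: L1D; [apply: L1D|]; exact: LF.
by rewrite /sum3 (RID (L1D (LF ax1) (LF ax2)) (LF ax3)) (RID (LF ax1) (LF ax2)).
Qed.

(** Integration by parts in [v], [w] and [y], summed over the coordinates. The left-hand side is the
    divergence computed in [field_identity]; on the right stand the scores of [f] at [v] and at
    [w]. *)
Lemma field_integral :
  [/\ L1 m3 (fun z => f z.1.1 * f z.1.2 * (main_term z + error_term z)), L1 m3 score_term &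
  RI m3 (fun z => f z.1.1 * f z.1.2 * (main_term z + error_term z)) = - RI m3 score_term].
Proof.
have Hv i : [/\ L1 m3 (fun z => f z.1.1 * f z.1.2 * dPv' i z),
      L1 m3 (fun z => 2 * a z.1.1 * h i z.1.1 * f z.1.2 * Pv i z) &
      RI m3 (fun z => f z.1.1 * f z.1.2 * dPv' i z) =
        - RI m3 (fun z => 2 * a z.1.1 * h i z.1.1 * f z.1.2 * Pv i z)].
  have [|||| C [h1 h2]] := @uniform (Pv i) (dPv' i).
  - by apply: bdM; [exact: bd_cv|exact: bd_fG].
  - exact: bd_dPv.
  - by move=> z nP; rewrite /Pv (out_zero nP).1 mulr0.
  - by move=> z nP; rewrite /dPv' /dPv (out_zero nP).1 (out_zero nP).2 !mulr0 addr0.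
  exact: (ibp_v f0 Lf Lh wh (m_Pv i).1 (m_Pv i).2 h1 h2 (isD_Pv i)).
have Hw i : [/\ L1 m3 (fun z => f z.1.1 * f z.1.2 * dPw' i z),
      L1 m3 (fun z => 2 * a z.1.2 * h i z.1.2 * f z.1.1 * Pw i z) &
      RI m3 (fun z => f z.1.1 * f z.1.2 * dPw' i z) =
        - RI m3 (fun z => 2 * a z.1.2 * h i z.1.2 * f z.1.1 * Pw i z)].
  have [|||| C [h1 h2]] := @uniform (Pw i) (dPw' i).
  - by apply: bdM; [exact: bd_cw|exact: bd_fG].
  - exact: bd_dPw.
  - by move=> z nP; rewrite /Pw (out_zero nP).1 mulr0.
  - by move=> z nP; rewrite /dPw' /dPw (out_zero nP).1 (out_zero nP).2 !mulr0 addr0.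
  exact: (ibp_w f0 Lf Lh wh (m_Pw i).1 (m_Pw i).2 h1 h2 (isD_Pw i)).
have Hy i : L1 m3 (fun z => f z.1.1 * f z.1.2 * dPy' i z) /\ RI m3 (fun z => f z.1.1 * f z.1.2 * dPy' i z) = 0.
  have [|||| C [h1 h2]] := @uniform (Py i) (dPy' i).
  - by apply: bdM; [exact: bd_fdy|exact: bd_fG].
  - exact: bd_dPy.
  - by move=> z nP; rewrite /Py (out_zero nP).1 mulr0.
  - by move=> z nP; rewrite /dPy' /dPy (out_zero nP).1 (out_zero nP).2 !mulr0 addr0.
  exact: (ibp_y f0 Lf (m_Py i).1 (m_Py i).2 h1 h2 (isD_Py i)).
have Lv i : L1 m3 (fun z => f z.1.1 * f z.1.2 * dPv' i z) by have [] := Hv i.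
have Lw i : L1 m3 (fun z => f z.1.1 * f z.1.2 * dPw' i z) by have [] := Hw i.
have Ly i := (Hy i).1.
have Lv' i : L1 m3 (fun z => 2 * a z.1.1 * h i z.1.1 * f z.1.2 * Pv i z) by have [] := Hv i.
have Lw' i : L1 m3 (fun z => 2 * a z.1.2 * h i z.1.2 * f z.1.1 * Pw i z) by have [] := Hw i.
have [LA EA] := RI_sum3 (fun i => L1D (L1D (Lv i) (Lw i)) (Ly i)).
have [LB EB] := RI_sum3 (fun i => L1D (Lv' i) (Lw' i)).
have E1 z : sum3 (fun i => f z.1.1 * f z.1.2 * dPv' i z + f z.1.1 * f z.1.2 * dPw' i z + f z.1.1 * f z.1.2 * dPy' i z) =
    f z.1.1 * f z.1.2 * (main_term z + error_term z).
  have FI : sum3 (fun i => dPv' i z + dPw' i z + dPy' i z) = main_term z + error_term z.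
    exact: (@field_identity R b eps j eps0 be dbe phi dphi).
  by rewrite -FI /sum3; ring.
have E2 z : sum3 (fun i => 2 * a z.1.1 * h i z.1.1 * f z.1.2 * Pv i z + 2 * a z.1.2 * h i z.1.2 * f z.1.1 * Pw i z) = score_term z.
  by rewrite /score_term /Pv /Pw /sum3; ring.
split; [exact: L1_eq E1 LA|exact: L1_eq E2 LB|].
rewrite -(RI_eq _ E1) -(RI_eq _ E2) EA EB.
have E3 i : RI m3 (fun z => f z.1.1 * f z.1.2 * dPv' i z + f z.1.1 * f z.1.2 * dPw' i z + f z.1.1 * f z.1.2 * dPy' i z) =
   - RI m3 (fun z => 2 * a z.1.1 * h i z.1.1 * f z.1.2 * Pv i z + 2 * a z.1.2 * h i z.1.2 * f z.1.1 * Pw i z).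
  rewrite (RID (L1D (Lv i) (Lw i)) (Ly i)) (RID (Lv i) (Lw i)) (RID (Lv' i) (Lw' i)) (Hy i).2 addr0 opprD.
  by have [_ _ ->] := Hv i; have [_ _ ->] := Hw i.
by rewrite /sum3 (E3 ax1) (E3 ax2) (E3 ax3) !opprD.
Qed.

End FieldIntegral.

(** * Null sets and Hardy's inequality *)

Section NullSets.
Context {R : realType}.
Local Notation V := (V3 R).
Local Notation mu := (@mu3 R).
Local Notation leb := (@leb1 R).

Lemma null_sub d (T : measurableType d) (m : {measure set T -> \bar R}) (A : set T) (F : T -> R) :
  measurable A -> L1 m F -> RI m F = 0 -> (forall x, \1_A x <= F x) -> m A = 0%E.
Proof.
move=> mA LF EF AF; have LA : L1 m (\1_A).
  by apply: L1_dom LF; [exact: measurable_indr|move=> x; rewrite ger0_norm ?indicE//; have := AF x; rewrite indicE].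
rewrite (measure_indic mA LA); congr EFin; apply/eqP; rewrite eq_le; apply/andP; split.
  by rewrite -EF; apply: RI_le.
by apply: RI_ge0 => x; rewrite indicE.
Qed.

Definition usphere : set V := [set y | norm3 y = 1].

Lemma measurable_usphere : measurable usphere.
Proof.
have -> : usphere = @norm3 R @^-1` [set 1] by [].
rewrite -[X in measurable X]setTI.
by apply: (measurable_norm3 (@measurable_id _ _ _) measurableT); exact: measurable_set1.
Qed.

(** A line parallel to the z axis meets the sphere in at most two points. *)
Lemma usphere_null : mu usphere = 0%E.
Proof.
have ms : measurable_fun setT (\1_usphere : V -> R) := measurable_indr measurable_usphere.
have S (p : R * R) (z : R) : \1_usphere ((p, z) : V) <=
   \1_[set Num.sqrt (1 - (p.1 ^+ 2 + p.2 ^+ 2))] z + \1_[set - Num.sqrt (1 - (p.1 ^+ 2 + p.2 ^+ 2))] z :> R.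
  have [h|h] := pselect (usphere ((p, z) : V)); last first.
    by rewrite [leLHS]indicE memNset// addr_ge0// indicE.
  have h2 : p.1 ^+ 2 + p.2 ^+ 2 + z ^+ 2 = 1.
    have := norm3_sqr ((p, z) : V); rewrite h expr1n /dot3 /v3x /v3y /v3z /= => ->.
    by rewrite !expr2.
  have -> : 1 - (p.1 ^+ 2 + p.2 ^+ 2) = z ^+ 2 by rewrite -h2 addrC addKr.
  rewrite sqrtr_sqr [leLHS]indicE mem_set//.
  have [z0|z0] := leP 0 z.
    by rewrite ger0_norm// [X in X + _]indicE mem_set// lerDl indicE.
  by rewrite ltr0_norm// opprK [X in _ + X]indicE mem_set// lerDr indicE.
have [||||L E] := @tonelli_x _ _ _ _ R (pm leb leb) leb (\1_usphere) (fun=> 0) _ (fun z => ltac:(by rewrite indicE)).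
- by apply: measurable_indr; exact: measurable_usphere.
- move=> p; set s := Num.sqrt (1 - (p.1 ^+ 2 + p.2 ^+ 2)).
  apply: (@L1_dom _ _ _ leb _ (fun z => \1_[set s] z + \1_[set - s] z)).
  + exact: (measurable_xsec p ms).
  + by move=> z; rewrite ger0_norm; [exact: S|rewrite indicE].
  + by apply: L1D; [exact: (L1_point1 s).1|exact: (L1_point1 (- s)).1].
- move=> p; apply/eqP; rewrite eq_le; apply/andP; split; last by apply: RI_ge0 => z; rewrite indicE.
  set s := Num.sqrt (1 - (p.1 ^+ 2 + p.2 ^+ 2)).
  have E0 : RI leb (fun z => \1_[set s] z + \1_[set - s] z) = 0.
    by rewrite (RID (L1_point1 s).1 (L1_point1 (- s)).1) (L1_point1 s).2 (L1_point1 (- s)).2 addr0.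
  rewrite -E0; apply: RI_le; last exact: S.
    apply: (@L1_dom _ _ _ leb _ (fun z => \1_[set s] z + \1_[set - s] z)); last first.
    + by apply: L1D; [exact: (L1_point1 s).1|exact: (L1_point1 (- s)).1].
    + by move=> z; rewrite ger0_norm; [exact: S|rewrite indicE].
    exact: (measurable_xsec p ms).
  by apply: L1D; [exact: (L1_point1 s).1|exact: (L1_point1 (- s)).1].
- exact: L1_0.
apply: (null_sub measurable_usphere L) => //.
by rewrite E RI0.
Qed.

Lemma diag_null : @m2 R diag = 0%E.
Proof. by apply: (null_sub (@measurable_diag R) L1_diag.1 L1_diag.2). Qed.

Lemma snd_null (A : set V) : measurable A -> mu A = 0%E -> @m3 R (snd @^-1` A) = 0%E.
Proof.
move=> mA A0; transitivity (\int[@m2 R]_x (mu \o xsection (snd @^-1` A : set (V * V * V)%type)) x)%E; first by [].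
rewrite -[RHS](@integral0 _ _ _ (@m2 R) setT); apply: eq_integral => p _ /=.
rewrite (_ : xsection _ _ = A)//.
by apply/seteqP; split => y; rewrite /xsection /= => h; [exact: (set_mem h)|exact: (mem_set h)].
Qed.

Lemma diag_ball_null : @m3 R ((fst @^-1` diag) `&` (snd @^-1` uball)) = 0%E.
Proof.
have [L E] := L1_tensor (@L1_diag R).1 (@ball_volume R).1.
rewrite (@L1_diag R).2 mul0r in E.
apply: (null_sub _ L E) => [|z].
  apply: measurableI; rewrite -[X in measurable X]setTI.
    by apply: (measurable_fst measurableT); exact: measurable_diag.
  by apply: (measurable_snd measurableT); exact: measurable_nball.
have [[h1 h2]|h] := pselect (((fst @^-1` diag) `&` (snd @^-1` uball)) z).
  by rewrite !indicE !mem_set// mulr1.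
by rewrite [leLHS]indicE memNset// mulr_ge0// indicE.
Qed.

(** The places where the cut-offs do not converge to 1 inside the ball, [v = w], [y = 0] and
    [|y| = 1], form a null set. *)
Lemma ae_generic : {ae @m3 R, forall z : V * V * V, uball z.2 ->
  0 < ip (cU z) (cU z) /\ 0 < ip (cY z) (cY z) < 1}.
Proof.
have A1 : {ae @m3 R, forall z : V * V * V, uball z.2 -> ~ diag z.1}.
  exists ((fst @^-1` diag) `&` (snd @^-1` uball)); split; [|exact: diag_ball_null|].
    apply: measurableI; rewrite -[X in measurable X]setTI.
      by apply: (measurable_fst measurableT); exact: measurable_diag.
    by apply: (measurable_snd measurableT); exact: measurable_nball.
  by move=> z /= h; split; apply: contrapT => h'; apply: h => hu hd; apply: h'.
have A2 (A : set V) : measurable A -> mu A = 0%E -> {ae @m3 R, forall z : V * V * V, ~ A z.2}.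
  move=> mA A0; exists (snd @^-1` A); split; [|exact: snd_null|].
    by rewrite -[X in measurable X]setTI; exact: (measurable_snd measurableT).
  by move=> z /= h; apply: contrapT => h'; apply: h.
have m0 : measurable [set (0 : V)].
  have -> : [set (0 : V)] = @norm3 R @^-1` [set 0].
    apply/seteqP; split => x /=; last exact: norm3_eq0.
    by move=> ->; rewrite /norm3 /dot3 /v3x /v3y /v3z /= !mulr0 !addr0 sqrtr0.
  rewrite -[X in measurable X]setTI.
  by apply: (measurable_norm3 (@measurable_id _ _ _) measurableT); exact: measurable_set1.
have z0 : mu [set (0 : V)] = 0%E.
  by rewrite (measure_indic m0 (L1_point 0).1) (L1_point 0).2.
apply: filterS3 A1 (A2 _ m0 z0) (A2 _ measurable_usphere usphere_null) => z h1 h2 h3 hb.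
have hU : ip (cU z) (cU z) = norm3 (sub3 z.1.1 z.1.2) ^+ 2 by exact: ip_norm.
have hY : ip (cY z) (cY z) = norm3 z.2 ^+ 2 by exact: ip_norm.
rewrite hU hY; split.
  by rewrite exprn_gt0// lt_neqAle norm3_ge0 andbT eq_sym; apply/eqP => e; exact: (h1 hb).
rewrite exprn_gt0 ?expr_lt1 ?norm3_ge0//=.
  by rewrite lt_neqAle hb andbT; apply/eqP.
by rewrite lt_neqAle norm3_ge0 andbT eq_sym; apply/eqP => e; apply: h2; exact: norm3_eq0.
Qed.

End NullSets.

Section Hardy.
Context {R : realType}.
Local Notation V := (V3 R).
Local Notation mu := (@mu3 R).
Variables (f : V -> R) (h : axis -> V -> R).
Hypotheses (f0 : forall v, 0 <= f v) (Lf : L1 mu f).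
Let a (v : V) := Num.sqrt (f v).
Hypotheses (Lh : forall i, L2 mu (h i)) (wh : forall i, weak_deriv a (h i) i).
Let La : L2 mu a := sqrt_L2 f0 Lf.
Let a2 v : a v ^+ 2 = f v. Proof. by rewrite sqr_sqrtr. Qed.

Let hardyC : R := sum3 (fun i => RI mu (fun v => `|2 * a v * h i v|)).

(** Integration by parts against the field [(v - w) / r], [r = sqrt(|v - w|^2 + dl)]: its components
    are bounded by 1 and its divergence [3 / r - |v - w|^2 / r^3] is at least [2 / r]. The bound
    depends neither on [w] nor on [dl]. *)
Lemma hardy_reg (w : V) (dl : R) : 0 < dl ->
  RI mu (fun v => f v * (Num.sqrt (norm3 (sub3 v w) ^+ 2 + dl))^-1) <= hardyC.
Proof.
move=> dl0.
pose q (v : V) := norm3 (sub3 v w) ^+ 2 + dl.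
have q0 v : 0 < q v by rewrite ltr_wpDl// sqr_ge0.
pose r v := Num.sqrt (q v).
have r0 v : 0 < r v by rewrite sqrtr_gt0.
have r2 v : r v ^+ 2 = q v by rewrite sqr_sqrtr// ltW.
pose Phi i (v : V) := cd i (sub3 v w) * (r v)^-1.
pose dPhi i (v : V) := (r v)^-1 - cd i (sub3 v w) ^+ 2 * (r v)^-1 ^+ 3.
have cr i v : cd i (sub3 v w) ^+ 2 <= q v.
  rewrite -[cd i _ ^+ 2]real_normK ?num_real// /q.
  apply: (@le_trans _ _ (norm3 (sub3 v w) ^+ 2)); last by rewrite lerDl ltW.
  by rewrite ler_sqr ?nnegrE ?norm3_ge0// cd_norm3.
have dr i v : isD r v (ee i) (cd i (sub3 v w) / r v).
  have dq : isD q v (ee i) (2 * cd i (sub3 v w)).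
    have dl' l : isD (fun v => cd l (sub3 v w)) v (ee i) (kd i l).
      refine (isd_eq (isdB (isD_cd l v (ee i)) (isd_cst (cd l w) 0)) _ _).
        by move=> t; rewrite cdB.
      by rewrite subr0 kdC.
    refine (isD_eq (isDD (isDD (isDD (isDM (dl' ax1) (dl' ax1)) (isDM (dl' ax2) (dl' ax2))) (isDM (dl' ax3) (dl' ax3))) (isD_cst dl v (ee i))) _ _).
      by move=> x; rewrite /q norm3_sqr dot3E.
    by rewrite -(kd_sum i (fun l => cd l (sub3 v w))) /sum3; ring.
  have ds : isd Num.sqrt (q v) ((2 * r v)^-1).
    have [d e] := is_derive1_sqrt (q0 v).
    by split.
  refine (isD_eq (isD_comp dq ds) (fun=> erefl) _); field; exact: lt0r_neq0.
have dP i v : isD (Phi i) v (ee i) (dPhi i v).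
  have dl' : isD (fun v => cd i (sub3 v w)) v (ee i) 1.
    refine (isd_eq (isdB (isD_cd i v (ee i)) (isd_cst (cd i w) 0)) _ _).
      by move=> t; rewrite cdB.
    by rewrite subr0; case: (i); rewrite cd_ee.
  have dv : isd (fun t => t^-1) (r v) (- (r v)^-1 ^+ 2).
    refine (isd_eq (isdV (f := fun y => y) (lt0r_neq0 (r0 v)) (isd_id (r v))) (fun=> erefl) _).
    by rewrite exprVn mulN1r.
  refine (isD_eq (isDM dl' (isD_comp (dr i v) dv)) (fun=> erefl) _).
  by rewrite /dPhi; field; exact: lt0r_neq0.
have mr : measurable_fun setT r.
  apply: (measurableT_comp (@measurable_sqrt R)); apply: measurable_funD; last exact: measurable_cst.
  apply: measurable_funX; apply: measurable_norm3; apply: measurable_sub3 => //; exact: measurable_cst.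
have mP i : measurable_fun setT (Phi i).
  apply: measurable_funM; last exact: measurable_invr.
  by apply: measurable_cd_comp; apply: measurable_sub3 => //; exact: measurable_cst.
have bP i v : `|Phi i v| <= 1.
  rewrite /Phi normrM normfV (ger0_norm (ltW (r0 v))) ler_pdivrMr// mul1r.
  by rewrite -ler_sqr ?nnegrE ?(ltW (r0 v))// real_normK ?num_real// r2.
have rd v : (r v)^-1 <= (Num.sqrt dl)^-1.
  by rewrite lef_pV2 ?posrE ?sqrtr_gt0// ler_wsqrtr// lerDr sqr_ge0.
have cr3 i v : 0 <= cd i (sub3 v w) ^+ 2 * (r v)^-1 ^+ 3 <= (r v)^-1.
  have ri : 0 <= (r v)^-1 by rewrite invr_ge0 ltW.
  rewrite mulr_ge0 ?sqr_ge0 ?exprn_ge0//=.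
  have -> : cd i (sub3 v w) ^+ 2 * (r v)^-1 ^+ 3 = (cd i (sub3 v w) ^+ 2 / r v ^+ 2) * (r v)^-1.
    by field; exact: lt0r_neq0.
  by rewrite -[leRHS]mul1r; apply: ler_wpM2r => //; rewrite ler_pdivrMr ?exprn_gt0// mul1r r2.
have bd i v : `|dPhi i v| <= (Num.sqrt dl)^-1.
  apply: le_trans (rd v); have /andP[h1 h2] := cr3 i v.
  by rewrite /dPhi ger0_norm ?subr_ge0// gerBl.
have md i : measurable_fun setT (dPhi i).
  apply: measurable_funB; first exact: measurable_invr.
  apply: measurable_funM; apply: measurable_funX; last exact: measurable_invr.
  by apply: measurable_cd_comp; apply: measurable_sub3 => //; exact: measurable_cst.
have ws i := weak_square La (Lh i) (@wh i) (mP i) (bP i) (bd i) (dP i).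
have Ld i : L1 mu (fun v => a v ^+ 2 * dPhi i v).
  by apply: L1_eq (L1_bd Lf (md i) (bd i)) => v; rewrite a2.
have Lah i : L1 mu (fun v => 2 * a v * h i v).
  by apply: L1_eq (L1Zl 2 (L2_mul La (Lh i))) => v; rewrite mulrA.
have Lfr : L1 mu (fun v => f v * (r v)^-1).
  apply: (L1_bd Lf (measurable_invr mr) (C := (Num.sqrt dl)^-1)) => v.
  by rewrite ger0_norm ?invr_ge0 ?(ltW (r0 v)).
have LS : L1 mu (fun v => a v ^+ 2 * dPhi ax1 v + a v ^+ 2 * dPhi ax2 v + a v ^+ 2 * dPhi ax3 v).
  by apply: L1D; [apply: L1D|]; exact: Ld.
apply: (@le_trans _ _ (RI mu (fun v => a v ^+ 2 * dPhi ax1 v + a v ^+ 2 * dPhi ax2 v + a v ^+ 2 * dPhi ax3 v))).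
  apply: RI_le => // v; rewrite a2 -!mulrDr; apply: ler_wpM2l; first exact: f0.
  have -> : dPhi ax1 v + dPhi ax2 v + dPhi ax3 v = 3 / r v - norm3 (sub3 v w) ^+ 2 * (r v)^-1 ^+ 3.
    by rewrite norm3_sqr dot3E /sum3 /dPhi; ring.
  have : norm3 (sub3 v w) ^+ 2 * (r v)^-1 ^+ 3 <= (r v)^-1.
    have ri : 0 <= (r v)^-1 by rewrite invr_ge0 ltW.
    have -> : norm3 (sub3 v w) ^+ 2 * (r v)^-1 ^+ 3 = (norm3 (sub3 v w) ^+ 2 / r v ^+ 2) * (r v)^-1.
      by field; exact: lt0r_neq0.
    rewrite -[leRHS]mul1r; apply: ler_wpM2r => //; rewrite ler_pdivrMr ?exprn_gt0// mul1r r2.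
    by rewrite lerDl ltW.
  have ri : 0 < (r v)^-1 by rewrite invr_gt0.
  move: ri; move: (r v)^-1 (_ * _) => x y; lra.
rewrite (RID (L1D (Ld ax1) (Ld ax2)) (Ld ax3)) (RID (Ld ax1) (Ld ax2)) /hardyC /sum3 !ws.
have B i : - RI mu (fun x => 2 * a x * h i x * Phi i x) <= RI mu (fun v => `|2 * a v * h i v|).
  apply: (le_trans (ler_norm _)); rewrite normrN; apply: RI_abs; last first.
  - by move=> v; rewrite normrM -[leRHS]mulr1; apply: ler_wpM2l.
  - exact: L1_abs.
  - exact: measurable_funM (L1_meas (Lah i)) (mP i).
by rewrite !lerD.
Qed.

(** The uniform bound [hardy_reg] is integrated in [w] against [f], and Fatou's lemma lets the
    regularisation tend to 0 off the diagonal. *)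
Lemma hardy : L1 (@m2 R) (fun p => f p.1 * f p.2 * (norm3 (sub3 p.1 p.2))^-1).
Proof.
pose dl n : R := n.+1%:R^-1.
have dl0 n : 0 < dl n by rewrite invr_gt0.
pose r n (p : V * V) := Num.sqrt (norm3 (sub3 p.1 p.2) ^+ 2 + dl n).
have mN : measurable_fun setT (fun p : V * V => norm3 (sub3 p.1 p.2)).
  by apply: measurable_norm3; exact: measurable_rel.
have mr n : measurable_fun setT (r n).
  apply: (measurableT_comp (@measurable_sqrt R)); apply: measurable_funD; last exact: measurable_cst.
  exact: measurable_funX.
have LF n : L1 (@m2 R) (fun p => f p.1 * f p.2 * (r n p)^-1).
  apply: (L1_bd (L1_tensor Lf Lf).1 (measurable_invr (mr n)) (C := (Num.sqrt (dl n))^-1)) => p.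
  rewrite ger0_norm ?invr_ge0 ?sqrtr_ge0// lef_pV2 ?posrE ?sqrtr_gt0//.
    by rewrite ler_wsqrtr// lerDr sqr_ge0.
  by rewrite ltr_wpDl// sqr_ge0.
have Ls n w : L1 mu (fun v => f v * f w * (r n (v, w))^-1).
  have m : measurable_fun setT (fun v => (r n (v, w))^-1) := measurable_ysec w (measurable_invr (mr n)).
  have L : L1 mu (fun v => f v * f w) by apply: L1_eq (L1Zl (f w) Lf) => v; rewrite mulrC.
  apply: (L1_bd L m (C := (Num.sqrt (dl n))^-1)) => v.
  rewrite ger0_norm ?invr_ge0 ?sqrtr_ge0// lef_pV2 ?posrE ?sqrtr_gt0//.
    by rewrite ler_wsqrtr// lerDr sqr_ge0.
  by rewrite ltr_wpDl// sqr_ge0.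
have BF n : RI (@m2 R) (fun p => f p.1 * f p.2 * (r n p)^-1) <= hardyC * RI mu f.
  have [LG ->] := fubini_y (LF n) (Ls n).
  rewrite -RIZl//; apply: RI_le => //; first exact: L1Zl.
  move=> w; have -> : RI mu (fun v => f v * f w * (r n (v, w))^-1) = f w * RI mu (fun v => f v * (r n (v, w))^-1).
    rewrite -RIZl; first by apply: RI_eq => v; ring.
    apply: (L1_bd Lf (measurable_ysec w (measurable_invr (mr n))) (C := (Num.sqrt (dl n))^-1)) => v.
    rewrite ger0_norm ?invr_ge0 ?sqrtr_ge0// lef_pV2 ?posrE ?sqrtr_gt0//.
      by rewrite ler_wsqrtr// lerDr sqr_ge0.
    by rewrite ltr_wpDl// sqr_ge0.
  by rewrite mulrC; apply: ler_wpM2r => //; exact: hardy_reg.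
have [||||//] := @RI_fatou _ _ _ (@m2 R) _ (fun p => f p.1 * f p.2 * (norm3 (sub3 p.1 p.2))^-1) _ LF _ _ _ BF.
- by apply: measurable_funM; [exact: L1_meas (L1_tensor Lf Lf).1|exact: measurable_invr].
- by move=> n p; rewrite !mulr_ge0// invr_ge0 sqrtr_ge0.
- by move=> p; rewrite !mulr_ge0// invr_ge0 norm3_ge0.
exists diag; split; [exact: measurable_diag|exact: diag_null|].
move=> p /= np; apply: contrapT => hd; apply: np.
have n0 : norm3 (sub3 p.1 p.2) != 0 by apply/eqP => e; apply: hd.
apply: cvgM; first exact: cvg_cst.
apply: cvgV => //.
have -> : norm3 (sub3 p.1 p.2) = Num.sqrt (norm3 (sub3 p.1 p.2) ^+ 2 + 0).
  by rewrite addr0 sqrtr_sqr ger0_norm// norm3_ge0.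
have c : (norm3 (sub3 p.1 p.2) ^+ 2 + dl n) @[n --> \oo] --> norm3 (sub3 p.1 p.2) ^+ 2 + 0.
  by apply: cvgD; [exact: cvg_cst|exact: cvg_harmonic].
exact: (cvg_comp _ _ c (@sqrt_continuous R _)).
Qed.

End Hardy.

(** * Removal of the cut-offs *)

Section LimitFields.
Context {R : realType}.
Local Notation V := (V3 R).
Local Notation mu := (@mu3 R).
Local Notation T3 := (V * V * V)%type.
Variables (b : R) (j : axis).
Hypothesis b12 : 1 <= b <= 2.
Implicit Types (u y v : axis -> R).

(** Names in [t] are the coefficients without truncation, with [0^-1 = 0]. They agree with the
    truncated ones wherever the cut-offs do not vanish, and the velocities of [v] and [w] are
    bounded uniformly. *)
Definition tS u y := ip u y ^+ 2 / (ip u u * ip y y).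
Definition tdu u y i := (1 - b * tS u y) * kd i j + b * (ip u y / (ip u u * ip y y)) * (u j * y i - y j * u i).
Definition tdz u y i := (1 + b * (2 - b) * tS u y) / 2 * kd i j.
Definition tcv u y i := tdz u y i + tdu u y i / 2.
Definition tcw u y i := tdz u y i - tdu u y i / 2.
Definition tvp u y v l := v l - b / 2 * (ip u y / ip y y) * y l.

Section True.
Variables (u y : axis -> R) (eps : R).
Hypotheses (e0 : 0 < eps) (hR : eps <= ip u u) (hY : eps <= ip y y).

Lemma fS_true : fS eps u y = tS u y.
Proof. by rewrite /fS /fX !rinvE// /tS invfM mulrA. Qed.
Lemma fdu_true i : fdu b eps j u y i = tdu u y i.
Proof. by rewrite /fdu fS_true /tdu /fX !rinvE//; congr (_ + b * _ * _); rewrite invfM mulrA. Qed.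
Lemma cv_true i : cv b eps j u y i = tcv u y i.
Proof. by rewrite /cv fdu_true /fdz fS_true. Qed.
Lemma cw_true i : cw b eps j u y i = tcw u y i.
Proof. by rewrite /cw fdu_true /fdz fS_true. Qed.
Lemma fvp_true v : fvp b eps u y v = tvp u y v.
Proof. by apply/funext => l; rewrite /fvp /fX !rinvE. Qed.

End True.

Lemma ip_cauchy u y : ip u y ^+ 2 <= ip u u * ip y y.
Proof.
rewrite -subr_ge0; have -> : ip u u * ip y y - ip u y ^+ 2 =
  (u ax1 * y ax2 - u ax2 * y ax1) ^+ 2 + (u ax1 * y ax3 - u ax3 * y ax1) ^+ 2 + (u ax2 * y ax3 - u ax3 * y ax2) ^+ 2.
  by rewrite /ip /sum3; ring.
by rewrite !addr_ge0 ?sqr_ge0.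
Qed.

Lemma tS_itv u y : 0 <= tS u y <= 1.
Proof.
rewrite /tS divr_ge0 ?sqr_ge0 ?mulr_ge0 ?ip_ge0//=.
have [->|n0] := eqVneq (ip u u * ip y y) 0; first by rewrite invr0 mulr0.
rewrite ler_pdivrMr ?mul1r ?ip_cauchy// lt_neqAle eq_sym n0 mulr_ge0 ?ip_ge0//.
Qed.

Lemma kd_itv i l : 0 <= (kd i l : R) <= 1.
Proof. by rewrite /kd cd_ee; case: i; case: l; rewrite ?lexx ?ler01. Qed.

Lemma coord_sq u l : u l ^+ 2 <= ip u u.
Proof.
rewrite /ip /sum3; have h1 := sqr_ge0 (u ax1); have h2 := sqr_ge0 (u ax2); have h3 := sqr_ge0 (u ax3).
by rewrite !expr2 in h1 h2 h3; case: l; rewrite expr2; lra.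
Qed.

Lemma abs_le_of_sq (x c : R) : 0 <= c -> x ^+ 2 <= c ^+ 2 -> `|x| <= c.
Proof. by move=> c0; rewrite -[x ^+ 2]real_normK ?num_real// ler_sqr ?nnegrE. Qed.

Lemma cross_bound u y i l : `|ip u y / (ip u u * ip y y) * (u i * y l)| <= 1.
Proof.
apply: abs_le_of_sq => //; rewrite expr1n.
have [z|n0] := eqVneq (ip u u * ip y y) 0; first by rewrite z invr0 mulr0 mul0r expr0n ler01.
have P0 : 0 < ip u u * ip y y by rewrite lt_neqAle eq_sym n0 mulr_ge0 ?ip_ge0.
have -> : (ip u y / (ip u u * ip y y) * (u i * y l)) ^+ 2 = (ip u y ^+ 2 * (u i ^+ 2 * y l ^+ 2)) / (ip u u * ip y y) ^+ 2.
  by move: n0; rewrite mulf_eq0 negb_or => /andP[n1 n2]; field; rewrite n1 n2.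
rewrite ler_pdivrMr ?exprn_gt0// mul1r [leRHS]expr2.
apply: (ler_pM (sqr_ge0 _) _ (ip_cauchy u y)); first by rewrite mulr_ge0 ?sqr_ge0.
exact: (ler_pM (sqr_ge0 _) (sqr_ge0 _) (coord_sq u i) (coord_sq y l)).
Qed.

Lemma tdu_bound u y i : `|tdu u y i| <= 5.
Proof.
have /andP[s0 s1] := tS_itv u y; have /andP[k0 k1] := kd_itv i j.
have /andP[b1 b2] := b12.
have h1 := cross_bound u y j i; have h2 := cross_bound u y i j.
have -> : tdu u y i = (1 - b * tS u y) * kd i j + b * (ip u y / (ip u u * ip y y) * (u j * y i)) -
   b * (ip u y / (ip u u * ip y y) * (u i * y j)) by rewrite /tdu; ring.
move: h1 h2 s0 s1 k0 k1; move: (ip u y / (ip u u * ip y y) * (u j * y i)) (ip u y / (ip u u * ip y y) * (u i * y j)) (tS u y) (kd i j).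
move=> p q s k hp hq s0 s1 k0 k1.
have p1 : `|b * p| <= 2.
  by rewrite normrM ger0_norm; [rewrite -[leRHS]mulr1; apply: ler_pM => //; lra|lra].
have q1 : `|b * q| <= 2.
  by rewrite normrM ger0_norm; [rewrite -[leRHS]mulr1; apply: ler_pM => //; lra|lra].
have r1 : `|(1 - b * s) * k| <= 1.
  have bs : 0 <= b * s <= 2 by apply/andP; split; nra.
  rewrite normrM -[leRHS]mulr1; apply: ler_pM => //; last by rewrite ger0_norm.
  by rewrite ler_norml; case/andP: bs => ? ?; apply/andP; split; lra.
apply: (le_trans (ler_normB _ _)); apply: (le_trans (lerD (ler_normD _ _) (lexx _))).
rewrite [leRHS](_ : _ = 1 + 2 + 2); last by ring.
exact: lerD (lerD r1 p1) q1.
Qed.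

Lemma tdz_bound u y i : `|tdz u y i| <= 1.
Proof.
have /andP[s0 s1] := tS_itv u y; have /andP[k0 k1] := kd_itv i j.
have /andP[b1 b2] := b12.
have c : 0 <= b * (2 - b) <= 1 by apply/andP; split; nra.
case/andP: c => c0 c1; rewrite /tdz normrM -[leRHS]mulr1; apply: ler_pM => //; last by rewrite ger0_norm.
have : 0 <= b * (2 - b) * tS u y <= 1 by rewrite mulr_ge0// mulr_ile1.
by case/andP => ? ?; rewrite ger0_norm; lra.
Qed.

Lemma tcv_bound u y i : `|tcv u y i| <= 4.
Proof.
have := tdu_bound u y i; have := tdz_bound u y i; rewrite /tcv !ler_norml => /andP[? ?] /andP[? ?].
by apply/andP; split; lra.
Qed.
Lemma tcw_bound u y i : `|tcw u y i| <= 4.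
Proof.
have := tdu_bound u y i; have := tdz_bound u y i; rewrite /tcw !ler_norml => /andP[? ?] /andP[? ?].
by apply/andP; split; lra.
Qed.

(** Along the field [|u|^2] changes at a rate of order [|u|] only. Against the derivative of the
    cut-off, of order [1 / |u|^2], this leaves [1 / |u|], which [hardy] controls. The constant is
    [1 + b <= 3]. *)
Lemma tdu_u u y : 0 < ip u u -> 0 < ip y y -> `|sum3 (fun i => tdu u y i * u i)| <= 3 * Num.sqrt (ip u u).
Proof.
move=> R0 Y0; have /andP[b1 b2] := b12.
have -> : sum3 (fun i => tdu u y i * u i) = u j - b * (ip u y / ip y y * y j).
  rewrite (lin_sum j u y (1 - b * tS u y) (b * (ip u y / (ip u u * ip y y))) u) /tS.
  have -> : ip y u = ip u y by rewrite /ip /sum3; ring.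
  by field; rewrite !lt0r_neq0.
have h1 : `|u j| <= Num.sqrt (ip u u).
  by apply: abs_le_of_sq; rewrite ?sqrtr_ge0// sqr_sqrtr ?ip_ge0// coord_sq.
have h2 : `|ip u y / ip y y * y j| <= Num.sqrt (ip u u).
  apply: abs_le_of_sq; rewrite ?sqrtr_ge0// sqr_sqrtr ?ip_ge0//.
  have -> : (ip u y / ip y y * y j) ^+ 2 = ip u y ^+ 2 * y j ^+ 2 / ip y y ^+ 2 by field; rewrite lt0r_neq0.
  rewrite ler_pdivrMr ?exprn_gt0// [leRHS](_ : _ = (ip u u * ip y y) * ip y y); last by rewrite expr2; ring.
  by apply: ler_pM; rewrite ?sqr_ge0 ?ip_cauchy ?coord_sq.
apply: (le_trans (ler_normB _ _)); rewrite normrM (ger0_norm (_ : 0 <= b)); last lra.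
move: h1 h2; move: `|u j| `|_ * y j| (Num.sqrt (ip u u)) (normr_ge0 (ip u y / ip y y * y j)) => p q s.
by move: b1 b2; clear; nra.
Qed.

Lemma tvp_post (z : T3) (e : R) : b = 1 + e -> post_vel e z.1.1 z.1.2 (hat z.2) = mk (tvp (cU z) (cY z) (cW z)).
Proof.
move=> be; apply: v3P => i.
have E : cd i (mk (tvp (cU z) (cY z) (cW z))) = tvp (cU z) (cY z) (cW z) i by case: i.
rewrite E /post_vel cdB cdZ /hat cdZ /tvp -be [dot3 (sub3 _ _) _]dotC dotZl.
have -> : dot3 z.2 (sub3 z.1.1 z.1.2) = ip (cU z) (cY z) by rewrite dotC dot3E.
have -> : ip (cY z) (cY z) = norm3 z.2 ^+ 2 by exact: ip_norm.
have [->|n0] := eqVneq (norm3 z.2) 0; first by rewrite expr0n !invr0 !(mulr0, mul0r).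
by rewrite /cW /cY; field.
Qed.

End LimitFields.

Section LimitIdentity.
Context {R : realType}.
Local Notation V := (V3 R).
Local Notation mu := (@mu3 R).
Local Notation T3 := (V * V * V)%type.

Lemma measurable_arg1 (g : V -> R) : measurable_fun setT g -> measurable_fun setT (fun z : T3 => g z.1.1).
Proof. by move=> mg; apply: (measurable_fst_comp (f := fun p : V * V => g p.1)); exact: measurable_fst_comp. Qed.

Lemma measurable_arg2 (g : V -> R) : measurable_fun setT g -> measurable_fun setT (fun z : T3 => g z.1.2).
Proof. by move=> mg; apply: (measurable_fst_comp (f := fun p : V * V => g p.2)); exact: measurable_snd_comp. Qed.

Lemma measurable_ball3 : measurable_fun setT (fun z : T3 => \1_uball z.2 : R).
Proof. by apply: (measurable_snd_comp (f := (\1_uball : V -> R))); apply: L1_meas ball_volume.1. Qed.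

Lemma indic_ball_ge0 (z : T3) : 0 <= (\1_uball z.2 : R).
Proof. by case/andP: (indic_itv uball z.2). Qed.

Lemma sqr_itv (s : R) : -1 <= s <= 1 -> 0 <= s ^+ 2 <= 1.
Proof. by move=> h; rewrite sqr_ge0/= -real_normK ?num_real// expr_le1// ler_norml. Qed.

Definition Sv (z : T3) : R := tS (cU z) (cY z).
Definition vp (b : R) (z : T3) : V := mk (tvp b (cU z) (cY z) (cW z)).

Lemma uball_ip (z : T3) : uball z.2 <-> ip (cY z) (cY z) <= 1.
Proof.
have -> : ip (cY z) (cY z) = norm3 z.2 ^+ 2 by exact: ip_norm.
by rewrite expr_le1 ?norm3_ge0.
Qed.

Lemma measurable_Sv : measurable_fun setT Sv.
Proof.
apply: measurable_funM; first by apply: measurable_funX; exact: m_ip.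
by apply: measurable_invr; apply: measurable_funM; [exact: m_ipU|exact: m_ipY].
Qed.

Lemma measurable_vp b : measurable_fun setT (vp b).
Proof.
have m l : measurable_fun setT (fun z : T3 => tvp b (cU z) (cY z) (cW z) l).
  apply: measurable_funB; first exact: measurable_cW.
  apply: measurable_funM; last exact: measurable_cY.
  apply: measurable_funM; first exact: measurable_cst.
  by apply: measurable_funM; [exact: m_ip|apply: measurable_invr; exact: m_ipY].
exact: measurable_mk3.
Qed.

Variables (b : R) (j : axis).
Hypothesis b12 : 1 <= b <= 2.

Lemma measurable_tdu i : measurable_fun setT (fun z : T3 => tdu b j (cU z) (cY z) i).
Proof.
apply: measurable_funD.
  apply: measurable_funM; last exact: measurable_cst.
  apply: measurable_funB; first exact: measurable_cst.
  by apply: measurable_funM; [exact: measurable_cst|exact: measurable_Sv].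
apply: measurable_funM; last first.
  by apply: measurable_funB; apply: measurable_funM; first [exact: measurable_cU|exact: measurable_cY].
apply: measurable_funM; first exact: measurable_cst.
apply: measurable_funM; first exact: m_ip.
by apply: measurable_invr; apply: measurable_funM; [exact: m_ipU|exact: m_ipY].
Qed.

Lemma measurable_tdz i : measurable_fun setT (fun z : T3 => tdz b j (cU z) (cY z) i).
Proof.
apply: measurable_funM; last exact: measurable_cst.
apply: measurable_funM; last exact: measurable_cst.
apply: measurable_funD; first exact: measurable_cst.
by apply: measurable_funM; [exact: measurable_cst|exact: measurable_Sv].
Qed.

Lemma measurable_tcv i : measurable_fun setT (fun z : T3 => tcv b j (cU z) (cY z) i).
Proof.
apply: measurable_funD; first exact: measurable_tdz.
by apply: measurable_funM; [exact: measurable_tdu|exact: measurable_cst].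
Qed.

Lemma measurable_tcw i : measurable_fun setT (fun z : T3 => tcw b j (cU z) (cY z) i).
Proof.
apply: measurable_funB; first exact: measurable_tdz.
by apply: measurable_funM; [exact: measurable_tdu|exact: measurable_cst].
Qed.

Let ep n : R := n.+1%:R^-1.
Let ep0 n : 0 < ep n. Proof. by rewrite invr_gt0. Qed.
Let ep1 n : ep n <= 1. Proof. by rewrite invf_le1// ler1n. Qed.
Let cut n (z : T3) := cutY (ep n) (ip (cY z) (cY z)) * cutR (ep n) (ip (cU z) (cU z)).
Let dcut n (z : T3) := cutY (ep n) (ip (cY z) (cY z)) * dcutR (ep n) (ip (cU z) (cU z)).

Let cut_cases n z : (cut n z = 0 /\ dcut n z = 0) \/
  [/\ ep n <= ip (cU z) (cU z), ep n <= ip (cY z) (cY z) & uball z.2].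
Proof.
have [hY|hY] := leP (ep n) (ip (cY z) (cY z)); last first.
  by left; rewrite /cut /dcut (cutY_out _).1 ?mul0r// (ltW hY).
have [hR|hR] := leP (ep n) (ip (cU z) (cU z)); last first.
  have o : (ip (cU z) (cU z) <= ep n) || (1 <= ep n * ip (cU z) (cU z)) by rewrite (ltW hR).
  by left; rewrite /cut /dcut (cutR_out o).1 (cutR_out o).2 !mulr0.
have [hu|hu] := pselect (uball z.2); first by right.
left; have o : (ip (cY z) (cY z) <= ep n) || (1 - ep n <= ip (cY z) (cY z)).
  apply/orP; right; have /negP := (fun h => hu ((uball_ip z).2 h)); rewrite -ltNge => h.
  by apply: le_trans (ltW h); rewrite gerBl ltW.
by rewrite /cut /dcut (cutY_out o).1 !mul0r.
Qed.

Let cut_itv n z : 0 <= cut n z <= \1_uball z.2.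
Proof.
have [[-> _]|[_ _ u]] := cut_cases n z; first by rewrite lexx; case/andP: (indic_itv uball z.2).
have /andP[y0 y1] := cutY_itv (ip (cY z) (cY z)) (ep0 n).
have /andP[r0 r1] := cutR_itv (ep0 n) (ip_ge0 (cU z)).
by rewrite indic_in// /cut mulr_ge0//= mulr_ile1.
Qed.

Let dcut_bound n z : `|dcut n z| * Num.sqrt (ip (cU z) (cU z)) <=
  (2 / Num.sqrt (ip (cU z) (cU z)) + 2) * \1_uball z.2.
Proof.
have s0 := sqrtr_ge0 (ip (cU z) (cU z)).
have r0 : 0 <= (2 / Num.sqrt (ip (cU z) (cU z)) + 2) * \1_uball z.2.
  by rewrite mulr_ge0// addr_ge0// divr_ge0.
have [[_ ->]|[hR _ u]] := cut_cases n z; first by rewrite normr0 mul0r.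
have /andP[y0 y1] := cutY_itv (ip (cY z) (cY z)) (ep0 n).
have R0 : 0 < ip (cU z) (cU z) by apply: lt_le_trans hR.
have [h _] := dcutR_bound (ep0 n) (ep1 n) R0.
rewrite indic_in// mulr1; apply: le_trans h; rewrite /dcut normrM.
apply: ler_wpM2r => //; rewrite -[leRHS]mul1r; apply: ler_wpM2r => //.
by rewrite ger0_norm.
Qed.

Let measurable_cut n : measurable_fun setT (cut n) /\ measurable_fun setT (dcut n).
Proof.
have [mY _] := isd_measurable (fun x => isd_cutY x (ep0 n)).
have [mR mdR] := isd_measurable (fun x => isd_cutR x (ep0 n)).
by split; apply: measurable_funM; first [exact: measurableT_comp mY m_ipY|exact: measurableT_comp mR m_ipU|exact: measurableT_comp mdR m_ipU].
Qed.

Let cut_cvg : {ae @m3 R, forall z : T3, cut n z @[n --> \oo] --> (\1_uball z.2 : R)}.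
Proof.
apply: filterS ae_generic => z g.
have [u|u] := pselect (uball z.2); last first.
  rewrite indic_out//; apply: cvg_near_cst; apply: nearW => n.
  by have [[]|[]] := cut_cases n z.
have [R0 /andP[Y0 Y1]] := g u.
have c := @cvg_harmonic R.
rewrite indic_in// -[1]mulr1; apply: cvgM.
  rewrite -[1]mulr1; apply: cvgM; first exact: (cutlow_cvg ep0 c Y0).
  by apply: (cutlow_cvg ep0 c); rewrite subr_gt0.
rewrite -[1]mulr1; apply: cvgM; first exact: (cutlow_cvg ep0 c R0).
have e : (1 - ep n * ip (cU z) (cU z)) @[n --> \oo] --> (1 : R).
  rewrite -[X in _ --> X]subr0; apply: cvgB; first exact: cvg_cst.
  by rewrite -(mul0r (ip (cU z) (cU z))); apply: cvgM => //; exact: cvg_cst.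
have := cvg_comp _ _ e (isd_continuous (isd_sqpos (1 : R))).
by rewrite {2}/sqpos (max_idPl ler01) expr1n.
Qed.

Let dcut_cvg : {ae @m3 R, forall z : T3, dcut n z @[n --> \oo] --> (0 : R)}.
Proof.
apply: filterS ae_generic => z g.
have [u|u] := pselect (uball z.2); last first.
  apply: cvg_near_cst; apply: nearW => n.
  by have [[]|[]] := cut_cases n z.
have [R0 _] := g u; set r := ip (cU z) (cU z).
have B n : `|dcut n z| <= ep n * (2 / r ^+ 2 + 2).
  have /andP[y0 y1] := cutY_itv (ip (cY z) (cY z)) (ep0 n).
  have [_ h] := dcutR_bound (ep0 n) (ep1 n) R0.
  rewrite [leRHS](_ : _ = 2 * ep n / r ^+ 2 + 2 * ep n); last by ring.
  apply: le_trans h; rewrite /dcut normrM -[leRHS]mul1r; apply: ler_wpM2r => //.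
  by rewrite ger0_norm.
have E : ep n * (2 / r ^+ 2 + 2) @[n --> \oo] --> (0 : R).
  by rewrite -(mul0r (2 / r ^+ 2 + 2)); apply: cvgM; [exact: cvg_harmonic|exact: cvg_cst].
apply: (@squeeze_cvgr _ _ _ _ (fun n => - (ep n * (2 / r ^+ 2 + 2))) (fun n => ep n * (2 / r ^+ 2 + 2))) => //.
- by apply: nearW => n; rewrite -ler_norml.
- by rewrite -oppr0; apply: cvgN.
Qed.

Let cut_dct (F g : T3 -> R) : measurable_fun setT F -> L1 m3 g ->
  (forall z, `|\1_uball z.2 * F z| <= g z) ->
  [/\ L1 m3 (fun z => \1_uball z.2 * F z), forall n, L1 m3 (fun z => cut n z * F z) &
  RI m3 (fun z => cut n z * F z) @[n --> \oo] --> RI m3 (fun z => \1_uball z.2 * F z)].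
Proof.
move=> mF Lg B.
have mc n : measurable_fun setT (fun z => cut n z * F z) := measurable_funM (measurable_cut n).1 mF.
have Bc n z : `|cut n z * F z| <= g z.
  apply: le_trans (B z); rewrite (normrM (cut n z)) (normrM (\1_uball z.2)); apply: ler_wpM2r => //.
  have /andP[c0 c1] := cut_itv n z; rewrite (ger0_norm c0) ger0_norm//.
have cc : {ae @m3 R, forall z : T3, cut n z * F z @[n --> \oo] --> (\1_uball z.2 * F z : R)}.
  by apply: filterS cut_cvg => z c; apply: cvgM => //; exact: cvg_cst.
have [L C] := RI_dct mc (measurable_funM measurable_ball3 mF) Lg Bc cc.
by split => // n; apply: L1_dom (mc n) (Bc n) Lg.
Qed.

Variables (be dbe : R -> R) (phi : V -> R) (dphi : axis -> V -> R) (Cb : R).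
Hypotheses (hbe : forall x, isd be x (dbe x)) (hphi : C1b phi dphi).
Hypotheses (bbe : forall x, `|be x| <= Cb) (bdbe : forall x, `|dbe x| <= Cb).
Variables (f : V -> R) (h : axis -> V -> R).
Hypotheses (f0 : forall v, 0 <= f v) (Lf : L1 mu f).
Let a (v : V) := Num.sqrt (f v).
Hypotheses (Lh : forall i, L2 mu (h i)) (wh : forall i, weak_deriv a (h i) i).

(** As [2 a (h i)] is the i-th derivative of [f], this is the derivative of [f(v) f(w)] along the
    field. *)
Definition tscore (z : T3) := sum3 (fun i =>
  2 * a z.1.1 * h i z.1.1 * f z.1.2 * tcv b j (cU z) (cY z) i +
  2 * a z.1.2 * h i z.1.2 * f z.1.1 * tcw b j (cU z) (cY z) i).

Let mainE n z : main_term b (ep n) j be dphi z = cut n z * (be (Sv z) * dphi j (vp b z)).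
Proof.
rewrite /main_term -/(cut n z).
have [[-> _]|[hR hY _]] := cut_cases n z; first by rewrite !mul0r.
by rewrite (fS_true hR hY) (fvp_true b _ hY) mulrA.
Qed.

Let errE n z : error_term b (ep n) j be phi z =
  dcut n z * (2 * sum3 (fun i => tdu b j (cU z) (cY z) i * cU z i) * (be (Sv z) * phi (vp b z))).
Proof.
rewrite /error_term mulrA -/(dcut n z).
have [[_ ->]|[hR hY _]] := cut_cases n z; first by rewrite !mul0r.
rewrite (fS_true hR hY) (fvp_true b _ hY) /sum3 !(fdu_true b j hR hY).
by rewrite !mulrA.
Qed.

Let scoreE n z : score_term b (ep n) j be phi f h z = cut n z * (tscore z * (be (Sv z) * phi (vp b z))).
Proof.
rewrite /score_term /fG -/(cut n z).
have [[-> _]|[hR hY _]] := cut_cases n z; first by rewrite !mul0r mulr0.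
rewrite (fS_true hR hY) (fvp_true b _ hY) /sum3 !(cv_true b j hR hY) !(cw_true b j hR hY) -/(tscore z).
by rewrite -[cut n z * _ * _]mulrA [LHS]mulrCA.
Qed.

Let tscore_bound z : `|tscore z| <= 4 * (sum3 (fun i => `|2 * a z.1.1 * h i z.1.1|) * f z.1.2 +
   f z.1.1 * sum3 (fun i => `|2 * a z.1.2 * h i z.1.2|)).
Proof.
have B i : `|2 * a z.1.1 * h i z.1.1 * f z.1.2 * tcv b j (cU z) (cY z) i +
  2 * a z.1.2 * h i z.1.2 * f z.1.1 * tcw b j (cU z) (cY z) i| <=
  4 * (`|2 * a z.1.1 * h i z.1.1| * f z.1.2 + f z.1.1 * `|2 * a z.1.2 * h i z.1.2|).
  apply: (le_trans (ler_normD _ _)); rewrite [leRHS]mulrDr; apply: lerD.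
    rewrite normrM normrM (ger0_norm (f0 _)) [leRHS]mulrC; apply: ler_wpM2l; last exact: tcv_bound.
    by rewrite mulr_ge0.
  rewrite normrM normrM (ger0_norm (f0 _)) [leRHS]mulrC [f _ * _]mulrC; apply: ler_wpM2l; last exact: tcw_bound.
  by rewrite mulr_ge0.
rewrite /tscore /sum3; apply: (le_trans (ler_normD _ _)); apply: (le_trans (lerD (ler_normD _ _) (lexx _))).
apply: (le_trans (lerD (lerD (B _) (B _)) (B _))); rewrite le_eqVlt; apply/orP; left; apply/eqP; ring.
Qed.

Lemma measurable_be : measurable_fun setT (fun z : T3 => be (Sv z)).
Proof. exact: measurableT_comp (isd_measurable hbe).1 measurable_Sv. Qed.

Lemma measurable_tscore : measurable_fun setT tscore.
Proof.
have ma : measurable_fun setT a := (sqrt_L2 f0 Lf).1.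
have mh i : measurable_fun setT (h i) := (Lh i).1.
have mf := L1_meas Lf.
apply: measurable_sum3 => i; apply: measurable_funD.
  apply: measurable_funM; last exact: measurable_tcv.
  apply: measurable_funM; last exact: measurable_arg2.
  apply: (measurable_arg1 (g := fun v => 2 * a v * h i v)).
  by apply: measurable_funM => //; apply: measurable_funM => //; exact: measurable_cst.
apply: measurable_funM; last exact: measurable_tcw.
apply: measurable_funM; last exact: measurable_arg1.
apply: (measurable_arg2 (g := fun v => 2 * a v * h i v)).
by apply: measurable_funM => //; apply: measurable_funM => //; exact: measurable_cst.
Qed.

Let Lu : L1 mu (\1_uball : V -> R) := ball_volume.1.

(** The score of the gain operator in weak form. Bounded coefficients dominate the main and the
    score terms, and the error of the cut-off in [|u|] tends to 0 under the majorant [g2]. *)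
Lemma limit_identity :
  [/\ L1 m3 (fun z => \1_uball z.2 * (f z.1.1 * f z.1.2 * (be (Sv z) * dphi j (vp b z)))),
      L1 m3 (fun z => \1_uball z.2 * (tscore z * (be (Sv z) * phi (vp b z)))) &
      RI m3 (fun z => \1_uball z.2 * (f z.1.1 * f z.1.2 * (be (Sv z) * dphi j (vp b z)))) =
      - RI m3 (fun z => \1_uball z.2 * (tscore z * (be (Sv z) * phi (vp b z))))].
Proof.
have [cphi [M hM] cdphi bdphi _] := hphi; have [M' hM'] := bdphi j.
have M0 : 0 <= M := le_trans (normr_ge0 _) (hM (0 : V)).
have M0' : 0 <= M' := le_trans (normr_ge0 _) (hM' (0 : V)).
have C0 : 0 <= Cb := le_trans (normr_ge0 _) (bbe 0).
have mphi : measurable_fun setT (fun z : T3 => phi (vp b z)).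
  by apply: measurableT_comp (measurable_vp b); exact: continuous_measurable3.
have mdphi : measurable_fun setT (fun z : T3 => dphi j (vp b z)).
  by apply: measurableT_comp (measurable_vp b); exact: continuous_measurable3.
have mff : measurable_fun setT (fun z : T3 => f z.1.1 * f z.1.2).
  exact: (measurable_fst_comp (L1_meas (L1_tensor Lf Lf).1)).
have L3 (K1 K2 : V -> R) : L1 mu K1 -> L1 mu K2 -> L1 m3 (fun z : T3 => K1 z.1.1 * K2 z.1.2 * \1_uball z.2).
  by move=> l1 l2; exact: (L1_tensor3 l1 l2 Lu).1.
have Lah i : L1 mu (fun v => `|2 * a v * h i v|) by apply: L1_abs; exact: L1_ah f0 Lf Lh i.
have LK : L1 mu (fun v => sum3 (fun i => `|2 * a v * h i v|)) by apply: L1D => //; exact: L1D.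
have f2 (z : T3) : 0 <= f z.1.1 * f z.1.2 by exact: mulr_ge0.
have [L_1 Ln1 C1] : [/\ L1 m3 (fun z : T3 => \1_uball z.2 * (f z.1.1 * f z.1.2 * (be (Sv z) * dphi j (vp b z)))),
   forall n, L1 m3 (fun z => cut n z * (f z.1.1 * f z.1.2 * (be (Sv z) * dphi j (vp b z)))) &
  RI m3 (fun z => cut n z * (f z.1.1 * f z.1.2 * (be (Sv z) * dphi j (vp b z)))) @[n --> \oo] -->
  RI m3 (fun z => \1_uball z.2 * (f z.1.1 * f z.1.2 * (be (Sv z) * dphi j (vp b z))))].
  apply: (cut_dct _ (L1Zl (Cb * M') (L3 _ _ Lf Lf))).
    by apply: measurable_funM => //; apply: measurable_funM => //; exact: measurable_be.
  move=> z; rewrite normrM (ger0_norm (indic_ball_ge0 z)) normrM (ger0_norm (f2 z)) normrM.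
  rewrite [leRHS](_ : _ = \1_uball z.2 * (f z.1.1 * f z.1.2 * (Cb * M'))); last by ring.
  by do 2!apply: ler_wpM2l => //; apply: ler_pM.
have [L_3 Ln3 C3] : [/\ L1 m3 (fun z : T3 => \1_uball z.2 * (tscore z * (be (Sv z) * phi (vp b z)))),
   forall n, L1 m3 (fun z => cut n z * (tscore z * (be (Sv z) * phi (vp b z)))) &
  RI m3 (fun z => cut n z * (tscore z * (be (Sv z) * phi (vp b z)))) @[n --> \oo] -->
  RI m3 (fun z => \1_uball z.2 * (tscore z * (be (Sv z) * phi (vp b z))))].
  apply: (cut_dct _ (L1Zl (4 * (Cb * M)) (L1D (L3 _ _ LK Lf) (L3 _ _ Lf LK)))).
    by apply: measurable_funM; [exact: measurable_tscore|apply: measurable_funM => //; exact: measurable_be].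
  move=> z; rewrite normrM (ger0_norm (indic_ball_ge0 z)) normrM normrM.
  set X := sum3 _; set Y := sum3 _.
  rewrite [leRHS](_ : _ = \1_uball z.2 * (4 * (X * f z.1.2 + f z.1.1 * Y) * (Cb * M))); last by ring.
  apply: ler_wpM2l => //.
  apply: (ler_pM (normr_ge0 _) (mulr_ge0 (normr_ge0 _) (normr_ge0 _)) (tscore_bound z)).
  exact: ler_pM.
pose Er z := 2 * sum3 (fun i => tdu b j (cU z) (cY z) i * cU z i) * (be (Sv z) * phi (vp b z)).
have mEr : measurable_fun setT Er.
  apply: measurable_funM; last by apply: measurable_funM => //; exact: measurable_be.
  apply: measurable_funM; first exact: measurable_cst.
  by apply: measurable_sum3 => i; apply: measurable_funM; [exact: measurable_tdu|exact: measurable_cU].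
have mn n : measurable_fun setT (fun z => dcut n z * (f z.1.1 * f z.1.2 * Er z)).
  by apply: measurable_funM; [exact: (measurable_cut n).2|exact: measurable_funM].
(* Here 6 is twice the constant 3 of [tdu_u], and the two summands are those of [dcut_bound]; the
   first is integrable by [hardy]. *)
pose g2 (z : T3) := 6 * (Cb * M) * (2 * (f z.1.1 * f z.1.2 * (norm3 (sub3 z.1.1 z.1.2))^-1 * \1_uball z.2) + 2 * (f z.1.1 * f z.1.2 * \1_uball z.2)).
have Lg2 : L1 m3 g2.
  apply: L1Zl; apply: L1D; last by apply: L1Zl; exact: L3.
  by apply: L1Zl; exact: (L1_tensor (hardy f0 Lf Lh wh) Lu).1.
have nrm z : norm3 (sub3 z.1.1 z.1.2) = Num.sqrt (ip (cU z) (cU z)).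
  by rewrite [ip _ _]ip_norm sqrtr_sqr ger0_norm// norm3_ge0.
have Bg n z : `|dcut n z * (f z.1.1 * f z.1.2 * Er z)| <= g2 z.
  have g20 : 0 <= g2 z.
    by rewrite /g2 nrm !mulr_ge0// addr_ge0// !mulr_ge0// invr_ge0 sqrtr_ge0.
  have [[_ ->]|[hR hY _]] := cut_cases n z; first by rewrite mul0r normr0.
  have R0 : 0 < ip (cU z) (cU z) by apply: lt_le_trans hR.
  have Y0 : 0 < ip (cY z) (cY z) by apply: lt_le_trans hY.
  have t := tdu_u j b12 R0 Y0.
  have := dcut_bound n z; set s := Num.sqrt _ in t * => d.
  have e : `|Er z| <= 6 * (Cb * M) * s.
    rewrite /Er normrM normrM ger0_norm// normrM.
    rewrite [leRHS](_ : _ = 2 * (3 * s) * (Cb * M)); last by ring.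
    apply: ler_pM; rewrite ?mulr_ge0//; last exact: ler_pM.
    by apply: ler_wpM2l.
  rewrite (normrM (dcut n z)) (normrM (f z.1.1 * f z.1.2)) (ger0_norm (f2 z)).
  apply: (@le_trans _ _ (`|dcut n z| * (f z.1.1 * f z.1.2 * (6 * (Cb * M) * s)))).
    by do 2!apply: ler_wpM2l => //.
  rewrite [leLHS](_ : _ = 6 * (Cb * M) * (f z.1.1 * f z.1.2) * (`|dcut n z| * s)); last by ring.
  rewrite /g2 nrm -/s [leRHS](_ : _ = 6 * (Cb * M) * (f z.1.1 * f z.1.2) * ((2 / s + 2) * \1_uball z.2)); last by ring.
  by apply: ler_wpM2l d; rewrite !mulr_ge0.
have cc : {ae @m3 R, forall z : T3, dcut n z * (f z.1.1 * f z.1.2 * Er z) @[n --> \oo] --> (0 : R)}.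
  apply: filterS dcut_cvg => z c; rewrite -(mul0r (f z.1.1 * f z.1.2 * Er z)).
  by apply: cvgM => //; exact: cvg_cst.
have [_ C2] := RI_dct mn (measurable_cst (0 : R)) Lg2 Bg cc.
rewrite RI0 in C2.
split => //; apply: (lim_uniq (u := fun n => - RI m3 (fun z => cut n z * (tscore z * (be (Sv z) * phi (vp b z)))))).
  have E n : - RI m3 (fun z => cut n z * (tscore z * (be (Sv z) * phi (vp b z)))) =
    RI m3 (fun z => cut n z * (f z.1.1 * f z.1.2 * (be (Sv z) * dphi j (vp b z)))) + RI m3 (fun z => dcut n z * (f z.1.1 * f z.1.2 * Er z)).
    have [_ _ I] := field_integral b j (ep0 n) hbe hphi bbe bdbe f0 Lf Lh wh.
    rewrite -(@RI_eq _ _ _ m3 _ _ (scoreE n)) -I -RID//; last exact: L1_dom (mn n) (Bg n) Lg2.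
    by apply: RI_eq => z; rewrite mainE errE -/(Er z); ring.
  rewrite (funext E) -[X in _ --> X]addr0; exact: cvgD.
exact: cvgN.
Qed.

End LimitIdentity.

(** * The score of the gain operator *)

Section AngularAverage.
Context {R : realType}.
Local Notation V := (V3 R).
Local Notation mu := (@mu3 R).
Local Notation T3 := (V * V * V)%type.

(** Weights are functions of the squared cosine: this is the quantity that the field preserves, and
    an even kernel can be written through it. *)
Definition even_avg (g : R -> R) : R := RI mu (ball_avg (fun s => g (s ^+ 2)) (ee ax3)).

Lemma ker_Sv (g : R -> R) (z : T3) : 0 < ip (cU z) (cU z) ->
  ker (fun s => g (s ^+ 2)) z = \1_uball z.2 * g (Sv z).
Proof.
move=> R0; rewrite /ker /ball_avg; congr (_ * g _).
have E : ip (cU z) (cU z) = norm3 (sub3 z.1.1 z.1.2) ^+ 2 by exact: ip_norm.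
have EY : ip (cY z) (cY z) = norm3 z.2 ^+ 2 by exact: ip_norm.
have n0 : norm3 (sub3 z.1.1 z.1.2) != 0 by apply: contraTneq R0 => n; rewrite E n expr0n ltxx.
rewrite /kdir (negbTE n0) /rel_dir /hat dotZl dotC dotZl dotC /Sv /tS E EY.
have -> : dot3 z.2 (sub3 z.1.1 z.1.2) = ip (cU z) (cY z) by rewrite dotC dot3E.
by rewrite invfM -!exprVn; ring.
Qed.

Section Weight.
Variables (g : R -> R) (C : R).
Hypotheses (mg : measurable_fun setT g) (bg : forall s, 0 <= s <= 1 -> `|g s| <= C).

Let mG : measurable_fun setT (fun s : R => g (s ^+ 2)).
Proof. by apply: measurableT_comp mg _; apply: measurable_funX. Qed.

Lemma even_avg_bound (k y : V) : dot3 k k = 1 -> `|ball_avg (fun s => g (s ^+ 2)) k y| <= C * \1_uball y.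
Proof.
move=> k1; rewrite /ball_avg normrM mulrC; have /andP[u0 _] := indic_itv uball y.
rewrite (ger0_norm u0); apply: ler_wpM2r => //; apply: bg.
have := hat_dot_itv y k1; exact: sqr_itv.
Qed.

Lemma even_avg_L1 : L1 mu (ball_avg (fun s => g (s ^+ 2)) (ee ax3)).
Proof.
have k1 : dot3 (@ee R ax3) (ee ax3) = 1 by rewrite -norm3_sqr ee_norm expr1n.
apply: (L1_dom _ (fun y => even_avg_bound y k1) (L1Zl C ball_volume.1)).
by apply: measurable_ball_avg => //; exact: measurable_cst.
Qed.

(** By rotation invariance the integral in [y] does not depend on the direction of [v - w], so the
    average factors out. *)
Lemma weight_avg (K : V * V -> R) : L1 m2 K ->
  L1 m3 (fun z => \1_uball z.2 * g (Sv z) * K z.1) /\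
  RI m3 (fun z => \1_uball z.2 * g (Sv z) * K z.1) = even_avg g * RI m2 K.
Proof.
move=> LK; pose F (z : T3) := ker (fun s => g (s ^+ 2)) z * K z.1.
have mF : measurable_fun setT F.
  by apply: measurable_funM; [exact: measurable_ker|exact: measurable_fst_comp (L1_meas LK)].
have LF : L1 m3 F.
  apply: (L1_dom mF _ (L1_tensor (L1_abs LK) (L1Zl C ball_volume.1)).1) => z.
  rewrite /F normrM mulrC; apply: ler_wpM2l => //; apply: even_avg_bound; exact: kdir_unit.
have sec := @ker_section R _ mG even_avg_L1.
have Ls p : L1 mu (fun y => F (p, y)).
  by apply: L1_eq (L1Zl (K p) (sec p).1) => y; rewrite /F mulrC.
have RF : RI m3 F = even_avg g * RI m2 K.
  have [_ ->] := fubini_x LF Ls; rewrite -RIZl//; apply: RI_eq => p.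
  rewrite [RHS]mulrC /even_avg -(sec p).2 -RIZl; last exact: (sec p).1.
  by apply: RI_eq => y; rewrite /F mulrC.
have m : measurable_fun setT (fun z : T3 => \1_uball z.2 * g (Sv z) * K z.1).
  apply: measurable_funM; last exact: measurable_fst_comp (L1_meas LK).
  apply: measurable_funM; last exact: measurableT_comp mg measurable_Sv.
  by apply: (measurable_snd_comp (f := (\1_uball : V -> R))); apply: L1_meas ball_volume.1.
rewrite -RF; apply: (L1_ae m _ LF); apply: filterS ae_generic => z h; rewrite /F.
have [u|u] := pselect (uball z.2); first by rewrite ker_Sv//; exact: (h u).1.
by rewrite /ker /ball_avg indic_out// !mul0r.
Qed.

End Weight.
End AngularAverage.

Section Quadratic.
Context {R : realType}.
Variables (b : R).
Hypothesis b12 : 1 <= b <= 2.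
Implicit Types (u y H K : axis -> R).

(** Coefficients of the score in direction [j] ([field_sum]): [alp] for the score at [v], [bet] for
    the score at [w], and [kap] for the infinitesimal rotation in the plane of [u] and [y], whose
    squared size is [qq] ([kap_gram]). *)
Definition alp (t : R) := 1 + (b - b ^+ 2) / 2 * t.
Definition bet (t : R) := (3 * b - b ^+ 2) / 2 * t.
Definition qq (t : R) := b ^+ 2 / 4 * (t * (1 - t)).
Definition kap u y := b / 2 * (ip u y / (ip u u * ip y y)).
Definition wedge u y H K := ip H u * ip y K - ip H y * ip u K.

Lemma field_sum j u y H K : sum3 (fun i => tcv b j u y i * H i + tcw b j u y i * K i) =
  alp (tS u y) * H j + bet (tS u y) * K j +
  kap u y * (u j * (ip y H - ip y K) - y j * (ip u H - ip u K)).
Proof.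
rewrite /tcv /tcw /tdz /tdu /alp /bet /kap; move: (tS u y) (ip u y / _) => t c.
by rewrite /sum3 /kd !cd_ee; case: j; rewrite /ip /sum3; field.
Qed.

(** The difference of the two sides is the square of the determinant of [H], [u], [y]. *)
Lemma gram u y H : sum3 (fun j => (u j * ip y H - y j * ip u H) ^+ 2) <=
  (ip u u * ip y y - ip u y ^+ 2) * ip H H.
Proof.
rewrite -subr_ge0; have -> : (ip u u * ip y y - ip u y ^+ 2) * ip H H -
    sum3 (fun j => (u j * ip y H - y j * ip u H) ^+ 2) =
  (H ax1 * (u ax2 * y ax3 - u ax3 * y ax2) + H ax2 * (u ax3 * y ax1 - u ax1 * y ax3) +
   H ax3 * (u ax1 * y ax2 - u ax2 * y ax1)) ^+ 2 by rewrite /ip /sum3; ring.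
exact: sqr_ge0.
Qed.

Lemma kap_gram u y : kap u y ^+ 2 * (ip u u * ip y y - ip u y ^+ 2) = qq (tS u y).
Proof.
rewrite /kap /qq /tS; have [->|n0] := eqVneq (ip u u * ip y y) 0; first by rewrite invr0; ring.
by move: n0; rewrite mulf_eq0 negb_or => /andP[n1 n2]; field; rewrite n1 n2.
Qed.

(** [gram] is applied to [H - K], and the rest is an exact expansion. It is arranged so that the
    last two terms integrate to 0: [ip H K] because grad f has integral 0, and the product of [kap]
    and [wedge] because it is odd under the exchange of [v] and [w]. *)
Lemma quad_bound u y H K :
  sum3 (fun j => sum3 (fun i => tcv b j u y i * H i + tcw b j u y i * K i) ^+ 2) <=
  (alp (tS u y) ^+ 2 + qq (tS u y)) * ip H H + (bet (tS u y) ^+ 2 + qq (tS u y)) * ip K K +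
  (2 * alp (tS u y) * bet (tS u y) - 2 * qq (tS u y)) * ip H K -
  2 * (alp (tS u y) + bet (tS u y)) * (kap u y * wedge u y H K).
Proof.
pose d i := H i - K i.
have := ler_wpM2l (sqr_ge0 (kap u y)) (gram u y d).
rewrite [leRHS]mulrA kap_gram => g; rewrite {1}/sum3 !field_sum.
rewrite -subr_ge0 in g; rewrite -subr_ge0; apply: le_trans g _.
move: (qq _) (alp _) (bet _) (kap _ _) => q A B k.
by rewrite le_eqVlt; apply/orP; left; apply/eqP; rewrite /d /wedge /ip /sum3; ring.
Qed.

Lemma sum3_norm (F : axis -> R) : `|sum3 F| <= sum3 (fun i => `|F i|).
Proof. by apply: (le_trans (ler_normD _ _)); apply: lerD => //; exact: ler_normD. Qed.

Lemma sum3_le (F G : axis -> R) : (forall i, F i <= G i) -> sum3 F <= sum3 G.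
Proof. by move=> h; apply: lerD => //; apply: lerD. Qed.

Lemma wedge_bound u y H K : `|kap u y * wedge u y H K| <=
  2 * (sum3 (fun i => `|H i|) * sum3 (fun i => `|K i|)).
Proof.
have /andP[b1 b2] := b12; set c := ip u y / (ip u u * ip y y).
pose X i l := b / 2 * (c * (u i * y l) - c * (u l * y i)).
have hX i l : `|X i l| <= 2.
  rewrite normrM ger0_norm; last lra.
  have h := le_trans (ler_normB _ _) (lerD (cross_bound u y i l) (cross_bound u y l i)).
  have b0 : 0 <= b / 2 by lra.
  have b3 : b / 2 <= 1 by lra.
  by rewrite -[leRHS]mul1r; apply: ler_pM => //; move: h; rewrite -/c; move: `|_|; lra.
have -> : kap u y * wedge u y H K = sum3 (fun i => sum3 (fun l => H i * K l * X i l)).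
  by rewrite /kap -/c /wedge /X /ip /sum3; field.
apply: (le_trans (sum3_norm _)).
have -> : 2 * (sum3 (fun i => `|H i|) * sum3 (fun i => `|K i|)) =
  sum3 (fun i => sum3 (fun l => `|H i| * `|K l| * 2)) by rewrite /sum3; ring.
apply: sum3_le => i; apply: (le_trans (sum3_norm _)); apply: sum3_le => l.
by rewrite (normrM (H i * K l)) (normrM (H i)); apply: ler_wpM2l => //; exact: mulr_ge0.
Qed.

Lemma alp_bet_sum t : alp t ^+ 2 + qq t + (bet t ^+ 2 + qq t) =
  1 + b * (2 - b) * t / 2 + (b * (2 - b) * t) ^+ 2 / 2.
Proof. by rewrite /alp /bet /qq; field. Qed.

End Quadratic.

(** The left-hand side increases with [t]. At [t = 1] the claim reduces, after division by [1 - e],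
    to [4 e^3 (1 + e) (2 - e^2) <= 2 + e + 15 e^2], which follows from [(1 + e) (2 - e^2) <= 4] and
    [e^3 <= e^2 <= e]. *)
Lemma fisher_const_bound (R : realType) (e t : R) : 0 < e <= 1 -> 0 <= t <= 1 ->
  1 + (1 + e) * (2 - (1 + e)) * t / 2 + ((1 + e) * (2 - (1 + e)) * t) ^+ 2 / 2 <= fisher_const e.
Proof.
move=> /andP[e0 e1] /andP[t0 t1].
have E : fisher_const e - (1 + (1 - e ^+ 2) / 2 + (1 - e ^+ 2) ^+ 2 / 2) =
  (1 - e) * (2 + e + 15 * e ^+ 2 - 4 * e ^+ 3 * ((1 + e) * (2 - e ^+ 2))) / (8 * e ^+ 3).
  by rewrite /fisher_const; field; rewrite lt0r_neq0.
have e2 : e ^+ 2 <= e by rewrite expr2 -[leRHS]mul1r; apply: ler_wpM2r => //; exact: ltW.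
have e3 : e ^+ 3 <= e ^+ 2 by rewrite exprS -[leRHS]mul1r; apply: ler_wpM2r => //; exact: sqr_ge0.
have q0 : 0 <= e ^+ 2 := sqr_ge0 e.
have c0 : 0 <= e ^+ 3 by rewrite exprn_ge0// ltW.
have m : (1 + e) * (2 - e ^+ 2) <= 4.
  by rewrite [leRHS](_ : _ = 2 * 2); [apply: ler_pM; lra|ring].
have m2 : e ^+ 3 * ((1 + e) * (2 - e ^+ 2)) <= e ^+ 3 * 4 by exact: ler_wpM2l.
have F : 0 <= fisher_const e - (1 + (1 - e ^+ 2) / 2 + (1 - e ^+ 2) ^+ 2 / 2).
  rewrite E divr_ge0//; last by rewrite mulr_ge0.
  rewrite mulr_ge0//; first lra.
  rewrite -[4 * e ^+ 3 * _]mulrA; set w := e ^+ 3 * _ in m2 *.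
  by move: e0 e1 e2 e3 m2; move: (e ^+ 2) (e ^+ 3) w; clear; move=> *; lra.
rewrite -subr_ge0; apply: le_trans F _; apply: lerB => //.
have -> : (1 + e) * (2 - (1 + e)) * t = (1 - e ^+ 2) * t by ring.
have p0 : 0 <= 1 - e ^+ 2 by lra.
have p1 : (1 - e ^+ 2) * t <= 1 - e ^+ 2 by rewrite -[leRHS]mulr1; apply: ler_wpM2l.
have pt : 0 <= (1 - e ^+ 2) * t by rewrite mulr_ge0.
have p2 : ((1 - e ^+ 2) * t) ^+ 2 <= (1 - e ^+ 2) ^+ 2 by rewrite ler_sqr ?nnegrE.
by move: p1 p2; move: (_ * t) ((1 - e ^+ 2) ^+ 2) => x s; lra.
Qed.

(** * The inequality for a smooth kernel *)

Section SmoothKernel.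
Context {R : realType}.
Local Notation V := (V3 R).
Local Notation mu := (@mu3 R).
Local Notation T3 := (V * V * V)%type.

Section Coefficients.
Variable b : R.
Hypothesis b12 : 1 <= b <= 2.

Lemma alp_itv t : 0 <= t <= 1 -> 0 <= alp b t <= 1.
Proof.
move=> /andP[t0 t1]; have /andP[b1 b2] := b12; rewrite /alp.
have h : 0 <= (b ^+ 2 - b) / 2 <= 1 by rewrite expr2; apply/andP; split; nra.
case/andP: h; have -> : (b - b ^+ 2) / 2 = - ((b ^+ 2 - b) / 2) by field.
by move: (_ / 2) => c c0 c1; apply/andP; split; nra.
Qed.

Lemma bet_itv t : 0 <= t <= 1 -> 0 <= bet b t <= 2.
Proof.
move=> /andP[t0 t1]; have /andP[b1 b2] := b12; rewrite /bet.
have h : 0 <= (3 * b - b ^+ 2) / 2 <= 2 by rewrite expr2; apply/andP; split; nra.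
by case/andP: h; move: (_ / 2) => c c0 c1; apply/andP; split; nra.
Qed.

Lemma qq_itv t : 0 <= t <= 1 -> 0 <= qq b t <= 1.
Proof.
move=> /andP[t0 t1]; have /andP[b1 b2] := b12; rewrite /qq.
have h : 0 <= b ^+ 2 / 4 <= 1 by rewrite expr2; apply/andP; split; nra.
have k : 0 <= t * (1 - t) <= 1 by apply/andP; split; nra.
by case/andP: h => ? ?; case/andP: k => ? ?; rewrite mulr_ge0// mulr_ile1.
Qed.

Lemma measurable_coef : [/\ measurable_fun setT (alp b), measurable_fun setT (bet b) & measurable_fun setT (qq b)].
Proof.
split.
- by apply: measurable_funD; [exact: measurable_cst|apply: measurable_funM; [exact: measurable_cst|exact: measurable_id]].
- by apply: measurable_funM; [exact: measurable_cst|exact: measurable_id].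
- apply: measurable_funM; first exact: measurable_cst.
  apply: measurable_funM; first exact: measurable_id.
  by apply: measurable_funB; [exact: measurable_cst|exact: measurable_id].
Qed.

Lemma coef_bound t : 0 <= t <= 1 -> [/\ `|alp b t ^+ 2 + qq b t| <= 10, `|bet b t ^+ 2 + qq b t| <= 10,
  `|2 * alp b t * bet b t - 2 * qq b t| <= 10 & `|alp b t + bet b t| <= 10].
Proof.
move=> ht; have /andP[a0 a1] := alp_itv ht; have /andP[c0 c1] := bet_itv ht; have /andP[q0 q1] := qq_itv ht.
move: a0 a1 c0 c1 q0 q1; move: (alp b t) (bet b t) (qq b t) => x y q a0 a1 c0 c1 q0 q1.
have x2 : 0 <= x ^+ 2 <= 1 by rewrite sqr_ge0 expr_le1.
have y2 : 0 <= y ^+ 2 <= 4.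
  by rewrite sqr_ge0/= [leRHS](_ : _ = 2 ^+ 2); [rewrite ler_sqr ?nnegrE|ring].
have xy : 0 <= x * y <= 2 by rewrite mulr_ge0//= -[leRHS]mul1r; exact: ler_pM.
rewrite -mulrA; case/andP: x2 => ? ?; case/andP: y2 => ? ?; case/andP: xy => ? ?.
by split; rewrite ler_norml; apply/andP; split; lra.
Qed.

End Coefficients.

Variables (f : V -> R) (h : axis -> V -> R).
Hypotheses (f0 : forall v, 0 <= f v) (Lf : L1 mu f) (f1 : RI mu f = 1).
Let a (v : V) := Num.sqrt (f v).
Hypotheses (Lh : forall i, L2 mu (h i)) (wh : forall i, weak_deriv a (h i) i).
Let La : L2 mu a := sqrt_L2 f0 Lf.
Let a2 v : a v ^+ 2 = f v. Proof. by rewrite /a sqr_sqrtr. Qed.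
Let a0 v : 0 <= a v. Proof. exact: sqrtr_ge0. Qed.
(** [HH] and [KK] are half the gradients of [f(v) f(w)] in [v] and in [w], divided by the square
    root of [f(v) f(w)]. The square of each integrates to [Nh], a quarter of the Fisher integral of
    [f]. *)
Let HH (z : T3) i := h i z.1.1 * a z.1.2.
Let KK (z : T3) i := a z.1.1 * h i z.1.2.
Let Nh : R := sum3 (fun i => n2 mu (h i) ^+ 2).

Let N1 (p : V * V) := sum3 (fun i => h i p.1 ^+ 2) * f p.2.
Let N2 (p : V * V) := f p.1 * sum3 (fun i => h i p.2 ^+ 2).
Let XX (p : V * V) := sum3 (fun i => a p.1 * h i p.1 * (a p.2 * h i p.2)).

Let Lhh : L1 mu (fun v => sum3 (fun i => h i v ^+ 2)) /\ RI mu (fun v => sum3 (fun i => h i v ^+ 2)) = Nh.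
Proof.
have L i : L1 mu (fun v => h i v ^+ 2) := (Lh i).2.
split; first by apply: L1D => //; exact: L1D.
by rewrite /Nh /sum3 !n2_sqr (RID (L1D (L ax1) (L ax2)) (L ax3)) (RID (L ax1) (L ax2)).
Qed.

Let N1_int : L1 m2 N1 /\ RI m2 N1 = Nh.
Proof. by have [l e] := L1_tensor Lhh.1 Lf; split => //; rewrite e f1 mulr1 Lhh.2. Qed.
Let N2_int : L1 m2 N2 /\ RI m2 N2 = Nh.
Proof. by have [l e] := L1_tensor Lf Lhh.1; split => //; rewrite e f1 mul1r Lhh.2. Qed.

(** That grad f has integral 0: [weak_square] against the constant function 1. *)
Let ah0 i : L1 mu (fun v => a v * h i v) /\ RI mu (fun v => a v * h i v) = 0.
Proof.
have L : L1 mu (fun v => a v * h i v) := L2_mul La (Lh i); split => //.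
have := @weak_square _ a (h i) (ee i) La (Lh i) (wh i) (fun=> 1) (fun=> 0) 1 0 (measurable_cst _).
have -> : RI mu (fun x => a x ^+ 2 * 0) = 0 by rewrite -[RHS](@RI0 _ _ _ mu); apply: RI_eq => x; rewrite mulr0.
have -> : RI mu (fun x => 2 * a x * h i x * 1) = 2 * RI mu (fun v => a v * h i v).
  by rewrite -RIZl//; apply: RI_eq => x; ring.
have n1 : `|1 : R| <= 1 by rewrite normr1.
have n0 : `|0 : R| <= 0 by rewrite normr0.
move=> /(_ (fun=> n1) (fun=> n0) (fun x => isD_cst _ _ _)) E; lra.
Qed.

Let XX_int : L1 m2 XX /\ RI m2 XX = 0.
Proof.
have T i := L1_tensor (ah0 i).1 (ah0 i).1.
split; first by apply: L1D; [apply: L1D|]; exact: (T _).1.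
have t0 i : RI m2 (fun p => a p.1 * h i p.1 * (a p.2 * h i p.2)) = 0.
  by rewrite (T i).2 (ah0 i).2 mulr0.
by rewrite /XX /sum3 (RID (L1D (T ax1).1 (T ax2).1) (T ax3).1) (RID (T ax1).1 (T ax2).1) !t0 !addr0.
Qed.

Variables (e : R).
Hypothesis he : 0 < e <= 1.
Let b := 1 + e.
Let b12 : 1 <= b <= 2. Proof. by rewrite /b; case/andP: he => ? ?; apply/andP; split; lra. Qed.

Variables (be dbe : R -> R) (Cb : R).
Hypotheses (hbe : forall x, isd be x (dbe x)) (be0 : forall x, 0 <= be x).
Hypotheses (bbe : forall x, `|be x| <= Cb) (bdbe : forall x, `|dbe x| <= Cb).
Let mbe : measurable_fun setT be := (isd_measurable hbe).1.
Let C0 : 0 <= Cb := le_trans (normr_ge0 _) (bbe 0).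

Let YY (z : T3) := \1_uball z.2 * be (Sv z) * (alp b (Sv z) + bet b (Sv z)) *
  (kap b (cU z) (cY z) * wedge (cU z) (cY z) (HH z) (KK z)).

Let mball := @measurable_ball3 R.

Let YY_L1 : L1 m3 YY.
Proof.
have [ma mb mq] := measurable_coef b.
have mS (g : R -> R) : measurable_fun setT g -> measurable_fun setT (fun z => g (Sv z)).
  by move=> mg; exact: measurableT_comp mg measurable_Sv.
have mH i : measurable_fun setT (fun z => HH z i).
  by apply: measurable_funM; [apply: measurable_arg1; exact: (Lh i).1|apply: measurable_arg2; exact: La.1].
have mK i : measurable_fun setT (fun z => KK z i).
  by apply: measurable_funM; [apply: measurable_arg1; exact: La.1|apply: measurable_arg2; exact: (Lh i).1].
have mU l : measurable_fun setT (fun z : T3 => cU z l) := measurable_cU l.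
have mY l : measurable_fun setT (fun z : T3 => cY z l) := measurable_cY l.
have mYY : measurable_fun setT YY.
  apply: measurable_funM.
    apply: measurable_funM; first by apply: measurable_funM => //; exact: mS.
    by apply: measurable_funD; exact: mS.
  apply: measurable_funM.
    apply: measurable_funM; first exact: measurable_cst.
    apply: measurable_funM; first exact: m_ip.
    by apply: measurable_invr; apply: measurable_funM; [exact: m_ipU|exact: m_ipY].
  by apply: measurable_funB; apply: measurable_funM; apply: measurable_ip2.
have LG : L1 mu (fun v => a v * sum3 (fun i => `|h i v|)).
  apply: L2_mul => //; apply: L2D; last exact: L2_abs.
  by apply: L2D; exact: L2_abs.
apply: (L1_dom mYY _ (L1Zl (Cb * 10 * 2) (L1_tensor3 LG LG ball_volume.1).1)) => z.
have [_ _ _ cb] := coef_bound b12 (tS_itv (cU z) (cY z)).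
have wb := wedge_bound b12 (cU z) (cY z) (HH z) (KK z).
rewrite /YY (normrM (_ * _)) (normrM (_ * be _)) (normrM (\1_uball z.2)) (ger0_norm (indic_ball_ge0 z)).
set X := sum3 _; set Y := sum3 _.
rewrite [leRHS](_ : _ = \1_uball z.2 * Cb * 10 * (2 * (X * a z.1.2 * (a z.1.1 * Y)))); last by ring.
apply: ler_pM => //.
  apply: ler_pM; rewrite ?mulr_ge0//; exact: ler_wpM2l.
apply: (le_trans wb); rewrite /HH /KK /sum3 !normrM !(ger0_norm (a0 _)) -!mulrDl -!mulrDr /X /Y /sum3.
by rewrite !mulrA.
Qed.

Let sw (z : T3) : T3 := (z.1.2, z.1.1, z.2).
Let YY_sw z : YY (sw z) = - YY z.
Proof.
have u l : cU (sw z) l = - cU z l by rewrite /cU /sw /= !cdB opprB.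
have S : Sv (sw z) = Sv z.
  rewrite /Sv /tS; congr (_ / (_ * _)); last by rewrite /ip /sum3 !u; ring.
  by rewrite /ip /sum3 !u; ring.
rewrite /YY S; have -> : kap b (cU (sw z)) (cY (sw z)) = - kap b (cU z) (cY z).
  rewrite /kap; have -> : ip (cU (sw z)) (cU (sw z)) = ip (cU z) (cU z) by rewrite /ip /sum3 !u; ring.
  have -> : ip (cU (sw z)) (cY (sw z)) = - ip (cU z) (cY z) by rewrite /ip /sum3 !u; ring.
  by rewrite mulNr mulrN.
have -> : wedge (cU (sw z)) (cY (sw z)) (HH (sw z)) (KK (sw z)) = wedge (cU z) (cY z) (HH z) (KK z).
  by rewrite /wedge /ip /sum3 !u /HH /KK /sw /cY /=; ring.
by rewrite mulNr mulrN.
Qed.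

(** The exchange of [v] and [w] preserves the measure and changes the sign of [YY]. *)
Let YY_int : RI m3 YY = 0.
Proof.
have mp : mpres (@m3 R) (@m3 R) sw.
  exact: (mpres_prod (mpres_swap mu mu) (mpres_id mu)).
have [_] := mpres_RI mp YY_L1.
rewrite (@RI_eq _ _ _ m3 _ _ YY_sw) RIN; last exact: YY_L1.
by move=> E; lra.
Qed.

Variables (phi : axis -> V -> R) (dphi : axis -> axis -> V -> R).
Hypothesis hphi : forall j, C1b (phi j) (dphi j).

(** The dual functional is the integral of [g] against this function ([total_scoreP]), which is
    bounded and continuous, so the weak formulation of the gain operator applies to it. *)
Definition score_test (v : V) := sum3 (fun j => - (2 * dphi j j v + phi j v ^+ 2)).

Let UU j (z : T3) := \1_uball z.2 * (tscore b j f h z * (be (Sv z) * phi j (vp b z))).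
Let MM j (z : T3) := \1_uball z.2 * (f z.1.1 * f z.1.2 * (be (Sv z) * dphi j j (vp b z))).
Let QQ j (z : T3) := \1_uball z.2 * (f z.1.1 * f z.1.2 * (be (Sv z) * phi j (vp b z) ^+ 2)).

Let QQ_L1 j : L1 m3 (QQ j).
Proof.
have [cphi [M hM] _ _ _] := hphi j.
have mphi : measurable_fun setT (fun z : T3 => phi j (vp b z)).
  by apply: measurableT_comp (measurable_vp b); exact: continuous_measurable3.
have mff : measurable_fun setT (fun z : T3 => f z.1.1 * f z.1.2).
  exact: (measurable_fst_comp (L1_meas (L1_tensor Lf Lf).1)).
have f2 (z : T3) : 0 <= f z.1.1 * f z.1.2 by exact: mulr_ge0.
apply: (L1_dom _ _ (L1Zl (Cb * M ^+ 2) (L1_tensor3 Lf Lf ball_volume.1).1)).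
  apply: measurable_funM => //; apply: measurable_funM => //; apply: measurable_funM; last exact: measurable_funX.
  exact: measurableT_comp mbe measurable_Sv.
move=> z; rewrite /QQ normrM (ger0_norm (indic_ball_ge0 z)) normrM (ger0_norm (f2 z)) normrM normrX.
rewrite [leRHS](_ : _ = \1_uball z.2 * (f z.1.1 * f z.1.2 * (Cb * M ^+ 2))); last by ring.
have M0 : 0 <= M := le_trans (normr_ge0 _) (hM (0 : V)).
apply: ler_wpM2l => //; apply: ler_wpM2l => //.
by apply: ler_pM; rewrite ?exprn_ge0// ler_sqr ?nnegrE.
Qed.

Let bound (z : T3) := 4 * (\1_uball z.2 * (be (Sv z) * (alp b (Sv z) ^+ 2 + qq b (Sv z))) * N1 z.1 +
  \1_uball z.2 * (be (Sv z) * (bet b (Sv z) ^+ 2 + qq b (Sv z))) * N2 z.1 +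
  \1_uball z.2 * (be (Sv z) * (2 * alp b (Sv z) * bet b (Sv z) - 2 * qq b (Sv z))) * XX z.1 - 2 * YY z).

Let pointwise z : sum3 (fun j => 2 * UU j z - QQ j z) <= bound z.
Proof.
pose P j := sum3 (fun i => tcv b j (cU z) (cY z) i * HH z i + tcw b j (cU z) (cY z) i * KK z i).
have T j : tscore b j f h z = a z.1.1 * a z.1.2 * (2 * P j).
  rewrite /tscore /sum3 -/(a z.1.1) -/(a z.1.2) -(a2 z.1.1) -(a2 z.1.2) /P /HH /KK /sum3.
  by move: (a z.1.1) (a z.1.2) => x y; ring.
have w0 : 0 <= \1_uball z.2 * be (Sv z) by rewrite mulr_ge0.
(* Completion of the square in the test field: with [c = a(v) a(w)], [4 c p x - c^2 x^2 = 4 p^2 - (c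
   x - 2 p)^2]. *)
have J j : 2 * UU j z - QQ j z <= \1_uball z.2 * be (Sv z) * (4 * P j ^+ 2).
  rewrite /UU /QQ T -!a2; move: (phi j _) (P j) => x p.
  rewrite [leLHS](_ : _ = \1_uball z.2 * be (Sv z) * (4 * p ^+ 2 - (a z.1.1 * a z.1.2 * x - 2 * p) ^+ 2)); last by ring.
  by apply: ler_wpM2l => //; rewrite gerBl sqr_ge0.
apply: (le_trans (sum3_le J)).
have Q := ler_wpM2l w0 (quad_bound b (cU z) (cY z) (HH z) (KK z)).
rewrite [leLHS](_ : _ = 4 * (\1_uball z.2 * be (Sv z) * sum3 (fun j => P j ^+ 2))); last by rewrite /sum3; ring.
apply: (le_trans (ler_wpM2l _ Q)) => //.
have e1 : ip (HH z) (HH z) = N1 z.1 by rewrite /ip /N1 /HH /sum3 -!a2; ring.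
have e2 : ip (KK z) (KK z) = N2 z.1 by rewrite /ip /N2 /KK /sum3 -!a2; ring.
have e3 : ip (HH z) (KK z) = XX z.1 by rewrite /ip /XX /HH /KK /sum3; ring.
by rewrite le_eqVlt; apply/orP; left; apply/eqP; rewrite e1 e2 e3 /bound /YY -/(Sv z); ring.
Qed.

Let bound_int : L1 m3 bound /\ RI m3 bound <= fisher_const e * (4 * Nh) * even_avg be.
Proof.
have [ma mb mq] := measurable_coef b.
pose g1 t := be t * (alp b t ^+ 2 + qq b t).
pose g2 t := be t * (bet b t ^+ 2 + qq b t).
pose g3 t := be t * (2 * alp b t * bet b t - 2 * qq b t).
have mg1 : measurable_fun setT g1.
  by apply: measurable_funM => //; apply: measurable_funD => //; exact: measurable_funX.
have mg2 : measurable_fun setT g2.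
  by apply: measurable_funM => //; apply: measurable_funD => //; exact: measurable_funX.
have mg3 : measurable_fun setT g3.
  apply: measurable_funM => //; apply: measurable_funB; last by apply: measurable_funM => //; exact: measurable_cst.
  by apply: measurable_funM => //; apply: measurable_funM => //; exact: measurable_cst.
have bg (c : R -> R) : (forall t, 0 <= t <= 1 -> `|c t| <= 10) -> forall t, 0 <= t <= 1 -> `|be t * c t| <= Cb * 10.
  by move=> hc t ht; rewrite normrM; apply: ler_pM => //; exact: hc.
have b1 t (ht : 0 <= t <= 1) : `|g1 t| <= Cb * 10.
  by apply: (bg (fun t => alp b t ^+ 2 + qq b t)) ht => s hs; case: (coef_bound b12 hs).
have b2 t (ht : 0 <= t <= 1) : `|g2 t| <= Cb * 10.
  by apply: (bg (fun t => bet b t ^+ 2 + qq b t)) ht => s hs; case: (coef_bound b12 hs).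
have b3 t (ht : 0 <= t <= 1) : `|g3 t| <= Cb * 10.
  by apply: (bg (fun t => 2 * alp b t * bet b t - 2 * qq b t)) ht => s hs; case: (coef_bound b12 hs).
have [L_1 I1] := weight_avg mg1 b1 N1_int.1.
have [L_2 I2] := weight_avg mg2 b2 N2_int.1.
have [L_3 I3] := weight_avg mg3 b3 XX_int.1.
rewrite N1_int.2 in I1; rewrite N2_int.2 in I2; rewrite XX_int.2 mulr0 in I3.
have LY : L1 m3 (fun z => 2 * YY z) by exact: L1Zl YY_L1.
have L12 := L1D L_1 L_2; have L123 := L1D L12 L_3; have L := L1B L123 LY.
split; first exact: L1Zl L.
rewrite /bound (RIZl 4 L) (RIB L123 LY) (RID L12 L_3) (RID L_1 L_2) I1 I2 I3 (RIZl 2 YY_L1) YY_int.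
have A : even_avg g1 + even_avg g2 <= fisher_const e * even_avg be.
  have A1 := even_avg_L1 mg1 b1; have A2 := even_avg_L1 mg2 b2.
  have A3 := even_avg_L1 mbe (fun t _ => bbe t).
  rewrite /even_avg -(RID A1 A2) -(RIZl _ A3); apply: RI_le; [exact: L1D|exact: L1Zl|move=> y].
  have k1 : dot3 (@ee R ax3) (ee ax3) = 1 by rewrite -norm3_sqr ee_norm expr1n.
  rewrite /ball_avg /g1 /g2; have := hat_dot_itv y k1; move: (dot3 _ _) => s /andP[s0 s1].
  have s2 := sqr_itv (introT andP (conj s0 s1)).
  have F := fisher_const_bound he s2; rewrite -/b -alp_bet_sum in F.
  have /andP[v0 _] := indic_itv uball y.
  rewrite -mulrDr -mulrDr [leRHS]mulrCA; apply: ler_wpM2l => //.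
  by rewrite [leRHS]mulrC; apply: ler_wpM2l.
rewrite mulr0 subr0 addr0 -mulrDl.
rewrite [leRHS](_ : _ = 4 * (fisher_const e * even_avg be * Nh)); last by ring.
apply: ler_wpM2l => //; apply: ler_wpM2r => //.
by rewrite /Nh !addr_ge0 ?sqr_ge0.
Qed.

Lemma smooth_kernel_ineq :
  L1 m3 (fun z => \1_uball z.2 * be (Sv z) * (f z.1.1 * f z.1.2 * score_test (vp b z))) /\
  RI m3 (fun z => \1_uball z.2 * be (Sv z) * (f z.1.1 * f z.1.2 * score_test (vp b z))) <=
    fisher_const e * (4 * Nh) * even_avg be.
Proof.
have I j := limit_identity j b12 hbe (hphi j) bbe bdbe f0 Lf Lh wh.
have LM j : L1 m3 (MM j) by case: (I j).
have LU j : L1 m3 (UU j) by case: (I j).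
have L_1 j : L1 m3 (fun z => - (2 * MM j z) - QQ j z) by apply: L1B => //; apply: L1N; exact: L1Zl.
have L_2 j : L1 m3 (fun z => 2 * UU j z - QQ j z) by apply: L1B => //; exact: L1Zl.
have E j : RI m3 (fun z => - (2 * MM j z) - QQ j z) = RI m3 (fun z => 2 * UU j z - QQ j z).
  have l1 := L1Zl 2 (LM j); have l2 := L1Zl 2 (LU j).
  rewrite (RIB (L1N l1) (QQ_L1 j)) (RIB l2 (QQ_L1 j)) (RIN l1) (RIZl 2 (LM j)) (RIZl 2 (LU j)).
  by have [_ _ ->] := I j; congr (_ - _); rewrite mulrN opprK.
have [S1 S2] := RI_sum3 L_1; have [S3 S4] := RI_sum3 L_2.
have P z : sum3 (fun j => - (2 * MM j z) - QQ j z) =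
  \1_uball z.2 * be (Sv z) * (f z.1.1 * f z.1.2 * score_test (vp b z)).
  by rewrite /MM /QQ /score_test /sum3; ring.
split; first exact: L1_eq P S1.
rewrite -(@RI_eq _ _ _ m3 _ _ P) S2 /sum3 !E -/(sum3 (fun j => RI m3 (fun z => 2 * UU j z - QQ j z))) -S4.
by have [Lb hb] := bound_int; apply: le_trans hb; exact: RI_le S3 Lb pointwise.
Qed.

End SmoothKernel.

(** * Approximation of the kernel *)

Section KernelApproximation.
Context {R : realType}.
Local Notation V := (V3 R).
Local Notation mu := (@mu3 R).
Local Notation T3 := (V * V * V)%type.
Variable B : R -> R.
Hypothesis hB : kernel_hyp B.

Lemma Bc_norm s : Bc B (Num.sqrt (s ^+ 2)) = Bc B s.
Proof. by rewrite sqrtr_sqr; have [h|h] := ger0P s => //; exact: BcN hB s. Qed.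

Let e3 : dot3 (@ee R ax3) (ee ax3) = 1. Proof. by rewrite -norm3_sqr ee_norm expr1n. Qed.

Lemma Bc_smooth_approx (eps : R) : 0 < eps -> exists (be dbe : R -> R) (C : R),
  [/\ forall x, isd be x (dbe x), forall x, 0 <= be x, forall x, `|be x| <= C, forall x, `|dbe x| <= C &
   L1 mu (ball_avg (fun s => `|Bc B s - be (s ^+ 2)|) (ee ax3)) /\
   RI mu (ball_avg (fun s => `|Bc B s - be (s ^+ 2)|) (ee ax3)) <= eps].
Proof.
move=> eps0; have [L0 _] := Bc_ball hB.
have mB := measurable_Bc hB.
have eps2 : 0 < eps / 2 by rewrite divr_gt0.
have [m [Lm hm]] := RI_tail L0 eps2.
(* The kernel as a function of the squared cosine, truncated at the level [m] beyond which its tail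
   is at most [eps / 2]. *)
pose bN t := Num.min (Bc B (Num.sqrt t)) m%:R.
have bN_itv t : 0 <= bN t <= m%:R.
  by rewrite /bN ge_min lexx orbT le_min Bc_ge0//= ler0n.
pose F (x : V) := bN (cd ax1 x) * \1_(box 2) x.
have mF : measurable_fun setT F.
  apply: measurable_funM; last exact: (measurable_indr (measurable_box _)).
  have mb : measurable_fun setT bN.
    apply: measurable_minr; last exact: measurable_cst.
    exact: measurableT_comp mB measurable_sqrt.
  exact: measurableT_comp mb (measurable_cd ax1).
(* Points outside the ball are sent to abscissa 5, out of [box 2], so that the image measure of this
   box is finite. *)
pose T (y : V) : V := mkV3 (axial y ^+ 2 * \1_uball y + 5 * (1 - \1_uball y)) 0 0.
have mu1 : measurable_fun setT (\1_uball : V -> R) := L1_meas ball_volume.1.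
have mT : measurable_fun setT T.
  apply: measurable_mk3; try exact: measurable_cst.
  apply: measurable_funD; apply: measurable_funM => //.
  - by apply: measurable_funX; exact: measurable_axial.
  - by apply: measurable_funB; first exact: measurable_cst.
have T_in y : uball y -> T y = mkV3 (dot3 (hat y) (ee ax3) ^+ 2) 0 0 /\ 0 <= dot3 (hat y) (ee ax3) ^+ 2 <= 1.
  move=> u; rewrite /T indic_in// subrr mulr0 addr0 mulr1 /axial real_normK ?num_real//; split => //.
  exact: sqr_itv (hat_dot_itv y e3).
have T_out y : ~ uball y -> ~ box 2 (T y).
  move=> u /(_ ax1); rewrite /T indic_out// mulr0 add0r subr0 mulr1 /cd /v3x /mkV3 /=.
  by rewrite ger0_norm//; lra.
have [nu hnu] := pushforward_measure mu mT.
have mp : mpres mu nu T by split => // A mA; rewrite hnu.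
have bf : (nu (box 2) < +oo)%E.
  rewrite hnu; apply: (@le_lt_trans _ _ (mu uball)).
    apply: le_measure; rewrite ?inE.
    - by rewrite -[T @^-1` _]setTI; apply: mT => //; exact: measurable_box.
    - exact: (measurable_nball 1).
    - by move=> y /= hb; apply: contrapT => /T_out.
  by rewrite (measure_indic (measurable_nball 1) ball_volume.1) ltry.
have F_itv x : 0 <= F x <= m%:R.
  have /andP[n0 n1] := bN_itv (cd ax1 x); have /andP[i0 i1] := indic_itv (box 2) x.
  by rewrite /F mulr_ge0//= -[leRHS]mulr1; exact: ler_pM.
have nF : nullout 2 F by move=> x nb; rewrite /F indic_out// mulr0.
have z0 : is_true (((0 : R) <= 0) && ((0 : R) <= m%:R)).
  by rewrite (lexx (0 : R)) (ler0n R m).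
have [t [st nt bt [Lt It]]] := smooth_dense bf mF F_itv z0 nF eps2.
have [ct [M hM] cdt bdt dt] := smooth_C1b st.
have [M' hM'] := bdt ax1.
pose be s := t (mkV3 s 0 0); pose dbe s := 'D_(ee ax1) t (mkV3 s 0 0).
have lin s : mkV3 s 0 0 = add3 (mkV3 0 0 0) (scale3 s (@ee R ax1)).
  by apply: v3P => i; rewrite cdD cdZ; case: i; rewrite /cd /v3x /v3y /v3z /mkV3 /=; ring.
have dbeE s : isd be s (dbe s).
  have E : (fun r => t (add3 (mkV3 0 0 0) (scale3 r (ee ax1)))) = be by apply/funext => r; rewrite /be -lin.
  by have := @isD_line R t (fun x => 'D_(ee ax1) t x) (mkV3 0 0 0) (ee ax1) (dt ax1) s; rewrite E -lin.
have mbe : measurable_fun setT be := (isd_measurable dbeE).1.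
exists be, dbe, (Num.max M M'); split => //.
- by move=> x; case/andP: (bt (mkV3 x 0 0)).
- by move=> x; rewrite le_max hM.
- by move=> x; rewrite le_max hM' orbT.
have mG : measurable_fun setT (fun s : R => `|Bc B s - be (s ^+ 2)|).
  apply: measurableT_comp => //; apply: measurable_funB => //.
  by apply: measurableT_comp mbe _; exact: measurable_funX.
have mb : measurable_fun setT (ball_avg (fun s => `|Bc B s - be (s ^+ 2)|) (ee ax3)).
  by apply: measurable_ball_avg => //; exact: measurable_cst.
have [LtT RtT] := mpres_RI mp Lt.
have D y : `|ball_avg (fun s => `|Bc B s - be (s ^+ 2)|) (ee ax3) y| <=
   `|F (T y) - t (T y)| + `|ball_avg (Bc B) (ee ax3) y| * (m%:R < `|ball_avg (Bc B) (ee ax3) y|)%R%:R.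
  have [u|u] := pselect (uball y); last by rewrite /ball_avg indic_out// mul0r normr0 addr_ge0// mulr_ge0.
  have [-> /andP[s0 s1]] := T_in y u; rewrite /ball_avg indic_in// !mul1r normr_id.
  have -> : F (mkV3 (dot3 (hat y) (ee ax3) ^+ 2) 0 0) = bN (dot3 (hat y) (ee ax3) ^+ 2).
    rewrite /F indic_in ?mulr1// => i; case: i; rewrite /cd /v3x /v3y /v3z /mkV3 /= ?normr0 ?ltr0n//.
    by rewrite ger0_norm//; lra.
  move: s0 s1; rewrite -/(be _) /bN Bc_norm; move: (dot3 (hat y) (ee ax3)) => s s0 s1.
  have p0 := Bc_ge0 hB s; rewrite (ger0_norm p0).
  rewrite [X in `|X| <= _](_ : _ = (Num.min (Bc B s) m%:R - be (s ^+ 2)) + (Bc B s - Num.min (Bc B s) m%:R)); last by ring.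
  apply: (le_trans (ler_normD _ _)); apply: lerD => //.
  have [h|h] := leP (Bc B s) m%:R; first by rewrite subrr normr0 mulr0.
  have d0 : 0 <= Bc B s - m%:R by rewrite subr_ge0; exact: ltW.
  have q0 : 0 <= m%:R :> R by exact: ler0n.
  by rewrite mulr1 (ger0_norm d0) gerBl.
have LS := L1D LtT Lm.
split; first exact: L1_dom mb D LS.
apply: (le_trans (ler_norm _)); apply: (le_trans (RI_abs mb LS D)).
by rewrite (RID LtT Lm) RtT [leRHS](_ : _ = eps / 2 + eps / 2); [exact: lerD|field].
Qed.

End KernelApproximation.

Section KernelInequality.
Context {R : realType}.
Local Notation V := (V3 R).
Local Notation mu := (@mu3 R).
Local Notation T3 := (V * V * V)%type.
Variables (B : R -> R) (e : R).
Hypotheses (hB : kernel_hyp B) (he : 0 < e <= 1).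
Variables (f : V -> R) (h : axis -> V -> R).
Hypotheses (f0 : forall v, 0 <= f v) (Lf : L1 mu f) (f1 : RI mu f = 1).
Hypotheses (Lh : forall i, L2 mu (h i)) (wh : forall i, weak_deriv (fun v => Num.sqrt (f v)) (h i) i).
Variables (phi : axis -> V -> R) (dphi : axis -> axis -> V -> R).
Hypothesis hphi : forall j, C1b (phi j) (dphi j).

Lemma score_test_bounded : continuous (score_test phi dphi) /\ exists C, forall v, `|score_test phi dphi v| <= C.
Proof.
split.
  apply: continuous_sum3 => j; have [cphi _ cdphi _ _] := hphi j.
  move=> x; apply: cvgN; apply: cvgD; first by apply: cvgM; [exact: cvg_cst|exact: cdphi].
  rewrite /continuous_at expr2; apply: (@cvgM _ _ _ _ (phi j) (phi j)); exact: cphi.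
have H j : exists C, forall v, `|- (2 * dphi j j v + phi j v ^+ 2)| <= C.
  have [_ [M hM] _ bd _] := hphi j; have [M' hM'] := bd j.
  exists (2 * M' + M ^+ 2) => v; rewrite normrN; apply: (le_trans (ler_normD _ _)).
  have M0 : 0 <= M := le_trans (normr_ge0 _) (hM (0 : V)).
  by rewrite normrM ger0_norm// normrX; apply: lerD; [exact: ler_wpM2l|rewrite ler_sqr ?nnegrE].
have [[c1 h1] [c2 h2] [c3 h3]] := And3 (H ax1) (H ax2) (H ax3).
exists (c1 + c2 + c3) => v; apply: (le_trans (sum3_norm _)).
by apply: lerD => //; exact: lerD.
Qed.

Let Theta (z : T3) := score_test phi dphi (post_vel e z.1.1 z.1.2 (hat z.2)).

Lemma measurable_post_vel : measurable_fun setT (fun z : T3 => post_vel e z.1.1 z.1.2 (hat z.2)).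
Proof.
have m1 : measurable_fun setT (fun z : T3 => z.1.1) := measurable_fst_comp measurable_fst.
have m2 : measurable_fun setT (fun z : T3 => z.1.2) := measurable_fst_comp measurable_snd.
have mh : measurable_fun setT (fun z : T3 => hat z.2) := measurable_hat measurable_snd.
apply: measurable_sub3 => //; apply: measurable_scale3 => //.
apply: measurable_funM; first exact: measurable_cst.
by apply: measurable_dot3 => //; exact: measurable_sub3.
Qed.

(** The smooth inequality bounds the weight only through its angular integral. Replacing the kernel
    by a weight at distance [eps] therefore costs [eps K] there and [eps C] in the integrand. *)
Lemma kernel_ineq : RI m3 (fun z => ker (Bc B) z * (f z.1.1 * f z.1.2 * Theta z)) <=
  fisher_const e * (4 * sum3 (fun i => n2 mu (h i) ^+ 2)) * (4 * pi / 3).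
Proof.
have [cT [C hC]] := score_test_bounded.
have C0 : 0 <= C := le_trans (normr_ge0 _) (hC (0 : V)).
have [LB IB] := Bc_ball hB.
have mB := measurable_Bc hB.
have Lff := (L1_tensor Lf Lf).1; have Rff := (L1_tensor Lf Lf).2.
rewrite f1 mulr1 in Rff.
have mTh : measurable_fun setT Theta.
  exact: measurableT_comp (continuous_measurable3 cT) measurable_post_vel.
set K := fisher_const e * _; pose N := K * (4 * pi / 3).
have K0 : 0 <= K.
  have /andP[e0 e1] := he.
  have q : 1 <= fisher_const e.
    rewrite /fisher_const lerDl divr_ge0//; last by rewrite mulr_ge0// exprn_ge0// ltW.
    by rewrite mulr_ge0 ?subr_ge0// !addr_ge0 ?mulr_ge0 ?sqr_ge0// ltW.
  apply: mulr_ge0; first exact: le_trans q.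
  by apply: mulr_ge0 => //; rewrite /sum3 !addr_ge0 ?sqr_ge0.
have mF : measurable_fun setT (fun z : T3 => f z.1.1 * f z.1.2 * Theta z).
  by apply: measurable_funM => //; exact: (measurable_fst_comp (L1_meas Lff)).
have bF (z : T3) : `|f z.1.1 * f z.1.2 * Theta z| <= C * (f z.1.1 * f z.1.2).
  by rewrite normrM ger0_norm ?mulr_ge0// mulrC; apply: ler_wpM2r; [exact: mulr_ge0|exact: hC].
have step eps : 0 < eps -> RI m3 (fun z => ker (Bc B) z * (f z.1.1 * f z.1.2 * Theta z)) <= N + eps * (K + C).
  move=> eps0; have [be [dbe [Cb [hbe be0 bbe bdbe [Ld Id]]]]] := Bc_smooth_approx hB eps0.
  have [Ls Is] := smooth_kernel_ineq f0 Lf f1 Lh wh he hbe be0 bbe bdbe hphi.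
  have mbe : measurable_fun setT be := (isd_measurable hbe).1.
  have mbe2 : measurable_fun setT (fun s : R => be (s ^+ 2)) by apply: measurableT_comp mbe _; exact: measurable_funX.
  have Lbe := even_avg_L1 mbe (fun t _ => bbe t).
  have mD : measurable_fun setT (fun s : R => `|Bc B s - be (s ^+ 2)|).
    by apply: measurableT_comp => //; exact: measurable_funB.
  have Lk1 := ker_bound mB LB (Bc_ge0 hB) mF (L1Zl C Lff) bF.
  have Lk2 := ker_bound mbe2 Lbe (fun s => be0 _) mF (L1Zl C Lff) bF.
  have p0 p : 0 <= C * (f p.1 * f p.2) by rewrite !mulr_ge0.
  have [Lk3 Ik3] := ker_tensor_ge0 mD Ld (fun s => normr_ge0 _) p0 (L1Zl C Lff).
  have E : RI m3 (fun z => ker (fun s => be (s ^+ 2)) z * (f z.1.1 * f z.1.2 * Theta z)) =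
    RI m3 (fun z => \1_uball z.2 * be (Sv z) * (f z.1.1 * f z.1.2 * score_test phi dphi (vp (1 + e) z))).
    apply: (L1_ae (L1_meas Lk2) _ Ls).2.
    apply: filterS ae_generic => z hz.
    rewrite /Theta (tvp_post z (erefl (1 + e))) -/(vp (1 + e) z).
    have [u|u] := pselect (uball z.2); first by rewrite ker_Sv//; exact: (hz u).1.
    by rewrite /ker /ball_avg indic_out// !mul0r.
  have D z : ker (Bc B) z * (f z.1.1 * f z.1.2 * Theta z) <=
     ker (fun s => be (s ^+ 2)) z * (f z.1.1 * f z.1.2 * Theta z) +
     ker (fun s => `|Bc B s - be (s ^+ 2)|) z * (C * (f z.1.1 * f z.1.2)).
    rewrite -lerBlDl -mulrBl /ker /ball_avg -mulrBr.
    apply: (le_trans (ler_norm _)); rewrite normrM (normrM (\1_uball z.2)).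
    have /andP[u0 _] := indic_itv uball z.2; rewrite (ger0_norm u0).
    by apply: ler_wpM2l; [exact: mulr_ge0|exact: bF].
  have A : even_avg be <= 4 * pi / 3 + eps.
    have LS := L1D LB Ld; rewrite -IB; apply: (@le_trans _ _ (RI mu (fun y => ball_avg (Bc B) (ee ax3) y +
      ball_avg (fun s => `|Bc B s - be (s ^+ 2)|) (ee ax3) y))).
      apply: RI_le => // y; rewrite /ball_avg -mulrDr.
      have /andP[u0 _] := indic_itv uball y; apply: ler_wpM2l => //.
      by rewrite -lerBlDl -normrN opprB ler_norm.
    by rewrite (RID LB Ld) lerD2l.
  apply: (le_trans (RI_le Lk1 (L1D Lk2 Lk3) D)).
  rewrite (RID Lk2 Lk3) E Ik3 (RIZl C Lff) Rff mulr1.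
  rewrite [leRHS](_ : _ = K * (4 * pi / 3 + eps) + eps * C); last by rewrite /N; ring.
  apply: lerD; first by apply: (le_trans Is); exact: ler_wpM2l.
  exact: ler_wpM2r.
apply/ler_addgt0Pr => d d0.
have KC : 0 < K + C + 1 by rewrite ltr_wpDl// addr_ge0.
apply: (le_trans (step _ (divr_gt0 d0 KC))); rewrite lerD2l.
rewrite -mulrA -[leRHS]mulr1; apply: ler_wpM2l; first exact: ltW.
by rewrite mulrC ler_pdivrMr// mul1r lerDl.
Qed.

End KernelInequality.

(** * Weak gain operator and transfer to the Fisher information *)

Section Gain.
Context {R : realType}.
Local Notation V := (V3 R).
Local Notation mu := (@mu3 R).
Local Notation T3 := (V * V * V)%type.
Variables (B : R -> R) (e : R).
Hypotheses (hB : kernel_hyp B) (he : 0 < e <= 1).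

Definition pv (z : T3) : V := post_vel e z.1.1 z.1.2 (hat z.2).
Definition gain (f phi : V -> R) : R :=
  (4 * pi)^-1 * (3 * RI m3 (fun z => ker (Bc B) z * (f z.1.1 * f z.1.2 * phi (pv z)))).

Lemma prob_L1 (f : V -> R) : prob_density f -> [/\ forall v, 0 <= f v, L1 mu f & RI mu f = 1].
Proof.
move=> [mf [f0 f1]]; have le1 : (\int[@leb3 R]_v (f v)%:E <= 1%:E)%E by rewrite f1.
have [Lf Rf] : L1 (@leb3 R) f /\ RI (@leb3 R) f = 1.
  have [L _] := @L1_bound _ _ _ (@leb3 R) f 1 mf f0 le1; split => //.
  by rewrite /RI f1.
by have [L E] := L1_mu Lf; split => //; rewrite E.
Qed.

Lemma gain_L1 (f phi : V -> R) C : (forall v, 0 <= f v) -> L1 mu f -> measurable_fun setT phi ->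
  (forall v, `|phi v| <= C) -> L1 m3 (fun z => ker (Bc B) z * (f z.1.1 * f z.1.2 * phi (pv z))).
Proof.
move=> f0 Lf mphi hC; have Lff := (L1_tensor Lf Lf).1.
apply: (ker_bound (measurable_Bc hB) (Bc_ball hB).1 (Bc_ge0 hB) _ (L1Zl C Lff)).
  apply: measurable_funM; first exact: (measurable_fst_comp (L1_meas Lff)).
  exact: measurableT_comp mphi (measurable_post_vel e).
by move=> z; rewrite normrM ger0_norm ?mulr_ge0// mulrC; apply: ler_wpM2r; [exact: mulr_ge0|exact: hC].
Qed.

Lemma coll_int_gain (f phi : V -> R) C : (forall v, 0 <= f v) -> L1 mu f -> measurable_fun setT phi ->
  (forall v, `|phi v| <= C) -> coll_int B f (fun v w n => phi (post_vel e v w n)) = (gain f phi)%:E.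
Proof.
move=> f0 Lf mphi hC; apply: (coll_int_RI hB f0 Lf (C := C)) => //.
exact: measurableT_comp mphi (measurable_post_vel e).
Qed.

Lemma pi43 : (4 * pi)^-1 * (3 * (4 * pi / 3)) = 1 :> R.
Proof.
have p : (4 * pi : R) != 0 by rewrite lt0r_neq0// mulr_gt0// pi_gt0.
by rewrite (_ : 3 * (4 * pi / 3) = 4 * pi) ?mulVf//; field.
Qed.

Lemma total_score_weak (f : V -> R) (K : R) : (forall v, 0 <= f v) -> L1 mu f -> total_score f K ->
  exists h : axis -> V -> R, [/\ forall i, L2 mu (h i),
    forall i, weak_deriv (fun x => Num.sqrt (f x)) (h i) i & 4 * sum3 (fun i => n2 mu (h i) ^+ 2) <= K].
Proof.
move=> f0 Lf /total_score_split [k [k0 sk Sk]].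
have H i := score_weak_derivative f0 Lf (k0 i) (sk i).
have [h1 [l1 b1 w1]] := H ax1; have [h2 [l2 b2 w2]] := H ax2; have [h3 [l3 b3 w3]] := H ax3.
exists (fun i => match i with ax1 => h1 | ax2 => h2 | ax3 => h3 end); split; try by case.
by apply: le_trans Sk; rewrite /sum3; lra.
Qed.

Lemma gain_score (f : V -> R) (K : R) phi dphi : (forall v, 0 <= f v) -> L1 mu f -> RI mu f = 1 ->
  total_score f K -> (forall j, C1b (phi j) (dphi j)) ->
  gain f (score_test phi dphi) <= fisher_const e * K.
Proof.
move=> f0 Lf f1 TK hphi; have [h [Lh wh hK]] := total_score_weak f0 Lf TK.
have I := kernel_ineq hB he f0 Lf f1 Lh wh hphi.
have p0 : 0 <= (4 * pi)^-1 :> R by rewrite invr_ge0 mulr_ge0// pi_ge0.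
have fc0 : 0 <= fisher_const e.
  have t : 0 <= (0 : R) <= 1 by rewrite lexx ler01.
  have := fisher_const_bound he t; rewrite !mulr0 mul0r expr0n mul0r !addr0; exact: le_trans.
apply: (@le_trans _ _ (fisher_const e * (4 * sum3 (fun i => n2 mu (h i) ^+ 2)))); last exact: ler_wpM2l.
apply: (le_trans (ler_wpM2l p0 (ler_wpM2l _ I))) => //.
rewrite [leLHS](_ : _ = fisher_const e * (4 * sum3 (fun i => n2 mu (h i) ^+ 2)) * ((4 * pi)^-1 * (3 * (4 * pi / 3)))).
  by rewrite pi43 mulr1.
by ring.
Qed.

Lemma total_scoreP (g : V -> R) phi dphi : L1 mu g -> (forall j, C1b (phi j) (dphi j)) ->
  sum3 (fun i => - RI mu (fun x => g x * (2 * dphi i i x + phi i x ^+ 2))) = RI mu (fun x => g x * score_test phi dphi x).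
Proof.
move=> Lg hphi.
have L i : L1 mu (fun x => g x * (2 * dphi i i x + phi i x ^+ 2)).
  have [cp [M hM] cd [M' hM']] : [/\ continuous (phi i), bounded (phi i), continuous (dphi i i) & bounded (dphi i i)].
    by have [? ? c d _] := hphi i; split.
  apply: (L1_bd Lg (C := 2 * M' + M ^+ 2)).
    apply: measurable_funD; last by apply: measurable_funX; exact: continuous_measurable3.
    by apply: measurable_funM; [exact: measurable_cst|exact: continuous_measurable3].
  move=> v; apply: (le_trans (ler_normD _ _)).
  have M0 : 0 <= M := le_trans (normr_ge0 _) (hM (0 : V)).
  by rewrite normrM ger0_norm// normrX; apply: lerD; [exact: ler_wpM2l|rewrite ler_sqr ?nnegrE].
have LN i : L1 mu (fun x => - (g x * (2 * dphi i i x + phi i x ^+ 2))) := L1N (L i).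
rewrite /sum3 -!RIN// -(RID (LN ax1) (LN ax2)) -(RID (L1D (LN ax1) (LN ax2)) (LN ax3)).
by apply: RI_eq => x; rewrite /score_test /sum3; ring.
Qed.

Lemma gain_total_score (f g : V -> R) (K : R) : (forall v, 0 <= f v) -> L1 mu f -> RI mu f = 1 ->
  L1 mu g -> (forall phi, bounded_continuous phi -> RI mu (fun v => g v * phi v) = gain f phi) ->
  total_score f K -> total_score g (fisher_const e * K).
Proof.
move=> f0 Lf f1 Lg gq TK phi dphi hphi; rewrite (total_scoreP Lg hphi) gq; last exact: score_test_bounded.
exact: gain_score.
Qed.

Lemma fisher_ge0 (f : V -> R) : (0 <= fisher f)%E.
Proof.
apply: le_ereal_inf_tmp => _ [h _ <-]; apply: mule_ge0; first by rewrite lee_fin.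
by apply: integral_ge0 => x _; rewrite lee_fin dot3_ge0.
Qed.

(** [total_of_fisher] needs [K] strictly above [fisher f], hence the margin [d / c]; when [fisher f]
    is infinite there is nothing to prove, as [c] is positive. *)
Lemma fisher_total_le (f g : V -> R) (c : R) : 0 < c -> (forall v, 0 <= f v) -> L1 mu f ->
  (forall v, 0 <= g v) -> L1 mu g ->
  (forall K, total_score f K -> total_score g (c * K)) -> (fisher g <= c%:E * fisher f)%E.
Proof.
move=> c0 f0 Lf g0 Lg H; have := fisher_ge0 f; have := fun K => @total_of_fisher _ f K f0 Lf.
case: (fisher f) => [r| |//] T r0; last by rewrite gt0_muley ?lte_fin// leey.
apply/lee_addgt0Pr => d d0; rewrite -EFinM -EFinD.
have rd : (r%:E < (r + d / c)%:E)%E by rewrite lte_fin ltrDl divr_gt0.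
have := fisher_le_total g0 Lg (H _ (T _ rd)).
by rewrite mulrDr mulrC mulrCA mulfV ?mulr1 ?lt0r_neq0.
Qed.

Lemma fisher_const_gt0 : 0 < fisher_const e.
Proof.
have t : 0 <= (0 : R) <= 1 by rewrite lexx ler01.
have := fisher_const_bound he t; rewrite !mulr0 mul0r expr0n mul0r !addr0; exact: lt_le_trans.
Qed.

Lemma fisher_gain (f g : V -> R) : prob_density f -> is_Qplus e B f g ->
  (fisher g <= (fisher_const e)%:E * fisher f)%E.
Proof.
move=> pf [pg gq]; have [f0 Lf f1] := prob_L1 pf; have [g0 Lg g1] := prob_L1 pg.
apply: fisher_total_le => //; first exact: fisher_const_gt0.
move=> K; apply: gain_total_score => // phi [cphi [M hM]].
have mphi := continuous_measurable3 cphi.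
have [L E] := L1_leb (L1_bd Lg mphi hM).
apply: EFin_inj; rewrite -(coll_int_gain f0 Lf mphi hM) -gq; last by split => //; exists M.
by rewrite -E -RI_E.
Qed.

End Gain.

(** * Existence of the density of the gain operator *)

Section MarginalDensity.
Context d1 d2 (T1 : measurableType d1) (T2 : measurableType d2) (R : realType).
Variables (m1 : {sigma_finite_measure set T1 -> \bar R})
          (m2 : {sigma_finite_measure set T2 -> \bar R}).

(** Sections of [F] are integrable only almost everywhere, so [g] is the finite part of their
    extended integral. Tonelli treats nonnegative [phi], and a bounded [phi] is reached by adding
    the constant [C]. *)
Lemma marginal_density (F : T1 * T2 -> R) : L1 (pm m1 m2) F -> (forall z, 0 <= F z) ->
  exists g : T1 -> R, [/\ forall x, 0 <= g x, L1 m1 g &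
    forall (phi : T1 -> R) (C : R), measurable_fun setT phi -> (forall x, `|phi x| <= C) ->
      RI (pm m1 m2) (fun z => F z * phi z.1) = RI m1 (fun x => g x * phi x)].
Proof.
move=> LF F0; have mF : measurable_fun setT (EFin \o F) by apply/measurable_EFinP; exact: L1_meas LF.
have F0' z : (0 <= (EFin \o F) z)%E by rewrite /= lee_fin.
pose E x : \bar R := (\int[m2]_y (F (x, y))%:E)%E.
have E0 x : (0 <= E x)%E by apply: integral_ge0 => y _; rewrite lee_fin.
have mE : measurable_fun setT E := measurable_fun_fubini_tonelli_F (m2 := m2) (EFin \o F) mF F0'.
have IE : (\int[m1]_x E x = (RI (pm m1 m2) F)%:E)%E by rewrite -(RI_E LF); exact/esym/(fubini_tonelli1 (m1 := m1) (m2 := m2) (EFin \o F) mF F0').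
have LE : m1.-integrable setT E.
  apply/integrableP; split => //; under eq_integral do rewrite gee0_abs//.
  by rewrite IE ltry.
pose g x := fine (E x).
have gE : {ae m1, forall x, E x = (g x)%:E}.
  have := integrable_ae measurableT LE; apply: filterS => x /(_ I) fx.
  by rewrite /g fineK.
have mg : measurable_fun setT g by exact: measurableT_comp mE.
have g0 x : 0 <= g x by exact: fine_ge0.
have Lg : L1 m1 g.
  apply/integrableP; split; first exact/measurable_EFinP.
  rewrite (ae_eq_integral E) //.
  - by rewrite IE ltry.
  - by apply: measurableT_comp => //; exact/measurable_EFinP.
  - by apply: filterS gE => x h _; rewrite h /= ger0_norm.
exists g; split => //.
have pos (phi : T1 -> R) C : measurable_fun setT phi -> (forall x, 0 <= phi x <= C) ->
  RI (pm m1 m2) (fun z => F z * phi z.1) = RI m1 (fun x => g x * phi x).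
  move=> mphi hphi; congr fine.
  have mFp : measurable_fun setT (EFin \o (fun z : T1 * T2 => F z * phi z.1)).
    by apply/measurable_EFinP; apply: measurable_funM; [exact: L1_meas LF|exact: measurable_fst_comp].
  pose Fp (z : T1 * T2) : R := F z * phi z.1.
  have Fp0 z : (0 <= (EFin \o Fp) z)%E.
    by rewrite /= lee_fin /Fp mulr_ge0//; case/andP: (hphi z.1).
  transitivity (\int[m1]_x (E x * (phi x)%:E))%E.
    transitivity (\int[m1]_x \int[m2]_y (F (x, y) * phi x)%:E)%E; first exact: (fubini_tonelli1 (m1 := m1) (m2 := m2) _ mFp Fp0).
    apply: eq_integral => x _; have /andP[p0 _] := hphi x.
    under eq_integral do rewrite EFinM.
    rewrite ge0_integralZr//; first exact: (measurableT_comp mF (pair1_measurable x)).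
    by move=> y _; rewrite lee_fin.
  apply: ae_eq_integral => //.
  - by apply: emeasurable_funM => //; exact/measurable_EFinP.
  - by apply/measurable_EFinP; exact: measurable_funM.
  - by apply: filterS gE => x h _; rewrite h -EFinM.
move=> phi C mphi hphi.
have L_1 : L1 (pm m1 m2) (fun z => F z * phi z.1).
  by apply: (L1_bd LF (measurable_fst_comp mphi)) => z; exact: hphi.
have L_2 : L1 m1 (fun x => g x * phi x) := L1_bd Lg mphi hphi.
have P : RI (pm m1 m2) (fun z => F z * (phi z.1 + C)) = RI m1 (fun x => g x * (phi x + C)).
  apply: (pos (fun x => phi x + C) (C + C)); first by apply: measurable_funD => //; exact: measurable_cst.
  by move=> x; have := hphi x; rewrite ler_norml => /andP[? ?]; apply/andP; split; lra.
have Q : RI (pm m1 m2) (fun z => F z * 1) = RI m1 (fun x => g x * 1).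
  by apply: (pos (fun=> 1) 1) => [|x]; [exact: measurable_cst|rewrite ler01 lexx].
have e1 : RI (pm m1 m2) (fun z => F z * (phi z.1 + C)) =
  RI (pm m1 m2) (fun z => F z * phi z.1) + C * RI (pm m1 m2) (fun z => F z * 1).
  rewrite -RIZl -?RID//; first by apply: RI_eq => z; ring.
  - by apply: L1Zl; apply: L1_eq LF => z; rewrite mulr1.
  - by apply: L1_eq LF => z; rewrite mulr1.
have e2 : RI m1 (fun x => g x * (phi x + C)) = RI m1 (fun x => g x * phi x) + C * RI m1 (fun x => g x * 1).
  rewrite -RIZl -?RID//; first by apply: RI_eq => z; ring.
  - by apply: L1Zl; apply: L1_eq Lg => z; rewrite mulr1.
  - by apply: L1_eq Lg => z; rewrite mulr1.
move: P; rewrite e1 e2 Q; exact: addIr.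
Qed.

End MarginalDensity.

Section GainDensity.
Context {R : realType}.
Local Notation V := (V3 R).
Local Notation mu := (@mu3 R).
Local Notation T3 := (V * V * V)%type.
Variables (B : R -> R) (e : R).
Hypothesis hB : kernel_hyp B.

Let loss (u y : V) : V := scale3 ((1 + e) / 2 * dot3 u (hat y)) (hat y).
(* The inverse of [(v, w, y) |-> (v', v - w, y)]. *)
Let psi (z : T3) : T3 := (add3 z.1.1 (loss z.1.2 z.2), sub3 (add3 z.1.1 (loss z.1.2 z.2)) z.1.2, z.2).

Let measurable_loss d (T : measurableType d) (F G : T -> V) : measurable_fun setT F -> measurable_fun setT G ->
  measurable_fun setT (fun t => loss (F t) (G t)).
Proof.
move=> mF mG; have mh := measurable_hat mG; apply: measurable_scale3 => //.
by apply: measurable_funM; [exact: measurable_cst|exact: measurable_dot3].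
Qed.

(** Up to swaps, [psi] is a translation of the first variable with [u] and [y] fixed, followed by a
    reflection and translation of the second with the first fixed. *)
Let psi_mpres : mpres (@m3 R) (@m3 R) psi.
Proof.
pose S (y : V) (p : V * V) : V * V := (add3 p.1 (loss p.2 y), p.2).
pose S' (p : V * V) : V * V := (p.1, sub3 p.1 p.2).
have mS y : mpres (@m2 R) (@m2 R) (S y).
  have m := @mpres_snd _ _ _ _ _ mu mu (fun u x => add3 x (loss u y)).
  have m' : measurable_fun setT (fun z : V * V => add3 z.2 (loss z.1 y)).
    by apply: measurable_add3; [exact: measurable_snd|apply: measurable_loss; [exact: measurable_fst|exact: measurable_cst]].
  have := mpres_comp (mpres_comp (mpres_swap mu mu) (m m' (fun u => mu3_shift (loss u y)))) (mpres_swap mu mu).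
  exact.
have mS' : mpres (@m2 R) (@m2 R) S'.
  apply: (@mpres_snd _ _ _ _ _ mu mu (fun v u => sub3 v u)); first by apply: measurable_sub3; [exact: measurable_fst|exact: measurable_snd].
  move=> v; apply: (mpres_eq _ (mpres_comp mu3_opp (mu3_shift v))) => u.
  by apply: v3P => i; rewrite /opp3 cdD cdB cdZ; ring.
have m := @mpres_snd _ _ _ _ _ mu (@m2 R) (fun y p => S' (S y p)).
have m' : measurable_fun setT (fun z : V * (V * V) => S' (S z.1 z.2)).
  have mA : measurable_fun setT (fun z : V * (V * V) => add3 z.2.1 (loss z.2.2 z.1)).
    apply: measurable_add3; first exact: (measurableT_comp measurable_fst measurable_snd).
    by apply: measurable_loss; [exact: (measurableT_comp measurable_snd measurable_snd)|exact: measurable_fst].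
  apply/measurable_fun_pairP; split; first exact: mA.
  by apply: measurable_sub3 => //; exact: (measurableT_comp measurable_snd measurable_snd).
have := mpres_comp (mpres_comp (mpres_swap (@m2 R) mu) (m m' (fun y => mpres_comp (mS y) mS'))) (mpres_swap mu (@m2 R)).
exact.
Qed.

Let psi_pv z : pv e (psi z) = z.1.1.
Proof.
rewrite /pv /post_vel /psi /=.
have -> : sub3 (add3 z.1.1 (loss z.1.2 z.2)) (sub3 (add3 z.1.1 (loss z.1.2 z.2)) z.1.2) = z.1.2.
  by apply: v3P => i; rewrite !cdB !cdD; ring.
by apply: v3P => i; rewrite !cdB !cdD /loss !cdZ; ring.
Qed.

(** In the variables [v'], [u], [y] the test function depends on the first one only, so integrating
    out [y] and then [u] gives a density. The Euler iterates need it as an actual function. *)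
Lemma gain_density (f : V -> R) : (forall v, 0 <= f v) -> L1 mu f ->
  exists g : V -> R, [/\ forall v, 0 <= g v, L1 mu g &
    forall (phi : V -> R) (C : R), measurable_fun setT phi -> (forall v, `|phi v| <= C) ->
      RI mu (fun v => g v * phi v) = gain B e f phi].
Proof.
move=> f0 Lf; pose F (z : T3) := ker (Bc B) (psi z) * (f (psi z).1.1 * f (psi z).1.2).
have n1 : forall v : V, `|1 : R| <= 1 by move=> _; rewrite normr1.
have L0 : L1 m3 (fun z => ker (Bc B) z * (f z.1.1 * f z.1.2)).
  by apply: L1_eq (gain_L1 e hB f0 Lf (measurable_cst _) n1) => z; rewrite mulr1.
have [LF _] := mpres_RI psi_mpres L0.
have F0 z : 0 <= F z.
  rewrite /F /ker /ball_avg; have /andP[u0 _] := indic_itv uball (psi z).2.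
  exact: mulr_ge0 (mulr_ge0 u0 (Bc_ge0 hB _)) (mulr_ge0 (f0 _) (f0 _)).
have [G [G0 LG IG]] := marginal_density LF F0.
have [g [g0 Lg Ig]] := marginal_density LG G0.
have p0 : 0 <= (4 * pi)^-1 * 3 :> R by rewrite mulr_ge0// invr_ge0 mulr_ge0// pi_ge0.
exists (fun v => (4 * pi)^-1 * 3 * g v); split; [by move=> v; rewrite mulr_ge0|exact: L1Zl|].
move=> phi C mphi hC.
have Lp : L1 mu (fun v => g v * phi v) := L1_bd Lg mphi hC.
have -> : RI mu (fun v => (4 * pi)^-1 * 3 * g v * phi v) = (4 * pi)^-1 * 3 * RI mu (fun v => g v * phi v).
  by rewrite -RIZl//; apply: RI_eq => v; rewrite mulrA.
rewrite /gain mulrA; congr (_ * _); rewrite -(Ig _ C)// -(IG (fun p => phi p.1) C); last 2 first.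
- exact: measurable_fst_comp.
- by move=> p; exact: hC.
have [_ <-] := mpres_RI psi_mpres (gain_L1 e hB f0 Lf mphi hC).
by apply: RI_eq => z; rewrite psi_pv /F -!mulrA.
Qed.

Lemma gain_one (f : V -> R) : (forall v, 0 <= f v) -> L1 mu f -> gain B e f (fun=> 1) = RI mu f ^+ 2.
Proof.
move=> f0 Lf; have [LB IB] := Bc_ball hB; have [Lff Rff] := L1_tensor Lf Lf.
have p0 (p : V * V) : 0 <= f p.1 * f p.2 by rewrite mulr_ge0.
have [_ E] := ker_tensor_ge0 (measurable_Bc hB) LB (Bc_ge0 hB) p0 Lff.
rewrite /gain; have -> : RI m3 (fun z => ker (Bc B) z * (f z.1.1 * f z.1.2 * 1)) = 4 * pi / 3 * RI mu f ^+ 2.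
  by rewrite expr2 -Rff -IB -E; apply: RI_eq => z; rewrite mulr1.
transitivity ((4 * pi)^-1 * (3 * (4 * pi / 3)) * RI mu f ^+ 2); [by ring|by rewrite pi43 mul1r].
Qed.

End GainDensity.

(** * The evolution equation *)

Section Duality.
Context {R : realType}.
Local Notation V := (V3 R).
Local Notation mu := (@mu3 R).

(** The natural test function, the sign of [g], is only measurable. On each box it is approximated
    by smooth functions bounded by 1, with [L1_weak] for the error; Fatou's lemma then lets the box
    grow. *)
Lemma L1_dual (g : V -> R) (dl : R) : L1 mu g ->
  (forall phi, continuous phi -> (forall x, `|phi x| <= 1) -> RI mu (fun x => g x * phi x) <= dl) ->
  RI mu (fun x => `|g x|) <= dl.
Proof.
move=> Lg H; have mg := L1_meas Lg.
pose s x := `|g x| / g x.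
have s1 x : `|s x| <= 1.
  rewrite /s; have [->|n0] := eqVneq (g x) 0; first by rewrite invr0 mulr0 normr0.
  by rewrite normrM normfV normr_id mulfV ?normr_eq0.
have gs x : g x * s x = `|g x|.
  rewrite /s; have [->|n0] := eqVneq (g x) 0; first by rewrite mul0r normr0.
  by field.
have ms : measurable_fun setT s by apply: measurable_funM; [exact: measurableT_comp|exact: measurable_invr].
have bx (r : R) : RI mu (fun x => `|g x| * \1_(box r) x) <= dl.
  pose F x := s x * \1_(box r) x.
  have mF : measurable_fun setT F by apply: measurable_funM => //; exact: (measurable_indr (measurable_box _)).
  have F1 x : -1 <= F x <= 1.
    rewrite -ler_norml /F normrM; have /andP[i0 i1] := indic_itv (box r) x.
    by rewrite (ger0_norm i0) -[leRHS]mulr1; apply: ler_pM.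
  have nF : nullout r F by move=> x nb; rewrite /F indic_out// mulr0.
  have z0 : is_true (((-1 : R) <= 0) && ((0 : R) <= 1)) by rewrite lerN10 ler01.
  have n0 n : 0 < n.+1%:R^-1 :> R by rewrite invr_gt0.
  have [t ht] := choice (fun n => smooth_dense (mu3_box r) mF F1 z0 nF (n0 n)).
  have t1 n x : `|t n x| <= 1 by have [_ _ h _] := ht n; rewrite ler_norml h.
  have d2 n x : 0 <= `|F x - t n x| <= 2.
    rewrite normr_ge0/= [leRHS](_ : _ = 1 + 1); last by ring.
    by apply: (le_trans (ler_normB _ _)); apply: lerD => //; rewrite ler_norml F1.
  have Ld n : L1 mu (fun x => `|F x - t n x|) by have [_ _ _ []] := ht n.
  have Rd n : RI mu (fun x => `|F x - t n x|) <= n.+1%:R^-1 by have [_ _ _ []] := ht n.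
  apply/ler_addgt0Pr => eps eps0; have [n [Ln hn]] := L1_weak Lg Ld d2 Rd eps0.
  have [st _ _ _] := ht n; have ct : continuous (t n) by have [] := smooth_C1b st.
  have Lt : L1 mu (fun x => g x * t n x) := L1_bd Lg (continuous_measurable3 ct) (t1 n).
  apply: (@le_trans _ _ (RI mu (fun x => g x * t n x + `|g x| * `|F x - t n x|))).
    apply: RI_le; [|exact: L1D|].
      by apply: (L1_bd (L1_abs Lg) (measurable_indr (measurable_box r)) (C := 1)) => x; have /andP[i0 i1] := indic_itv (box r) x; rewrite ger0_norm.
    move=> x; have -> : `|g x| * \1_(box r) x = g x * t n x + g x * (F x - t n x) by rewrite -gs /F; ring.
    by rewrite lerD2l -normrM ler_norm.
  by rewrite (RID Lt Ln); apply: lerD => //; exact: H.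
have [||||||_ h] := @RI_fatou _ _ _ mu (fun n x => `|g x| * \1_(box n%:R) x) (fun x => `|g x|) dl; last exact: h.
- move=> n; apply: (L1_bd (L1_abs Lg) (measurable_indr (measurable_box _)) (C := 1)) => x.
  by have /andP[i0 i1] := indic_itv (box n%:R) x; rewrite ger0_norm.
- exact: measurableT_comp.
- by move=> n x; rewrite mulr_ge0//; case/andP: (indic_itv (box n%:R) x).
- by [].
- by move=> n; exact: bx.
apply: aeW => x; apply: cvg_near_cst.
have [n hn] : exists n : nat, norm3 x < n%:R.
  by exists (Num.bound (norm3 x)); have := archi_boundP (norm3_ge0 x).
exists n => // k /= nk; rewrite indic_in ?mulr1// => i.
by apply: (le_lt_trans (cd_norm3 i x)); apply: (lt_le_trans hn); rewrite ler_nat.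
Qed.

End Duality.

Section Evolution.
Context {R : realType}.
Local Notation V := (V3 R).
Local Notation mu := (@mu3 R).
Local Notation T3 := (V * V * V)%type.
Variables (B : R -> R) (e : R).
Hypotheses (hB : kernel_hyp B) (he : 0 < e <= 1).

Definition prob (f : V -> R) := [/\ forall v, 0 <= f v, L1 mu f & RI mu f = 1].

Lemma gain_bound (f phi : V -> R) : prob f -> measurable_fun setT phi -> (forall v, `|phi v| <= 1) ->
  `|gain B e f phi| <= 1.
Proof.
move=> [f0 Lf f1] mphi h1; have [g [g0 Lg Ig]] := gain_density e hB f0 Lf.
have n1 : forall v : V, `|1 : R| <= 1 by move=> _; rewrite normr1.
have E : RI mu g = 1.
  rewrite -[RHS](expr1n _ 2) -f1 -(gain_one e hB f0 Lf) -(Ig _ 1 (measurable_cst _) n1).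
  by apply: RI_eq => v; rewrite mulr1.
rewrite -(Ig _ 1 mphi h1) -E; apply: RI_abs => //; first exact: measurable_funM (L1_meas Lg) mphi.
by move=> v; rewrite normrM (ger0_norm (g0 v)) -[leRHS]mulr1; apply: ler_wpM2l.
Qed.

(** The gain is bilinear, and each of the two slots contributes the L1 distance once. *)
Lemma gain_lipschitz (f g phi : V -> R) : prob f -> prob g -> measurable_fun setT phi ->
  (forall v, `|phi v| <= 1) -> `|gain B e f phi - gain B e g phi| <= 2 * RI mu (fun v => `|f v - g v|).
Proof.
move=> [f0 Lf f1] [g0 Lg g1] mphi h1; have [LB IB] := Bc_ball hB; have mB := measurable_Bc hB.
have LD : L1 mu (fun v => `|f v - g v|) := L1_dist Lf Lg.
have [L_1 I1] := L1_tensor LD Lf; have [L_2 I2] := L1_tensor Lg LD.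
rewrite f1 mulr1 in I1; rewrite g1 mul1r in I2.
pose D (p : V * V) := `|f p.1 - g p.1| * f p.2 + g p.1 * `|f p.2 - g p.2|.
have D0 p : 0 <= D p by rewrite addr_ge0// mulr_ge0.
have LDD : L1 m2 D := L1D L_1 L_2.
have [LK IK] := ker_tensor_ge0 mB LB (Bc_ge0 hB) D0 LDD.
have Gf := gain_L1 e hB f0 Lf mphi h1; have Gg := gain_L1 e hB g0 Lg mphi h1.
have bd z : `|ker (Bc B) z * (f z.1.1 * f z.1.2 * phi (pv e z)) - ker (Bc B) z * (g z.1.1 * g z.1.2 * phi (pv e z))|
   <= ker (Bc B) z * D z.1.
  have k0 : 0 <= ker (Bc B) z by rewrite /ker /ball_avg mulr_ge0// ?Bc_ge0//; case/andP: (indic_itv uball z.2).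
  rewrite -mulrBr normrM (ger0_norm k0); apply: ler_wpM2l => //.
  rewrite -mulrBl normrM -[leRHS]mulr1; apply: ler_pM => //.
  have -> : f z.1.1 * f z.1.2 - g z.1.1 * g z.1.2 =
    (f z.1.1 - g z.1.1) * f z.1.2 + g z.1.1 * (f z.1.2 - g z.1.2) by ring.
  by apply: (le_trans (ler_normD _ _)); rewrite !normrM (ger0_norm (f0 _)) (ger0_norm (g0 _)).
have := RI_abs (L1_meas (L1B Gf Gg)) LK bd; rewrite (RIB Gf Gg) IK IB (RID L_1 L_2) I1 I2.
rewrite /gain -mulrBr -mulrBr normrM normrM.
have p0 : 0 <= (4 * pi)^-1 :> R by rewrite invr_ge0 mulr_ge0// pi_ge0.
rewrite (ger0_norm p0) (ger0_norm (_ : 0 <= 3)) // => h.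
apply: (le_trans (ler_wpM2l p0 (ler_wpM2l _ h))) => //.
set d := RI mu _; rewrite [leLHS](_ : _ = (4 * pi)^-1 * (3 * (4 * pi / 3)) * (2 * d)); last by ring.
by rewrite pi43 mul1r.
Qed.

Lemma collision_derivative (f phi : V -> R) M : prob f -> measurable_fun setT phi -> (forall v, `|phi v| <= M) ->
  coll_int B f (fun v w n => phi (post_vel e v w n) - phi v) = (gain B e f phi - RI mu (fun v => f v * phi v))%:E.
Proof.
move=> [f0 Lf f1] mphi hM; have [LB IB] := Bc_ball hB; have mB := measurable_Bc hB.
have m1 := measurable_arg1 mphi.
rewrite (coll_int_RI hB f0 Lf (C := M + M)); last 2 first.
- by apply: measurable_funB => //; exact: measurableT_comp mphi (measurable_post_vel e).
- by move=> v w n; apply: (le_trans (ler_normB _ _)); exact: lerD.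
congr (_%:E).
have M0 : 0 <= M := le_trans (normr_ge0 _) (hM (0 : V)).
(* [phi + M] is nonnegative, as [ker_tensor_ge0] asks; the contribution of [M] is subtracted
   afterwards. *)
have Lp : L1 mu (fun v => f v * (phi v + M)).
  apply: (L1_bd Lf (C := M + M)); first by apply: measurable_funD => //; exact: measurable_cst.
  by move=> v; apply: (le_trans (ler_normD _ _)); rewrite (ger0_norm M0) lerD2r.
have Lfp : L1 mu (fun v => f v * phi v) := L1_bd Lf mphi hM.
have [L_1 I1] := L1_tensor Lp Lf; have [L_2 I2] := L1_tensor Lf Lf.
rewrite f1 mulr1 in I1; rewrite f1 mulr1 in I2.
have pp (p : V * V) : 0 <= f p.1 * (phi p.1 + M) * f p.2.
  by have := hM p.1; rewrite ler_norml => /andP[? _]; rewrite !mulr_ge0//; lra.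
have p2 (p : V * V) : 0 <= f p.1 * f p.2 by rewrite mulr_ge0.
have [K1 J1] := ker_tensor_ge0 mB LB (Bc_ge0 hB) pp L_1.
have [K2 J2] := ker_tensor_ge0 mB LB (Bc_ge0 hB) p2 L_2.
have G := gain_L1 e hB f0 Lf mphi hM.
have KM := L1Zl M K2.
have E : RI m3 (fun z => ker (Bc B) z * (f z.1.1 * f z.1.2 * (phi (post_vel e z.1.1 z.1.2 (hat z.2)) - phi z.1.1))) =
  RI m3 (fun z => ker (Bc B) z * (f z.1.1 * f z.1.2 * phi (pv e z))) - 4 * pi / 3 * RI mu (fun v => f v * phi v).
  transitivity (RI m3 (fun z => ker (Bc B) z * (f z.1.1 * f z.1.2 * phi (pv e z)) -
    (ker (Bc B) z * (f z.1.1 * (phi z.1.1 + M) * f z.1.2) - M * (ker (Bc B) z * (f z.1.1 * f z.1.2))))).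
    by apply: RI_eq => z; rewrite /pv; ring.
  rewrite (RIB G (L1B K1 KM)) (RIB K1 KM) (RIZl M K2) J1 J2 I1 I2 IB; congr (_ - _).
  have -> : RI mu (fun v => f v * (phi v + M)) = RI mu (fun v => f v * phi v) + M.
    rewrite -[X in _ + X]mulr1 -f1 -(RIZl M Lf) -(RID Lfp (L1Zl M Lf)).
    by apply: RI_eq => v; ring.
  by ring.
rewrite E /gain; set d := RI mu _; set x := RI m3 _.
transitivity ((4 * pi)^-1 * (3 * x) - (4 * pi)^-1 * (3 * (4 * pi / 3)) * d); first by ring.
by rewrite pi43 mul1r.
Qed.

Variable f : R -> V -> R.
Hypothesis E1 : E1_solution e B f.

Let pf t : 0 <= t -> prob (f t).
Proof. by move=> t0; apply: prob_L1; exact: E1.1. Qed.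

Section Test.
Variable phi : V -> R.
Hypotheses (cphi : continuous phi) (p1 : forall v, `|phi v| <= 1).
Let mphi := continuous_measurable3 cphi.
Let m t := fine (\int[@leb3 R]_v (f t v * phi v)%:E)%E.

Lemma E1_moment t : 0 <= t -> m t = RI mu (fun v => f t v * phi v).
Proof. by move=> t0; have [_ Lf _] := pf t0; have [_ <-] := L1_leb (L1_bd Lf mphi p1). Qed.

Lemma E1_increment s t : 0 <= s -> s <= t -> exists2 r, s <= r <= t &
  m t - m s = (gain B e (f r) phi - m r) * (t - s).
Proof.
move=> s0; rewrite le_eqVlt => /predU1P[<-|st]; first by exists s; rewrite ?lexx// !subrr mulr0.
have [cm dm] := E1.2 phi (conj cphi (ex_intro _ 1 p1)).
have d r : r \in `]s, t[%R -> is_derive r 1 m (gain B e (f r) phi - m r).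
  rewrite in_itv /= => /andP[sr rt]; have r0 : 0 < r by exact: le_lt_trans sr.
  have [dr vr] := dm r r0; apply: DeriveDef => //; rewrite -/m in vr.
  by rewrite vr (collision_derivative (pf (ltW r0)) mphi p1) /= E1_moment// ltW.
have c : {within `[s, t], continuous m}.
  apply: continuous_subspaceW cm => r /=; rewrite !in_itv /= andbT => /andP[sr _]; exact: le_trans sr.
have [r rst E] := MVT st d c; exists r => //.
by move: rst; rewrite in_itv /= => /andP[sr rt]; rewrite !ltW.
Qed.

Lemma E1_lipschitz s t : 0 <= s -> s <= t ->
  RI mu (fun v => f t v * phi v) - RI mu (fun v => f s v * phi v) <= 2 * (t - s).
Proof.
move=> s0 st; have t0 := le_trans s0 st; rewrite -!E1_moment//.
have [r /andP[sr rt] ->] := E1_increment s0 st; apply: ler_wpM2r; first by rewrite subr_ge0.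
have r0 := le_trans s0 sr; have [f0 Lf f1] := pf r0.
have := gain_bound (pf r0) mphi p1; rewrite ler_norml => /andP[_ h].
have : `|m r| <= 1.
  rewrite E1_moment// -f1; apply: RI_abs => //; first exact: measurable_funM (L1_meas Lf) mphi.
  by move=> v; rewrite normrM (ger0_norm (f0 v)) -[leRHS]mulr1; apply: ler_wpM2l.
by rewrite ler_norml => /andP[k _]; lra.
Qed.

End Test.

Lemma E1_L1_lipschitz s t : 0 <= s -> s <= t -> RI mu (fun v => `|f t v - f s v|) <= 2 * (t - s).
Proof.
move=> s0 st; have [_ Lt _] := pf (le_trans s0 st); have [_ Ls _] := pf s0.
apply: L1_dual; first exact: L1B.
move=> phi cphi p1; have mphi := continuous_measurable3 cphi.
apply: le_trans (E1_lipschitz cphi p1 s0 st).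
rewrite -RIB; [|exact: L1_bd Lt mphi p1|exact: L1_bd Ls mphi p1].
by rewrite le_eqVlt; apply/orP; left; apply/eqP; apply: RI_eq => v; ring.
Qed.

(** The mean value theorem evaluates the right-hand side of the equation at some [r] in
    [[s, s + tau]], at L1 distance at most [2 tau] from time [s]. Returning to [s] costs [4 tau] in
    the gain and [2 tau] in the loss, whence the 6. *)
Lemma E1_euler (phi : V -> R) s tau : continuous phi -> (forall v, `|phi v| <= 1) -> 0 <= s -> 0 <= tau ->
  RI mu (fun v => f (s + tau) v * phi v) <= RI mu (fun v => f s v * phi v) +
    tau * (gain B e (f s) phi - RI mu (fun v => f s v * phi v)) + 6 * tau ^+ 2.
Proof.
move=> cphi p1 s0 t0; have mphi := continuous_measurable3 cphi.
have st : s <= s + tau by rewrite lerDl.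
have [r /andP[sr rt] E] := E1_increment cphi p1 s0 st.
have r0 := le_trans s0 sr; have s1 := le_trans s0 st.
move: E; rewrite !(E1_moment cphi p1)// [s + tau - s]addrC addKr => E.
have D := E1_L1_lipschitz s0 sr.
have D2 : 2 * (r - s) <= 2 * tau by apply: ler_wpM2l => //; rewrite lerBlDl.
have g := gain_lipschitz (pf r0) (pf s0) mphi p1.
have [_ Lr _] := pf r0; have [_ Ls _] := pf s0.
have q : `|RI mu (fun v => f r v * phi v) - RI mu (fun v => f s v * phi v)| <= RI mu (fun v => `|f r v - f s v|).
  have l1 := L1_bd Lr mphi p1; have l2 := L1_bd Ls mphi p1.
  rewrite -(RIB l1 l2); apply: RI_abs; [exact: L1_meas (L1B l1 l2)|exact: L1_dist|].
  by move=> v; rewrite -mulrBl normrM -[leRHS]mulr1; apply: ler_wpM2l.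
move: E D g q; move: (RI mu (fun v => f (s + tau) v * phi v)) (RI mu (fun v => f s v * phi v)) (RI mu (fun v => f r v * phi v)) => x y z.
move: (gain _ _ _ _) (gain _ _ _ _) (RI _ _) => a b d E D.
rewrite !ler_norml => /andP[_ g] /andP[q _].
have h : b - z <= a - y + 6 * tau by lra.
have := ler_wpM2r t0 h; rewrite -E => hh.
rewrite [leRHS](_ : _ = y + (a - y + 6 * tau) * tau); last by ring.
by rewrite -lerBlDl.
Qed.

(** For [tau <= 1] a step is a convex combination, so it preserves probability densities. It turns
    an L1 error [D] into at most [(1 - tau) D + 2 tau D + 6 tau^2], and a score bound [K] into
    [(1 - tau) K + tau (1 + rate) K]. *)
Lemma euler_scheme (tau K : R) : 0 <= tau <= 1 -> total_score (f 0) K -> forall k : nat,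
  exists F, [/\ prob F,
    RI mu (fun v => `|f (k%:R * tau) v - F v|) <= 6 * tau ^+ 2 * k%:R * (1 + tau) ^+ k &
    total_score F ((1 + tau * fisher_rate e) ^+ k * K)].
Proof.
move=> /andP[t0 t1] TK; elim=> [|k [F [pF DF TF]]].
  exists (f 0); split; first exact: pf.
    rewrite mul0r mulr0 mul0r -[leRHS](@RI0 _ _ _ mu) le_eqVlt; apply/orP; left; apply/eqP.
    by apply: RI_eq => v; rewrite subrr normr0.
  by rewrite expr0 mul1r.
have [F0 LF F1] := pF; have [g [g0 Lg Ig]] := gain_density e hB F0 LF.
have n1 : forall v : V, `|1 : R| <= 1 by move=> _; rewrite normr1.
have g1 : RI mu g = 1.
  rewrite -[RHS](expr1n _ 2) -F1 -(gain_one e hB F0 LF) -(Ig _ 1 (measurable_cst _) n1).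
  by apply: RI_eq => v; rewrite mulr1.
have u0 : 0 <= 1 - tau by rewrite subr_ge0.
pose G v := (1 - tau) * F v + tau * g v.
have LG : L1 mu G by apply: L1D; exact: L1Zl.
have IG (phi : V -> R) (C : R) : measurable_fun setT phi -> (forall v, `|phi v| <= C) ->
  RI mu (fun v => G v * phi v) = (1 - tau) * RI mu (fun v => F v * phi v) + tau * gain B e F phi.
  move=> mphi hC; rewrite -(Ig _ C mphi hC).
  have l1 := L1_bd LF mphi hC; have l2 := L1_bd Lg mphi hC.
  rewrite -(RIZl _ l1) -(RIZl _ l2) -RID; [|exact: L1Zl|exact: L1Zl].
  by apply: RI_eq => v; rewrite /G; ring.
have k0 : 0 <= k%:R * tau by rewrite mulr_ge0.
have kE : k.+1%:R * tau = k%:R * tau + tau by rewrite -natr1; ring.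
exists G; split.
- split => //; first by move=> v; rewrite addr_ge0// mulr_ge0.
  by rewrite (RID (L1Zl _ LF) (L1Zl _ Lg)) (RIZl _ LF) (RIZl _ Lg) F1 g1; ring.
- have [_ Lx _] := pf (addr_ge0 k0 t0); have [_ Ls _] := pf k0.
  rewrite kE; set D := RI mu (fun v => `|f (k%:R * tau) v - F v|) in DF.
  apply: (@le_trans _ _ ((1 + tau) * D + 6 * tau ^+ 2)).
    apply: L1_dual; first exact: L1B.
    move=> phi cphi p1; have mphi := continuous_measurable3 cphi.
    have E := E1_euler cphi p1 k0 t0.
    have Gl := gain_lipschitz (pf k0) pF mphi p1; rewrite -/D in Gl.
    have l1 := L1_bd Ls mphi p1; have l2 := L1_bd LF mphi p1.
    have q : `|RI mu (fun v => f (k%:R * tau) v * phi v) - RI mu (fun v => F v * phi v)| <= D.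
      rewrite -(RIB l1 l2); apply: RI_abs; [exact: L1_meas (L1B l1 l2)|exact: L1_dist|].
      by move=> v; rewrite -mulrBl normrM -[leRHS]mulr1; apply: ler_wpM2l.
    have -> : RI mu (fun v => (f (k%:R * tau + tau) v - G v) * phi v) =
      RI mu (fun v => f (k%:R * tau + tau) v * phi v) - RI mu (fun v => G v * phi v).
      rewrite -RIB; [|exact: L1_bd Lx mphi p1|exact: L1_bd LG mphi p1].
      by apply: RI_eq => v; ring.
    rewrite (IG _ 1 mphi p1).
    move: E Gl q; move: (RI mu (fun v => f (k%:R * tau + tau) v * phi v)) (RI mu (fun v => f (k%:R * tau) v * phi v)) (RI mu (fun v => F v * phi v)) => x y z.
    move: (gain _ _ _ _) (gain _ _ _ _) => a b E.
    rewrite !ler_norml => /andP[_ h1] /andP[_ h2].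
    have := ler_wpM2l t0 h1; have := ler_wpM2l u0 h2.
    move=> k1 k2; rewrite -subr_ge0 in E; rewrite -subr_ge0 in k1; rewrite -subr_ge0 in k2; rewrite -subr_ge0.
    have := addr_ge0 (addr_ge0 E k1) k2; congr (0 <= _); ring.
  have q1 : 1 <= (1 + tau) ^+ k.+1 by rewrite exprn_ege1// lerDl.
  have := ler_wpM2l (addr_ge0 ler01 t0) DF.
  have p0 : 0 <= 6 * tau ^+ 2 by rewrite mulr_ge0// sqr_ge0.
  have := ler_wpM2l p0 q1; rewrite mulr1 => h1 h2.
  rewrite [leRHS](_ : _ = (1 + tau) * (6 * tau ^+ 2 * k%:R * (1 + tau) ^+ k) + 6 * tau ^+ 2 * (1 + tau) ^+ k.+1).
    exact: lerD.
  have -> : k.+1%:R = k%:R + 1 :> R by rewrite natr1.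
  by rewrite (exprS (1 + tau)); move: ((1 + tau) ^+ k) (k%:R : R) => p q; ring.
- move=> phi dphi hphi; rewrite (total_scoreP LG hphi).
  have [cT [C hC]] := score_test_bounded hphi.
  rewrite (IG _ C (continuous_measurable3 cT) hC).
  have h1 := TF phi dphi hphi; rewrite (total_scoreP LF hphi) in h1.
  have h2 := gain_score hB he F0 LF F1 TF hphi.
  apply: (le_trans (lerD (ler_wpM2l u0 h1) (ler_wpM2l t0 h2))).
  have -> : fisher_const e = 1 + fisher_rate e by [].
  by rewrite le_eqVlt; apply/orP; left; apply/eqP; rewrite exprS; ring.
Qed.

Lemma fisher_rate_ge0 : 0 <= fisher_rate e.
Proof.
have /andP[e0 e1] := he; rewrite /fisher_rate divr_ge0//; last by rewrite mulr_ge0// exprn_ge0// ltW.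
by rewrite mulr_ge0 ?subr_ge0// !addr_ge0 ?mulr_ge0 ?sqr_ge0// ltW.
Qed.

Lemma total_score_ge0 (g : V -> R) K : total_score g K -> 0 <= K.
Proof.
move=> /(_ (fun=> fun=> 0) (fun=> fun=> fun=> 0) (fun=> C1b_0)).
rewrite /sum3 (_ : RI mu _ = 0) ?oppr0 ?addr0//.
by rewrite -[RHS](@RI0 _ _ _ mu); apply: RI_eq => x; rewrite expr0n mulr0 addr0 mulr0.
Qed.

Lemma power_expR (x : R) n : 0 <= x -> (1 + x) ^+ n <= expR (n%:R * x).
Proof.
move=> x0; rewrite expRM_natl; apply: lerXn2r; rewrite ?nnegrE ?addr_ge0 ?expR_ge0//.
exact: expR_ge1Dx.
Qed.

Lemma E1_total_score (t K : R) : 0 <= t -> total_score (f 0) K ->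
  total_score (f t) (expR (fisher_rate e * t) * K).
Proof.
move=> t0 TK phi dphi hphi; have [f0 Lf f1] := pf t0; rewrite (total_scoreP Lf hphi).
have [cT [C hC]] := score_test_bounded hphi; have mT := continuous_measurable3 cT.
have C0 : 0 <= C := le_trans (normr_ge0 _) (hC (0 : V)).
have K0 := total_score_ge0 TK.
(* After [n] steps of length [t / n], [C] times the Euler error is at most [A / n], because
   [(1 + t / n)^n <= exp t]. *)
pose A := C * (6 * t ^+ 2 * expR t).
have A0 : 0 <= A by rewrite !mulr_ge0 ?sqr_ge0 ?expR_ge0.
apply/ler_addgt0Pr => d d0.
(* [n >= t] makes the step at most 1, and [n >= A / d] makes the error at most [d]. *)
pose n := (Num.bound (t + A / d)).+1.
have tAd : 0 <= t + A / d by rewrite addr_ge0// divr_ge0// ltW.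
have hn : t + A / d <= n%:R.
  by apply: (le_trans (ltW (archi_boundP tAd))); rewrite ler_nat.
have n0 : 0 < n%:R :> R by rewrite ltr0n.
have tn : t <= n%:R by apply: le_trans hn; rewrite lerDl divr_ge0// ltW.
pose tau := t / n%:R.
have tau01 : 0 <= tau <= 1.
  by apply/andP; split; [exact: divr_ge0 t0 (ltW n0)|rewrite /tau ler_pdivrMr// mul1r].
have nt : n%:R * tau = t by rewrite /tau mulrC divfK// lt0r_neq0.
have [F [[F0 LF F1] DF TF]] := euler_scheme tau01 TK n.
rewrite nt in DF; have /andP[tau0 tau1] := tau01.
have LFT := L1_bd LF mT hC; have LfT := L1_bd Lf mT hC.
have s1 : RI mu (fun v => f t v * score_test phi dphi v) <= RI mu (fun v => F v * score_test phi dphi v) +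
   C * RI mu (fun v => `|f t v - F v|).
  have Ld := L1_dist Lf LF.
  rewrite -(RIZl C Ld) -(RID LFT (L1Zl C Ld)); apply: RI_le => //; first by apply: L1D => //; exact: L1Zl.
  move=> v; rewrite -lerBlDl -mulrBl; apply: (le_trans (ler_norm _)); rewrite normrM mulrC.
  exact: ler_wpM2r.
have s2 := TF phi dphi hphi; rewrite (total_scoreP LF hphi) in s2.
have s3 : (1 + tau * fisher_rate e) ^+ n * K <= expR (fisher_rate e * t) * K.
  apply: ler_wpM2r => //; rewrite -nt [fisher_rate e * _]mulrCA [fisher_rate e * _]mulrC.
  by apply: power_expR; rewrite mulr_ge0// fisher_rate_ge0.
have s4 : C * RI mu (fun v => `|f t v - F v|) <= d.
  apply: (le_trans (ler_wpM2l C0 DF)).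
  have ht : (1 + tau) ^+ n <= expR t by have := power_expR n tau0; rewrite nt.
  have p0 : 0 <= 6 * tau ^+ 2 * n%:R by rewrite !mulr_ge0 ?sqr_ge0// ltW.
  apply: (le_trans (ler_wpM2l C0 (ler_wpM2l p0 ht))).
  rewrite [leLHS](_ : _ = A / n%:R); last by rewrite /A /tau; field; rewrite lt0r_neq0.
  rewrite ler_pdivrMr// mulrC -ler_pdivrMr//.
  by apply: le_trans hn; rewrite lerDr.
apply: (le_trans s1); apply: lerD => //.
exact: le_trans s2 s3.
Qed.

Lemma fisher_E1 t : 0 <= t -> (fisher (f t) <= (expR (fisher_rate e * t))%:E * fisher (f 0%R))%E.
Proof.
move=> t0; have [f0 Lf f1] := pf t0; have [g0 Lg g1] := pf (lexx 0).
apply: fisher_total_le => //; first exact: expR_gt0.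
by move=> K; exact: E1_total_score.
Qed.

End Evolution.

Theorem theorem2p1 (R : realType) (e : R) (B : R -> R) :
  0 < e <= 1 -> kernel_hyp B ->
  (forall f g : V3 R -> R, prob_density f -> is_Qplus e B f g ->
     (fisher g <= (fisher_const e)%:E * fisher f)%E) /\
  (forall f : R -> V3 R -> R, E1_solution e B f ->
     forall t : R, 0 <= t ->
       (fisher (f t) <= (expR (fisher_rate e * t))%:E * fisher (f 0%R))%E).
Proof.
move=> he hB; split=> [f g|f hf t]; first exact: fisher_gain.
exact: (fisher_E1 hB he hf).
Qed.
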